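(* Let $\nu = e^{-f}$ be a probability density on $\mathbb{R}^n$ that satisfies the log-Sobolev inequality with constant $\alpha>0$ and is $(L,M)$-smooth. Let $0 < \epsilon \le \min\{ \frac{1}{8L}, \frac{1}{M}, \frac{3\alpha}{32 L^2} \}$. For any initial distribution $x_0 \sim \rho_0$, the iterates $x_k \sim \rho_k$ of the Proximal Langevin Algorithm with step size $\epsilon$ satisfy, for all $k \ge 0$, \[ H_\nu(\rho_k) \le e^{-\alpha \epsilon k} H_\nu(\rho_0) + \frac{34\, \epsilon^2 n(L^3 + 9n^2 M^2)}{\alpha}. \]
   Context: Proximal Langevin Algorithm (PLA) with step size $\epsilon>0$ for $\nu=e^{-f}$: starting from a random $x_0\in\mathbb{R}^n$, set $x_{k+1} = x_k - \epsilon \nabla f(x_{k+1}) + \sqrt{2\epsilon}\, z_k$, where $z_k \sim \mathcal{N}(0,I)$ are independent of each other and of $x_0,\dots,x_k$; equivalently $x_{k+1} = \arg\min_{x} \{ f(x) + \frac{1}{2\epsilon}\|x - (x_k + \sqrt{2\epsilon} z_k)\|^2\}$ (well defined when $\epsilon\|\nabla^2 f\|<1$). $\rho_k$ denotes the law of $x_k$. Densities are assumed smooth with finite second moments. KL divergence: $H_\nu(\rho) = \int \rho \log\frac{\rho}{\nu}\,dx$. Relative Fisher information: $J_\nu(\rho) = \int \rho \|\nabla \log \frac{\rho}{\nu}\|^2 dx$. $\nu$ satisfies the log-Sobolev inequality (LSI) with constant $\alpha>0$ if $H_\nu(\rho) \le \frac{1}{2\alpha} J_\nu(\rho)$ for all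 $\rho$. $\nu=e^{-f}$ is $(L,M)$-smooth if $f$ is three times differentiable, $\|\nabla^2 f(x)\|_{\mathrm{op}} \le L$ for all $x$ (i.e. $-LI\preceq \nabla^2 f\preceq LI$), and $\|\nabla^2 f(x) - \nabla^2 f(y)\|_{\mathrm{op}} \le M\|x-y\|$ for all $x,y$. *)

(* Defs.v *)
From HB Require Import structures.
From mathcomp Require Import all_boot all_order all_algebra.
From mathcomp Require Import all_classical all_reals all_analysis.
Set Implicit Arguments. Unset Strict Implicit. Unset Printing Implicit Defensive.
Import Order.TTheory GRing.Theory Num.Theory.
Import numFieldNormedType.Exports.
Local Open Scope classical_set_scope.
Local Open Scope ring_scope.

Section PLA_defs.
Variable R : realType.

(* Euclidean squared norm on R^n (the library norm on matrices is the sup norm). *)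
Definition sqnorm (n : nat) (v : 'rV[R]_n) : R := \sum_(i < n) v 0 i ^+ 2.

Definition evec (n : nat) (i : 'I_n) : 'rV[R]_n := delta_mx 0 i.

Definition partial (n : nat) (i : 'I_n) (g : 'rV[R]_n -> R) : 'rV[R]_n -> R :=
  fun x => 'D_(evec i) g x.

Fixpoint pder (n : nat) (s : seq 'I_n) (g : 'rV[R]_n -> R) : 'rV[R]_n -> R :=
  match s with
  | [::] => g
  | i :: s' => partial i (pder s' g)
  end.

Definition smooth (n : nat) (g : 'rV[R]_n -> R) : Prop :=
  forall (s : seq 'I_n) (x : 'rV[R]_n), differentiable (pder s g) x.

Definition grad (n : nat) (g : 'rV[R]_n -> R) (x : 'rV[R]_n) : 'rV[R]_n :=
  \row_i partial i g x.

Definition hess (n : nat) (g : 'rV[R]_n -> R) (x : 'rV[R]_n) : 'M[R]_n :=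
  \matrix_(i, j) partial j (partial i g) x.

Definition thrice_differentiable (n : nat) (f : 'rV[R]_n -> R) : Prop :=
  forall x, [/\ differentiable f x, differentiable (grad f) x
              & differentiable (hess f) x].

(* Lebesgue integral over R^n of a nonnegative (extended-valued) function,
   computed as the iterated one-dimensional Lebesgue integral (Tonelli). *)
Fixpoint iint (n : nat) : ('rV[R]_n -> \bar R) -> \bar R :=
  match n return ('rV[R]_n -> \bar R) -> \bar R with
  | 0 => fun g => g 0
  | m.+1 => fun g =>
      (\int[lebesgue_measure]_(t in [set: R])
         iint (fun y : 'rV[R]_m => g (row_mx (const_mx t : 'rV[R]_1) y)))%E
  end.

Definition integral_Rn (n : nat) (g : 'rV[R]_n -> R) : \bar R :=
  (iint (fun x => (Num.max (g x) 0)%:E) - iint (fun x => (Num.max (- g x) 0)%:E))%E.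

Definition prob_density (n : nat) (rho : 'rV[R]_n -> R) : Prop :=
  (forall x, 0 <= rho x) /\ iint (fun x => (rho x)%:E) = 1%E.

Definition finite_second_moment (n : nat) (rho : 'rV[R]_n -> R) : Prop :=
  (iint (fun x => (sqnorm x * rho x)%:E) < +oo)%E.

Definition KL (n : nat) (nu rho : 'rV[R]_n -> R) : \bar R :=
  integral_Rn (fun x => rho x * ln (rho x / nu x)).

Definition Fisher (n : nat) (nu rho : 'rV[R]_n -> R) : \bar R :=
  iint (fun x => (rho x * sqnorm (grad (fun y => ln (rho y / nu y)) x))%:E).

Definition LSI (n : nat) (nu : 'rV[R]_n -> R) (alpha : R) : Prop :=
  forall rho : 'rV[R]_n -> R, smooth rho -> prob_density rho ->
    finite_second_moment rho ->
    (KL nu rho <= ((2 * alpha)^-1)%:E * Fisher nu rho)%E.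

(* nu = e^{-f} is (L,M)-smooth; operator norms written out (Euclidean) *)
Definition LM_smooth (n : nat) (f : 'rV[R]_n -> R) (L M : R) : Prop :=
  [/\ thrice_differentiable f,
      forall x (v : 'rV[R]_n), sqnorm (v *m hess f x) <= L ^+ 2 * sqnorm v
    & forall x y (v : 'rV[R]_n),
        sqnorm (v *m (hess f x - hess f y)) <= M ^+ 2 * sqnorm (x - y) * sqnorm v].

Definition is_prox (n : nat) (eps : R) (f : 'rV[R]_n -> R) (P : 'rV[R]_n -> 'rV[R]_n) :
  Prop :=
  forall w x, f (P w) + sqnorm (P w - w) / (2 * eps) <= f x + sqnorm (x - w) / (2 * eps).

Definition gauss (n : nat) (z : 'rV[R]_n) : R :=
  (Num.sqrt (2 * pi))^-1 ^+ n * expR (- (sqnorm z / 2)).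

(* rho : nat -> densities is the sequence of laws of the PLA iterates
   x_{k+1} = P (x_k + sqrt(2 eps) z_k), z_k ~ N(0,I) independent of x_k:
   E[phi(x_{k+1})] = E[phi(P(x_k + sqrt(2 eps) z_k))] for every bounded
   continuous nonnegative test function phi. *)
Definition PLA_laws (n : nat) (eps : R) (P : 'rV[R]_n -> 'rV[R]_n)
  (rho : nat -> 'rV[R]_n -> R) : Prop :=
  forall (k : nat) (phi : 'rV[R]_n -> R),
    continuous phi -> (forall x, 0 <= phi x) -> (exists C, forall x, phi x <= C) ->
    iint (fun y => (phi y * rho k.+1 y)%:E) =
    iint (fun x => iint (fun z =>
      (phi (P (x + Num.sqrt (2 * eps) *: z)) * rho k x * gauss z)%:E)).

End PLA_defs.

(* Main.v *)
Require Import Defs.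
From HB Require Import structures.
From mathcomp Require Import all_boot all_order all_algebra.
From mathcomp Require Import all_classical all_reals all_analysis.
From mathcomp Require Import measurable_realfun ring lra zify.
Set Implicit Arguments. Unset Strict Implicit. Unset Printing Implicit Defensive.
Import Order.TTheory GRing.Theory Num.Theory.
Import numFieldNormedType.Exports.
Local Open Scope classical_set_scope.
Local Open Scope ring_scope.

(* One step of the algorithm is the heat flow sigma_t = rho * N(0, 2t) for time
   eps followed by the proximal map T_eps = (1 + eps grad f)^-1.  We interpolate
   with H(t) = Ent(sigma_t) + E[phi_t(X + sqrt(2t) Z)], where
   phi_t(y) = f(x) + l_t(x), x = T_t y, and l_t is a second-order upper bound of
   ln det (1 + t hess f).  Then H(0) = KL(rho) and, by the change of variables
   x = T_eps y, KL of the next iterate is at most H(eps).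

   The entropy decreases at least at the rate of the Fisher information of
   sigma_t (Donsker-Varadhan applied to the mutual information of noise and
   output), and the energy term is differentiated under the integral.  With
   s = grad log sigma_t, p = grad f(x), g = s + p, Stein's identity turns the trace
   terms into inner products and completes the square -|g|^2; the log-Sobolev
   inequality for sigma_t then gives H' <= - alpha H + O(eps^2), and a Gronwall
   argument for one-sided derivatives concludes.  The constants need
   alpha <= (5/4) L, obtained by testing the log-Sobolev inequality on Gaussians
   centred where f is large. *)

(** * Euclidean geometry of row vectors and operator bounds of matrices *)

Section euclid.
Context {R : realType}.

(** The iterates are only known to have continuous densities, so no density is ever differentiated
    in time. Entropy enters through finite increments, bounded below by [t - s] times the Fisher
    information at the later time [t]; this is what forces a Gronwall argument on left increments.
    The square of [p] has no a priori bound. It occurs with a factor [(t L)^2], and there Stein's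
    identity trades its mean for [|g|^2] and a trace of size [n L]. Replacing the log-determinant by
    a polynomial in [t] leaves only [tr K] and [tr K^2] to differentiate in space, [K] being the
    transposed Hessian. Their gradients carry [M], with one factor [n] per trace. The error is of
    order [t^2] because the time derivative of the polynomial and the trace of [(1 + tK)^-1 K]
    coming from Stein's identity agree up to that order. Each step contracts the excess of the
    divergence over the fixed level [C / alpha], so no geometric series has to be summed. *)

Definition dotv n (u v : 'rV[R]_n) : R := \sum_i u ord0 i * v ord0 i.
Definition enorm n (v : 'rV[R]_n) : R := Num.sqrt (sqnorm v).
Definition opbound n (A : 'M[R]_n) (a : R) :=
  forall v : 'rV[R]_n, enorm (v *m A) <= a * enorm v.

Section fixed_dim.
Variable n : nat.
Implicit Types (u v w : 'rV[R]_n) (A B : 'M[R]_n).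

Lemma dotvC u v : dotv u v = dotv v u.
Proof. by apply: eq_bigr => i _; rewrite mulrC. Qed.

Lemma dotvDl u v w : dotv (u + v) w = dotv u w + dotv v w.
Proof. by rewrite -big_split; apply: eq_bigr => i _; rewrite mxE mulrDl. Qed.

Lemma dotvZl a u v : dotv (a *: u) v = a * dotv u v.
Proof. by rewrite mulr_sumr; apply: eq_bigr => i _; rewrite mxE mulrA. Qed.

Lemma dotvNl u v : dotv (- u) v = - dotv u v.
Proof. by rewrite -scaleN1r dotvZl mulN1r. Qed.

Lemma dotvDr u v w : dotv w (u + v) = dotv w u + dotv w v.
Proof. by rewrite dotvC dotvDl !(dotvC w). Qed.

Lemma dotvZr a u v : dotv u (a *: v) = a * dotv u v.
Proof. by rewrite dotvC dotvZl dotvC. Qed.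

Lemma dotvNr u v : dotv u (- v) = - dotv u v.
Proof. by rewrite dotvC dotvNl dotvC. Qed.

Lemma dotv0l v : dotv 0 v = 0.
Proof. by rewrite -(scale0r 0) dotvZl mul0r. Qed.

Lemma dotvv v : dotv v v = sqnorm v.
Proof. by apply: eq_bigr => i _; rewrite expr2. Qed.

Lemma dotv_trmx u v A : dotv (u *m A) v = dotv u (v *m A^T).
Proof.
rewrite /dotv; under eq_bigr do rewrite mxE mulr_suml.
rewrite exchange_big; apply: eq_bigr => i _ /=; rewrite mxE mulr_sumr.
by apply: eq_bigr => j _; rewrite mxE; ring.
Qed.

Lemma sqnorm_ge0 v : 0 <= sqnorm v.
Proof. by apply: sumr_ge0 => i _; exact: sqr_ge0. Qed.

Lemma sqnormZ a v : sqnorm (a *: v) = a ^+ 2 * sqnorm v.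
Proof. by rewrite -!dotvv dotvZl dotvZr mulrA -expr2. Qed.

Lemma sqnormN v : sqnorm (- v) = sqnorm v.
Proof. by rewrite -!dotvv dotvNl dotvNr opprK. Qed.

Lemma sqnormD u v : sqnorm (u + v) = sqnorm u + 2 * dotv u v + sqnorm v.
Proof. by rewrite -!dotvv dotvDl !dotvDr (dotvC v u); ring. Qed.

Lemma sqnormB u v : sqnorm (u - v) = sqnorm u - 2 * dotv u v + sqnorm v.
Proof. by rewrite sqnormD sqnormN dotvNr; ring. Qed.

Lemma sqnormDle u v : sqnorm (u + v) <= 2 * sqnorm u + 2 * sqnorm v.
Proof.
have := sqnorm_ge0 (u - v); rewrite sqnormB sqnormD; lra.
Qed.

Lemma enorm_ge0 v : 0 <= enorm v. Proof. exact: sqrtr_ge0. Qed.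

Lemma sqr_enorm v : enorm v ^+ 2 = sqnorm v.
Proof. by rewrite sqr_sqrtr// sqnorm_ge0. Qed.

Lemma enorm_leP v a : 0 <= a -> (enorm v <= a) = (sqnorm v <= a ^+ 2).
Proof. by move=> a0; rewrite -sqr_enorm ler_pXn2r// nnegrE enorm_ge0. Qed.

Lemma enormZ a v : enorm (a *: v) = `|a| * enorm v.
Proof. by rewrite /enorm sqnormZ sqrtrM ?sqr_ge0// sqrtr_sqr. Qed.

Lemma enormN v : enorm (- v) = enorm v. Proof. by rewrite /enorm sqnormN. Qed.

Lemma sqnorm0 : sqnorm (0 : 'rV[R]_n) = 0.
Proof. by rewrite -dotvv dotv0l. Qed.

Lemma enorm0 : enorm (0 : 'rV[R]_n) = 0.
Proof. by rewrite /enorm sqnorm0 sqrtr0. Qed.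

Lemma sqnorm_eq0 v : sqnorm v = 0 -> v = 0.
Proof.
move=> /eqP; rewrite psumr_eq0; last by move=> i _; exact: sqr_ge0.
move=> /allP h; apply/rowP => i; rewrite mxE.
by have := h i (mem_index_enum _); rewrite sqrf_eq0 => /eqP.
Qed.

Lemma enorm_eq0 v : enorm v = 0 -> v = 0.
Proof. by move=> h; apply: sqnorm_eq0; rewrite -sqr_enorm h expr0n. Qed.

Lemma dotv_le u v : dotv u v <= enorm u * enorm v.
Proof.
have [/enorm_eq0 ->|v0] := eqVneq (enorm v) 0.
  by rewrite dotvC dotv0l enorm0 mulr0.
have v1 : 0 < enorm v by rewrite lt_neqAle eq_sym v0 enorm_ge0.
have [/enorm_eq0 ->|u0] := eqVneq (enorm u) 0.
  by rewrite dotv0l enorm0 mul0r.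
have u1 : 0 < enorm u by rewrite lt_neqAle eq_sym u0 enorm_ge0.
have := sqnorm_ge0 (enorm v *: u - enorm u *: v).
rewrite sqnormB !sqnormZ dotvZl dotvZr -!sqr_enorm => h.
rewrite -(ler_pM2l (mulr_gt0 u1 v1)); move: h; nra.
Qed.

Lemma normr_dotv u v : `|dotv u v| <= enorm u * enorm v.
Proof.
by rewrite ler_norml dotv_le andbT -[enorm u]enormN lerNl -dotvNl dotv_le.
Qed.

Lemma enormD u v : enorm (u + v) <= enorm u + enorm v.
Proof.
rewrite enorm_leP ?addr_ge0 ?enorm_ge0// sqnormD -!sqr_enorm.
have := dotv_le u v; lra.
Qed.

Lemma enormB u v : enorm (u - v) <= enorm u + enorm v.
Proof. by rewrite -(enormN v) enormD. Qed.

Lemma coord_le_enorm v i : `|v ord0 i| <= enorm v.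
Proof.
rewrite -sqrtr_sqr ler_sqrt ?sqr_ge0 ?sqnorm_ge0//.
rewrite /sqnorm (bigD1 i)//= lerDl.
by apply: sumr_ge0 => j _; exact: sqr_ge0.
Qed.

Lemma normr_le_enorm v : `|v| <= enorm v.
Proof.
rewrite -[leLHS]/(mx_norm v) mx_normrE; apply: bigmax_le; first exact: enorm_ge0.
by move=> [i j] _; rewrite ord1; exact: coord_le_enorm.
Qed.

Lemma enorm_le_normr v : enorm v <= n%:R * `|v|.
Proof.
rewrite enorm_leP ?mulr_ge0//.
apply: (@le_trans _ _ (\sum_(i < n) `|v| ^+ 2)).
  apply: ler_sum => i _; rewrite -real_normK ?num_real// lerXn2r ?nnegrE//.
  rewrite -[leRHS]/(mx_norm v) mx_normrE.
  exact: (le_bigmax _ (fun ij : 'I_1 * 'I_n => `|v ij.1 ij.2|) (ord0, i)).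
rewrite sumr_const card_ord (exprMn _ n%:R) -(mulr_natl (`|v| ^+ 2) n) ler_wpM2r ?sqr_ge0//.
by rewrite -natrX ler_nat; case: (n) => // m; rewrite expnS expn1 leq_pmull.
Qed.

Lemma sqnorm_evec (i : 'I_n) : sqnorm (evec R i) = 1.
Proof.
rewrite /sqnorm (bigD1 i)//= mxE !eqxx expr1n big1 ?addr0// => j ji.
by rewrite mxE eqxx (negbTE ji) expr0n.
Qed.

Lemma enorm_evec (i : 'I_n) : enorm (evec R i) = 1.
Proof. by rewrite /enorm sqnorm_evec sqrtr1. Qed.

Lemma dotv_evec v i : dotv v (evec R i) = v ord0 i.
Proof.
rewrite /dotv (bigD1 i)//= mxE !eqxx mulr1 big1 ?addr0// => j ji.
by rewrite mxE eqxx (negbTE ji) mulr0.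
Qed.

Lemma evec_mulmx A i : evec R i *m A = row i A.
Proof. by rewrite /evec -rowE. Qed.

Lemma opbound_le A a b : opbound A a -> a <= b -> opbound A b.
Proof. by move=> h ab v; apply: (le_trans (h v)); rewrite ler_wpM2r// enorm_ge0. Qed.

Lemma opboundM A B a b : 0 <= b -> opbound A a -> opbound B b -> opbound (A *m B) (a * b).
Proof.
move=> b0 hA hB v; rewrite mulmxA; apply: (le_trans (hB _)).
by rewrite (mulrC a) -mulrA ler_wpM2l.
Qed.

Lemma opboundD A B a b : opbound A a -> opbound B b -> opbound (A + B) (a + b).
Proof.
by move=> hA hB v; rewrite mulmxDr mulrDl; apply: (le_trans (enormD _ _)); rewrite lerD.
Qed.

Lemma opboundZ A a t : opbound A a -> opbound (t *: A) (`|t| * a).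
Proof.
by move=> hA v; rewrite -scalemxAr enormZ -mulrA ler_wpM2l.
Qed.

(** [|v A^T|^2 = <v, v A^T A>], so Cauchy-Schwarz and the bound on [A] leave one factor [|v A^T|] to
    cancel. *)
Lemma opbound_trmx A a : 0 <= a -> opbound A a -> opbound A^T a.
Proof.
move=> a0 hA v.
have [->|h0] := eqVneq (enorm (v *m A^T)) 0; first by rewrite mulr_ge0 ?enorm_ge0.
have h1 : 0 < enorm (v *m A^T) by rewrite lt_neqAle eq_sym h0 enorm_ge0.
rewrite -(ler_pM2r h1) -expr2 sqr_enorm -dotvv dotv_trmx trmxK dotvC.
apply: (le_trans (dotv_le _ _)); rewrite mulrAC ler_wpM2r ?enorm_ge0//; exact: hA.
Qed.

Lemma opbound_entry A a i j : opbound A a -> `|A i j| <= a.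
Proof.
move=> hA; have := hA (evec R i); rewrite enorm_evec mulr1; apply: le_trans.
by apply: le_trans (coord_le_enorm _ j); rewrite evec_mulmx mxE.
Qed.

Lemma opbound_trace A a : opbound A a -> `|\tr A| <= n%:R * a.
Proof.
move=> hA; rewrite /mxtrace (le_trans (ler_norm_sum _ _ _))//.
apply: (@le_trans _ _ (\sum_(i < n) a)); first by apply: ler_sum => i _; exact: opbound_entry.
by rewrite sumr_const card_ord mulr_natl.
Qed.

(* A perturbation of the identity of size below one is invertible; the bound
   is the one of the Neumann series. *)
Lemma unitmx_1D A a : 0 <= a -> a < 1 -> opbound A a -> 1%:M + A \in unitmx.
Proof.
move=> a0 a1 hA; rewrite -row_free_unit -kermx_eq0; apply/eqP/row_matrixP => i.
rewrite row0; set v := row i _.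
have : v *m (1%:M + A) = 0 by rewrite /v -row_mul mulmx_ker row0.
rewrite mulmxDr mulmx1 => /eqP; rewrite addr_eq0 => /eqP vE.
have := hA v; rewrite -enormN -vE => h; apply: enorm_eq0.
have := enorm_ge0 v; nra.
Qed.

Lemma opbound_inv_1D A a : 0 <= a -> a < 1 -> opbound A a ->
  opbound (invmx (1%:M + A)) (1 - a)^-1.
Proof.
move=> a0 a1 hA v; have uA := unitmx_1D a0 a1 hA.
set w := v *m _; have vE : v = w + w *m A.
  by rewrite -[in X in X + _](mulmx1 w) -mulmxDr /w -mulmxA mulVmx ?mulmx1.
rewrite mulrC ler_pdivlMr ?subr_gt0//.
have h1 : enorm w <= enorm v + enorm (w *m A).
  by rewrite {1}(_ : w = v - w *m A) ?enormB// {1}vE addrK.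
have := hA w; nra.
Qed.

End fixed_dim.
End euclid.

(** * Measurability on row vectors *)

Section rV_measurable.
Variables (R : realType) (n : nat).

(** Generating the sigma-algebra by the coordinates reduces measurability of a vector-valued map to
    its coordinates ([measurable_fun_rV]); continuous functions are recovered in
    [continuous_measurable_rV]. *)
Let coord (i : 'I_n) (x : 'rV[R]_n) : R := x ord0 i.

Let rV_set0 : g_sigma_preimage coord set0.
Proof. exact: sigma_algebra0. Qed.

Let rV_setC A : g_sigma_preimage coord A -> g_sigma_preimage coord (~` A).
Proof. exact: sigma_algebraC. Qed.

Let rV_bigcup (F : _^nat) : (forall i, g_sigma_preimage coord (F i)) ->
  g_sigma_preimage coord (\bigcup_i (F i)).
Proof. exact: sigma_algebra_bigcup. Qed.

HB.instance Definition _ := @isMeasurable.Build default_measure_display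
  'rV[R]_n (g_sigma_preimage coord) rV_set0 rV_setC rV_bigcup.

End rV_measurable.

Section rV_norm.
Context {R : realType} (n : nat).
Implicit Type x : 'rV[R]_n.

Lemma coord_le_norm x i : `|x ord0 i| <= `|x|.
Proof.
rewrite -[leRHS]/(mx_norm x) mx_normrE.
exact: (le_bigmax _ (fun ij : 'I_1 * 'I_n => `|x ij.1 ij.2|) (ord0, i)).
Qed.

Lemma norm_rV_le x c : 0 <= c -> (forall i, `|x ord0 i| <= c) -> `|x| <= c.
Proof.
move=> c0 h; rewrite -[leLHS]/(mx_norm x) mx_normrE; apply: bigmax_le => // -[i j] _.
by rewrite ord1.
Qed.

Lemma norm_rV_lt x c : 0 < c -> (forall i, `|x ord0 i| < c) -> `|x| < c.
Proof.
move=> c0 h; rewrite -[ltLHS]/(mx_norm x) mx_normrE; apply/bigmax_ltP; split => // -[i j] _.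
by rewrite ord1.
Qed.

End rV_norm.

Section rV_measurable_fun.
Context {R : realType}.

Lemma measurable_coord n (i : 'I_n) :
  measurable_fun [set: 'rV[R]_n] (fun x => x ord0 i).
Proof.
move=> _ Y mY; rewrite setTI; apply: sub_sigma_algebra => /=.
rewrite -bigcup_seq/=; exists i => /=; first by rewrite mem_index_enum.
by exists Y => //; rewrite setTI.
Qed.

Lemma measurable_fun_rV d (T : measurableType d) n (F : T -> 'rV[R]_n) :
  (forall i, measurable_fun setT (fun x => F x ord0 i)) ->
  measurable_fun setT F.
Proof.
move=> mF _ A mA.
have : preimage_set_system setT F (g_sigma_preimage
  (fun (i : 'I_n) (x : 'rV[R]_n) => x ord0 i)) `<=` measurable.
  rewrite -g_sigma_preimage_comp; apply: smallest_sub.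
    exact: sigma_algebra_measurable.
  rewrite -bigcup_seq => B [i _] [C mC <-].
  exact: mF.
by apply; exists A.
Qed.

Let grid n k (x : 'rV[R]_n) : 'rV[int]_n :=
  \row_i Num.floor (k.+1%:R * x ord0 i).

Let of_grid n k (m : 'rV[int]_n) : 'rV[R]_n :=
  \row_i ((m ord0 i)%:~R / k.+1%:R).

Let grid_fiber n k (m : 'rV[int]_n) : measurable (@grid n k @^-1` [set m]).
Proof.
have -> : @grid n k @^-1` [set m] =
    \bigcap_(i in [set` (index_enum 'I_n)])
      ((fun x : 'rV[R]_n => x ord0 i) @^-1`
        [set t | Num.floor (k.+1%:R * t) = m ord0 i]).
  apply/seteqP; split => x /=.
    by move=> <- i _ /=; rewrite mxE.
  move=> h; apply/rowP => i; rewrite mxE.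
  by apply: h => /=; rewrite mem_index_enum.
rewrite bigcap_seq; apply: bigsetI_measurable => i _.
rewrite -[X in measurable X]setTI; apply: (@measurable_coord n i) => //.
have -> : [set t : R | Num.floor (k.+1%:R * t) = m ord0 i] =
   `[(m ord0 i)%:~R / k.+1%:R, ((m ord0 i + 1)%:~R) / k.+1%:R[%classic.
  apply/seteqP; split => t /=.
    move=> <-; rewrite in_itv /= ler_pdivrMr ?ltr0n// mulrC Num.Theory.ge_floor ?num_real//=.
    by rewrite ltr_pdivlMr ?ltr0n// mulrC; exact: floorD1_gt.
  rewrite in_itv/= ler_pdivrMr ?ltr0n// ltr_pdivlMr ?ltr0n// => h.
  by apply: floor_def; rewrite mulrC.
exact: measurable_itv.
Qed.

(** The sigma-algebra is not defined from the topology. [f] is the pointwise limit of its values at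
    the lower corners of a grid of mesh [1 / (k + 1)], and each approximation takes countably many
    values on measurable cells. *)
Lemma continuous_measurable_rV n (f : 'rV[R]_n -> R) :
  continuous f -> measurable_fun setT f.
Proof.
move=> cf.
apply: (@measurable_fun_cvg _ _ _ _ (fun k => f \o @of_grid n k \o @grid n k)).
  move=> k _ Y mY; rewrite setTI.
  have -> : (f \o @of_grid n k \o @grid n k) @^-1` Y =
    \bigcup_(m : 'rV[int]_n)
      ((@grid n k @^-1` [set m]) `&` [set _ | Y (f (of_grid k m))]).
    apply/seteqP; split => x /=.
      by move=> h; exists (grid k x).
    by move=> [m /= _ [<-]].
  apply: countable_bigcupT_measurable => // m; apply: measurableI.
    exact: grid_fiber.
  by have [h|h] := pselect (Y (f (of_grid k m)));
    [rewrite (_ : mkset _ = setT)|rewrite (_ : mkset _ = set0)] => //;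
    apply/seteqP; split.
move=> x _.
apply: (@cvg_comp _ _ _ (fun k => of_grid k (grid k x)) f _ (nbhs x));
  last exact: cf.
apply/cvgrPdist_lt => e e0.
near=> k; apply: norm_rV_lt => // j; rewrite !mxE.
have k1 : 0 < k.+1%:R :> R by rewrite ltr0n.
rewrite ger0_norm; last first.
  by rewrite subr_ge0 ler_pdivrMr// mulrC Num.Theory.ge_floor ?num_real.
rewrite ltrBlDl -ltrBlDr ltr_pdivlMr// mulrBl mulrC.
have h1 := floorD1_gt (k.+1%:R * x ord0 j).
rewrite intrD in h1; rewrite ltrBlDr; apply: (lt_trans h1); rewrite ltrD2l.
near: k; exists (Num.trunc e^-1).+1 => // k /= hk.
rewrite -ltr_pdivrMl// mulr1; apply: (lt_le_trans (truncnS_gt _)).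
by rewrite ler_nat; apply: (leq_trans hk).
Unshelve. all: by end_near. Qed.

End rV_measurable_fun.

(** * Lebesgue measure on R^n by iterated products *)

Lemma sigma_finite_prod d1 d2 (T1 : measurableType d1) (T2 : measurableType d2)
    (R : realType) (m1 : {sigma_finite_measure set T1 -> \bar R})
    (m2 : {sigma_finite_measure set T2 -> \bar R}) :
  sigma_finite setT (m1 \x m2)%E.
Proof.
have /sigma_finiteP[F [UF ndF Ffin]] := sigma_finiteT m1.
have /sigma_finiteP[G [UG ndG Gfin]] := sigma_finiteT m2.
exists (fun k => F k `*` G k).
  apply/seteqP; split => // -[x y] _.
  have [i _ Fx] : (\bigcup_i F i) x by rewrite -UF.
  have [j _ Gy] : (\bigcup_i G i) y by rewrite -UG.
  exists (maxn i j) => //; split => /=.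
    by apply: (subsetPset _ _ (ndF _ _ (leq_maxl i j))) Fx.
  by apply: (subsetPset _ _ (ndG _ _ (leq_maxr i j))) Gy.
move=> k; have [mF Fk] := Ffin k; have [mG Gk] := Gfin k.
split; first exact: measurableX.
by rewrite product_measure1E// lte_mul_pinfty// ge0_fin_numE.
Qed.

Section lebesgue_rV_step.
Context {R : realType} (n : nat).
Variable m : {sigma_finite_measure set 'rV[R]_n -> \bar R}.
Local Open Scope ereal_scope.

(** Literally the vector built in [iint], so that [iintE] can match the two recursions. *)
Definition row_cons (p : R * 'rV[R]_n) : 'rV[R]_n.+1 :=
  row_mx (const_mx p.1 : 'rV[R]_1) p.2.

Lemma row_cons0 p : row_cons p ord0 ord0 = p.1.
Proof.
rewrite /row_cons mxE; case: splitP => [j _|k].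
  by rewrite mxE.
by rewrite /= => /eqP; rewrite eq_sym addn_eq0.
Qed.

Lemma row_consS p (i : 'I_n) : row_cons p ord0 (lift ord0 i) = p.2 ord0 i.
Proof.
rewrite /row_cons mxE; case: splitP => [j|k].
  by rewrite ord1 /= => /eqP.
by rewrite /= /bump /= => /addnI /val_inj ->.
Qed.

Lemma measurable_row_cons : measurable_fun setT row_cons.
Proof.
apply: measurable_fun_rV => i.
case: (unliftP ord0 i) => [j ->|->].
  under eq_fun do rewrite row_consS.
  exact: (measurableT_comp (@measurable_coord R n j) measurable_snd).
under eq_fun do rewrite row_cons0.
exact: measurable_fst.
Qed.

Lemma measurable_row_consr t : measurable_fun setT (fun y => row_cons (t, y)).
Proof.
apply: measurable_fun_rV => i.
case: (unliftP ord0 i) => [j ->|->].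
  by under eq_fun do rewrite row_consS; exact: measurable_coord.
by under eq_fun do rewrite row_cons0; exact: measurable_cst.
Qed.

(** Pushforward of the product measure. Keeping it sigma-finite is what lets Tonelli be applied
    again in the next dimension. *)
Definition lebesgue_rV_step (A : set 'rV[R]_n.+1) : \bar R :=
  (lebesgue_measure \x m) (row_cons @^-1` A).

Let step0 : lebesgue_rV_step set0 = 0.
Proof. by rewrite /lebesgue_rV_step preimage_set0 measure0. Qed.

Let step_ge0 A : 0 <= lebesgue_rV_step A.
Proof. exact: measure_ge0. Qed.

Let step_sigma_additive : semi_sigma_additive lebesgue_rV_step.
Proof.
exact: (@measure_semi_sigma_additive _ _ _
  (measure_function_pushforward__canonical__measure_function_Measure
    (lebesgue_measure \x m) measurable_row_cons)).
Qed.

HB.instance Definition _ := isMeasure.Build _ _ _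
  lebesgue_rV_step step0 step_ge0 step_sigma_additive.

Let step_sigma_finite : sigma_finite setT lebesgue_rV_step.
Proof.
have [F UF Fm] := sigma_finite_prod lebesgue_measure m.
pose un (x : 'rV[R]_n.+1) : R * 'rV[R]_n := (x ord0 ord0, \row_i x ord0 (lift ord0 i)).
have unK : cancel row_cons un.
  by move=> [t y]; rewrite /un row_cons0; congr pair; apply/rowP => i; rewrite mxE row_consS.
have mun : measurable_fun setT un.
  apply/measurable_fun_pairP; split; first exact: measurable_coord.
  apply: measurable_fun_rV => i; rewrite /un/=.
  under eq_fun do rewrite mxE.
  exact: measurable_coord.
exists (fun k => un @^-1` F k).
  by rewrite -preimage_bigcup -UF preimage_setT.
move=> k; split.
  by rewrite -[X in measurable X]setTI; apply: mun => //; have [] := Fm k.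
rewrite /lebesgue_rV_step.
have -> : row_cons @^-1` (un @^-1` F k) = F k.
  by rewrite -comp_preimage; apply/seteqP; split => x /=; rewrite unK.
by have [] := Fm k.
Qed.

HB.instance Definition _ := Measure_isSigmaFinite.Build _ _ _
  lebesgue_rV_step step_sigma_finite.

Definition lebesgue_rV_succ : {sigma_finite_measure set 'rV[R]_n.+1 -> \bar R} :=
  lebesgue_rV_step.

End lebesgue_rV_step.

Section lebesgue_rV.
Context {R : realType}.
Local Open Scope ereal_scope.

Fixpoint lebesgue_rV n : {sigma_finite_measure set 'rV[R]_n -> \bar R} :=
  match n return {sigma_finite_measure set 'rV[R]_n -> \bar R} with
  | 0 => \d_(0%R : 'rV[R]_0)
  | m.+1 => lebesgue_rV_succ (lebesgue_rV m)
  end.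

Lemma ge0_integral_rV_step n (m : {sigma_finite_measure set 'rV[R]_n -> \bar R})
    (g : 'rV[R]_n.+1 -> \bar R) :
  measurable_fun setT g -> (forall x, 0 <= g x) ->
  \int[lebesgue_rV_succ m]_x g x =
  \int[lebesgue_measure \x m]_p g (row_cons p).
Proof.
move=> mg g0.
have := @ge0_integral_pushforward _ _ (measurableTypeR R * 'rV[R]_n)%type
  'rV[R]_n.+1 R (@row_cons R n) (@measurable_row_cons R n)
  (lebesgue_measure \x m) setT g measurableT mg (fun x _ => g0 x).
rewrite preimage_setT => <-; apply: eq_measure_integral => //.
exact: measurable_row_cons.
Qed.

Lemma ge0_integral_rVS1 n (g : 'rV[R]_n.+1 -> \bar R) :
  measurable_fun setT g -> (forall x, 0 <= g x) ->
  \int[lebesgue_rV n.+1]_x g x =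
  \int[lebesgue_measure]_t \int[lebesgue_rV n]_y g (row_cons (t, y)).
Proof.
move=> mg g0; rewrite ge0_integral_rV_step// fubini_tonelli1//.
exact: measurableT_comp mg (@measurable_row_cons R n).
Qed.

Lemma ge0_integral_rVS2 n (g : 'rV[R]_n.+1 -> \bar R) :
  measurable_fun setT g -> (forall x, 0 <= g x) ->
  \int[lebesgue_rV n.+1]_x g x =
  \int[lebesgue_rV n]_y \int[lebesgue_measure]_t g (row_cons (t, y)).
Proof.
move=> mg g0; rewrite ge0_integral_rV_step// fubini_tonelli2//.
exact: measurableT_comp mg (@measurable_row_cons R n).
Qed.

Lemma ge0_integral_rV0 (g : 'rV[R]_0 -> \bar R) : (forall x, 0 <= g x) ->
  \int[lebesgue_rV 0]_x g x = g 0%R.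
Proof.
move=> g0; have mg : measurable_fun setT g.
  rewrite (_ : g = cst (g 0%R)); first exact: measurable_cst.
  by apply/funext => x; rewrite (thinmx0 x).
by rewrite [LHS]integral_dirac// diracT mul1e.
Qed.

(** Connects the iterated integrals of the statement to a measure, to which convergence theorems and
    Fubini apply. *)
Lemma iintE n (g : 'rV[R]_n -> \bar R) :
  measurable_fun setT g -> (forall x, 0 <= g x) ->
  iint g = \int[lebesgue_rV n]_x g x.
Proof.
elim: n g => [|n IH] g mg g0.
  by rewrite ge0_integral_rV0.
rewrite ge0_integral_rVS1//=; apply: eq_integral => t _.
rewrite IH//.
exact: (measurableT_comp mg (measurable_row_consr t)).
Qed.

End lebesgue_rV.

(** * Substitution in one variable *)

Section subst1.
Context {R : realType}.
Let mu := @lebesgue_measure R.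

Lemma is_derive_ge_expanding (F F' : R -> R) (c : R) :
  (forall x : R, is_derive x (1 : R) F (F' x)) -> (forall x, c <= F' x) ->
  forall x y, x <= y -> c * (y - x) <= F y - F x.
Proof.
move=> dF cF x y; rewrite le_eqVlt => /predU1P[->|xy].
  by rewrite !subrr mulr0.
have [|z _ ->] := @MVT _ F F' _ _ xy (fun z _ => dF z).
  apply: continuous_subspaceT => z.
  by apply: differentiable_continuous; apply/derivable1_diffP; case: (dF z).
by apply: ler_wpM2r => //; rewrite subr_ge0 ltW.
Qed.

(** Substitute on [[-k, k]] and let [k] grow. The images [B k] exhaust the line because [F] expands
    distances by at least [c], and monotone convergence applies on both sides. *)
Lemma ge0_substitution_R (F F' : R -> R) (c : R) (G : R -> R) :
  (forall x : R, is_derive x (1 : R) F (F' x)) -> continuous F' -> 0 < c ->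
  (forall x, c <= F' x) -> continuous G -> (forall x, 0 <= G x) ->
  (\int[mu]_x (G (F x) * F' x)%:E = \int[mu]_x (G x)%:E)%E.
Proof.
move=> dF cF' c0 cF cG G0.
have F'E : derive1 F = F'.
  by apply/funext => x; rewrite derive1E; exact: derive_val.
have cFc : continuous F.
  move=> z; apply: differentiable_continuous; apply/derivable1_diffP.
  by case: (dF z).
have ex := is_derive_ge_expanding dF cF.
have incF : {homo F : x y / x < y}.
  move=> x y xy; rewrite -subr_gt0; apply: lt_le_trans (ex _ _ (ltW xy)).
  by rewrite mulr_gt0// subr_gt0.
have incF' : {homo F : x y / x <= y}.
  move=> x y xy; rewrite -subr_ge0; apply: le_trans (ex _ _ xy).
  by rewrite mulr_ge0 ?subr_ge0// ltW.
pose A k := `[- (k%:R : R), k%:R]%classic.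
pose B k := `[F (- (k%:R : R)), F k%:R]%classic.
have ndA : nondecreasing_seq A.
  move=> i j ij; apply/subsetPset => x; rewrite /A /= !in_itv /= => /andP[h1 h2].
  by rewrite (le_trans _ h1) ?lerN2 ?ler_nat// (le_trans h2) ?ler_nat.
have ndB : nondecreasing_seq B.
  move=> i j ij; apply/subsetPset => x; rewrite /B /= !in_itv /= => /andP[h1 h2].
  rewrite (le_trans _ h1) ?incF' ?lerN2 ?ler_nat//.
  by rewrite (le_trans h2) ?incF' ?ler_nat.
have bignat (x : R) : exists k : nat, `|x| <= k%:R.
  by exists (Num.trunc `|x|).+1; rewrite ltW// truncnS_gt.
have UA : \bigcup_k A k = setT.
  apply/seteqP; split => // x _; have [k hk] := bignat x; exists k => //.
  by rewrite /A /= in_itv /= -ler_norml.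
have UB : \bigcup_k B k = setT.
  apply/seteqP; split => // x _.
  have [k hk] := bignat ((`|x| + `|F 0|) / c); exists k => //.
  move: hk; rewrite ger0_norm ?divr_ge0 ?addr_ge0 ?(ltW c0)//.
  rewrite ler_pdivrMr// => hk; rewrite /B /= in_itv /=.
  have h1 : c * (0 - - k%:R) <= F 0 - F (- k%:R) by apply: ex; rewrite oppr_le0.
  have h2 : c * (k%:R - 0) <= F k%:R - F 0 by exact: ex.
  have := ler_norm x; have := ler_norm (- x); rewrite normrN.
  have := ler_norm (F 0); have := ler_norm (- F 0); rewrite normrN.
  move=> *; apply/andP; split; lra.
have mGF : measurable_fun setT (fun x => (G (F x) * F' x)%:E).
  apply/measurable_EFinP; apply: continuous_measurable_fun => x.
  apply: cvgM; last exact: cF'.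
  by apply: continuous_comp; [exact: cFc|exact: cG].
have mG : measurable_fun setT (fun x => (G x)%:E).
  by apply/measurable_EFinP; apply: continuous_measurable_fun.
have F'0 x : 0 <= F' x by rewrite (le_trans (ltW c0)).
have H1 : (\int[mu]_(x in A k) (G (F x) * F' x)%:E @[k --> \oo] -->
           \int[mu]_x (G (F x) * F' x)%:E)%E.
  rewrite -[in X in _ --> X]UA; apply: ge0_nondecreasing_set_cvg_integral => //.
  - by move=> i; exact: measurable_itv.
  - by move=> i; apply: measurable_funTS.
  - by move=> i x _; rewrite lee_fin mulr_ge0.
have H2 : (\int[mu]_(x in B k) (G x)%:E @[k --> \oo] --> \int[mu]_x (G x)%:E)%E.
  rewrite -[in X in _ --> X]UB; apply: ge0_nondecreasing_set_cvg_integral => //.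
  - by move=> i; exact: measurable_itv.
  - by move=> i; apply: measurable_funTS.
  - by move=> i x _; rewrite lee_fin.
have E12 : (fun k => \int[mu]_(x in A k) (G (F x) * F' x)%:E)%E =
           (fun k => \int[mu]_(x in B k) (G x)%:E)%E.
  apply/funext => k; rewrite /A /B.
  rewrite (@integration_by_substitution_increasing _ F G) //.
  - by apply: eq_integral => x _; rewrite F'E.
  - by rewrite (@le_trans _ _ 0) ?oppr_le0.
  - by move=> x y _ _; exact: incF.
  - by rewrite F'E => x _; exact: cF'.
  - apply/cvg_ex; exists (F' (- k%:R)); rewrite F'E.
    by apply: cvg_at_right_filter; exact: cF'.
  - apply/cvg_ex; exists (F' k%:R); rewrite F'E.
    by apply: cvg_at_left_filter; exact: cF'.
  - split.
    + by move=> x _; case: (dF x).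
    + by apply: cvg_at_right_filter; exact: cFc.
    + by apply: cvg_at_left_filter; exact: cFc.
  - exact: continuous_subspaceT.
rewrite E12 in H1.
by rewrite -(cvg_lim (@ereal_hausdorff R) H1) -(cvg_lim (@ereal_hausdorff R) H2).
Qed.

End subst1.

(** * Schur complements of coercive matrices *)

Section schur.
Context {R : realType}.

Definition schur n (J : 'M[R]_n.+1) : 'M[R]_n :=
  \matrix_(i, j) (J (lift ord0 i) (lift ord0 j) -
     J (lift ord0 i) ord0 * J ord0 (lift ord0 j) / J ord0 ord0).

(** The head [t] for which [row_cons (t, v) *m J] has zero head; it reappears as the derivative of
    the implicit function in [has_jac_fibre]. *)
Definition pivot_lift n (J : 'M[R]_n.+1) (v : 'rV[R]_n) : R :=
  - (\sum_i v ord0 i * J (lift ord0 i) ord0) / J ord0 ord0.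

Lemma row_cons_mulmx0 n (J : 'M[R]_n.+1) t (v : 'rV[R]_n) :
  (row_cons (t, v) *m J) ord0 ord0 =
  t * J ord0 ord0 + \sum_i v ord0 i * J (lift ord0 i) ord0.
Proof.
rewrite mxE big_ord_recl row_cons0; congr (_ + _); apply: eq_bigr => i _.
by rewrite row_consS.
Qed.

Lemma row_cons_mulmxS n (J : 'M[R]_n.+1) t (v : 'rV[R]_n) j :
  (row_cons (t, v) *m J) ord0 (lift ord0 j) =
  t * J ord0 (lift ord0 j) + \sum_i v ord0 i * J (lift ord0 i) (lift ord0 j).
Proof.
rewrite mxE big_ord_recl row_cons0; congr (_ + _); apply: eq_bigr => i _.
by rewrite row_consS.
Qed.

Lemma schurE n (J : 'M[R]_n.+1) (v : 'rV[R]_n) j :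
  (v *m schur J) ord0 j = (row_cons (pivot_lift J v, v) *m J) ord0 (lift ord0 j).
Proof.
rewrite row_cons_mulmxS mxE /pivot_lift -mulrA mulNr.
rewrite mulr_suml addrC -sumrB; apply: eq_bigr => i _; rewrite mxE; lra.
Qed.

Lemma pivot_liftE n (J : 'M[R]_n.+1) (v : 'rV[R]_n) : J ord0 ord0 != 0 ->
  (row_cons (pivot_lift J v, v) *m J) ord0 ord0 = 0.
Proof.
by move=> J0; rewrite row_cons_mulmx0 /pivot_lift mulfVK// addNr.
Qed.

(** Coercivity rather than invertibility: it keeps the pivot at least [c] and passes to the Schur
    complement with the same constant, so elimination can be iterated over the dimension. *)
Definition coercive n (J : 'M[R]_n) c :=
  forall v : 'rV[R]_n, c * sqnorm v <= dotv (v *m J) v.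

Lemma sqnorm_row_cons n t (v : 'rV[R]_n) :
  sqnorm (row_cons (t, v)) = t ^+ 2 + sqnorm v.
Proof.
rewrite /sqnorm big_ord_recl row_cons0; congr (_ + _); apply: eq_bigr => i _.
by rewrite row_consS.
Qed.

Lemma coercive_pivot n (J : 'M[R]_n.+1) c : coercive J c -> c <= J ord0 ord0.
Proof.
move=> /(_ (evec R ord0)); rewrite sqnorm_evec mulr1 dotv_evec evec_mulmx.
by rewrite mxE.
Qed.

(** Test [J] on the lift of [v]: the product has zero head, so the pairing only sees its tail, which
    is [v *m schur J]. *)
Lemma coercive_schur n (J : 'M[R]_n.+1) c : 0 < c -> coercive J c ->
  coercive (schur J) c.
Proof.
move=> c0 hJ v.
have J0 : J ord0 ord0 != 0 by rewrite gt_eqF// (lt_le_trans c0)// coercive_pivot.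
have := hJ (row_cons (pivot_lift J v, v)).
rewrite [X in _ <= X -> _]/dotv big_ord_recl pivot_liftE// mul0r add0r sqnorm_row_cons.
under eq_bigr do rewrite row_consS -schurE.
rewrite -/(dotv _ _); apply: le_trans; rewrite ler_wpM2l ?(ltW c0)//.
by rewrite lerDr sqr_ge0.
Qed.

Lemma det_schur n (J : 'M[R]_n.+1) : J ord0 ord0 != 0 ->
  \det J = J ord0 ord0 * \det (schur J).
Proof.
move=> J0; pose J' : 'M[R]_(1 + n) := J.
pose E : 'M[R]_(1 + n) := block_mx 1%:M 0 (- (J ord0 ord0)^-1 *: dlsubmx J') 1%:M.
have dE : \det E = 1 by rewrite /E det_lblock !det1 mulr1.
have -> : \det J = \det (E *m J') by rewrite det_mulmx dE mul1r.
rewrite -[X in E *m X]submxK /E mulmx_block !mul1mx !mul0mx !addr0.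
have -> : - (J ord0 ord0)^-1 *: dlsubmx J' *m ulsubmx J' + dlsubmx J' = 0.
  apply/matrixP => i j; rewrite !mxE big_ord1 !mxE !ord1 /=.
  rewrite (_ : lshift n 0 = ord0); last exact/val_inj.
  by rewrite mulrC mulrA mulrN divff// mulN1r addNr.
rewrite det_ublock; congr (_ * _).
  rewrite det_mx11 !mxE; congr (J _ _); exact/val_inj.
congr (\det _); apply/matrixP => i j; rewrite !mxE big_ord1 !mxE.
have -> : lshift n (0 : 'I_1) = ord0 by exact/val_inj.
have E1 (k : 'I_n) : rshift 1 k = lift ord0 k by exact/val_inj.
by rewrite !E1 /J'; lra.
Qed.

Lemma coercive_det_gt0 n (J : 'M[R]_n) c : 0 < c -> coercive J c -> 0 < \det J.
Proof.
elim: n J => [|n IH] J c0 hJ; first by rewrite det_mx00.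
have J0 : 0 < J ord0 ord0 by rewrite (lt_le_trans c0)// coercive_pivot.
rewrite det_schur ?gt_eqF// mulr_gt0// IH//.
exact: coercive_schur.
Qed.

Lemma continuous_sum (T : topologicalType) (I : Type) (r : seq I) (P : pred I) (F : I -> T -> R) :
  (forall i, continuous (F i)) -> continuous (fun x => \sum_(i <- r | P i) F i x).
Proof.
move=> h x; elim: r => [|i r IH].
  under eq_fun do rewrite big_nil; exact: cvg_cst.
under eq_fun do rewrite big_cons.
by case: (P i) => //; apply: cvgD => //; exact: h.
Qed.

Lemma continuous_prod (T : topologicalType) (I : Type) (r : seq I) (P : pred I) (F : I -> T -> R) :
  (forall i, continuous (F i)) -> continuous (fun x => \prod_(i <- r | P i) F i x).
Proof.
move=> h x; elim: r => [|i r IH].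
  under eq_fun do rewrite big_nil; exact: cvg_cst.
under eq_fun do rewrite big_cons.
by case: (P i) => //; apply: cvgM => //; exact: h.
Qed.

Lemma continuous_det (T : topologicalType) n (J : T -> 'M[R]_n) :
  (forall i j, continuous (fun x => J x i j)) -> continuous (fun x => \det (J x)).
Proof.
move=> cJ; rewrite /determinant.
apply: continuous_sum => s x; apply: cvgM; first exact: cvg_cst.
by apply: continuous_prod => i; exact: cJ.
Qed.

End schur.

Section continuity.
Context {R : realType} (T : topologicalType).
Implicit Types f g : T -> R.

Lemma ctsD f g : continuous f -> continuous g -> continuous (fun x => f x + g x).
Proof. by move=> hf hg x; apply: cvgD; [exact: hf|exact: hg]. Qed.

Lemma ctsN f : continuous f -> continuous (fun x => - f x).
Proof. by move=> hf x; apply: cvgN; exact: hf. Qed.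

Lemma ctsB f g : continuous f -> continuous g -> continuous (fun x => f x - g x).
Proof. by move=> hf hg; apply: ctsD => //; exact: ctsN. Qed.

Lemma ctsM f g : continuous f -> continuous g -> continuous (fun x => f x * g x).
Proof. by move=> hf hg x; apply: cvgM; [exact: hf|exact: hg]. Qed.

Lemma ctsV f : (forall x, f x != 0) -> continuous f -> continuous (fun x => (f x)^-1).
Proof. by move=> f0 hf x; apply: cvgV; [exact: f0|exact: hf]. Qed.

Lemma ctsC (U : topologicalType) (a : U) : continuous (fun _ : T => a).
Proof. by move=> x; exact: cvg_cst. Qed.

Lemma cts_comp (U V : topologicalType) (f : T -> U) (g : U -> V) :
  continuous f -> continuous g -> continuous (fun x => g (f x)).
Proof. by move=> hf hg x; apply: continuous_comp; [exact: hf|exact: hg]. Qed.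

End continuity.

(** * Jacobians as linear approximations *)

Section jacobian.
Context {R : realType}.

(** Frechet differentiability in the sup norm, the Jacobian acting on row vectors from the right.
    Explicit moduli suit the implicit function treated in [has_jac_fibre]. *)
Definition has_jac n m (S : 'rV[R]_n -> 'rV[R]_m) (x : 'rV[R]_n) (J : 'M[R]_(n, m)) :=
  forall e : R, 0 < e -> exists d : R, 0 < d /\ forall v : 'rV[R]_n,
    `|v| <= d -> `|S (x + v) - S x - v *m J| <= e * `|v|.

Lemma rV_coordB n (u v : 'rV[R]_n) i : (u - v) ord0 i = u ord0 i - v ord0 i.
Proof. by rewrite !mxE. Qed.

Lemma norm_mulmx_le n m (J : 'M[R]_(n, m)) (v : 'rV[R]_n) :
  `|v *m J| <= (\sum_i \sum_j `|J i j|) * `|v|.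
Proof.
apply: norm_rV_le => [|j].
  by rewrite mulr_ge0// sumr_ge0// => i _; exact: sumr_ge0.
rewrite mxE (le_trans (ler_norm_sum _ _ _))// mulr_suml; apply: ler_sum => i _.
rewrite normrM mulrC ler_pM ?coord_le_norm//.
by rewrite (bigD1 j)//= lerDl sumr_ge0.
Qed.

Lemma has_jac_lip n m (S : 'rV[R]_n -> 'rV[R]_m) x J : has_jac S x J ->
  exists C d, [/\ 0 < d, 0 <= C & forall v, `|v| <= d -> `|S (x + v) - S x| <= C * `|v|].
Proof.
move=> /(_ 1 ltr01) [d [d0 h]].
exists (1 + \sum_i \sum_j `|J i j|), d; split => //.
  by rewrite addr_ge0// sumr_ge0// => i _; exact: sumr_ge0.
move=> v /h h1; rewrite mulrDl.
rewrite -[X in `|X|](subrK (v *m J)) (le_trans (ler_normD _ _))// lerD//.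
exact: norm_mulmx_le.
Qed.

Lemma near_norm_lt (V : normedModType R) (x : V) (e : R) : 0 < e ->
  \forall z \near x, `|x - z| < e.
Proof. by move=> e0; apply/nbhs_normP; exists e. Qed.

Lemma near_norm_le (V : normedModType R) (x : V) (e : R) : 0 < e ->
  \forall z \near x, `|x - z| <= e.
Proof. by move=> /(near_norm_lt x); apply: filterS => z /ltW. Qed.

Lemma continuous_at_dist (T : topologicalType) (V : normedModType R) (F : T -> V) x :
  (forall e : R, 0 < e -> \forall z \near x, `|F x - F z| <= e) -> {for x, continuous F}.
Proof. by move=> h; apply/cvgrPdist_le. Qed.

Lemma continuous_at_distP (T : topologicalType) (V : normedModType R) (F : T -> V) x :
  {for x, continuous F} -> forall e : R, 0 < e -> \forall z \near x, `|F x - F z| <= e.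
Proof. by move=> h e e0; have /cvgrPdist_le/(_ e e0) := h. Qed.

Lemma continuous_rVP (T : topologicalType) n (F : T -> 'rV[R]_n) :
  (forall i, continuous (fun x => F x ord0 i)) -> continuous F.
Proof.
move=> h x; apply/cvgrPdist_lt => e e0.
have : \forall z \near x, forall i, `|F x ord0 i - F z ord0 i| < e.
  by apply: filter_forall => i; have /cvgrPdist_lt/(_ e e0) := h i x.
by apply: filterS => z hz; apply: norm_rV_lt => // i; rewrite !mxE.
Qed.

Lemma continuous_coord n (i : 'I_n) : continuous (fun x : 'rV[R]_n => x ord0 i).
Proof. exact: coord_continuous. Qed.

Lemma row_consr_continuous n (t : R) : continuous (fun y : 'rV[R]_n => row_cons (t, y)).
Proof.
apply: continuous_rVP => i; case: (unliftP ord0 i) => [j ->|->].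
  by under eq_fun do rewrite row_consS /=; exact: continuous_coord.
by under eq_fun do rewrite row_cons0 /=; exact: cst_continuous.
Qed.

Lemma row_consl_continuous n (y : 'rV[R]_n) : continuous (fun t : R => row_cons (t, y)).
Proof.
apply: continuous_rVP => i; case: (unliftP ord0 i) => [j ->|->].
  by under eq_fun do rewrite row_consS /=; move=> p; exact: cvg_cst.
by under eq_fun do rewrite row_cons0 /=; move=> p; exact: cvg_id.
Qed.

Lemma has_jac_continuous n m (S : 'rV[R]_n -> 'rV[R]_m) x J : has_jac S x J ->
  {for x, continuous S}.
Proof.
move=> /has_jac_lip [C [d [d0 C0 h]]]; apply: continuous_at_dist => e e0.
have m0 : 0 < Num.min d (e / (C + 1)).
  by rewrite lt_min d0 divr_gt0// ltr_wpDl.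
apply: filterS (near_norm_le x m0) => z.
rewrite le_min ler_pdivlMr ?ltr_wpDl// => /andP[h1 h2].
rewrite distrC -[z](subrK x) [z - x + x]addrC.
apply: (le_trans (h _ _)); first by rewrite distrC.
rewrite (le_trans _ h2)// distrC mulrC; apply: ler_wpM2l => //.
by rewrite lerDl.
Qed.

Lemma is_derive_eps (f : R -> R) (x l : R) :
  (forall e, 0 < e -> exists d, 0 < d /\
     forall h, `|h| <= d -> `|f (x + h) - f x - h * l| <= e * `|h|) ->
  is_derive x (1 : R) f l.
Proof.
move=> H.
have K : h^-1 *: (f (h *: (1:R) + x) - f x) @[h --> 0^'] --> l.
  apply/cvgrPdist_le => e e0; have [d [d0 h1]] := H e e0.
  near=> h.
  have h0 : h != 0 by near: h; exact: nbhs_dnbhs_neq.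
  have hd : `|h| <= d.
    near: h; apply: dnbhs0_le => //.
  rewrite distrC -(@ler_pM2r _ `|h|) ?normr_gt0// -normrM mulrBl.
  rewrite [h^-1 *: _]/GRing.scale /= mulrAC mulVf// mul1r /GRing.scale /= mulr1.
  by rewrite (addrC h) (mulrC l); exact: h1.
by apply: DeriveDef; [apply/cvg_ex; exists l|apply: cvg_lim].
Unshelve. all: by end_near. Qed.

Definition row_tail n (x : 'rV[R]_n.+1) : 'rV[R]_n := \row_i x ord0 (lift ord0 i).

Lemma row_consK n (x : 'rV[R]_n.+1) : row_cons (x ord0 ord0, row_tail x) = x.
Proof.
apply/rowP => i; case: (unliftP ord0 i) => [j ->|->].
  by rewrite row_consS mxE.
by rewrite row_cons0.
Qed.

Lemma row_tailK n t (y : 'rV[R]_n) : row_tail (row_cons (t, y)) = y.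
Proof. by apply/rowP => i; rewrite mxE row_consS. Qed.

Lemma row_consD n t (y : 'rV[R]_n) h v :
  row_cons (t + h, y + v) = row_cons (t, y) + row_cons (h, v).
Proof.
apply/rowP => i; rewrite [RHS]mxE; case: (unliftP ord0 i) => [j ->|->].
  by rewrite !row_consS /= mxE.
by rewrite !row_cons0.
Qed.

Lemma norm_row_cons_le n t (y : 'rV[R]_n) : `|row_cons (t, y)| <= `|t| + `|y|.
Proof.
apply: norm_rV_le => [|i]; first by rewrite addr_ge0.
case: (unliftP ord0 i) => [j ->|->].
  by rewrite row_consS (le_trans (coord_le_norm _ _))// lerDr.
by rewrite row_cons0 lerDl.
Qed.

Lemma continuous_row_tail n : continuous (@row_tail n).
Proof.
apply: continuous_rVP => i; under eq_fun do rewrite mxE.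
exact: continuous_coord.
Qed.

Lemma expanding_surj (F : R -> R) (c : R) : 0 < c -> continuous F ->
  (forall x y, x <= y -> c * (y - x) <= F y - F x) -> forall u, exists t, F t = u.
Proof.
move=> c0 cF ex u; pose k := (`|u| + `|F 0|) / c.
have k0 : 0 <= k by rewrite divr_ge0 ?addr_ge0 ?(ltW c0).
have hk : `|u| + `|F 0| = c * k by rewrite mulrC divfK// gt_eqF.
have h1 : c * (0 - - k) <= F 0 - F (- k) by apply: ex; rewrite oppr_le0.
have h2 : c * (k - 0) <= F k - F 0 by exact: ex.
have [|||t _ <-] := @IVT _ F (- k) k u; last by exists t.
- by rewrite (@le_trans _ _ 0)// oppr_le0.
- exact: continuous_subspaceT.
have := ler_norm u; have := ler_norm (- u); rewrite normrN.
have := ler_norm (F 0); have := ler_norm (- F 0); rewrite normrN.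
move=> *; rewrite ge_min le_max; apply/andP; split; apply/orP; [left|right]; lra.
Qed.

Lemma has_jac_head n (S : 'rV[R]_n.+1 -> 'rV[R]_n.+1) t y J :
  has_jac S (row_cons (t, y)) J ->
  is_derive t (1 : R) (fun t => S (row_cons (t, y)) ord0 ord0) (J ord0 ord0).
Proof.
move=> hS; apply: is_derive_eps => e e0; have [d [d0 h]] := hS e e0.
exists d; split => // k kd.
have kE : row_cons (t + k, y) = row_cons (t, y) + row_cons (k, 0).
  by rewrite -row_consD addr0.
have nk : `|row_cons (k, 0 : 'rV[R]_n)| <= `|k|.
  by rewrite (le_trans (norm_row_cons_le _ _))// normr0 addr0.
apply: (@le_trans _ _ (e * `|row_cons (k, 0 : 'rV[R]_n)|)); last first.
  by rewrite ler_wpM2l// ltW.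
apply: le_trans (h _ (le_trans nk kd)).
apply: le_trans (coord_le_norm _ ord0).
rewrite !rV_coordB -kE row_cons_mulmx0.
by rewrite big1 ?addr0// => i _; rewrite mxE mul0r.
Qed.

End jacobian.

(** * Change of variables in several dimensions *)

Section change_of_variables.
Context {R : realType}.

Section fibration.
Variables (n : nat) (S : 'rV[R]_n.+1 -> 'rV[R]_n.+1) (J : 'rV[R]_n.+1 -> 'M[R]_n.+1).
Variable c : R.
Hypothesis c0 : 0 < c.
Hypothesis hS : forall x, has_jac S x (J x).
Hypothesis cJ : forall i j, continuous (fun x => J x i j).
Hypothesis pJ : forall x, coercive (J x) c.

Let a (y : 'rV[R]_n) t := S (row_cons (t, y)) ord0 ord0.

Let a_derive y t : is_derive t (1 : R) (a y) (J (row_cons (t, y)) ord0 ord0).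
Proof. exact: has_jac_head. Qed.

Let a_expand y t t' : t <= t' -> c * (t' - t) <= a y t' - a y t.
Proof.
by apply: (is_derive_ge_expanding (a_derive y)) => z; exact: coercive_pivot.
Qed.

Let a_expand_norm y t t' : c * `|t' - t| <= `|a y t' - a y t|.
Proof.
case: (leP t t') => [h|/ltW h].
  by rewrite ger0_norm ?subr_ge0// (le_trans (a_expand y h))// ler_norm.
rewrite distrC (distrC (a y t')) ger0_norm ?subr_ge0//.
by rewrite (le_trans (a_expand y h))// ler_norm.
Qed.

Let cS : continuous S.
Proof. by move=> x; exact: has_jac_continuous (hS x). Qed.

Let solve_exists (x : 'rV[R]_n.+1) : exists t, a (row_tail x) t = x ord0 ord0.
Proof.
apply: (expanding_surj c0) => [t|t t']; last exact: a_expand.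
by apply: differentiable_continuous; apply/derivable1_diffP; case: (a_derive (row_tail x) t).
Qed.

Let xi x : R := projT1 (cid (solve_exists x)).
Let xiP x : a (row_tail x) (xi x) = x ord0 ord0.
Proof. exact: (projT2 (cid (solve_exists x))). Qed.

(** Inverse of the map sending [(t, y)] to the head of [S (t, y)] together with [y]: only the first
    coordinate is solved for, which is a monotone equation in one variable. *)
Definition fibre_inv x : 'rV[R]_n.+1 := row_cons (xi x, row_tail x).

Lemma fibre_inv_head x : S (fibre_inv x) ord0 ord0 = x ord0 ord0.
Proof. exact: xiP. Qed.

Lemma fibre_invK t y :
  fibre_inv (row_cons (S (row_cons (t, y)) ord0 ord0, y)) = row_cons (t, y).
Proof.
rewrite /fibre_inv row_tailK; congr (row_cons (_, _)).
set x := row_cons _.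
have := a_expand_norm y (xi x) t.
have -> : a y (xi x) = a y t by have := xiP x; rewrite /x row_tailK row_cons0.
rewrite subrr normr0 pmulr_rle0// normr_le0 subr_eq0 => /eqP->//.
Qed.

Let xi_lip x x' : c * `|xi x' - xi x| <= `|x' - x| +
  `|S (row_cons (xi x, row_tail x')) - S (fibre_inv x)|.
Proof.
apply: (le_trans (a_expand_norm (row_tail x') _ _)); rewrite xiP.
set s := a _ (xi x).
have -> : x' ord0 ord0 - s = (x' ord0 ord0 - x ord0 ord0) - (s - x ord0 ord0) by ring.
apply: (le_trans (ler_normB _ _)); apply: lerD.
  by apply: le_trans (coord_le_norm _ ord0); rewrite rV_coordB.
by apply: le_trans (coord_le_norm _ ord0); rewrite rV_coordB fibre_inv_head.
Qed.

Lemma continuous_fibre_inv : continuous fibre_inv.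
Proof.
apply: continuous_rVP => i; case: (unliftP ord0 i) => [j ->|->]; last first.
  rewrite /fibre_inv; under eq_fun do rewrite row_cons0 /=.
  move=> x; apply: continuous_at_dist => e e0.
  have ce : 0 < c * e / 2 by rewrite divr_gt0// mulr_gt0.
  have K : {for x, continuous (fun z => S (row_cons (xi x, row_tail z)))}.
    apply: (@continuous_comp _ _ _ (fun z => row_cons (xi x, row_tail z)) S);
      last exact: cS.
    apply: (@continuous_comp _ _ _ (@row_tail R n) (fun y => row_cons (xi x, y))).
      exact: continuous_row_tail.
    exact: row_consr_continuous.
  apply: filterS2 (near_norm_le x ce) (continuous_at_distP K ce) => z h1 h2.
  rewrite distrC -(ler_pM2l c0); apply: (le_trans (xi_lip x z)).
  have -> : c * e = c * e / 2 + c * e / 2 by lra.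
  by apply: lerD; rewrite distrC.
rewrite /fibre_inv; under eq_fun do rewrite row_consS /= mxE.
exact: continuous_coord.
Qed.

(** Implicit differentiation at a fixed head value [u]. The motion [eta] of the first coordinate is
    O(|v|) by expansion; as the head of the increment vanishes, [eta] then equals [pivot_lift] up to
    o(|v|), and inserting this in the tail produces the Schur complement. *)
Lemma has_jac_fibre u y :
  has_jac (fun y => row_tail (S (fibre_inv (row_cons (u, y))))) y
    (schur (J (fibre_inv (row_cons (u, y))))).
Proof.
set x := row_cons (u, y); set X := fibre_inv x; set JX := J X.
have j0 : c <= JX ord0 ord0 by exact: (coercive_pivot (pJ X)).
have [C [d1 [d10 C0 lipX]]] := has_jac_lip (hS X).
pose D := C / c + 1.
have D0 : 0 < D by rewrite ltr_wpDl// divr_ge0// ltW.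
pose N := \sum_j `|JX ord0 j|.
have N0 : 0 <= N by exact: sumr_ge0.
(* Total amplification of the relative remainder: [D] from the size of [row_cons (eta, v)], and
   [N / c] from the head error divided by the pivot and multiplied by the first row. *)
pose K := D * (1 + N / c).
have K0 : 0 < K by rewrite mulr_gt0// ltr_wpDr// divr_ge0// ltW.
move=> e e0; have [d2 [d20 h2]] := hS X (divr_gt0 e0 K0).
exists (Num.min d1 (d2 / D)); split; first by rewrite lt_min d10 divr_gt0.
move=> v; rewrite le_min => /andP[vd1]; rewrite ler_pdivlMr// => vd2.
set x' := row_cons (u, y + v); pose eta := xi x' - xi x.
have X'E : fibre_inv x' = X + row_cons (eta, v).
  rewrite /X /fibre_inv -row_consD /x' /x !row_tailK /eta; congr (row_cons (_, _)).
  by ring.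
have eta_le : `|eta| <= C / c * `|v|.
  rewrite mulrAC ler_pdivlMr// mulrC; apply: (le_trans (a_expand_norm (y + v) _ _)).
  have -> : a (y + v) (xi x') = S X ord0 ord0.
    by rewrite fibre_inv_head; have := xiP x'; rewrite /x' /x row_tailK !row_cons0.
  have -> : a (y + v) (xi x) = S (X + row_cons (0, v)) ord0 ord0.
    by rewrite /X /fibre_inv -row_consD addr0 /x row_tailK.
  have nv : `|row_cons (0 : R, v)| <= `|v|.
    by rewrite (le_trans (norm_row_cons_le _ _))// normr0 add0r.
  rewrite distrC (@le_trans _ _ (C * `|row_cons (0 : R, v)|))//; last by rewrite ler_wpM2l.
  apply: le_trans (lipX _ (le_trans nv vd1)).
  by apply: le_trans (coord_le_norm _ ord0); rewrite rV_coordB.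
set w := row_cons (eta, v) in X'E.
have nw : `|w| <= D * `|v|.
  by rewrite (le_trans (norm_row_cons_le _ _))// /D mulrDl mul1r lerD2r.
rewrite mulrC in vd2; have := h2 w (le_trans nw vd2).
rewrite -X'E; set r := _ - _ => hr.
have hr' : `|r| <= e / K * D * `|v|.
  by rewrite (le_trans hr)// -mulrA ler_wpM2l// divr_ge0// ltW.
have cr i : `|r ord0 i| <= e / K * D * `|v| := le_trans (coord_le_norm _ i) hr'.
have etap : `|eta - pivot_lift JX v| <= e / K * D * `|v| / c.
  rewrite ler_pdivlMr// mulrC.
  apply: le_trans (cr ord0).
  have -> : r ord0 ord0 = JX ord0 ord0 * (pivot_lift JX v - eta).
    rewrite /r !rV_coordB !fibre_inv_head /x' /x !row_cons0 subrr sub0r.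
    rewrite /w row_cons_mulmx0 /pivot_lift.
    have j1 : JX ord0 ord0 != 0 by rewrite gt_eqF// (lt_le_trans c0).
    by field.
  rewrite normrM distrC ler_wpM2r//.
  by rewrite (le_trans j0)// ler_norm.
apply: norm_rV_le => [|j]; first by rewrite mulr_ge0// ltW.
have -> : (row_tail (S (fibre_inv x')) - row_tail (S (fibre_inv x)) - v *m schur JX) ord0 j
   = r ord0 (lift ord0 j) + (eta - pivot_lift JX v) * JX ord0 (lift ord0 j).
  rewrite /r !rV_coordB schurE [row_tail _ _ _]mxE [row_tail _ _ _]mxE.
  rewrite /w !row_cons_mulmxS.
  by rewrite -/X; ring.
apply: (le_trans (ler_normD _ _)).
have hN : `|JX ord0 (lift ord0 j)| <= N.
  by rewrite /N (bigD1 (lift ord0 j))//= lerDl sumr_ge0.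
have : `|(eta - pivot_lift JX v) * JX ord0 (lift ord0 j)| <= e / K * D * `|v| / c * N.
  by rewrite normrM ler_pM.
move: (cr (lift ord0 j)) => h3 h4; apply: (le_trans (lerD h3 h4)).
have -> : e / K * D * `|v| + e / K * D * `|v| / c * N = (e / K) * K * `|v|.
  move: (e / K) => ek; rewrite /K; set D' := D; field.
  by rewrite gt_eqF.
by rewrite divfK ?gt_eqF.
Qed.

End fibration.

(** Induction on the dimension. With the tail fixed, substitution in the head costs the pivot; with
    the head value fixed, the tail map has Jacobian [schur], to which the induction hypothesis
    applies. Tonelli exchanges the order in between, and [det_schur] multiplies the two factors. *)
Theorem ge0_change_of_variables n (S : 'rV[R]_n -> 'rV[R]_n) (J : 'rV[R]_n -> 'M[R]_n)
    (c : R) (g : 'rV[R]_n -> R) :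
  0 < c -> (forall x, has_jac S x (J x)) ->
  (forall i j, continuous (fun x => J x i j)) -> (forall x, coercive (J x) c) ->
  continuous g -> (forall x, 0 <= g x) ->
  (\int[lebesgue_rV n]_x (g (S x) * \det (J x))%:E = \int[lebesgue_rV n]_x (g x)%:E)%E.
Proof.
move=> c0; elim: n S J g => [|n IH] S J g hS cJ pJ cg g0.
  rewrite !ge0_integral_rV0; last 2 first.
  - by move=> x; rewrite lee_fin.
  - by move=> x; rewrite lee_fin det_mx00 mulr1.
  by rewrite det_mx00 mulr1 (thinmx0 (S 0)).
have cS : continuous S by move=> x; exact: has_jac_continuous (hS x).
pose Xi := fibre_inv c0 hS pJ.
have cXi : continuous Xi by exact: continuous_fibre_inv.
have J0 x : J x ord0 ord0 != 0.
  by rewrite gt_eqF// (lt_le_trans c0)// coercive_pivot.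
pose h x := g (S (Xi x)) * \det (schur (J (Xi x))).
have h0 x : 0 <= h x.
  rewrite mulr_ge0// ltW//; apply: (coercive_det_gt0 c0); exact: coercive_schur.
have cschur i j : continuous (fun x => schur (J x) i j).
  under eq_fun do rewrite mxE.
  apply: ctsB; first exact: cJ.
  apply: ctsM; first by apply: ctsM; exact: cJ.
  by apply: ctsV => //; exact: cJ.
have ch : continuous h.
  apply: ctsM.
    by apply: cts_comp; [apply: cts_comp; [exact: cXi|exact: cS]|exact: cg].
  apply: continuous_det => i j.
  by apply: (@cts_comp _ _ _ Xi (fun x => schur (J x) i j)); [exact: cXi|exact: cschur].
have mE (k : 'rV[R]_n.+1 -> R) : continuous k -> measurable_fun setT (fun x => (k x)%:E).
  by move=> ck; apply/measurable_EFinP; exact: continuous_measurable_rV.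
rewrite ge0_integral_rVS2; last 2 first.
- apply: mE; apply: ctsM; first exact: cts_comp.
  exact: continuous_det.
- by move=> x; rewrite lee_fin mulr_ge0// ltW// (coercive_det_gt0 c0).
transitivity (\int[lebesgue_rV n]_y \int[lebesgue_measure]_t (h (row_cons (t, y)))%:E)%E.
  apply: eq_integral => y _.
  rewrite -(@ge0_substitution_R _ (fun t => S (row_cons (t, y)) ord0 ord0)
     (fun t => J (row_cons (t, y)) ord0 ord0) c (fun t => h (row_cons (t, y)))
     (fun t => has_jac_head (hS (row_cons (t, y))))) //.
  - apply: eq_integral => t _; congr EFin.
    by rewrite /h /Xi fibre_invK det_schur// mulrA mulrAC -mulrA mulrA.
  - move=> t; apply: (@continuous_comp _ _ _ (fun t => row_cons (t, y)) (fun x => J x ord0 ord0)).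
      exact: row_consl_continuous.
    exact: cJ.
  - by move=> t; apply: coercive_pivot.
  - move=> t; apply: (@continuous_comp _ _ _ (fun t => row_cons (t, y)) h).
      exact: row_consl_continuous.
    exact: ch.
rewrite -(@ge0_integral_rVS2 _ _ (fun x => (h x)%:E)); [|exact: mE|by move=> x; rewrite lee_fin].
rewrite ge0_integral_rVS1; [|exact: mE|by move=> x; rewrite lee_fin].
rewrite ge0_integral_rVS1; [|exact: mE|by move=> x; rewrite lee_fin].
apply: eq_integral => u _.
have cX y : {for y, continuous (fun y => Xi (row_cons (u, y)))}.
  apply: (@continuous_comp _ _ _ (fun y => row_cons (u, y)) Xi).
    exact: row_consr_continuous.
  exact: cXi.
rewrite -(IH (fun y => row_tail (S (Xi (row_cons (u, y)))))
  (fun y => schur (J (Xi (row_cons (u, y))))) (fun y => g (row_cons (u, y)))) //.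
- apply: eq_integral => y _; congr EFin; rewrite /h; congr (g _ * _).
  by rewrite -[LHS]row_consK fibre_inv_head row_cons0.
- by move=> y; exact: has_jac_fibre.
- move=> i j; apply: (@cts_comp _ _ _ (fun y => Xi (row_cons (u, y))) (fun x => schur (J x) i j)).
    exact: cX.
  exact: cschur.
- by move=> y; exact: coercive_schur.
- apply: (@cts_comp _ _ _ (fun y => row_cons (u, y)) g); last exact: cg.
  exact: row_consr_continuous.
Qed.

End change_of_variables.

(** * Scaling and translation of Lebesgue measure *)

Section affine_invariance.
Context {R : realType}.
Local Open Scope ereal_scope.

Let affine (a b : R) : measurableTypeR R -> measurableTypeR R := fun t => (a * t + b)%R.

Let measurable_affine a b : measurable_fun setT (affine a b).
Proof.
apply: continuous_measurable_fun => t; apply: cvgD; last exact: cvg_cst.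
by apply: cvgM; [exact: cvg_cst|exact: cvg_id].
Qed.

(** For merely measurable [g]. The pushforward under the affine map, rescaled by [a], agrees with
    Lebesgue measure on half-open intervals, hence everywhere by uniqueness. *)
Lemma ge0_integral_affine_R (a b : R) (g : R -> \bar R) : (0 < a)%R ->
  measurable_fun setT g -> (forall t, 0 <= g t) ->
  a%:E * \int[lebesgue_measure]_t g (a * t + b)%R = \int[lebesgue_measure]_t g t.
Proof.
move=> a0 mg g0.
pose p : {measure set (measurableTypeR R) -> \bar R} :=
  measure_function_pushforward__canonical__measure_function_Measure
    (@lebesgue_measure R) (@measurable_affine a b).
pose m : {measure set (measurableTypeR R) -> \bar R} := mscale (NngNum (ltW a0)) p.
have mE A : measurable A -> lebesgue_measure A = m A.
  apply: lebesgue_measure_unique => _ [[x y]] _ <-.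
  transitivity (a%:E * lebesgue_measure (affine a b @^-1` `]x, y]%classic)); last by [].
  have -> : affine a b @^-1` `]x, y]%classic = `]((x - b) / a)%R, ((y - b) / a)%R]%classic.
    apply/seteqP; split => t /=; rewrite /affine !in_itv /= ltr_pdivrMr// ler_pdivlMr// mulrC.
      by rewrite ltrBlDr lerBrDr.
    by rewrite ltrBlDr lerBrDr.
  rewrite !lebesgue_measure_itv /= !lte_fin ltr_pM2r ?invr_gt0// ltrD2r.
  case: ifP => _; last by rewrite mule0.
  rewrite -!EFinB -EFinM; congr EFin; field.
  by rewrite gt_eqF.
transitivity (\int[m]_t g t); last by apply: eq_measure_integral => A mA _; first [exact: (mE A mA)|exact/esym/(mE A mA)].
rewrite /m ge0_integral_mscale//=; congr (_ * _).
have := @ge0_integral_pushforward _ _ (measurableTypeR R) (measurableTypeR R) R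
  (affine a b) (@measurable_affine a b) (@lebesgue_measure R) setT g measurableT mg (fun x _ => g0 x).
rewrite preimage_setT => <-.
exact: eq_measure_integral.
Qed.

Lemma ge0_integral_affine n (a : R) (b : 'rV[R]_n) (g : 'rV[R]_n -> \bar R) :
  (0 < a)%R -> measurable_fun setT g -> (forall x, 0 <= g x) ->
  (a ^+ n)%:E * \int[lebesgue_rV n]_x g (a *: x + b)%R = \int[lebesgue_rV n]_x g x.
Proof.
move=> a0; elim: n b g => [|n IH] b g mg g0.
  by rewrite expr0 mul1e !ge0_integral_rV0// (thinmx0 (_ + _)%R).
have maff : measurable_fun setT (fun x : 'rV[R]_n.+1 => (a *: x + b)%R).
  apply: measurable_fun_rV => i; under eq_fun do rewrite !mxE.
  apply: measurable_funD => //; apply: measurable_funM => //.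
  exact: measurable_coord.
have mga : measurable_fun setT (fun x : 'rV[R]_n.+1 => g (a *: x + b)%R).
  exact: (measurableT_comp mg maff).
pose b0 := b ord0 ord0; pose b' : 'rV[R]_n := \row_i b ord0 (lift ord0 i).
have bE t y : (a *: row_cons (t, y) + b = row_cons (a * t + b0, a *: y + b'))%R.
  apply/rowP => i; rewrite [LHS]mxE [X in (X + _)%R]mxE.
  case: (unliftP ord0 i) => [j ->|->].
    by rewrite !row_consS !mxE.
  by rewrite !row_cons0.
have mG : measurable_fun setT (fun t : R => \int[lebesgue_rV n]_y g (row_cons (t, y))).
  apply: (@measurable_fun_fubini_tonelli_F _ _ _ _ _ (lebesgue_rV n) (fun p => g (row_cons p))) => //.
  exact: (measurableT_comp mg (@measurable_row_cons R n)).
have mr t : measurable_fun setT (fun y : 'rV[R]_n => g (row_cons (t, y))).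
  exact: (measurableT_comp mg (measurable_row_consr t)).
rewrite ge0_integral_rVS1//.
under eq_integral do under eq_integral do rewrite bE.
rewrite (ge0_integral_rVS1 mg)//.
rewrite -(@ge0_integral_affine_R a b0 _ a0 mG); last by move=> t; exact: integral_ge0.
rewrite exprS EFinM -muleA; congr (_ * _).
rewrite -ge0_integralZl//.
- by apply: eq_integral => t _; rewrite (IH b' (fun y => g (row_cons ((a * t + b0)%R, y)))).
- have := @measurable_fun_fubini_tonelli_F _ _ _ _ _ (lebesgue_rV n)
    (fun p : measurableTypeR R * 'rV[R]_n => g (a *: row_cons p + b)%R).
  under [X in _ -> _ -> measurable_fun setT X]eq_fun do under eq_integral do rewrite bE.
  apply => //.
  exact: (measurableT_comp mga (@measurable_row_cons R n)).
- by move=> t _; exact: integral_ge0.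
- by rewrite lee_fin exprn_ge0// ltW.
Qed.

End affine_invariance.

(** * Expectations on a weighted class of functions *)

Section expectation.
Context d (T : measurableType d) (R : realType).
Variables (m : {measure set T -> \bar R}) (w q : T -> R).
Hypothesis mw : measurable_fun setT w.
Hypothesis w0 : forall x, 0 <= w x.
Hypothesis mq : measurable_fun setT q.
Hypothesis q1 : forall x, 1 <= q x.
Hypothesis iqw : m.-integrable setT (fun x => (q x * w x)%:E).

(** Since [q >= 1] is integrable against [w], the class contains the constants, is a vector space
    and consists of integrable functions. Linearity of [expect] then asks only for membership, and
    dominated convergence only for a common [C]. *)
Definition dominated (F : T -> R) :=
  measurable_fun setT F /\ exists C, forall x, `|F x| <= C * q x.

Definition expect (F : T -> R) : R := (\int[m]_x (F x * w x))%R.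

Let q0 x : 0 <= q x. Proof. by rewrite (le_trans ler01). Qed.

Lemma dominated_integrable F : dominated F ->
  m.-integrable setT (fun x => (F x * w x)%:E).
Proof.
move=> [mF [C hC]].
apply: (@le_integrable _ _ _ _ _ _ _ (fun x => (C%:E * (q x * w x)%:E)%E)) => //.
- by apply/measurable_EFinP; exact: measurable_funM.
- move=> x _; rewrite -EFinM !abse_EFin lee_fin !normrM mulrA ler_wpM2r//.
  by rewrite (le_trans (hC x))// -normrM ler_norm.
- exact: integrableZl.
Qed.

Lemma dominatedD F G : dominated F -> dominated G -> dominated (fun x => F x + G x).
Proof.
move=> [mF [C hC]] [mG [D hD]]; split; first exact: measurable_funD.
by exists (C + D) => x; rewrite mulrDl (le_trans (ler_normD _ _))// lerD.
Qed.

Lemma dominatedZ a F : dominated F -> dominated (fun x => a * F x).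
Proof.
move=> [mF [C hC]]; split; first exact: measurable_funM.
by exists (`|a| * C) => x; rewrite normrM -mulrA ler_wpM2l.
Qed.

Lemma dominatedN F : dominated F -> dominated (fun x => - F x).
Proof.
by move=> /(dominatedZ (-1)); congr dominated; apply/funext => x; rewrite mulN1r.
Qed.

Lemma dominatedB F G : dominated F -> dominated G -> dominated (fun x => F x - G x).
Proof. by move=> hF /dominatedN; exact: dominatedD. Qed.

Lemma dominatedC a : dominated (fun=> a).
Proof. by split => //; exists `|a| => x; rewrite ler_peMr. Qed.

Lemma dominated_sum (I : Type) (r : seq I) (P : pred I) (F : I -> T -> R) :
  (forall i, dominated (F i)) -> dominated (fun x => \sum_(i <- r | P i) F i x).
Proof.
move=> h; elim: r => [|i r IH].
  by under eq_fun do rewrite big_nil; exact: dominatedC.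
under eq_fun do rewrite big_cons.
by case: (P i) => //; exact: dominatedD.
Qed.

Lemma expectD F G : dominated F -> dominated G ->
  expect (fun x => F x + G x) = expect F + expect G.
Proof.
move=> hF hG; rewrite /expect -RintegralD//; [|exact: dominated_integrable..].
by apply: eq_Rintegral => x _; rewrite mulrDl.
Qed.

Lemma expectZ a F : dominated F -> expect (fun x => a * F x) = a * expect F.
Proof.
move=> hF; rewrite /expect -RintegralZl//; [|exact: dominated_integrable].
by apply: eq_Rintegral => x _; rewrite mulrA.
Qed.

Lemma expectN F : dominated F -> expect (fun x => - F x) = - expect F.
Proof.
move=> hF; rewrite -mulN1r -expectZ//; congr expect.
by apply/funext => x; rewrite mulN1r.
Qed.

Lemma expectB F G : dominated F -> dominated G ->
  expect (fun x => F x - G x) = expect F - expect G.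
Proof. by move=> hF hG; rewrite expectD ?expectN//; exact: dominatedN. Qed.

Lemma expect_sum (I : Type) (r : seq I) (P : pred I) (F : I -> T -> R) :
  (forall i, dominated (F i)) ->
  expect (fun x => \sum_(i <- r | P i) F i x) = \sum_(i <- r | P i) expect (F i).
Proof.
move=> h; elim: r => [|i r IH].
  rewrite big_nil /expect -[RHS](mul0r (\int[m]_x (1 * w x))%R).
  rewrite -RintegralZl//; last exact: (dominated_integrable (dominatedC 1)).
  by apply: eq_Rintegral => x _; rewrite big_nil !mul0r.
rewrite big_cons -IH.
case: ifP => Pi.
  rewrite -expectD//; last exact: dominated_sum.
  by congr expect; apply/funext => x; rewrite big_cons Pi.
by congr expect; apply/funext => x; rewrite big_cons Pi.
Qed.

Lemma expect_le F G : dominated F -> dominated G -> (forall x, F x <= G x) ->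
  expect F <= expect G.
Proof.
move=> hF hG h; apply: le_Rintegral => //; [exact: dominated_integrable..|].
by move=> x _; rewrite ler_wpM2r.
Qed.

Lemma expect_dct (F_ : nat -> T -> R) (F : T -> R) (C : R) :
  (forall k, measurable_fun setT (F_ k)) ->
  (forall k x, `|F_ k x| <= C * q x) ->
  (forall x, F_ k x @[k --> \oo] --> F x) ->
  dominated F /\ expect (F_ k) @[k --> \oo] --> expect F.
Proof.
move=> mF_ hC cF.
have mF : measurable_fun setT F by apply: (measurable_fun_cvg mF_) => x _; exact: cF.
have dF : dominated F.
  split => //; exists C => x.
  have c1 : `|F_ k x| @[k --> \oo] --> `|F x| by apply: cvg_norm; exact: cF.
  rewrite -(cvg_lim (@Rhausdorff R) c1); apply: limr_le; first by apply/cvg_ex; exists `|F x|.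
  by apply: nearW.
split => //.
have dFk k : dominated (F_ k) by split => //; exists C.
have [_ _ H] := @dominated_convergence _ _ R m setT measurableT
  (fun k x => (F_ k x * w x)%:E) (fun x => (F x * w x)%:E)
  (fun x => (C * (q x * w x))%:E)
  (fun k => measurable_int _ (dominated_integrable (dFk k))) (measurable_int _ (dominated_integrable dF))
  ltac:(apply/aeW => x _; apply/fine_cvgP; split; [exact: nearW|apply: cvgM; [exact: cF|exact: cvg_cst]])
  ltac:(by under eq_fun do rewrite EFinM; exact: integrableZl)
  ltac:(apply/aeW => x k _; rewrite abse_EFin lee_fin normrM mulrA (ger0_norm (w0 x)) ler_wpM2r//).
rewrite /expect /Rintegral.
have fF : (\int[m]_x (F x * w x)%:E)%E \is a fin_num.
  exact/integrable_fin_num/dominated_integrable.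
by apply: fine_cvg; rewrite fineK.
Qed.

End expectation.

(** * Differentials, gradients and Taylor bounds *)

Section differential_bridge.
Context {R : realType}.

Lemma differentiable_eps n (V : normedModType R) (F : 'rV[R]_n -> V) x : differentiable F x ->
  forall e : R, 0 < e -> exists d : R, 0 < d /\ forall v, `|v| <= d ->
    `|F (x + v) - F x - 'D_v F x| <= e * `|v|.
Proof.
move=> dF e e0.
have /diff_locallyP [_ /eqaddoP H] := dF.
have /nbhs_normP [d /= d0 hd] := H e e0.
exists (d / 2); split; first by rewrite divr_gt0.
move=> v vd.
have : `|v| < d by rewrite (le_lt_trans vd)// ltr_pdivrMr// ltr_pMr// ltr1n.
rewrite deriveE// => vd'.
have := hd v; rewrite /ball_ /= sub0r normrN => /(_ vd').
rewrite -[X in `|X|]/(F (v + x) - (F x + 'd F x v)) => h.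
by rewrite (_ : _ - _ - _ = F (v + x) - (F x + 'd F x v)) // (addrC x) opprD addrA.
Qed.

Definition lin_of n (a : 'rV[R]_n) (v : 'rV[R]_n) : R := dotv v a.

Lemma lin_of_linear n (a : 'rV[R]_n) : linear (lin_of a).
Proof. by move=> k u v; rewrite /lin_of dotvDl dotvZl. Qed.

HB.instance Definition _ n (a : 'rV[R]_n) :=
  GRing.isLinear.Build R 'rV[R]_n R *:%R (lin_of a) (@lin_of_linear n a).

Lemma lin_of_continuous n (a : 'rV[R]_n) : continuous (lin_of a).
Proof.
rewrite /lin_of /dotv; apply: continuous_sum => i; apply: ctsM.
  exact: continuous_coord.
exact: ctsC.
Qed.

Lemma eps_differentiable n (F : 'rV[R]_n -> R) (x a : 'rV[R]_n) :
  (forall e : R, 0 < e -> exists d : R, 0 < d /\ forall v, `|v| <= d ->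
    `|F (x + v) - F x - dotv v a| <= e * `|v|) ->
  differentiable F x /\ forall v, 'D_v F x = dotv v a.
Proof.
move=> H.
have E : F \o shift x = cst (F x) + lin_of a +o_ (0 : 'rV[R]_n) id.
  apply/eqaddoP => e e0; have [d [d0 hd]] := H e e0.
  suff : \forall v \near (0 : 'rV[R]_n),
    `|(F \o shift x - (cst (F x) + lin_of a)) v| <= e * `|v| by [].
  apply/nbhs_normP; exists d => // v; rewrite /ball_ /= sub0r normrN => /ltW vd.
  rewrite -[X in `|X|]/(F (v + x) - (F x + lin_of a v)).
  by rewrite opprD addrA addrC (addrC v) addrC; exact: hd.
have dE := diff_unique (@lin_of_continuous n a) E.
have dF : differentiable F x.
  by apply/diff_locallyP; rewrite dE; split; [exact: lin_of_continuous|exact: E].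
by split => // v; rewrite deriveE// dE.
Qed.

Lemma derive_grad n (F : 'rV[R]_n -> R) x v : differentiable F x ->
  'D_v F x = dotv v (grad F x).
Proof.
move=> dF; rewrite deriveE//.
have {1}-> : v = \sum_i v ord0 i *: evec R i.
  apply/rowP => j; rewrite summxE (bigD1 j)//= !mxE !eqxx mulr1 big1 ?addr0// => i ij.
  by rewrite !mxE eqxx eq_sym (negbTE ij) mulr0.
rewrite linear_sum; apply: eq_bigr => i _; rewrite linearZ /= mxE /partial.
by rewrite deriveE.
Qed.

Lemma is_derive_line n (F : 'rV[R]_n -> R) x v (t : R) : differentiable F (x + t *: v) ->
  is_derive t (1 : R) (fun t => F (x + t *: v)) (dotv v (grad F (x + t *: v))).
Proof.
move=> dF; rewrite -derive_grad//.
apply: is_derive_eps => e e0.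
have e1 : 0 < e / (`|v| + 1) by rewrite divr_gt0// ltr_wpDl.
have [d [d0 hd]] := differentiable_eps dF e1.
exists (d / (`|v| + 1)); split; first by rewrite divr_gt0// ltr_wpDl.
move=> h hh.
have nh : `|h *: v| <= d.
  rewrite normrZ (@le_trans _ _ (d / (`|v| + 1) * `|v|))//; first by rewrite ler_wpM2r.
  rewrite mulrAC ler_pdivrMr ?ltr_wpDl// ler_wpM2l ?(ltW d0)// lerDl//.
have := hd _ nh; rewrite scalerDl addrA => h1.
have <- : 'D_(h *: v) F (x + t *: v) = h * 'D_v F (x + t *: v).
  by rewrite !deriveE// linearZ.
apply: (le_trans h1); rewrite normrZ mulrCA mulrC; apply: ler_wpM2r => //.
by rewrite mulrAC ler_pdivrMr ?ltr_wpDl// ler_wpM2l ?(ltW e0)// lerDl.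
Qed.

Lemma MVT_rV n (F : 'rV[R]_n -> R) x v : (forall y, differentiable F y) ->
  exists t : R, [/\ 0 <= t, t <= 1 & F (x + v) - F x = dotv v (grad F (x + t *: v))].
Proof.
move=> dF.
have [||t] := @MVT R (fun t => F (x + t *: v)) (fun t => dotv v (grad F (x + t *: v))) 0 1 ltr01.
- by move=> t _; exact: is_derive_line.
- apply: continuous_subspaceT => t; apply: differentiable_continuous.
  by apply/derivable1_diffP; case: (is_derive_line (dF (x + t *: v))).
rewrite in_itv /= => /andP[t0 t1]; rewrite scale1r scale0r addr0 subr0 mulr1 => h.
by exists t; rewrite !ltW.
Qed.

Lemma differentiable_cts n (F : 'rV[R]_n -> R) : (forall y, differentiable F y) -> continuous F.
Proof. by move=> dF y; exact: differentiable_continuous. Qed.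

(* Quadratic Taylor remainder, from bounds on the second partial derivatives. *)
Lemma taylor2_partial n (F : 'rV[R]_n -> R) (B : R) :
  (forall y, differentiable F y) -> (forall i y, differentiable (partial i F) y) ->
  (forall i j y, `|partial j (partial i F) y| <= B) ->
  forall y v, `|F (y + v) - F y - dotv v (grad F y)| <= (n%:R * n%:R * B) * `|v| ^+ 2.
Proof.
move=> dF dpF hB y v; have [t [t0 t1 ->]] := MVT_rV y v dF.
have B0 (i : 'I_n) : 0 <= B by rewrite (le_trans _ (hB i i 0)).
have K i : `|partial i F (y + t *: v) - partial i F y| <= n%:R * B * `|v|.
  have [s [s0 s1 ->]] := MVT_rV y (t *: v) (dpF i).
  rewrite /dotv (le_trans (ler_norm_sum _ _ _))//.
  apply: (@le_trans _ _ (\sum_(j < n) (`|v| * B))).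
    apply: ler_sum => j _; rewrite normrM ler_pM//; last by rewrite mxE.
    rewrite mxE normrM ger0_norm// (le_trans _ (coord_le_norm _ j))//.
    by rewrite ler_piMl.
  by rewrite sumr_const card_ord -mulr_natr le_eqVlt; apply/orP; left; apply/eqP; ring.
rewrite -dotvNr -dotvDr /dotv (le_trans (ler_norm_sum _ _ _))//.
apply: (@le_trans _ _ (\sum_(j < n) (`|v| * (n%:R * B * `|v|)))).
  apply: ler_sum => i _; rewrite normrM ler_pM ?coord_le_norm//.
  by rewrite !mxE.
rewrite sumr_const card_ord -mulr_natr expr2 le_eqVlt; apply/orP; left; apply/eqP.
ring.
Qed.

End differential_bridge.

(** * Gronwall inequality for one-sided increments *)

Section dini.
Context {R : realType}.

Lemma expR_quad (x : R) : 0 <= x -> x <= 2^-1 -> expR x - 1 - x <= 2 * x ^+ 2.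
Proof.
move=> x0 x1.
have h1 : 1 - x <= expR (- x) by exact: expR_ge1Dx.
have h2 : 0 < 1 - x by lra.
have h3 : expR x <= (1 - x)^-1.
  by rewrite -[expR x]invrK -expRN lef_pV2 ?posrE ?expR_gt0.
have h4 : (1 - x)^-1 <= 1 + x + 2 * x ^+ 2.
  rewrite -[leLHS]mul1r ler_pdivrMr//; nra.
lra.
Qed.

(* No left continuity is needed of E: going backward from [ep], the set of
   times at which the exponentially weighted value dominates the one at [ep]
   is stable to the left, and it is closed from the right since E is
   nonincreasing. *)
Lemma dini_decay (E U : R -> R) (al c ep : R) : 0 < al -> 0 < ep ->
  (forall s t, 0 <= s -> s <= t -> t <= ep -> E t <= E s) ->
  (forall s, 0 <= s -> s < ep -> forall e, 0 < e ->
     exists d, 0 < d /\ forall r, s <= r -> r <= s + d -> r <= ep -> U r <= U s + e) ->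
  (forall t, 0 < t -> t <= ep -> forall k d, 0 < k -> 0 < d ->
     exists h, [/\ 0 < h, h <= d, h <= t &
       E t + U t - (E (t - h) + U (t - h)) <= h * (- (al * (E t + U t)) + c + k)]) ->
  E ep + U ep - c / al <= expR (- (al * ep)) * (E 0 + U 0 - c / al).
Proof.
move=> al0 ep0 nE cU step.
pose X t := E t + U t - c / al.
pose K t := expR (al * t) * X t.
suff H : K ep <= K 0.
  have : expR (- (al * ep)) * K ep <= expR (- (al * ep)) * K 0.
    by rewrite ler_wpM2l// expR_ge0.
  by rewrite /K mulrA -expRD addNr expR0 mul1r mulr0 expR0 mul1r.
apply/ler_addgt0Pr => e e0.
(* The tolerance [e] is spent at the constant rate [k] over [[0, ep]]. *)
pose k := e / ep; have k0 : 0 < k by rewrite divr_gt0.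
pose S := [set s | [/\ 0 <= s, s <= ep & K ep <= K s + k * (ep - s)]].
have Sep : S ep by split => //; [exact: ltW|rewrite subrr mulr0 addr0].
have hasS : has_inf S by split; [exists ep|exists 0 => s []].
have Slb s : S s -> inf S <= s by move=> Ss; apply: ge_inf => //; exact: hasS.2.
set s := inf S in Slb.
have s0 : 0 <= s by apply: lb_le_inf; [exists ep|move=> r []].
have sep : s <= ep by exact: Slb.
(* The infimum is attained: at points [r] of [S] just to the right of [s], [E r] is at most [E s],
   [U r] exceeds [U s] by little, and the weight is continuous. *)
have Ss : S s.
  split => //; apply/ler_addgt0Pr => g g0.
  have [sE|sN] := eqVneq s ep; first by rewrite sE subrr mulr0 addr0 lerDl ltW.
  have slt : s < ep by rewrite lt_neqAle sN.
  pose M := expR (al * ep); have M0 : 0 < M by exact: expR_gt0.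
  have [d1 [d10 h1]] := cU s s0 slt (g / (2 * M)) ltac:(by rewrite divr_gt0// mulr_gt0).
  have cexp : continuous (fun r : R => expR (al * r) * X s).
    apply: ctsM; last exact: ctsC.
    apply: cts_comp; last exact: continuous_expR.
    by apply: ctsM; [exact: ctsC|move=> ?; exact: cvg_id].
  have /nbhs_normP [d2 /= d20 h2] := continuous_at_distP (cexp s) (divr_gt0 g0 (ltr0n _ 2)).
  pose d := Num.min d1 (d2 / 2).
  have d0 : 0 < d by rewrite lt_min d10 divr_gt0.
  have [r Sr rlt] := inf_adherent d0 hasS.
  have [r0 rep Kr] := Sr; have sr : s <= r by exact: Slb.
  apply: (le_trans Kr).
  have rs1 : r - s <= d1 by move: rlt; rewrite -/s => /ltW; rewrite -lerBlDl le_min => /andP[].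
  have rs2 : r - s <= d2 / 2 by move: rlt; rewrite -/s => /ltW; rewrite -lerBlDl le_min => /andP[].
  have Xr : X r <= X s + g / (2 * M).
    have := nE s r s0 sr rep; have := h1 r sr _ rep.
    have -> : r <= s + d1 by lra.
    move=> /(_ isT); rewrite /X; lra.
  have er : expR (al * r) <= M by rewrite ler_expR ler_wpM2l// ltW.
  have er0 : 0 < expR (al * r) by exact: expR_gt0.
  have : `|s - r| < d2 by rewrite distrC ger0_norm ?subr_ge0//; lra.
  move=> /h2; rewrite ler_norml => /andP[h3 h4].
  have h5 : K r <= expR (al * r) * X s + g / 2.
    rewrite /K; apply: (@le_trans _ _ (expR (al * r) * (X s + g / (2 * M)))).
      by rewrite ler_wpM2l// ltW.
    rewrite mulrDr lerD2l.
    have -> : g / 2 = M * (g / (2 * M)) by field; rewrite gt_eqF.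
    by rewrite ler_wpM2r// ltW// divr_gt0// mulr_gt0.
  have h6 : k * (ep - r) <= k * (ep - s) by rewrite ler_wpM2l ?(ltW k0)// lerB.
  move: h5; rewrite /K; lra.
have [s_eq0|sN0] := eqVneq s 0.
  have [_ _] := Ss; rewrite s_eq0 subr0 => h; apply: (le_trans h).
  by rewrite lerD2l /k divfK// gt_eqF.
exfalso.
have sgt : 0 < s by rewrite lt_neqAle eq_sym sN0.
pose M := expR (al * s); have M0 : 0 < M by exact: expR_gt0.
(* [A] controls the second-order part of the exponential weight, with 1 added for positivity. Half
   of [k] pays for it through the choice of [d]; the other half pays for the slack [k / (2 * M)]
   passed to [step], which is later multiplied by a weight at most [M]. *)
pose A := `|X s| * (2 * al ^+ 2) * M + 1.
have A0 : 0 < A by rewrite ltr_wpDl// !mulr_ge0// ?sqr_ge0// ltW.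
pose d := Num.min (2^-1 / al) (k / 2 / A).
have d0 : 0 < d by rewrite lt_min !divr_gt0.
have [h [h0 hd hs hh]] := step s sgt sep (k / (2 * M)) d ltac:(by rewrite divr_gt0// mulr_gt0) d0.
have alh : al * h <= 2^-1.
  by rewrite mulrC -ler_pdivlMr//; apply: le_trans hd _; rewrite ge_min lexx.
have hA : h * A <= k / 2.
  by rewrite -ler_pdivlMr//; apply: le_trans hd _; rewrite ge_min lexx orbT.
have alh0 : 0 <= al * h by rewrite mulr_ge0// ltW.
pose m := expR (al * (s - h)).
have m0 : 0 < m by exact: expR_gt0.
have mM : m <= M.
  by rewrite ler_expR ler_wpM2l ?(ltW al0)// lerBlDr lerDl ltW.
have ME : M = m * expR (al * h).
  by rewrite /M /m -expRD; congr expR; ring.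
have q := expR_quad alh0 alh.
have q0 : 0 <= expR (al * h) - 1 - al * h.
  by have := expR_ge1Dx (al * h); lra.
set Q := expR (al * h) - 1 - al * h in q q0.
have alN : al != 0 by rewrite gt_eqF.
have KE : K s - K (s - h) =
    m * (X s * Q) + m * ((E s + U s - (E (s - h) + U (s - h))) + h * (al * X s)).
  rewrite /K -/M -/m ME /Q /X; ring.
have alX : al * X s = al * (E s + U s) - c by rewrite /X mulrBr mulrCA divff// mulr1.
have B1 : X s * Q <= `|X s| * (2 * (al * h) ^+ 2).
  apply: (le_trans (ler_norm _)); rewrite normrM ler_wpM2l// ger0_norm//.
have B2 : m * (X s * Q) <= h * (h * (A - 1)).
  apply: (@le_trans _ _ (M * (`|X s| * (2 * (al * h) ^+ 2)))).
    apply: (@le_trans _ _ (m * (`|X s| * (2 * (al * h) ^+ 2)))).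
      by rewrite ler_wpM2l// ltW.
    by rewrite ler_wpM2r// mulr_ge0// mulr_ge0// sqr_ge0.
  rewrite /A addrK le_eqVlt; apply/orP; left; apply/eqP; ring.
have B3 : m * ((E s + U s - (E (s - h) + U (s - h))) + h * (al * X s)) <= h * (k / 2).
  apply: (@le_trans _ _ (m * (h * (k / (2 * M))))).
    by rewrite ler_wpM2l ?(ltW m0)//; move: hh; rewrite alX; lra.
  apply: (@le_trans _ _ (M * (h * (k / (2 * M))))).
    by rewrite ler_wpM2r// mulr_ge0 ?(ltW h0)// ltW// divr_gt0// mulr_gt0.
  rewrite le_eqVlt; apply/orP; left; apply/eqP; field.
  by rewrite gt_eqF.
have B4 : K s - K (s - h) <= h * k.
  rewrite KE; have : h * (h * A) <= h * (k / 2) by rewrite ler_wpM2l// ltW.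
  have : 0 <= h * h by rewrite mulr_ge0// ltW.
  move: B2; rewrite (_ : h * (h * (A - 1)) = h * (h * A) - h * h); [lra|by ring].
have : S (s - h).
  split; [lra|lra|].
  have [_ _ h7] := Ss; apply: (le_trans h7); lra.
move=> /Slb; lra.
Qed.

End dini.

(** * Expansion of the logarithm of a determinant *)

Section log_det.
Context {R : realType}.

(** In dimension [m.+1] the determinant is [h ^+ m.+1] times the characteristic polynomial of [- B]
    at [1 / h]. Its two leading coefficients are 1 and [\tr B], and every other one ends up
    multiplied by at least [h ^+ 2]. *)
Lemma det_1D_expand n (B : 'M[R]_n) :
  exists C : R, 0 <= C /\ forall h : R, `|h| <= 1 ->
    `|\det (1%:M + h *: B) - 1 - h * \tr B| <= C * h ^+ 2.
Proof.
case: n B => [|m] B.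
  exists 0; split => // h _; rewrite det_mx00 mul0r /mxtrace big_ord0 mulr0.
  by rewrite !subrr normr0.
pose p := char_poly (- B).
exists (\sum_(i < m) `|p`_i|); split; first exact: sumr_ge0.
move=> h h1; have [->|h0] := eqVneq h 0.
  by rewrite scale0r addr0 det1 mul0r subrr subr0 normr0 expr0n mulr0.
have E1 : \det (1%:M + h *: B) = h ^+ m.+1 * p.[h^-1].
  have -> : 1%:M + h *: B = h *: (h^-1%:M + B).
    by rewrite scalerDr scale_scalar_mx divff.
  rewrite detZ; congr (_ * _); rewrite /p /char_poly -horner_evalE -det_map_mx.
  congr (\det _); apply/matrixP => i j; rewrite !mxE /= /horner_eval.
  by rewrite !(hornerE, hornerMn) opprK.
have sp : size p = m.+2 by rewrite size_char_poly.
have lp : p`_m.+1 = 1.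
  have := char_poly_monic (- B); rewrite monicE lead_coefE -/p sp => /eqP//.
have tp : p`_m = \tr B.
  by have := char_poly_trace (n := m.+1) (- B) isT; rewrite /= -/p => ->; rewrite raddfN opprK.
rewrite E1 horner_coef sp !big_ord_recr /= lp tp mul1r.
have -> : h ^+ m.+1 * (\sum_(i < m) p`_i * h^-1 ^+ i + \tr B * h^-1 ^+ m + h^-1 ^+ m.+1)
   - 1 - h * \tr B = \sum_(i < m) p`_i * h ^+ (m.+1 - i).
  have -> : h ^+ m.+1 * (\sum_(i < m) p`_i * h^-1 ^+ i + \tr B * h^-1 ^+ m + h^-1 ^+ m.+1)
    = h ^+ m.+1 * (\sum_(i < m) p`_i * h^-1 ^+ i) + h * \tr B + 1.
    rewrite !mulrDr; congr (_ + _ + _).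
      by rewrite exprS !exprVn; field; rewrite expf_neq0.
    by rewrite exprVn divff// expf_neq0.
  rewrite addrK addrK mulr_sumr; apply: eq_bigr => i _.
  rewrite mulrCA; congr (_ * _).
  have im : (i <= m.+1)%N by rewrite ltnW// ltnS ltnW.
  by rewrite exprVn -[in LHS](subnK im) exprD mulfK// expf_neq0.
rewrite (le_trans (ler_norm_sum _ _ _))// mulr_suml; apply: ler_sum => i _.
rewrite normrM ler_wpM2l// normrX -real_normK ?num_real//.
have -> : (m.+1 - i = 2 + (m - i.+1))%N.
  have := ltn_ord i; lia.
by rewrite exprD ler_piMr ?exprn_ge0// exprn_ile1.
Qed.

Lemma coercive_1D n (K : 'M[R]_n) a : opbound K a -> coercive (1%:M + K) (1 - a).
Proof.
move=> hK v; rewrite mulmxDr mulmx1 dotvDl dotvv mulrBl mul1r lerD2l.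
rewrite -[leLHS]opprK lerNl -dotvNl; apply: (le_trans (dotv_le _ _)).
by rewrite opprK enormN -sqr_enorm expr2 mulrA ler_wpM2r ?enorm_ge0.
Qed.

Variables (n : nat) (K : 'M[R]_n) (L : R).
Hypotheses (L0 : 0 <= L) (hK : opbound K L).

Let A (t : R) := 1%:M + t *: K.

Let hA t : 0 <= t -> opbound (t *: K) (t * L).
Proof. by move=> t0; have := opboundZ t hK; rewrite ger0_norm. Qed.

(** Two rounds of [(1 + tK)^-1 B = B - t (1 + tK)^-1 K B]. The remainder is kept exact because its
    trace is estimated both in [ln_det_le] and in [dissipation_pointwise]. *)
Lemma inv_1D_expand t : A t \in unitmx ->
  invmx (A t) *m K = K - t *: (K *m K) + (t ^+ 2) *: (invmx (A t) *m (K *m (K *m K))).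
Proof.
move=> uA.
have E (B : 'M[R]_n) : invmx (A t) *m B = B - t *: (invmx (A t) *m (K *m B)).
  have : invmx (A t) *m (A t *m B) = B by rewrite mulmxA mulVmx// mul1mx.
  rewrite {2}/A mulmxDl mul1mx mulmxDr -scalemxAl -scalemxAr => {2}<-.
  by rewrite addrK.
by rewrite [LHS]E (E (K *m K)) scalerBr opprB scalerA -expr2 addrA addrAC.
Qed.

(** Jacobi's formula, from the factorisation [A (t + h) = A t *m (1 + h B)]. *)
Lemma is_derive_det t : A t \in unitmx ->
  is_derive t (1 : R) (fun t => \det (A t)) (\det (A t) * \tr (invmx (A t) *m K)).
Proof.
move=> uA; set B := invmx (A t) *m K.
have [C [C0 hC]] := det_1D_expand B.
have E h : \det (A (t + h)) = \det (A t) * \det (1%:M + h *: B).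
  rewrite -det_mulmx /A scalerDl addrA; congr (\det _).
  by rewrite mulmxDr mulmx1 -scalemxAr /B mulmxA mulmxV// mul1mx.
apply: is_derive_eps => e e0.
pose D := `|\det (A t)| * C + 1; have D0 : 0 < D by rewrite ltr_wpDl// mulr_ge0.
exists (Num.min 1 (e / D)); split; first by rewrite lt_min ltr01 divr_gt0.
move=> h; rewrite le_min => /andP[h1]; rewrite ler_pdivlMr// => hD.
have -> : \det (A (t + h)) - \det (A t) - h * (\det (A t) * \tr B) =
    \det (A t) * (\det (1%:M + h *: B) - 1 - h * \tr B) by rewrite E; ring.
rewrite normrM; apply: (@le_trans _ _ (`|\det (A t)| * (C * h ^+ 2))).
  by rewrite ler_wpM2l// hC.
rewrite -real_normK ?num_real// expr2 !mulrA; apply: ler_wpM2r => //.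
apply: le_trans hD; rewrite mulrC ler_wpM2l// /D lerDl//.
Qed.

(** Both sides vanish at 0, so derivatives are compared. On the left stands the trace of
    [(1 + sK)^-1 K], whose third-order remainder is at most [(1 - sL)^-1 n L^3 s^2]; since
    [(1 - sL)^-1 <= 3/2], the derivative of the cubic term covers it. *)
Lemma ln_det_le t : 0 <= t -> t * L <= 4^-1 ->
  ln (\det (A t)) <= t * \tr K - t ^+ 2 / 2 * \tr (K *m K) + n%:R * L ^+ 3 / 2 * t ^+ 3.
Proof.
move=> t0 tL.
have small s : 0 <= s -> s <= t -> [/\ s * L < 1, 0 <= s * L, s * L <= 4^-1,
    A s \in unitmx & 0 < \det (A s)].
  move=> s0 st; have h1 : s * L <= t * L by rewrite ler_wpM2r.
  have h2 : 0 <= s * L by rewrite mulr_ge0.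
  have h3 : s * L < 1 by lra.
  split => //; [lra|exact: (unitmx_1D h2 h3 (hA s0))|].
  by apply: (@coercive_det_gt0 _ _ _ (1 - s * L)); [lra|exact: coercive_1D (hA s0)].
pose psi s := ln (\det (A s)) - (s * \tr K - s ^+ 2 / 2 * \tr (K *m K) + n%:R * L ^+ 3 / 2 * s ^+ 3).
pose dpsi s := \tr (invmx (A s) *m K) - (\tr K - s * \tr (K *m K) + n%:R * L ^+ 3 / 2 * (3 * s ^+ 2)).
have dpsiP s : 0 <= s -> s <= t -> is_derive s (1 : R) psi (dpsi s).
  move=> s0 st; have [_ _ _ uA dA] := small s s0 st.
  have d1 := is_derive_det uA.
  have d2 : is_derive s (1 : R) (fun s => ln (\det (A s))) (\tr (invmx (A s) *m K)).
    apply: is_derive_eq (is_derive1_comp (is_derive1_ln dA) d1) _.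
    by rewrite mulrA mulVf ?mul1r// gt_eqF.
  have d3 : is_derive s (1 : R) (fun s : R => s * \tr K - s ^+ 2 / 2 * \tr (K *m K) + n%:R * L ^+ 3 / 2 * s ^+ 3)
     (\tr K - s * \tr (K *m K) + n%:R * L ^+ 3 / 2 * (3 * s ^+ 2)).
    by apply: is_derive_eq; rewrite /GRing.scale /=; field.
  exact: is_deriveB.
have dle s : 0 <= s -> s <= t -> dpsi s <= 0.
  move=> s0 st; have [h1 h2 h3 uA _] := small s s0 st.
  rewrite /dpsi inv_1D_expand// !raddfD /= raddfN /= !mxtraceZ.
  have oK3 : opbound (invmx (A s) *m (K *m (K *m K))) ((1 - s * L)^-1 * (L * (L * L))).
    apply: opboundM; first by rewrite !mulr_ge0.
      exact: opbound_inv_1D (hA s0).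
    by apply: opboundM => //; [rewrite mulr_ge0|exact: opboundM].
  have := opbound_trace oK3; rewrite ler_norml => /andP[_ h4].
  have h5 : (1 - s * L)^-1 <= 3 / 2.
    by rewrite -[leLHS]mul1r ler_pdivrMr; lra.
  have L3 : 0 <= n%:R * (L * (L * L)) by rewrite !mulr_ge0.
  have h6 : \tr (invmx (A s) *m (K *m (K *m K))) <= 3 / 2 * (n%:R * (L * (L * L))).
    by apply: (le_trans h4); rewrite mulrCA ler_wpM2r.
  have : s ^+ 2 * \tr (invmx (A s) *m (K *m (K *m K))) <= s ^+ 2 * (3 / 2 * (n%:R * (L * (L * L)))).
    by rewrite ler_wpM2l// sqr_ge0.
  have -> : L ^+ 3 = L * (L * L) by rewrite !exprS expr0 mulr1.
  lra.
suff : psi t <= psi 0.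
  rewrite /psi /A scale0r addr0 det1 ln1 !mul0r expr0n /= !mul0r !subr0 expr0n mulr0 addr0 subr0.
  by rewrite subr_le0.
have [->//|tN] := eqVneq t 0.
have tgt : 0 < t by rewrite lt_neqAle eq_sym tN.
have [||s] := @MVT R psi dpsi 0 t tgt.
- by move=> s; rewrite in_itv /= => /andP[s0 st]; apply: dpsiP; exact: ltW.
- apply: derivable_within_continuous => s; rewrite in_itv /= => /andP[s0 st].
  by case: (dpsiP s s0 st).
rewrite in_itv /= => /andP[s0 st] h.
rewrite -subr_le0 h; apply: mulr_le0_ge0; last by rewrite subr0.
by apply: dle; exact: ltW.
Qed.

End log_det.

(** * Differentiation rules *)

Section chain.
Context {R : realType} (n : nat).

Lemma chain_real (phi : R -> R) (h : 'rV[R]_n -> R) x (l : R) :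
  differentiable h x -> is_derive (h x) (1 : R) phi l ->
  differentiable (fun y => phi (h y)) x /\
  forall v, 'D_v (fun y => phi (h y)) x = l * 'D_v h x.
Proof.
move=> dh dphi.
have dp : differentiable phi (h x) by apply/derivable1_diffP; case: dphi.
have dc : differentiable (phi \o h) x by exact: differentiable_comp.
split => // v.
rewrite -[X in 'D_v X x]/(phi \o h) deriveE// diff_comp//= deriveE//.
rewrite -[X in 'd phi _ X]mulr1 -[X in 'd phi _ X]/('d h x v *: (1 : R)) linearZ /=.
by have [_ <-] := dphi; rewrite deriveE// mulrC.
Qed.

Lemma sqnorm_differentiable (x : 'rV[R]_n) :
  differentiable (@sqnorm R n) x /\ forall v, 'D_v (@sqnorm R n) x = dotv v (2 *: x).
Proof.
apply: eps_differentiable => e e0.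
pose N : R := n%:R * n%:R + 1.
have N0 : 0 < N by rewrite ltr_wpDl// mulr_ge0.
exists (e / N); split; first by rewrite divr_gt0.
move=> v; rewrite ler_pdivlMr// => hv.
rewrite sqnormD dotvZr (dotvC v).
rewrite (_ : _ - _ - _ = sqnorm v); last by ring.
rewrite ger0_norm ?sqnorm_ge0// -sqr_enorm.
apply: (@le_trans _ _ ((n%:R * `|v|) ^+ 2)).
  by rewrite ler_pXn2r ?nnegrE ?enorm_ge0 ?mulr_ge0// enorm_le_normr.
rewrite exprMn 2!expr2 mulrA; apply: ler_wpM2r => //.
apply: le_trans hv; rewrite mulrC ler_wpM2l// /N lerDl//.
Qed.

Lemma continuous_sqnorm : continuous (@sqnorm R n).
Proof. by apply: differentiable_cts => y; case: (sqnorm_differentiable y). Qed.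

Lemma differentiable_mul (F G : 'rV[R]_n -> R) x :
  differentiable F x -> differentiable G x ->
  differentiable (fun y => F y * G y) x /\
  forall v, 'D_v (fun y => F y * G y) x = F x * 'D_v G x + G x * 'D_v F x.
Proof.
move=> dF dG; split; first exact: differentiableM.
by move=> v; rewrite (deriveM (diff_derivable dF) (diff_derivable dG)).
Qed.

Lemma differentiable_add (F G : 'rV[R]_n -> R) x :
  differentiable F x -> differentiable G x ->
  differentiable (fun y => F y + G y) x /\
  forall v, 'D_v (fun y => F y + G y) x = 'D_v F x + 'D_v G x.
Proof.
move=> dF dG; split; first exact: differentiableD.
by move=> v; rewrite (deriveD (diff_derivable dF) (diff_derivable dG)).
Qed.

Lemma differentiable_scale (F : 'rV[R]_n -> R) (a : R) x :
  differentiable F x -> differentiable (fun y => a * F y) x /\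
  forall v, 'D_v (fun y => a * F y) x = a * 'D_v F x.
Proof.
move=> dF; split; first exact: (differentiableZ a dF).
by move=> v; exact: (deriveZ a (diff_derivable dF)).
Qed.

Lemma differentiable_proj (i : 'I_n) (x : 'rV[R]_n) :
  differentiable (fun y : 'rV[R]_n => y ord0 i) x /\
  forall v, 'D_v (fun y : 'rV[R]_n => y ord0 i) x = v ord0 i.
Proof.
have [H1 H2] : differentiable (fun y : 'rV[R]_n => y ord0 i) x /\
    forall v, 'D_v (fun y : 'rV[R]_n => y ord0 i) x = dotv v (evec R i).
  apply: eps_differentiable => e e0; exists 1; split => // v _.
  rewrite (_ : _ - _ - _ = 0); first by rewrite normr0 mulr_ge0// ltW.
  by rewrite dotv_evec mxE; ring.
by split => // v; rewrite H2 dotv_evec.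
Qed.

End chain.

(** * Polynomials times a Gaussian *)

Section gaussian_class.
Context {R : realType} (n : nat) (b : R).
Hypothesis b0 : 0 < b.

Definition kern (x : 'rV[R]_n) : R := expR (- (b * sqnorm x)).

(** Closed under partial derivatives and made of bounded functions, which yields bounds on all
    derivatives of the heat kernel at once. *)
Inductive gauss_poly : ('rV[R]_n -> R) -> Prop :=
| gp_kern : gauss_poly kern
| gp_X i F : gauss_poly F -> gauss_poly (fun x => x ord0 i * F x)
| gp_Z a F : gauss_poly F -> gauss_poly (fun x => a * F x)
| gp_D F G : gauss_poly F -> gauss_poly G -> gauss_poly (fun x => F x + G x).

Lemma kern_differentiable x : differentiable kern x /\
  forall v, 'D_v kern x = - (2 * b) * dotv v x * kern x.
Proof.
have [d1 D1] := sqnorm_differentiable x.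
have [d2 D2] := differentiable_scale (- b) d1.
have [d3 D3] := chain_real d2 (is_derive_expR (- b * sqnorm x)).
have -> : kern = fun y => expR (- b * sqnorm y).
  by apply/funext => y; rewrite /kern mulNr.
split => // v; rewrite D3 D2 D1 dotvZr; ring.
Qed.

Lemma gauss_poly_diff F : gauss_poly F -> (forall x, differentiable F x) /\
  forall i, gauss_poly (partial i F).
Proof.
elim => [|i G gG [dG pG]|a G gG [dG pG]|G H gG [dG pG] gH [dH pH]].
- split => [x|i]; first by case: (kern_differentiable x).
  have -> : partial i kern = fun x => - (2 * b) * (x ord0 i * kern x).
    apply/funext => x; rewrite /partial; have [_ ->] := kern_differentiable x.
    by rewrite dotvC dotv_evec mulrA.
  by apply: gp_Z; apply: gp_X; exact: gp_kern.
- have D x := differentiable_mul (differentiable_proj i x).1 (dG x).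
  split => [x|j]; first by case: (D x).
  have -> : partial j (fun x => x ord0 i * G x) =
      fun x => x ord0 i * partial j G x + (evec R j) ord0 i * G x.
    apply/funext => x; rewrite /partial (D x).2 (differentiable_proj i x).2.
    by rewrite (mulrC (G x)).
  by apply: gp_D; [exact: gp_X|exact: gp_Z].
- have D x := differentiable_scale a (dG x).
  split => [x|j]; first by case: (D x).
  have -> : partial j (fun x => a * G x) = fun x => a * partial j G x.
    by apply/funext => x; rewrite /partial (D x).2.
  exact: gp_Z.
- have D x := differentiable_add (dG x) (dH x).
  split => [x|j]; first by case: (D x).
  have -> : partial j (fun x => G x + H x) = fun x => partial j G x + partial j H x.
    by apply/funext => x; rewrite /partial (D x).2.
  exact: gp_D.
Qed.

Lemma expr_le_expR (m : nat) (u : R) : 0 <= u -> u ^+ m <= m%:R ^+ m * expR u.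
Proof.
case: m => [|m] u0; first by rewrite !expr0 mul1r -[leLHS]addr0 (le_trans _ (expR_ge1Dx _))// lerD2l.
have h : u / m.+1%:R <= expR (u / m.+1%:R).
  by rewrite (le_trans _ (expR_ge1Dx _))// lerDr.
have -> : expR u = expR (u / m.+1%:R) ^+ m.+1.
  by rewrite -expRM_natl mulrC divfK.
rewrite -exprMn ler_pXn2r ?nnegrE ?mulr_ge0 ?expR_ge0//.
by rewrite -ler_pdivrMl// mulrC.
Qed.

(** All powers are bounded simultaneously so that the induction survives multiplication by a
    coordinate, through [|x_i| <= 1 + |x|^2]. *)
Lemma gauss_poly_bound F : gauss_poly F -> forall m, exists C, 0 <= C /\
  forall x, sqnorm x ^+ m * `|F x| <= C.
Proof.
elim => [m|i G _ IH m|a G _ IH m|G H _ IG _ IH m].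
- exists (m%:R ^+ m / b ^+ m); split; first by rewrite divr_ge0 ?exprn_ge0// ltW.
  move=> x; rewrite ger0_norm ?expR_ge0// ler_pdivlMr ?exprn_gt0//.
  rewrite /kern expRN -mulrA [_^-1 * _]mulrC mulrA ler_pdivrMr ?expR_gt0//.
  rewrite -exprMn mulrC; apply: expr_le_expR.
  by rewrite mulr_ge0 ?sqnorm_ge0// ltW.
- have [C [C0 hC]] := IH m; have [D [D0 hD]] := IH m.+1.
  exists (C + D); split; first exact: addr_ge0.
  move=> x; rewrite normrM.
  have h : `|x ord0 i| <= 1 + sqnorm x.
    apply: (le_trans (coord_le_enorm _ _)); rewrite -sqr_enorm.
    have := enorm_ge0 x; have := sqr_ge0 (enorm x - 1); nra.
  apply: (@le_trans _ _ (sqnorm x ^+ m * ((1 + sqnorm x) * `|G x|))).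
    by rewrite ler_wpM2l ?exprn_ge0 ?sqnorm_ge0// ler_wpM2r.
  rewrite mulrDl mul1r mulrDr lerD//; apply: le_trans (hD x).
  by rewrite exprS mulrA (mulrC (sqnorm x ^+ m)).
- have [C [C0 hC]] := IH m; exists (`|a| * C); split; first exact: mulr_ge0.
  by move=> x; rewrite normrM mulrCA ler_wpM2l.
- have [C [C0 hC]] := IG m; have [D [D0 hD]] := IH m.
  exists (C + D); split; first exact: addr_ge0.
  move=> x; apply: le_trans (lerD (hC x) (hD x)); rewrite -mulrDr.
  by rewrite ler_wpM2l ?exprn_ge0 ?sqnorm_ge0// ler_normD.
Qed.

Definition smooth_bounded (F : 'rV[R]_n -> R) :=
  forall s, (forall x, differentiable (pder s F) x) /\
    exists B, forall x, `|pder s F x| <= B.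

Lemma gauss_poly_smooth_bounded F : gauss_poly F -> smooth_bounded F.
Proof.
move=> gF s.
have gs : gauss_poly (pder s F).
  by elim: s => //= i s IH; case: (gauss_poly_diff IH).
split; first by case: (gauss_poly_diff gs).
have [C [_ hC]] := gauss_poly_bound gs 0.
by exists C => x; have := hC x; rewrite expr0 mul1r.
Qed.

End gaussian_class.

(** * The standard Gaussian and the heat kernel *)

Section gaussian.
Context {R : realType} (n : nat).
Local Notation mu := (lebesgue_rV n).

Lemma gauss_gt0 m (z : 'rV[R]_m) : 0 < gauss z.
Proof.
by rewrite mulr_gt0 ?expR_gt0// exprn_gt0// invr_gt0 sqrtr_gt0 mulr_gt0// pi_gt0.
Qed.

Lemma gauss_ge0 m (z : 'rV[R]_m) : 0 <= gauss z.
Proof. exact/ltW/gauss_gt0. Qed.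

Lemma continuous_gauss m : continuous (@gauss R m).
Proof.
apply: ctsM; first exact: ctsC.
apply: cts_comp; last exact: continuous_expR.
apply: ctsN; apply: ctsM; [exact: continuous_sqnorm|exact: ctsC].
Qed.

Lemma measurable_gauss m : measurable_fun setT (@gauss R m).
Proof. by apply: continuous_measurable_rV; exact: continuous_gauss. Qed.

Lemma gauss_row_cons m t (y : 'rV[R]_m) :
  gauss (row_cons (t, y)) = normal_pdf 0 1 t * gauss y.
Proof.
rewrite (_ : normal_pdf 0 1 t =
  (Num.sqrt (1 ^+ 2 * pi *+ 2))^-1 * expR (- (t - 0) ^+ 2 / (1 ^+ 2 *+ 2))); last first.
  by rewrite normal_pdfE// oner_eq0.
rewrite /gauss.
rewrite sqnorm_row_cons exprS subr0 expr1n mul1r -(mulr_natl pi 2) -[1 *+ 2]/(2 : R).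
by rewrite mulrACA -expRD; congr (_ * expR _); rewrite mulNr; lra.
Qed.

Lemma integral_gauss : (\int[mu]_z (gauss (z : 'rV[R]_n))%:E = 1)%E.
Proof.
elim: n => [|m IH].
  rewrite ge0_integral_rV0; last by move=> x; rewrite lee_fin gauss_ge0.
  by rewrite /gauss sqnorm0 expr0 mul0r oppr0 expR0 mulr1.
rewrite ge0_integral_rVS1; last 2 first.
- by apply/measurable_EFinP; exact: measurable_gauss.
- by move=> x; rewrite lee_fin gauss_ge0.
rewrite -[RHS](@integral_normal_pdf R 0 1); apply: eq_integral => t _.
under eq_integral do rewrite gauss_row_cons EFinM.
rewrite ge0_integralZl//; first by rewrite IH mule1.
- by apply/measurable_EFinP; exact: measurable_gauss.
- by move=> x _; rewrite lee_fin gauss_ge0.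
- by rewrite lee_fin normal_pdf_ge0.
Qed.

Lemma measurable_sqnorm : measurable_fun setT (@sqnorm R n).
Proof. by apply: continuous_measurable_rV; exact: continuous_sqnorm. Qed.

(** A weight that beats polynomials and exponentials of linear functions, yet stays integrable:
    [expq * gauss] is a multiple of the Gaussian of variance 2. *)
Definition expq (z : 'rV[R]_n) : R := expR (sqnorm z / 4).

Lemma measurable_expq : measurable_fun setT expq.
Proof.
apply: continuous_measurable_rV; apply: cts_comp; last exact: continuous_expR.
by apply: ctsM; [exact: continuous_sqnorm|exact: ctsC].
Qed.

Lemma integral_expq_gauss : (\int[mu]_z (expq z * gauss z)%:E = ((Num.sqrt 2) ^+ n)%:E)%E.
Proof.
have s2 : 0 < Num.sqrt 2 :> R by rewrite sqrtr_gt0.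
rewrite -(@ge0_integral_affine _ _ (Num.sqrt 2) 0)//; last 2 first.
- apply/measurable_EFinP; apply: measurable_funM; [exact: measurable_expq|exact: measurable_gauss].
- by move=> x; rewrite lee_fin mulr_ge0 ?gauss_ge0 ?expR_ge0.
rewrite (_ : (\int[mu]_z _)%E = 1%E) ?mule1//.
rewrite -integral_gauss; apply: eq_integral => z _; congr EFin.
rewrite addr0 /expq /gauss sqnormZ sqr_sqrtr// mulrCA -expRD.
by congr (_ * expR _); lra.
Qed.

Lemma expq_ge1 z : 1 <= expq z.
Proof. by rewrite -expR0 ler_expR divr_ge0 ?sqnorm_ge0. Qed.

Lemma sqnorm_le_expq z : sqnorm z <= 4 * expq z.
Proof. by have := expR_ge1Dx (sqnorm z / 4); rewrite -/(expq z); lra. Qed.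

End gaussian.

Lemma ler_sum_one {R : realType} (n : nat) (F : 'I_n -> R) i :
  (forall j, 0 <= F j) -> F i <= \sum_j F j.
Proof. by move=> h; rewrite (bigD1 i) //= lerDl sumr_ge0. Qed.

Section heat_kernel.
Context {R : realType} (n : nat).
Implicit Types (c : R) (w : 'rV[R]_n).

(** The density of [c Z] for a standard Gaussian [Z]: [c] is a standard deviation, linked to time by
    [rad]. *)
Definition heat_kernel c w : R := c^-1 ^+ n * gauss (c^-1 *: w).

Definition heat_peak c : R := c^-1 ^+ n * (Num.sqrt (2 * pi))^-1 ^+ n.

Lemma heat_kernelE c : heat_kernel c = fun w => heat_peak c * kern (c^-1 ^+ 2 / 2) w.
Proof.
apply/funext => w; rewrite /heat_kernel /heat_peak /gauss /kern sqnormZ mulrA.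
by congr (_ * expR _); lra.
Qed.

Lemma heat_kernel_gt0 c w : 0 < c -> 0 < heat_kernel c w.
Proof. by move=> c0; rewrite mulr_gt0 ?gauss_gt0// exprn_gt0// invr_gt0. Qed.

Lemma heat_kernel_ge0 c w : 0 < c -> 0 <= heat_kernel c w.
Proof. by move=> c0; exact/ltW/heat_kernel_gt0. Qed.

Lemma heat_peak_gt0 c : 0 < c -> 0 < heat_peak c.
Proof.
move=> c0; rewrite mulr_gt0// exprn_gt0// invr_gt0//.
by rewrite sqrtr_gt0 mulr_gt0// pi_gt0.
Qed.

Lemma heat_kernel_expq c w : 0 < c -> heat_kernel c w * expq (c^-1 *: w) <= heat_peak c.
Proof.
move=> c0; rewrite heat_kernelE /kern /expq -mulrA -expRD sqnormZ.
rewrite ler_piMr ?(ltW (heat_peak_gt0 c0))// expR_le1.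
have : 0 <= c^-1 ^+ 2 * sqnorm w by rewrite mulr_ge0 ?sqr_ge0 ?sqnorm_ge0.
lra.
Qed.

Lemma heat_kernel_le c w : 0 < c -> heat_kernel c w <= heat_peak c.
Proof.
move=> c0; apply: le_trans (heat_kernel_expq w c0).
by rewrite ler_peMr ?expq_ge1// heat_kernel_ge0.
Qed.

Lemma heat_kernel_smooth c : 0 < c -> smooth_bounded (heat_kernel c).
Proof.
move=> c0; rewrite heat_kernelE.
have b0 : 0 < c^-1 ^+ 2 / 2 by rewrite divr_gt0// exprn_gt0// invr_gt0.
by apply: (gauss_poly_smooth_bounded b0); apply: gp_Z; exact: gp_kern.
Qed.

Lemma partial_heat_kernel c i w : 0 < c ->
  partial i (heat_kernel c) w = - c^-1 * ((c^-1 *: w) ord0 i * heat_kernel c w).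
Proof.
move=> c0; rewrite heat_kernelE /partial.
have [d D] := kern_differentiable (c^-1 ^+ 2 / 2) w.
rewrite (differentiable_scale (heat_peak c) d).2 D dotvC dotv_evec mxE; lra.
Qed.

Lemma continuous_heat_kernel c : continuous (heat_kernel c).
Proof.
rewrite heat_kernelE; apply: ctsM; first exact: ctsC.
apply: cts_comp; last exact: continuous_expR.
by apply: ctsN; apply: ctsM; [exact: ctsC|exact: continuous_sqnorm].
Qed.

Lemma pder_cat (s s' : seq 'I_n) (F : 'rV[R]_n -> R) : pder s (pder s' F) = pder (s ++ s') F.
Proof. by elim: s => //= i s ->. Qed.

Lemma smooth_bounded_pder (F : 'rV[R]_n -> R) s : smooth_bounded F -> smooth_bounded (pder s F).
Proof. by move=> h s'; rewrite pder_cat. Qed.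

Lemma smooth_bounded_cts (F : 'rV[R]_n -> R) : smooth_bounded F -> continuous F.
Proof. by move=> /(_ [::]) [h _]; exact: differentiable_cts. Qed.

Lemma continuous_rsub (y : 'rV[R]_n) : continuous (fun x : 'rV[R]_n => y - x).
Proof.
apply: continuous_rVP => i; under eq_fun do rewrite rV_coordB.
by apply: ctsB; [exact: ctsC|exact: continuous_coord].
Qed.

Lemma continuous_comp_rsub (k : 'rV[R]_n -> R) (y : 'rV[R]_n) :
  continuous k -> continuous (fun x : 'rV[R]_n => k (y - x)).
Proof.
move=> ck x; apply: (@continuous_comp _ _ _ (fun x : 'rV[R]_n => y - x) k).
  exact: continuous_rsub.
exact: ck.
Qed.

Lemma continuous_scalev (a : R) : continuous (fun x : 'rV[R]_n => a *: x).
Proof.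
apply: continuous_rVP => i; under eq_fun do rewrite mxE.
by apply: ctsM; [exact: ctsC|exact: continuous_coord].
Qed.

End heat_kernel.

(** * Densities smoothed by Gaussian noise *)

Section convolution.
Context {R : realType} (n : nat).
Local Notation mu := (lebesgue_rV n).
Variable rho : 'rV[R]_n -> R.

Definition quad (x : 'rV[R]_n) : R := 1 + sqnorm x.

(** The regularity carried from one iterate to the next: it passes through the noise
    ([heat_density]) and through a whole step ([step_density]). *)
Record density : Prop := Density {
  density_cts : continuous rho;
  density_ge0 : forall x, 0 <= rho x;
  density_int1 : (\int[mu]_x (rho x)%:E = 1)%E;
  density_quad : mu.-integrable setT (fun x => (quad x * rho x)%:E) }.

Hypothesis drho : density.

Let mrho : measurable_fun setT rho.
Proof. by apply: continuous_measurable_rV; exact: density_cts drho. Qed.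
Let rho0 x : 0 <= rho x. Proof. exact: density_ge0 drho x. Qed.
Let iq : mu.-integrable setT (fun x => (quad x * rho x)%:E).
Proof. exact: density_quad drho. Qed.

Lemma continuous_quad : continuous quad.
Proof. by apply: ctsD; [exact: ctsC|exact: continuous_sqnorm]. Qed.

Lemma measurable_quad : measurable_fun setT quad.
Proof. by apply: continuous_measurable_rV; exact: continuous_quad. Qed.

Let mquad : measurable_fun setT quad := measurable_quad.

Lemma quad_ge1 x : 1 <= quad x.
Proof. by rewrite lerDl sqnorm_ge0. Qed.

Let q1 := quad_ge1.

Lemma cts_dominated F C : continuous F -> (forall x, `|F x| <= C * quad x) -> dominated quad F.
Proof. by move=> cF h; split; [exact: continuous_measurable_rV|exists C]. Qed.

Lemma bounded_dominated F C : continuous F -> (forall x, `|F x| <= C) -> dominated quad F.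
Proof.
move=> cF h; apply: (@cts_dominated _ `|C|) => // x.
apply: (le_trans (h x)); apply: (le_trans (ler_norm _)).
by rewrite ler_peMr.
Qed.

Lemma expect_cst (a : R) : expect mu rho (fun=> a) = a.
Proof.
rewrite /expect /Rintegral.
under eq_integral do rewrite EFinM.
rewrite integralZl//; first by rewrite (density_int1 drho) mule1.
rewrite (_ : (fun x => (rho x)%:E) = (fun x => (1 * rho x)%:E)); last first.
  by apply/funext => x; rewrite mul1r.
apply: (@dominated_integrable _ _ _ _ rho quad) => //.
exact: dominatedC.
Qed.

Lemma expect_abs_le F b : dominated quad F -> (forall x, `|F x| <= b) ->
  `|expect mu rho F| <= b.
Proof.
move=> dF h; rewrite ler_norml; apply/andP; split.
  rewrite -(expect_cst (- b)); apply: (@expect_le _ _ _ _ _ quad) => //.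
    exact: dominatedC.
  by move=> x; have := h x; rewrite ler_norml => /andP[].
rewrite -(expect_cst b); apply: (@expect_le _ _ _ _ _ quad) => //.
  exact: dominatedC.
by move=> x; have := h x; rewrite ler_norml => /andP[].
Qed.

Definition conv (k : 'rV[R]_n -> R) (y : 'rV[R]_n) : R := expect mu rho (fun x => k (y - x)).

Lemma conv_dominated k C y : continuous k -> (forall w, `|k w| <= C) ->
  dominated quad (fun x => k (y - x)).
Proof.
move=> ck hk; apply: (@bounded_dominated _ C) => //.
exact: continuous_comp_rsub.
Qed.

(** Differentiation under the integral by a Taylor remainder that is uniform in the integration
    variable, the second partial derivatives of [k] being bounded. *)
Lemma conv_diff k y : smooth_bounded k ->
  differentiable (conv k) y /\ forall i, partial i (conv k) y = conv (partial i k) y.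
Proof.
move=> sk.
have bd s : exists B, forall x, `|pder s k x| <= B by case: (sk s).
pose B i j := projT1 (cid (bd [:: j; i])).
have BP i j x : `|partial j (partial i k) x| <= B i j.
  exact: (projT2 (cid (bd [:: j; i]))).
have B0 i j : 0 <= B i j by exact: le_trans (BP i j 0).
pose C := \sum_i \sum_j B i j.
have BC i j x : `|partial j (partial i k) x| <= C.
  apply: (le_trans (BP i j x)); apply: (@le_trans _ _ (\sum_l B i l)).
    exact: (@ler_sum_one _ _ (fun l => B i l)).
  by apply: (@ler_sum_one _ _ (fun i => \sum_l B i l)) => l; exact: sumr_ge0.
have C0 : 0 <= C by apply: sumr_ge0 => i _; exact: sumr_ge0.
have dk z : differentiable k z := (sk [::]).1 z.
have dpk i z : differentiable (partial i k) z := (sk [:: i]).1 z.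
have T := taylor2_partial dk dpk BC.
set N := n%:R * n%:R * C in T.
have N0 : 0 <= N by rewrite !mulr_ge0.
have dom_k z : dominated quad (fun x => k (z - x)).
  have [K hK] := bd [::]; apply: (@conv_dominated _ K) => //.
  exact: smooth_bounded_cts.
have dom_p i z : dominated quad (fun x => partial i k (z - x)).
  have [K hK] := bd [:: i]; apply: (@conv_dominated _ K) => //.
  exact: differentiable_cts (dpk i).
pose a := \row_i conv (partial i k) y.
have [H1 H2] : differentiable (conv k) y /\ forall v, 'D_v (conv k) y = dotv v a.
  apply: eps_differentiable => e e0.
  exists (e / (N + 1)); split; first by rewrite divr_gt0// ltr_wpDl.
  move=> v; rewrite ler_pdivlMr ?ltr_wpDl// => hv.
  have dom_d : dominated quad (fun x => dotv v (grad k (y - x))).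
    rewrite /dotv; apply: dominated_sum => // i; apply: dominatedZ.
    by under eq_fun do rewrite mxE; exact: dom_p.
  have -> : conv k (y + v) - conv k y - dotv v a =
      expect mu rho (fun x => k (y + v - x) - k (y - x) - dotv v (grad k (y - x))).
    rewrite (@expectB _ _ _ _ _ quad)//; last exact: dominatedB.
    rewrite (@expectB _ _ _ _ _ quad)//; congr (_ - _).
    rewrite /dotv (@expect_sum _ _ _ _ _ quad)//; last first.
      by move=> i; apply: dominatedZ; under eq_fun do rewrite mxE; exact: dom_p.
    apply: eq_bigr => i _; rewrite (@expectZ _ _ _ _ _ quad)//.
      by rewrite mxE; congr (_ * expect _ _ _); apply/funext => x; rewrite mxE.
    by under eq_fun do rewrite mxE; exact: dom_p.
  apply: (@le_trans _ _ (N * `|v| ^+ 2)).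
    apply: expect_abs_le; first by apply: dominatedB => //; exact: dominatedB.
    by move=> x; rewrite (_ : y + v - x = y - x + v); [exact: T|rewrite addrAC].
  rewrite expr2 mulrA ler_wpM2r//; apply: le_trans hv; rewrite mulrC ler_wpM2l//.
  by rewrite lerDl.
by split => // i; rewrite /partial H2 dotvC dotv_evec mxE.
Qed.

Lemma conv_pder k s : smooth_bounded k -> pder s (conv k) = conv (pder s k).
Proof.
move=> sk; elim: s => //= i s ->; apply/funext => y.
by rewrite (conv_diff y (smooth_bounded_pder s sk)).2.
Qed.

Lemma conv_smooth k : smooth_bounded k -> smooth (conv k).
Proof.
move=> sk s x; rewrite conv_pder//.
by case: (conv_diff x (smooth_bounded_pder s sk)).
Qed.

Variable c : R.
Hypothesis c0 : 0 < c.

Definition heat : 'rV[R]_n -> R := conv (heat_kernel c).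

Definition score_kernel (i : 'I_n) (w : 'rV[R]_n) := (c^-1 *: w) ord0 i * heat_kernel c w.

(* [posterior y] is the conditional expectation E[Z | X + c Z = y]. *)
Definition posterior (y : 'rV[R]_n) : 'rV[R]_n := \row_i (conv (score_kernel i) y / heat y).

Lemma heat_smooth : smooth heat.
Proof. exact/conv_smooth/heat_kernel_smooth. Qed.

Lemma heat_differentiable y : differentiable heat y.
Proof. exact: (heat_smooth [::]). Qed.

Lemma continuous_heat : continuous heat.
Proof. exact: differentiable_cts heat_differentiable. Qed.

Lemma heat_kernel_dominated y : dominated quad (fun x => heat_kernel c (y - x)).
Proof.
apply: (@conv_dominated _ (heat_peak n c)); first exact: continuous_heat_kernel.
by move=> w; rewrite ger0_norm ?heat_kernel_ge0// heat_kernel_le.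
Qed.

Lemma quad_coord_le (z : 'rV[R]_n) i : `|z ord0 i| <= quad z.
Proof.
apply: (le_trans (coord_le_enorm _ _)); rewrite /quad -sqr_enorm.
have := sqr_ge0 (enorm z - 1); have := enorm_ge0 z; nra.
Qed.

Lemma quad_le_expq (z : 'rV[R]_n) : quad z <= 5 * expq z.
Proof. by have := sqnorm_le_expq z; have := expq_ge1 z; rewrite /quad; lra. Qed.

Lemma score_kernel_le i w : `|score_kernel i w| <= 5 * heat_peak n c.
Proof.
rewrite normrM (ger0_norm (heat_kernel_ge0 _ c0)).
apply: (@le_trans _ _ (5 * expq (c^-1 *: w) * heat_kernel c w)).
  rewrite ler_wpM2r ?heat_kernel_ge0//.
  exact: le_trans (quad_coord_le _ _) (quad_le_expq _).
by rewrite -mulrA ler_wpM2l// mulrC heat_kernel_expq.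
Qed.

Lemma continuous_score_kernel i : continuous (score_kernel i).
Proof.
apply: ctsM; last exact: continuous_heat_kernel.
apply: (@cts_comp _ _ _ (fun w : 'rV[R]_n => c^-1 *: w) (fun w => w ord0 i)).
  exact: continuous_scalev.
exact: continuous_coord.
Qed.

Lemma score_kernel_dominated i y : dominated quad (fun x => score_kernel i (y - x)).
Proof.
apply: conv_dominated; first exact: continuous_score_kernel.
exact: score_kernel_le.
Qed.

Lemma heat_le y : heat y <= heat_peak n c.
Proof.
rewrite -[leRHS]expect_cst; apply: (@expect_le _ _ _ _ _ quad) => //.
- exact: heat_kernel_dominated.
- exact: dominatedC.
- by move=> x; rewrite heat_kernel_le.
Qed.

Definition second_moment : R := expect mu rho (@sqnorm R n).

Lemma sqnorm_dominated : dominated quad (@sqnorm R n).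
Proof.
apply: (@cts_dominated _ 1); first exact: continuous_sqnorm.
by move=> x; rewrite ger0_norm ?sqnorm_ge0// mul1r lerDr.
Qed.

(* Jensen's inequality for the exponential, from [exp u >= exp m (1 + u - m)]. *)
Lemma heat_ge y : heat_peak n c * expR (- (c^-1 ^+ 2 * (sqnorm y + second_moment))) <= heat y.
Proof.
pose u x := - (c^-1 ^+ 2 / 2 * sqnorm (y - x)).
have cu : continuous u.
  apply: ctsN; apply: ctsM; first exact: ctsC.
  by apply: continuous_comp_rsub; exact: continuous_sqnorm.
have c2 : 0 <= c^-1 ^+ 2 / 2 by rewrite divr_ge0// sqr_ge0.
have yx x : sqnorm (y - x) <= 2 * sqnorm y + 2 * sqnorm x.
  by have := sqnormDle y (- x); rewrite sqnormN.
have du : dominated quad u.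
  apply: (@cts_dominated _ (c^-1 ^+ 2 / 2 * (2 * quad y))) => // x.
  rewrite /u normrN (ger0_norm (mulr_ge0 c2 (sqnorm_ge0 _))) -[leRHS]mulrA.
  apply: ler_wpM2l => //; apply: (le_trans (yx x)).
  by have := sqnorm_ge0 x; have := sqnorm_ge0 y; rewrite /quad; nra.
pose m := expect mu rho u.
have mle : - (c^-1 ^+ 2 * (sqnorm y + second_moment)) <= m.
  rewrite (_ : - _ = expect mu rho (fun x => - (c^-1 ^+ 2) * sqnorm y + - (c^-1 ^+ 2) * sqnorm x)).
    apply: (@expect_le _ _ _ _ _ quad) => //.
      apply: dominatedD => //; first exact: dominatedC.
      by apply: dominatedZ; exact: sqnorm_dominated.
    move=> x; rewrite /u; have := ler_wpM2l c2 (yx x); lra.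
  rewrite (@expectD _ _ _ _ _ quad)//; [|exact: dominatedC|by apply: dominatedZ; exact: sqnorm_dominated].
  rewrite expect_cst (@expectZ _ _ _ _ _ quad)//; last exact: sqnorm_dominated.
  by rewrite /second_moment; ring.
apply: (@le_trans _ _ (heat_peak n c * expR m)).
  by rewrite ler_wpM2l ?(ltW (heat_peak_gt0 n c0))// ler_expR.
have de : dominated quad (fun x => heat_peak n c * expR m * (1 - m + u x)).
  by apply: dominatedZ; apply: dominatedD => //; exact: dominatedC.
have -> : heat_peak n c * expR m = expect mu rho (fun x => heat_peak n c * expR m * (1 - m + u x)).
  rewrite (@expectZ _ _ _ _ _ quad)//; last by apply: dominatedD => //; exact: dominatedC.
  rewrite (@expectD _ _ _ _ _ quad)//; last exact: dominatedC.
  by rewrite expect_cst -/m subrK mulr1.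
apply: (@expect_le _ _ _ _ _ quad) => //; first exact: heat_kernel_dominated.
move=> x; rewrite heat_kernelE -mulrA ler_wpM2l ?(ltW (heat_peak_gt0 n c0))//.
rewrite /kern -/(u x) -{2}[u x](subrK m) expRD mulrC ler_wpM2r ?expR_ge0//.
by have := expR_ge1Dx (u x - m); lra.
Qed.

Lemma second_moment_ge0 : 0 <= second_moment.
Proof. by apply: Rintegral_ge0 => x _; rewrite mulr_ge0 ?sqnorm_ge0. Qed.

Lemma heat_gt0 y : 0 < heat y.
Proof.
apply: lt_le_trans (heat_ge y); by rewrite mulr_gt0 ?expR_gt0// heat_peak_gt0.
Qed.

Lemma ln_heat_peak_le : exists C, 0 <= C /\ forall y, ln (heat_peak n c / heat y) <= C * quad y.
Proof.
have c20 : 0 <= c^-1 ^+ 2 by rewrite sqr_ge0.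
exists (c^-1 ^+ 2 * (1 + second_moment)); split.
  by rewrite mulr_ge0// addr_ge0// second_moment_ge0.
move=> y; rewrite ln_div ?posrE ?heat_gt0 ?heat_peak_gt0//.
have : ln (heat_peak n c * expR (- (c^-1 ^+ 2 * (sqnorm y + second_moment)))) <= ln (heat y).
  rewrite ler_ln ?posrE ?heat_gt0//; first exact: heat_ge.
  by rewrite mulr_gt0 ?expR_gt0// heat_peak_gt0.
rewrite lnM ?posrE ?expR_gt0 ?heat_peak_gt0// expRK.
have h2 := second_moment_ge0; have h1 := sqnorm_ge0 y.
have : c^-1 ^+ 2 * (sqnorm y + second_moment) <= c^-1 ^+ 2 * ((1 + second_moment) * quad y).
  by rewrite ler_wpM2l// /quad; nra.
by rewrite -mulrA; lra.
Qed.

Lemma ln_heat_le : exists C, 0 <= C /\ forall y, `|ln (heat y)| <= C * quad y.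
Proof.
have [C [C0 hC]] := ln_heat_peak_le.
exists (C + `|ln (heat_peak n c)|); split; first by rewrite addr_ge0.
move=> y; have := hC y; rewrite ln_div ?posrE ?heat_gt0 ?heat_peak_gt0// => h1.
have h2 : ln (heat y) <= ln (heat_peak n c).
  by rewrite ler_ln ?posrE ?heat_gt0 ?heat_peak_gt0// heat_le.
have h3 : `|ln (heat_peak n c)| <= `|ln (heat_peak n c)| * quad y by rewrite ler_peMr.
have h4 : 0 <= C * quad y by rewrite mulr_ge0// (le_trans ler01).
have := ler_norm (ln (heat_peak n c)); have := ler_norm (- ln (heat_peak n c)).
rewrite normrN => h5 h6; rewrite mulrDl ler_norml; apply/andP; split; lra.
Qed.

(** Tweedie's formula: the score of the noisy law is [- posterior / c]. *)
Lemma partial_heat i y : partial i heat y = - c^-1 * ((posterior y) ord0 i * heat y).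
Proof.
rewrite (conv_diff y (@heat_kernel_smooth R n c c0)).2 mxE divfK ?gt_eqF ?heat_gt0//.
rewrite /conv -(@expectZ _ _ _ _ _ quad)//; last exact: score_kernel_dominated.
by congr expect; apply/funext => x; rewrite partial_heat_kernel.
Qed.

Lemma posteriorE i y : conv (score_kernel i) y = posterior y ord0 i * heat y.
Proof. by rewrite mxE divfK// gt_eqF// heat_gt0. Qed.

Lemma continuous_posterior i : continuous (fun y => posterior y ord0 i).
Proof.
under eq_fun do rewrite mxE.
apply: ctsM; last by apply: ctsV; [move=> y; rewrite gt_eqF// heat_gt0|exact: continuous_heat].
have -> : conv (score_kernel i) = fun y => - c * partial i heat y.
  apply/funext => y; rewrite partial_heat mxE divfK ?gt_eqF ?heat_gt0//.
  by rewrite mulrA mulrNN divff ?mul1r// gt_eqF.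
apply: ctsM; first exact: ctsC.
exact: differentiable_cts (heat_smooth [:: i]).
Qed.

(* The conditional second moment of Z is controlled by the conditional
   exponential moment: [u <= exp (u - tau) + tau - 1] with
   [tau = ln (peak / heat y)]. *)
Lemma sqnorm_posterior_le : exists C, 0 <= C /\ forall y, sqnorm (posterior y) <= C * quad y.
Proof.
have [C [C0 hC]] := ln_heat_peak_le.
exists (4 * C); split; first by rewrite mulr_ge0.
move=> y; have hy := heat_gt0 y; have pk := heat_peak_gt0 n c0.
set a := posterior y.
pose tau := ln (heat_peak n c / heat y).
have etau : expR (- tau) = heat y / heat_peak n c.
  by rewrite expRN lnK ?invf_div// posrE divr_gt0.
(* [2 a.z - |a|^2 <= |z|^2] replaces the square by an affine function of the noise. Since [a] is the
   conditional mean, its average is exactly [sqnorm a * heat y]. *)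
pose k (w : 'rV[R]_n) := (2 * dotv a (c^-1 *: w) - sqnorm a) * heat_kernel c w.
pose k' (w : 'rV[R]_n) := 4 * (expR (- tau) * heat_peak n c + (tau - 1) * heat_kernel c w).
have kk' w : k w <= k' w.
  set z := c^-1 *: w.
  have h1 : 2 * dotv a z - sqnorm a <= sqnorm z.
    by have := sqnorm_ge0 (z - a); rewrite sqnormB (dotvC z); lra.
  have h2 : sqnorm z / 4 <= expR (- tau) * expq z + (tau - 1).
    rewrite /expq -expRD; have := expR_ge1Dx (- tau + sqnorm z / 4); lra.
  have h3 := heat_kernel_expq w c0; rewrite -/z in h3.
  have h4 := heat_kernel_ge0 w c0; have h5 := expR_ge0 (- tau).
  rewrite /k /k' -/z; set hw := heat_kernel c w in h3 h4 *.
  apply: (@le_trans _ _ (4 * (expR (- tau) * expq z + (tau - 1)) * hw)).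
    by rewrite ler_wpM2r//; lra.
  rewrite -mulrA ler_wpM2l// mulrDl lerD2r -mulrA ler_wpM2l// mulrC //.
have kE x : k (y - x) = \sum_i (2 * a ord0 i * score_kernel i (y - x)) - sqnorm a * heat_kernel c (y - x).
  rewrite /k mulrBl; congr (_ - _); rewrite /dotv mulr_sumr mulr_suml.
  by apply: eq_bigr => i _; rewrite /score_kernel; ring.
have dk : dominated quad (fun x => \sum_i (2 * a ord0 i * score_kernel i (y - x))).
  by apply: dominated_sum => // i; apply: dominatedZ; exact: score_kernel_dominated.
have dk2 : dominated quad (fun x => sqnorm a * heat_kernel c (y - x)).
  by apply: dominatedZ; exact: heat_kernel_dominated.
have dk' : dominated quad (fun x => k' (y - x)).
  apply: dominatedZ; apply: dominatedD; first exact: dominatedC.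
  by apply: dominatedZ; exact: heat_kernel_dominated.
have E1 : expect mu rho (fun x => k (y - x)) = sqnorm a * heat y.
  under [X in expect _ _ X]eq_fun do rewrite kE.
  rewrite (@expectB _ _ _ _ _ quad)// (@expect_sum _ _ _ _ _ quad)//; last first.
    by move=> i; apply: dominatedZ; exact: score_kernel_dominated.
  rewrite (@expectZ _ _ _ _ _ quad)//; last exact: heat_kernel_dominated.
  rewrite (eq_bigr (fun i => 2 * a ord0 i ^+ 2 * heat y)); last first.
    move=> i _; rewrite (@expectZ _ _ _ _ _ quad)//; last exact: score_kernel_dominated.
    by rewrite -[expect _ _ _]/(conv (score_kernel i) y) posteriorE -/a; ring.
  rewrite -mulr_suml -mulr_sumr -/(sqnorm a) -[expect _ _ _]/(heat y); ring.
have E2 : expect mu rho (fun x => k' (y - x)) = 4 * tau * heat y.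
  rewrite (@expectZ _ _ _ _ _ quad)//; last first.
    by apply: dominatedD; [exact: dominatedC|apply: dominatedZ; exact: heat_kernel_dominated].
  rewrite (@expectD _ _ _ _ _ quad)//; [|exact: dominatedC|by apply: dominatedZ; exact: heat_kernel_dominated].
  rewrite expect_cst (@expectZ _ _ _ _ _ quad)//; last exact: heat_kernel_dominated.
  rewrite -[expect _ _ _]/(heat y) etau divfK ?gt_eqF//; ring.
have : sqnorm a * heat y <= 4 * tau * heat y.
  rewrite -E1 -E2; apply: (@expect_le _ _ _ _ _ quad) => //.
  under eq_fun do rewrite kE.
  exact: dominatedB.
rewrite ler_pM2r// => h; apply: (le_trans h).
by rewrite -mulrA ler_wpM2l//; exact: hC.
Qed.

End convolution.

(** The transport formula is given for nonnegative integrands; positive and negative parts extend it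
    to signed ones. *)
Lemma signed_transfer d (T : measurableType d) (R : realType)
    (m : {measure set T -> \bar R}) (S : T -> T) (k : R) (h : T -> R) :
  0 < k -> measurable_fun setT S ->
  (forall H : T -> \bar R, measurable_fun setT H -> (forall p, (0 <= H p)%E) ->
     (k%:E * \int[m]_p H (S p) = \int[m]_p H p)%E) ->
  measurable_fun setT h -> m.-integrable setT (fun p => (h (S p))%:E) ->
  m.-integrable setT (fun p => (h p)%:E) /\
  k * (\int[m]_p h (S p))%R = (\int[m]_p h p)%R.
Proof.
move=> k0 mS tr mh ih.
have mhE : measurable_fun setT (fun p => (h p)%:E) by exact/measurable_EFinP.
have ih' : m.-integrable setT (fun p => (h p)%:E).
  apply/integrableP; split => //.
  rewrite -tr; [|exact: measurableT_comp|by []].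
  have /integrableP[_ lt] := ih.
  by rewrite lte_mul_pinfty// lee_fin ltW.
split => //.
have fp := integrable_pos_fin_num measurableT ih.
have fn := integrable_neg_fin_num measurableT ih.
rewrite /Rintegral [in LHS]integralE [in RHS]integralE.
rewrite -(tr ((fun p => (h p)%:E)^\+)%E); [|exact: measurable_funepos|by move=> p; exact: funepos_ge0].
rewrite -(tr ((fun p => (h p)%:E)^\-)%E); [|exact: measurable_funeneg|by move=> p; exact: funeneg_ge0].
have -> : (\int[m]_p ((fun p => (h p)%:E)^\+ (S p)) = \int[m]_p (fun p => (h (S p))%:E)^\+ p)%E.
  by apply: eq_integral => p _; rewrite !funeposE.
have -> : (\int[m]_p ((fun p => (h p)%:E)^\- (S p)) = \int[m]_p (fun p => (h (S p))%:E)^\- p)%E.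
  by apply: eq_integral => p _; rewrite !funenegE.
rewrite -(fineK fp) -(fineK fn) -!EFinM -!EFinB /=; ring.
Qed.

(** Derivatives along a sequence, the form in which [expect_dct] consumes them. *)
Lemma cvg_diff_quotient (R : realType) (f : R -> R) (x l : R) (u : nat -> R) :
  is_derive x (1 : R) f l -> (forall k, u k != 0) -> u k @[k --> \oo] --> 0 ->
  (f (x + u k) - f x) / u k @[k --> \oo] --> l.
Proof.
move=> [df dl] u0 cu.
have H : h^-1 *: (f (h *: (1 : R) + x) - f x) @[h --> 0^'] --> l.
  by rewrite -dl; exact: df.
have cu' : u k @[k --> \oo] --> 0^'.
  move=> A /= [e e0 hA].
  have /cvgrPdist_lt/(_ e e0) := cu; apply: filterS => k hk.
  by apply: hA => //; exact: u0.
have := cvg_comp _ _ cu' H.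
apply: cvg_trans; apply: near_eq_cvg; near=> k.
by rewrite /= /GRing.scale /= mulr1 mulrC (addrC x).
Unshelve. all: by end_near. Qed.

(** * Shears of the product space *)

Section shear.
Context {R : realType} (n : nat).
Local Notation mu := (lebesgue_rV n).
Local Notation mm := (mu \x mu)%E.

Lemma measurable_affv d (T : measurableType d) (c : R) (f g : T -> 'rV[R]_n) :
  measurable_fun setT f -> measurable_fun setT g ->
  measurable_fun setT (fun p => c *: f p + g p).
Proof.
move=> mf mg; apply: measurable_fun_rV => i; under eq_fun do rewrite !mxE.
apply: measurable_funD; last exact: (measurableT_comp (@measurable_coord R n i) mg).
apply: measurable_funM => //.
exact: (measurableT_comp (@measurable_coord R n i) mf).
Qed.

Lemma measurable_subv d (T : measurableType d) (f g : T -> 'rV[R]_n) :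
  measurable_fun setT f -> measurable_fun setT g ->
  measurable_fun setT (fun p => f p - g p).
Proof.
move=> mf mg; apply: measurable_fun_rV => i; under eq_fun do rewrite rV_coordB.
apply: measurable_funB.
  exact: (measurableT_comp (@measurable_coord R n i) mf).
exact: (measurableT_comp (@measurable_coord R n i) mg).
Qed.

(** With [b] the identity this passes from (input, noise) to (input, output); with [b] constant and
    [c = 1] it translates the noise. *)
Definition shear (c : R) (b : 'rV[R]_n -> 'rV[R]_n) (p : 'rV[R]_n * 'rV[R]_n) :=
  (p.1, c *: p.2 + b p.1).

Lemma measurable_shear c b : measurable_fun setT b -> measurable_fun setT (shear c b).
Proof.
move=> mb; apply: measurable_fun_pair => //.
by apply: measurable_affv => //; exact: (measurableT_comp mb measurable_fst).
Qed.

Lemma ge0_shear c b (H : 'rV[R]_n * 'rV[R]_n -> \bar R) : 0 < c ->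
  measurable_fun setT b -> measurable_fun setT H -> (forall p, (0 <= H p)%E) ->
  ((c ^+ n)%:E * \int[mm]_p H (shear c b p) = \int[mm]_p H p)%E.
Proof.
move=> c0 mb mH H0.
have mHS : measurable_fun setT (fun p => H (shear c b p)).
  exact: (measurableT_comp mH (measurable_shear c mb)).
rewrite fubini_tonelli1// fubini_tonelli1// -ge0_integralZl//; last 3 first.
- exact: measurable_fun_fubini_tonelli_F.
- by move=> x _; exact: integral_ge0.
- by rewrite lee_fin exprn_ge0// ltW.
apply: eq_integral => x _.
rewrite /fubini_F -(@ge0_integral_affine _ _ c (b x) (fun z => H (x, z)))//.
exact: (measurableT_comp mH (measurable_pair1 x)).
Qed.

End shear.

(** * The joint law of input and noise *)

Section gaussian_channel.
Context {R : realType} (n : nat).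
Local Notation mu := (lebesgue_rV n).
Local Notation mm := (mu \x mu)%E.
Variable rho : 'rV[R]_n -> R.
Hypothesis drho : density rho.

Definition joint (p : 'rV[R]_n * 'rV[R]_n) : R := rho p.1 * gauss p.2.
(** Quadratic in the input but exponential in the noise, because [stein] tilts the Gaussian by the
    exponential of a noise coordinate. *)
Definition jquad (p : 'rV[R]_n * 'rV[R]_n) : R := quad p.1 * expq p.2.

Let mrho : measurable_fun setT rho.
Proof. by apply: continuous_measurable_rV; exact: density_cts drho. Qed.
Let rho0 x : 0 <= rho x. Proof. exact: density_ge0 drho x. Qed.
Let iq : mu.-integrable setT (fun x => (quad x * rho x)%:E).
Proof. exact: density_quad drho. Qed.

Lemma measurable_joint : measurable_fun setT joint.
Proof.
apply: measurable_funM; first exact: (measurableT_comp mrho measurable_fst).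
exact: (measurableT_comp (@measurable_gauss R n) measurable_snd).
Qed.

Lemma joint_ge0 p : 0 <= joint p.
Proof. by rewrite mulr_ge0// gauss_ge0. Qed.

Lemma measurable_jquad : measurable_fun setT jquad.
Proof.
apply: measurable_funM; first exact: (measurableT_comp (@measurable_quad R n) measurable_fst).
exact: (measurableT_comp (@measurable_expq R n) measurable_snd).
Qed.

Lemma jquad_ge1 p : 1 <= jquad p.
Proof.
rewrite -[leLHS]mul1r ler_pM ?quad_ge1 ?expq_ge1//.
Qed.

Lemma integrable_jquad : mm.-integrable setT (fun p => (jquad p * joint p)%:E).
Proof.
have mF : measurable_fun setT (fun p => (jquad p * joint p)%:E).
  apply/measurable_EFinP; apply: measurable_funM; [exact: measurable_jquad|exact: measurable_joint].
apply/integrableP; split => //.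
have F0 p : (0 <= (jquad p * joint p)%:E)%E.
  by rewrite lee_fin mulr_ge0 ?joint_ge0// (le_trans ler01)// jquad_ge1.
under eq_integral do rewrite gee0_abs//.
rewrite fubini_tonelli1//.
rewrite (_ : (\int[mu]_x _)%E = (\int[mu]_x ((quad x * rho x)%:E * ((Num.sqrt 2) ^+ n)%:E))%E).
  rewrite ge0_integralZr//.
  - apply: lte_mul_pinfty.
    + by apply: integral_ge0 => x _; rewrite lee_fin mulr_ge0// (le_trans ler01)// quad_ge1.
    + exact: integrable_fin_num.
    + by rewrite ltry.
  - by apply: measurable_int iq.
  - by move=> x _; rewrite lee_fin mulr_ge0// (le_trans ler01)// quad_ge1.
apply: eq_integral => x _; rewrite /fubini_F -integral_expq_gauss.
rewrite -ge0_integralZl//.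
- by apply: eq_integral => z _; rewrite /jquad /joint -EFinM; congr EFin => /=; ring.
- apply/measurable_EFinP; apply: measurable_funM; [exact: measurable_expq|exact: measurable_gauss].
- by move=> z _; rewrite lee_fin mulr_ge0 ?gauss_ge0 ?expR_ge0.
- by rewrite lee_fin mulr_ge0// (le_trans ler01)// quad_ge1.
Qed.

Let mj := measurable_joint.
Let j0 := joint_ge0.
Let mjq := measurable_jquad.
Let jq1 := jquad_ge1.
Let ijq := integrable_jquad.

Lemma integral_joint : (\int[mm]_p (joint p)%:E = 1)%E.
Proof.
rewrite fubini_tonelli1//; last exact/measurable_EFinP.
rewrite -(density_int1 drho); apply: eq_integral => x _; rewrite /fubini_F.
under eq_integral do rewrite /joint EFinM /=.
rewrite ge0_integralZl//; first by rewrite integral_gauss mule1.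
- by apply/measurable_EFinP; exact: measurable_gauss.
- by move=> z _; rewrite lee_fin gauss_ge0.
- by rewrite lee_fin.
Qed.

Variable c : R.
Hypothesis c0 : 0 < c.

Definition noisy (p : 'rV[R]_n * 'rV[R]_n) : 'rV[R]_n := c *: p.2 + p.1.

Lemma measurable_noisy : measurable_fun setT noisy.
Proof. by apply: measurable_affv. Qed.

Lemma quad_noisy_le p : quad (noisy p) <= (2 + 8 * c ^+ 2) * jquad p.
Proof.
have h1 : sqnorm (noisy p) <= 2 * (c ^+ 2 * sqnorm p.2) + 2 * sqnorm p.1.
  by have := sqnormDle (c *: p.2) p.1; rewrite sqnormZ.
have h2 := sqnorm_le_expq p.2; have h3 := expq_ge1 p.2; have h4 := sqnorm_ge0 p.1.
have h5 : c ^+ 2 * sqnorm p.2 <= c ^+ 2 * (4 * expq p.2) by rewrite ler_wpM2l// sqr_ge0.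
have h6 : 0 <= c ^+ 2 by rewrite sqr_ge0.
have h7 := mulr_ge0 (mulr_ge0 h6 (le_trans ler01 h3)) h4.
have h8 : 0 <= (expq p.2 - 1) * sqnorm p.1 by rewrite mulr_ge0// subr_ge0.
rewrite /jquad /quad; nra.
Qed.

Lemma dominated_noisy F : dominated (@quad R n) F -> dominated jquad (fun p => F (noisy p)).
Proof.
move=> [mF [C hC]]; split; first exact: (measurableT_comp mF measurable_noisy).
exists (`|C| * (2 + 8 * c ^+ 2)) => p; apply: (le_trans (hC _)).
apply: (@le_trans _ _ (`|C| * quad (noisy p))).
  by rewrite ler_wpM2r ?ler_norm// (le_trans ler01)// quad_ge1.
by rewrite -mulrA ler_wpM2l// quad_noisy_le.
Qed.

(** Half of the admissible growth: a product of two such functions is dominated by [quad], and a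
    product with a noise coordinate by [jquad]. *)
Definition linear_growth (F : 'rV[R]_n -> R) :=
  measurable_fun setT F /\ exists C, forall y, `|F y| <= C * (1 + enorm y).

Lemma linear_growth_mul F G : linear_growth F -> linear_growth G ->
  dominated (@quad R n) (fun y => F y * G y).
Proof.
move=> [mF [C hC]] [mG [D hD]]; split; first exact: measurable_funM.
have C0 : 0 <= C by have := le_trans (normr_ge0 _) (hC 0); rewrite enorm0 addr0 mulr1.
have D0 : 0 <= D by have := le_trans (normr_ge0 _) (hD 0); rewrite enorm0 addr0 mulr1.
exists (2 * (C * D)) => y; rewrite normrM.
apply: (le_trans (ler_pM _ _ (hC y) (hD y))) => //.
have CD : 0 <= C * D by rewrite mulr_ge0.
rewrite mulrACA (mulrC 2) -[leRHS]mulrA; apply: ler_wpM2l => //.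
by rewrite /quad -sqr_enorm; have := sqr_ge0 (enorm y - 1); nra.
Qed.

Lemma linear_growth_coord_dominated F i : linear_growth F ->
  dominated jquad (fun p => F (noisy p) * p.2 ord0 i).
Proof.
move=> [mF [C hC]]; split.
  apply: measurable_funM; first exact: (measurableT_comp mF measurable_noisy).
  exact: (measurableT_comp (@measurable_coord R n i) measurable_snd).
have C0 : 0 <= C by have := le_trans (normr_ge0 _) (hC 0); rewrite enorm0 addr0 mulr1.
exists (C * (2 + 8 * c ^+ 2 + 4)) => p; rewrite normrM.
apply: (le_trans (ler_pM _ _ (hC _) (coord_le_enorm _ i))) => //.
rewrite -!mulrA; apply: ler_wpM2l => //.
have h1 := quad_noisy_le p.
have h2 : sqnorm p.2 <= 4 * jquad p.
  apply: (le_trans (sqnorm_le_expq _)); rewrite ler_wpM2l// ler_peMl ?expR_ge0//.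
  exact: quad_ge1.
have h3 := enorm_ge0 p.2; have h4 := enorm_ge0 (noisy p).
have : (1 + enorm (noisy p)) * enorm p.2 <= quad (noisy p) + sqnorm p.2.
  rewrite /quad -!sqr_enorm; have := sqr_ge0 (enorm (noisy p) - enorm p.2).
  have := sqr_ge0 (enorm p.2 - 1); nra.
move=> h5; apply: (le_trans h5); rewrite [leRHS]mulrDl; exact: lerD.
Qed.

Lemma heat_kernel_scale (z : 'rV[R]_n) : heat_kernel c (c *: z) = c^-1 ^+ n * gauss z.
Proof. by rewrite /heat_kernel scalerA mulVf ?scale1r// gt_eqF. Qed.

Lemma heat_ext y : (\int[mu]_x (heat_kernel c (y - x) * rho x)%:E = (heat rho c y)%:E)%E.
Proof.
rewrite /heat /conv /expect /Rintegral fineK//.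
apply: integrable_fin_num => //.
by apply: (@dominated_integrable _ _ _ _ rho (@quad R n)) => //; exact: heat_kernel_dominated.
Qed.

Let mY := measurable_noisy.

Let mdiff : measurable_fun setT (fun p : 'rV[R]_n * 'rV[R]_n => p.2 - p.1).
Proof. exact: measurable_subv. Qed.

Let mid : measurable_fun setT (@id 'rV[R]_n). Proof. exact: measurable_id. Qed.

(** The shear replaces the noise by the output [y] and the Gaussian by the heat kernel at [y - x];
    integrating over [x] first leaves [heat]. *)
Lemma ge0_transfer (F : 'rV[R]_n -> R) : measurable_fun setT F -> (forall y, 0 <= F y) ->
  (\int[mm]_p (F (noisy p) * joint p)%:E = \int[mu]_y (F y * heat rho c y)%:E)%E.
Proof.
move=> mF F0.
pose H (p : 'rV[R]_n * 'rV[R]_n) := (F p.2 * (heat_kernel c (p.2 - p.1) * rho p.1))%:E.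
have mk : measurable_fun setT (fun p : 'rV[R]_n * 'rV[R]_n => heat_kernel c (p.2 - p.1)).
  apply: (measurableT_comp _ mdiff); apply: continuous_measurable_rV.
  exact: continuous_heat_kernel.
have mH : measurable_fun setT H.
  apply/measurable_EFinP; apply: measurable_funM.
    exact: (measurableT_comp mF measurable_snd).
  by apply: measurable_funM => //; exact: (measurableT_comp mrho measurable_fst).
have H0 p : (0 <= H p)%E.
  by rewrite lee_fin; exact: (mulr_ge0 (F0 _) (mulr_ge0 (heat_kernel_ge0 _ c0) (rho0 _))).
transitivity (\int[mm]_p H p)%E.
  rewrite -(ge0_shear c0 mid mH H0) -ge0_integralZl//; last 2 first.
  - exact: (measurableT_comp mH (measurable_shear c mid)).
  - by rewrite lee_fin exprn_ge0// ltW.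
  apply: eq_integral => p _; rewrite /H -EFinM; congr EFin => /=.
  rewrite -/(noisy p) {2}/noisy addrK heat_kernel_scale /joint exprVn.
  by field; rewrite expf_neq0// gt_eqF.
rewrite fubini_tonelli2//; apply: eq_integral => y _; rewrite /fubini_G /H /=.
under eq_integral do rewrite EFinM.
rewrite ge0_integralZl//; last 3 first.
- apply/measurable_EFinP; apply: measurable_funM => //.
  apply: continuous_measurable_rV; apply: continuous_comp_rsub.
  exact: continuous_heat_kernel.
- by move=> x _; rewrite lee_fin mulr_ge0// heat_kernel_ge0.
- by rewrite lee_fin.
by rewrite heat_ext.
Qed.

Lemma heat_density : density (heat rho c).
Proof.
have hE : continuous (heat rho c) by exact: continuous_heat.
have h0 y : 0 <= heat rho c y by apply/ltW/heat_gt0.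
split => //.
  transitivity (\int[mu]_y (1 * heat rho c y)%:E)%E.
    by apply: eq_integral => y _; rewrite mul1r.
  rewrite -(@ge0_transfer (fun=> 1))//.
  by rewrite -integral_joint; apply: eq_integral => p _; rewrite mul1r.
have mq : measurable_fun setT (fun y => (quad y * heat rho c y)%:E).
  apply/measurable_EFinP; apply: measurable_funM; first exact: measurable_quad.
  exact: continuous_measurable_rV.
apply/integrableP; split => //.
have q0 y : 0 <= @quad R n y by rewrite (le_trans ler01)// quad_ge1.
under eq_integral do rewrite gee0_abs ?lee_fin ?mulr_ge0//.
rewrite -ge0_transfer//; last exact: measurable_quad.
have dq : dominated jquad (fun p => quad (noisy p)).
  apply: dominated_noisy; split; first exact: measurable_quad.
  by exists 1 => y; rewrite mul1r ger0_norm.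
have : mm.-integrable setT (fun p => (quad (noisy p) * joint p)%:E).
  exact: (@dominated_integrable _ _ _ _ joint jquad).
move=> /integrableP[_].
by under eq_integral do rewrite gee0_abs ?lee_fin ?mulr_ge0//.
Qed.

(* Disintegration of the joint law of (X, Z) along Y = X + c Z. *)
Lemma transfer (F k : 'rV[R]_n -> R) : measurable_fun setT F -> continuous k ->
  (exists C, forall w, `|k (c^-1 *: w) * heat_kernel c w| <= C) ->
  dominated jquad (fun p => F (noisy p) * k p.2) ->
  expect mm joint (fun p => F (noisy p) * k p.2) =
  (\int[mu]_y (F y * conv rho (fun w => k (c^-1 *: w) * heat_kernel c w) y))%R.
Proof.
move=> mF ck [C hC] dF.
pose K w := k (c^-1 *: w) * heat_kernel c w.
have cK : continuous K.
  apply: ctsM; last exact: continuous_heat_kernel.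
  apply: (@cts_comp _ _ _ (fun w : 'rV[R]_n => c^-1 *: w) k) => //.
  exact: continuous_scalev.
pose h (p : 'rV[R]_n * 'rV[R]_n) := F p.2 * (K (p.2 - p.1) * rho p.1).
have mh : measurable_fun setT h.
  apply: measurable_funM; first exact: (measurableT_comp mF measurable_snd).
  apply: measurable_funM; last exact: (measurableT_comp mrho measurable_fst).
  by apply: (measurableT_comp _ mdiff); exact: continuous_measurable_rV.
have cn : c ^+ n != 0 by rewrite expf_neq0// gt_eqF.
have hS p : h (shear c id p) = c^-1 ^+ n * (F (noisy p) * k p.2 * joint p).
  rewrite /h /K /= -/(noisy p) {2 3}/noisy addrK heat_kernel_scale /joint.
  rewrite scalerA mulVf ?scale1r ?gt_eqF//; ring.
have iF : mm.-integrable setT (fun p => (F (noisy p) * k p.2 * joint p)%:E).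
  exact: (@dominated_integrable _ _ _ _ joint jquad).
have ihS : mm.-integrable setT (fun p => (h (shear c id p))%:E).
  under eq_fun do rewrite hS EFinM.
  exact: integrableZl.
have [ih E] := signed_transfer (exprn_gt0 n c0) (measurable_shear c mid)
  (fun H mH H0 => ge0_shear c0 mid mH H0) mh ihS.
transitivity (\int[mm]_p h p)%R.
  rewrite -E /expect -RintegralZl//; apply: eq_Rintegral => p _.
  by rewrite hS exprVn; field.
rewrite /Rintegral -integral21_prod_meas1//; congr fine.
apply: eq_integral => y _; rewrite /fubini_G /h /=.
under eq_integral do rewrite EFinM.
have iK : mu.-integrable setT (fun x => (K (y - x) * rho x)%:E).
  apply: (@dominated_integrable _ _ _ _ rho (@quad R n)) => //.
  exact: (@conv_dominated _ _ K C).
rewrite integralZl// EFinM; congr (_ * _)%E.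
by rewrite /conv /expect /Rintegral fineK// integrable_fin_num.
Qed.

Lemma expect_noisy F : dominated (@quad R n) F ->
  expect mm joint (fun p => F (noisy p)) = expect mu (heat rho c) F.
Proof.
move=> dF.
have : dominated jquad (fun p => F (noisy p) * 1).
  by under eq_fun do rewrite mulr1; exact: dominated_noisy.
move=> /(@transfer F (fun=> 1) dF.1).
rewrite (_ : (fun w => 1 * heat_kernel c w) = heat_kernel c); last first.
  by apply/funext => w; rewrite mul1r.
under [X in _ -> _ -> expect _ _ X = _]eq_fun do rewrite mulr1.
move=> -> //; first exact: ctsC.
exists (heat_peak n c) => w; rewrite mul1r ger0_norm ?heat_kernel_ge0//.
exact: heat_kernel_le.
Qed.

(** Tower property: conditioning on the output replaces the noise by its posterior mean. *)
Lemma expect_noisy_coord F i : linear_growth F ->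
  expect mm joint (fun p => F (noisy p) * p.2 ord0 i) =
  expect mu (heat rho c) (fun y => F y * posterior rho c y ord0 i).
Proof.
move=> lF.
apply: (etrans (@transfer F (fun z : 'rV[R]_n => z ord0 i) lF.1 (@continuous_coord R n i)
  (ex_intro _ (5 * heat_peak n c) (score_kernel_le c0 i)) (linear_growth_coord_dominated i lF))).
apply: eq_Rintegral => y _; rewrite -[RHS]mulrA -(posteriorE drho c0) //.
Qed.

End gaussian_channel.

Section gauss_facts.
Context {R : realType} (n : nat).

Lemma gauss_shift (z a : 'rV[R]_n) :
  gauss (z - a) = gauss z * expR (dotv a z - sqnorm a / 2).
Proof.
rewrite /gauss -mulrA -expRD sqnormB (dotvC a); congr (_ * expR _); lra.
Qed.

Lemma normr_expR_sub1 (u : R) : `|expR u - 1| <= `|u| * expR `|u|.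
Proof.
have h1 : u - u * expR u + (expR u - 1) - u <= 0.
  have := expR_ge1Dx (- u); rewrite expRN => h.
  have e0 := expR_gt0 u.
  have : (1 - u) * expR u <= 1 by rewrite -ler_pdivlMr// mul1r.
  lra.
have h2 := expR_ge1Dx u.
have [u0|u0] := leP 0 u.
  rewrite (ger0_norm u0) ger0_norm; first lra.
  lra.
have e1 : expR u <= 1 by rewrite expR_le1 ltW.
rewrite ler0_norm ?subr_le0// (ltr0_norm u0) opprB.
have e2 : 1 <= expR (- u) by rewrite -expR0 ler_expR oppr_ge0 ltW.
apply: (@le_trans _ _ (- u)); first lra.
by rewrite ler_peMr// oppr_ge0 ltW.
Qed.

(** Combines [(1 + r)^2 <= 4 e^(1 + r)] with [2 (1 + r) <= 6 + r^2 / 4], which is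
    [(r / 2 - 2)^2 >= 0]. *)
Lemma exp_growth (r : R) : 0 <= r ->
  (1 + r) ^+ 2 * expR (1 + r) <= 4 * expR 6 * expR (r ^+ 2 / 4).
Proof.
move=> r0; have h : 0 <= 1 + r by lra.
apply: (@le_trans _ _ (4 * expR (1 + r) * expR (1 + r))).
  rewrite ler_wpM2r ?expR_ge0//.
  have := expr_le_expR 2 h; rewrite (_ : 2%:R ^+ 2 = 4 :> R)//.
  by rewrite -natrX.
rewrite -!mulrA ler_wpM2l// -!expRD ler_expR.
have := sqr_ge0 (r / 2 - 2); lra.
Qed.

Lemma ln_le_sub1 (v : R) : 0 < v -> ln v <= v - 1.
Proof. by move=> v0; have := expR_ge1Dx (ln v); rewrite lnK ?posrE//; lra. Qed.

End gauss_facts.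

(** * Stein's identity *)

Section stein.
Context {R : realType} (n : nat).
Local Notation mu := (lebesgue_rV n).
Local Notation mm := (mu \x mu)%E.
Variable rho : 'rV[R]_n -> R.
Hypothesis drho : density rho.
Variable c : R.
Hypothesis c0 : 0 < c.
Local Notation jnt := (joint rho).
Local Notation noisyc := (@noisy R n c).

Let mj := measurable_joint drho.
Let j0 := joint_ge0 drho.
Let jq1 := @jquad_ge1 R n.
Let ijq := integrable_jquad drho.
Let rho0 := density_ge0 drho.

(** Translating the noise by [h e_i] can be read as moving the output by [c h e_i] or as tilting the
    Gaussian density ([expF]). Dividing by [h] and letting it vanish along [1 / (k + 1)] yields the
    two sides, each by dominated convergence. *)
Lemma stein (F dF : 'rV[R]_n -> R) (i : 'I_n) (K : R) :
  continuous F -> (exists C, forall y, `|F y| <= C * (1 + enorm y)) ->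
  (forall y h, `|F (y + h *: evec R i) - F y| <= K * `|h|) ->
  (forall y, is_derive (0 : R) (1 : R) (fun h => F (y + h *: evec R i)) (dF y)) ->
  expect mm jnt (fun p => F (noisyc p) * p.2 ord0 i) =
  c * expect mm jnt (fun p => dF (noisyc p)).
Proof.
move=> cF [C hC] lipF derF.
have mF : measurable_fun setT F by exact: continuous_measurable_rV.
have C0 : 0 <= C by have := le_trans (normr_ge0 _) (hC 0); rewrite enorm0 addr0 mulr1.
have K0 : 0 <= K by have := le_trans (normr_ge0 _) (lipF 0 1); rewrite normr1 mulr1.
have quadF : dominated (@quad R n) F.
  split => //; exists (2 * C) => y; apply: (le_trans (hC y)).
  rewrite [2 * C]mulrC -mulrA ler_wpM2l// /quad -sqr_enorm.
  have := sqr_ge0 (enorm y - 1); nra.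
have mYh h : measurable_fun setT (fun p : 'rV[R]_n * 'rV[R]_n => F (noisyc p + h *: evec R i)).
  apply: (measurableT_comp mF).
  rewrite (_ : (fun p => _) = (fun p => 1 *: noisyc p + h *: evec R i)); last first.
    by apply/funext => p; rewrite scale1r.
  by apply: measurable_affv => //; exact: measurable_noisy.
have domF := dominated_noisy c quadF.
have domFh h : dominated (@jquad R n) (fun p => F (noisyc p + h *: evec R i)).
  have d1 : dominated (@jquad R n) (fun p => F (noisyc p + h *: evec R i) - F (noisyc p)).
    split; first by apply: measurable_funB => //; exact: domF.1.
    exists (K * `|h|) => p; apply: (le_trans (lipF _ _)).
    by rewrite ler_peMr// mulr_ge0.
  have := dominatedD d1 domF; congr dominated; apply/funext => p; by rewrite subrK.
have expF h : 0 <= h -> h <= 1 ->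
  expect mm jnt (fun p => F (noisyc p + (c * h) *: evec R i)) =
  expect mm jnt (fun p => F (noisyc p) * expR (h * p.2 ord0 i - h ^+ 2 / 2)).
  move=> h0 h1.
  pose g (p : 'rV[R]_n * 'rV[R]_n) := F (noisyc p) * (rho p.1 * gauss (p.2 - h *: evec R i)).
  have mg : measurable_fun setT g.
    apply: measurable_funM; first exact: domF.1.
    apply: measurable_funM.
      apply: (measurableT_comp _ measurable_fst); apply: continuous_measurable_rV.
      exact: density_cts drho.
    apply: (measurableT_comp (@measurable_gauss R n)).
    exact: measurable_subv.
  have gS p : g (shear 1 (cst (h *: evec R i)) p) = F (noisyc p + (c * h) *: evec R i) * jnt p.
    rewrite /g /shear /= /noisy /= scale1r addrK scalerDr scalerA.
    by rewrite addrAC.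
  have [|_ E] := signed_transfer (exprn_gt0 n (@ltr01 R)) (measurable_shear 1 (@measurable_cst _ _ _ _ setT (h *: evec R i)))
    (fun H mH H0 => ge0_shear (@ltr01 R) (@measurable_cst _ _ _ _ setT (h *: evec R i)) mH H0) mg.
    under eq_fun do rewrite gS.
    exact: (@dominated_integrable _ _ _ _ jnt (@jquad R n)).
  move: E; rewrite expr1n mul1r => E.
  transitivity (\int[mm]_p g p)%R.
    by rewrite -E; apply: eq_Rintegral => p _; rewrite gS.
  apply: eq_Rintegral => p _; rewrite /g /joint gauss_shift.
  rewrite sqnormZ sqnorm_evec mulr1 dotvZl (dotvC (evec R i)) dotv_evec; ring.
pose h (k : nat) : R := k.+1%:R^-1.
have hgt k : 0 < h k by rewrite invr_gt0 ltr0n.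
have hle k : h k <= 1 by rewrite invf_le1 ?ltr0n// ler1n.
have ch : h k @[k --> \oo] --> 0 by exact: cvg_harmonic.
pose A k (p : 'rV[R]_n * 'rV[R]_n) := (F (noisyc p + (c * h k) *: evec R i) - F (noisyc p)) / h k.
pose B k (p : 'rV[R]_n * 'rV[R]_n) := F (noisyc p) * ((expR (h k * p.2 ord0 i - h k ^+ 2 / 2) - 1) / h k).
have mz : measurable_fun setT (fun p : 'rV[R]_n * 'rV[R]_n => p.2 ord0 i).
  exact: (measurableT_comp (@measurable_coord R n i) measurable_snd).
have mexp k : measurable_fun setT (fun p : 'rV[R]_n * 'rV[R]_n => expR (h k * p.2 ord0 i - h k ^+ 2 / 2)).
  apply: measurableT_comp => //; apply: measurable_funB => //.
  exact: measurable_funM.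
have mB k : measurable_fun setT (B k).
  apply: measurable_funM; first exact: domF.1.
  apply: measurable_funM => //; exact: measurable_funB.
(* With [r] the size of the noise, the tilt quotient costs [(1 + r) e^(1 + r)] and the linear growth
   of [F] one more factor [1 + r]; [exp_growth] fits the product under [expq]. *)
have boundB k p : `|B k p| <= (C * (1 + c) * 2 * (4 * expR 6)) * jquad p.
  rewrite /B normrM.
  set r := enorm p.2; have r0 : 0 <= r by exact: enorm_ge0.
  have b1 : `|(expR (h k * p.2 ord0 i - h k ^+ 2 / 2) - 1) / h k| <= (1 + r) * expR (1 + r).
    rewrite normrM normfV (ger0_norm (ltW (hgt k))) ler_pdivrMr//.
    set u := _ - _ / 2.
    have hu : `|u| <= h k * (1 + r).
      apply: (le_trans (ler_normB _ _)); rewrite normrM (ger0_norm (ltW (hgt k))).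
      have := coord_le_enorm p.2 i; rewrite -/r => hr.
      have -> : `|h k ^+ 2 / 2| = h k * (h k / 2) by rewrite ger0_norm; [rewrite expr2 mulrA|apply: divr_ge0 => //; exact: sqr_ge0].
      rewrite -mulrDr ler_wpM2l ?(ltW (hgt k))//; have := hle k; lra.
    have hu' : `|u| <= 1 + r.
      apply: (le_trans hu); rewrite ler_piMl//; lra.
    apply: (le_trans (normr_expR_sub1 u)).
    rewrite [leRHS]mulrAC (mulrC (1 + r) (h k)); apply: ler_pM => //.
    by rewrite ler_expR; exact: hu'.
  have b2 : `|F (noisyc p)| <= C * (1 + c) * 2 * quad p.1 * (1 + r).
    apply: (le_trans (hC _)); rewrite -!mulrA; apply: ler_wpM2l => //.
    have h1 : enorm (noisyc p) <= c * r + enorm p.1.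
      by apply: (le_trans (enormD _ _)); rewrite enormZ (ger0_norm (ltW c0)).
    set x := enorm p.1 in h1; have x0 : 0 <= x by exact: enorm_ge0.
    have qx : quad p.1 = 1 + x ^+ 2 by rewrite /quad -sqr_enorm.
    rewrite qx; apply: (@le_trans _ _ ((1 + c) * ((1 + x) * (1 + r)))).
      have c1 := ltW c0; have := mulr_ge0 c1 x0; have := mulr_ge0 c1 (mulr_ge0 x0 r0).
      have := mulr_ge0 x0 r0; have := mulr_ge0 c1 r0; lra.
    rewrite ler_wpM2l ?addr_ge0// ?(ltW c0)// mulrA ler_wpM2r ?addr_ge0//.
    have := sqr_ge0 (x - 2^-1); have := sqr_ge0 x; lra.
  have D0 : 0 <= C * (1 + c) * 2 by rewrite !mulr_ge0// addr_ge0// ltW.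
  apply: (le_trans (ler_pM _ _ b2 b1)) => //.
  rewrite /jquad (_ : _ * _ * (1 + r) * _ = C * (1 + c) * 2 * quad p.1 * ((1 + r) ^+ 2 * expR (1 + r))); last by ring.
  rewrite (_ : _ * (4 * expR 6) * _ = C * (1 + c) * 2 * quad p.1 * (4 * expR 6 * expq p.2)); last by ring.
  apply: ler_wpM2l; first by rewrite mulr_ge0// (le_trans ler01)// quad_ge1.
  by have := exp_growth r0; rewrite /expq -sqr_enorm.
have cvB p : B k p @[k --> \oo] --> F (noisyc p) * p.2 ord0 i.
  apply: cvgM; first exact: cvg_cst.
  have D : is_derive (0 : R) (1 : R) (fun t : R => expR (t * p.2 ord0 i - t ^+ 2 / 2)) (p.2 ord0 i).
    have D1 : is_derive (0 : R) (1 : R) (fun t : R => t * p.2 ord0 i - t ^+ 2 / 2) (p.2 ord0 i).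
      by apply: is_derive_eq; rewrite /GRing.scale /= expr0n /= ; lra.
    have e0 : expR ((0 : R) * p.2 ord0 i - 0 ^+ 2 / 2) = 1.
      by rewrite mul0r expr0n /= mul0r subrr expR0.
    have D2 := is_derive_expR ((0 : R) * p.2 ord0 i - 0 ^+ 2 / 2).
    have := @is_derive1_comp R expR (fun t : R => t * p.2 ord0 i - t ^+ 2 / 2) 0 _ _ D2 D1.
    by rewrite e0 mul1r.
  have := cvg_diff_quotient D (fun k => lt0r_neq0 (hgt k)) ch.
  apply: cvg_trans; apply: near_eq_cvg; apply: nearW => k.
  by rewrite add0r mul0r expr0n /= mul0r subrr expR0.
have [_ LB] := expect_dct (measurable_joint drho) j0 ijq mB boundB cvB.
have mA k : measurable_fun setT (A k).
  apply: measurable_funM => //; apply: measurable_funB => //.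
  exact: domF.1.
have boundA k p : `|A k p| <= (K * c) * jquad p.
  rewrite /A normrM normfV (ger0_norm (ltW (hgt k))) ler_pdivrMr//.
  apply: (le_trans (lipF _ _)); rewrite normrM (ger0_norm (ltW c0)) (ger0_norm (ltW (hgt k))).
  rewrite mulrA ler_wpM2r ?(ltW (hgt k))// ler_peMr// mulr_ge0// ltW//.
have cvA p : A k p @[k --> \oo] --> c * dF (noisyc p).
  have u0 k : c * h k != 0 by rewrite mulf_neq0// gt_eqF.
  have cu : c * h k @[k --> \oo] --> 0 by rewrite -(mulr0 c); apply: cvgM => //; exact: cvg_cst.
  have L := cvg_diff_quotient (derF (noisyc p)) u0 cu.
  have : c * ((F (noisyc p + (0 + c * h k) *: evec R i) - F (noisyc p + 0 *: evec R i)) / (c * h k))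
      @[k --> \oo] --> c * dF (noisyc p) by apply: cvgM; [exact: cvg_cst|exact: L].
  apply: cvg_trans; apply: near_eq_cvg; apply: nearW => k.
  rewrite add0r scale0r addr0 /A /=; field.
  by rewrite !gt_eqF.
have [dcdF LA] := expect_dct (measurable_joint drho) j0 ijq mA boundA cvA.
have AB : (fun k => expect mm jnt (A k)) = (fun k => expect mm jnt (B k)).
  apply/funext => k.
  have domB : dominated (@jquad R n) (fun p => F (noisyc p) * expR (h k * p.2 ord0 i - h k ^+ 2 / 2)).
    have dB : dominated (@jquad R n) (B k) by split; [exact: mB|exists (C * (1 + c) * 2 * (4 * expR 6))].
    have := dominatedD (dominatedZ (h k) dB) domF; congr dominated; apply/funext => p.
    by rewrite /B; field; rewrite gt_eqF.
  have -> : expect mm jnt (A k) = (h k)^-1 *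
     (expect mm jnt (fun p => F (noisyc p + (c * h k) *: evec R i)) - expect mm jnt (fun p => F (noisyc p))).
    rewrite -(@expectB _ _ _ _ _ (@jquad R n))// -(@expectZ _ _ _ _ _ (@jquad R n))//; last exact: dominatedB.
    by congr expect; apply/funext => p; rewrite /A mulrC.
  rewrite expF ?(ltW (hgt k))//.
  rewrite -(@expectB _ _ _ _ _ (@jquad R n))// -(@expectZ _ _ _ _ _ (@jquad R n))//; last exact: dominatedB.
  by congr expect; apply/funext => p; rewrite /B; ring.
rewrite AB in LA.
have L1 := cvg_lim (@Rhausdorff R) LA.
have L2 := cvg_lim (@Rhausdorff R) LB.
rewrite -L2 L1.
have ddF : dominated (@jquad R n) (fun p => dF (noisyc p)).
  have := dominatedZ c^-1 dcdF; congr dominated; apply/funext => p.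
  by rewrite mulrA mulVf ?mul1r// gt_eqF.
by rewrite (@expectZ _ _ _ _ _ (@jquad R n)).
Qed.

End stein.

(** * Entropy dissipation under Gaussian smoothing *)

Section entropy.
Context {R : realType} (n : nat).
Local Notation mu := (lebesgue_rV n).
Local Notation mm := (mu \x mu)%E.
Variable rho : 'rV[R]_n -> R.
Hypothesis drho : density rho.
Variable c : R.
Hypothesis c0 : 0 < c.
Local Notation jnt := (joint rho).
Local Notation noisyc := (@noisy R n c).
Local Notation heat := (heat rho c).
Local Notation posterior := (posterior rho c).

Let mj := measurable_joint drho.
Let j0 := joint_ge0 drho.
Let jq1 := @jquad_ge1 R n.
Let ijq := integrable_jquad drho.
Let rho0 := density_ge0 drho.
Let mrho : measurable_fun setT rho.
Proof. by apply: continuous_measurable_rV; exact: density_cts drho. Qed.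

Lemma posterior_linear_growth i : linear_growth (fun y => posterior y ord0 i).
Proof.
split; first by apply: continuous_measurable_rV; exact: continuous_posterior.
have [C [C0 hC]] := sqnorm_posterior_le drho c0.
exists (C + 1) => y; apply: (le_trans (coord_le_enorm _ _)).
have e0 := enorm_ge0 y.
rewrite enorm_leP; last by rewrite mulr_ge0// addr_ge0.
apply: (le_trans (hC y)); rewrite /quad -sqr_enorm exprMn; apply: ler_pM => //.
- by rewrite addr_ge0// sqr_ge0.
- have := sqr_ge0 C; lra.
- lra.
Qed.

Lemma ln_heat_dominated : dominated (@quad R n) (fun y => ln (heat y)).
Proof.
have [C [C0 hC]] := ln_heat_le drho c0.
split; last by exists C.
apply: measurableT_comp; first exact: measurable_ln.
by apply: continuous_measurable_rV; exact: continuous_heat.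
Qed.

Lemma sqnorm_posterior_dominated : dominated (@quad R n) (fun y => sqnorm (posterior y)).
Proof.
have [C [C0 hC]] := sqnorm_posterior_le drho c0.
split; last by exists C => y; rewrite ger0_norm ?sqnorm_ge0.
apply: measurable_sum => i; apply: measurable_funX.
by apply: continuous_measurable_rV; exact: continuous_posterior.
Qed.

Let mpost : measurable_fun setT posterior.
Proof.
by apply: measurable_fun_rV => i; apply: continuous_measurable_rV; exact: continuous_posterior.
Qed.

(* The entropy gain h(Y) - h(X) is the mutual information of Y = X + cZ and Z;
   the Donsker-Varadhan bound with the test function a(y).z - |a(y)|^2/2,
   a = E[Z | Y], turns it into the Fisher information of Y. *)
Lemma entropy_dissipation :
  mu.-integrable setT (fun x => (rho x * ln (rho x))%:E) ->
  2^-1 * expect mu heat (fun y => sqnorm (posterior y)) <=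
  (\int[mu]_x (rho x * ln (rho x)))%R - expect mu heat (fun y => ln (heat y)).
Proof.
move=> ient.
pose t1 (p : 'rV[R]_n * 'rV[R]_n) := rho p.1 * ln (rho p.1) * gauss p.2.
pose D (p : 'rV[R]_n * 'rV[R]_n) := ln (heat (noisyc p)) +
   (dotv (posterior (noisyc p)) p.2 - sqnorm (posterior (noisyc p)) / 2).
(* In the coordinates (output, noise) this is the law with the same output and with noise N(a(y), I)
   given [y]. The change of coordinates preserves volume, so the mass is one. *)
pose t6 (p : 'rV[R]_n * 'rV[R]_n) := heat (noisyc p) * gauss (p.2 - posterior (noisyc p)).
have mrl : measurable_fun setT (fun x => rho x * ln (rho x)).
  by apply: measurable_funM => //; exact: (measurableT_comp (@measurable_ln R) mrho).
have mt1 : measurable_fun setT t1.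
  apply: measurable_funM; first exact: (measurableT_comp mrl measurable_fst).
  exact: (measurableT_comp (@measurable_gauss R n) measurable_snd).
have it1 : mm.-integrable setT (fun p => (t1 p)%:E).
  apply/integrableP; split; first exact/measurable_EFinP.
  rewrite fubini_tonelli1//; last by apply: measurableT_comp => //; exact/measurable_EFinP.
  rewrite (_ : (\int[mu]_x _)%E = (\int[mu]_x `|(rho x * ln (rho x))%:E|)%E).
    by have /integrableP[] := ient.
  apply: eq_integral => x _; rewrite /fubini_F /t1 /=.
  under eq_integral do rewrite normrM (ger0_norm (gauss_ge0 _)) EFinM.
  rewrite ge0_integralZl//; first by rewrite integral_gauss mule1.
  - by apply/measurable_EFinP; exact: measurable_gauss.
  - by move=> z _; rewrite lee_fin gauss_ge0.
have Et1 : (\int[mm]_p t1 p)%R = (\int[mu]_x (rho x * ln (rho x)))%R.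
  rewrite /Rintegral -integral12_prod_meas1//; congr fine.
  apply: eq_integral => x _; rewrite /fubini_F /t1 /=.
  under eq_integral do rewrite EFinM.
  rewrite integralZl//; first by rewrite integral_gauss mule1.
  apply/integrableP; split; first by apply/measurable_EFinP; exact: measurable_gauss.
  under eq_integral do rewrite gee0_abs ?lee_fin ?gauss_ge0//.
  by rewrite integral_gauss ltry.
have d1 := dominated_noisy c ln_heat_dominated.
have d2i i := linear_growth_coord_dominated c i (posterior_linear_growth i).
have d2 : dominated (@jquad R n) (fun p => dotv (posterior (noisyc p)) p.2).
  by apply: dominated_sum => //.
have d3 := dominated_noisy c sqnorm_posterior_dominated.
have d3' : dominated (@jquad R n) (fun p => sqnorm (posterior (noisyc p)) / 2).
  have := dominatedZ 2^-1 d3; congr dominated; apply/funext => p; by rewrite mulrC.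
have dD : dominated (@jquad R n) D.
  by apply: dominatedD => //; exact: dominatedB.
have dheat := heat_density drho c0.
have h0 y : 0 < heat y by exact: heat_gt0.
have mheat : measurable_fun setT heat by apply: continuous_measurable_rV; exact: continuous_heat.
have iqh := density_quad dheat.
have ED : expect mm jnt D = expect mu heat (fun y => ln (heat y)) +
    2^-1 * expect mu heat (fun y => sqnorm (posterior y)).
  rewrite /D (@expectD _ _ _ _ _ (@jquad R n))//; last exact: dominatedB.
  rewrite (expect_noisy drho c0 ln_heat_dominated); congr (_ + _).
  rewrite (@expectB _ _ _ _ _ (@jquad R n))//.
  have -> : expect mm jnt (fun p => sqnorm (posterior (noisyc p)) / 2) =
      2^-1 * expect mu heat (fun y => sqnorm (posterior y)).
    rewrite -(expect_noisy drho c0 sqnorm_posterior_dominated) -(@expectZ _ _ _ _ _ (@jquad R n))//.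
    by congr expect; apply/funext => p; rewrite mulrC.
  have -> : expect mm jnt (fun p => dotv (posterior (noisyc p)) p.2) =
      expect mu heat (fun y => sqnorm (posterior y)).
    rewrite /dotv (@expect_sum _ _ _ _ _ (@jquad R n))//.
    under eq_bigr do rewrite (expect_noisy_coord drho c0 _ (posterior_linear_growth _)).
    rewrite -(@expect_sum _ _ _ _ _ (@quad R n))//.
    - by apply: (@quad_ge1 R n).
    - by move=> i; apply: linear_growth_mul; exact: posterior_linear_growth.
  lra.
pose G (p : 'rV[R]_n * 'rV[R]_n) := (heat p.1 * gauss (p.2 - posterior p.1))%:E.
have mG : measurable_fun setT G.
  apply/measurable_EFinP; apply: measurable_funM; first exact: (measurableT_comp mheat measurable_fst).
  apply: (measurableT_comp (@measurable_gauss R n)).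
  exact: (measurable_subv measurable_snd (measurableT_comp mpost measurable_fst)).
have G0 p : (0 <= G p)%E by rewrite lee_fin mulr_ge0 ?gauss_ge0// ltW.
have mY := @measurable_noisy R n c.
have mt6 : measurable_fun setT t6.
  apply: measurable_funM; first exact: (measurableT_comp mheat mY).
  apply: (measurableT_comp (@measurable_gauss R n)).
  exact: (measurable_subv measurable_snd (measurableT_comp mpost mY)).
have t60 p : 0 <= t6 p by rewrite mulr_ge0 ?gauss_ge0// ltW.
have It6 : (\int[mm]_p (t6 p)%:E = 1)%E.
  transitivity (\int[mm]_p G p)%E.
    have emt6 : measurable_fun setT (fun p => (t6 p)%:E) by exact/measurable_EFinP.
    have et60 p : (0 <= (t6 p)%:E)%E by rewrite lee_fin.
    apply: (etrans (@fubini_tonelli2 _ _ _ _ _ mu mu _ emt6 et60)).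
    apply: (etrans _ (esym (@fubini_tonelli2 _ _ _ _ _ mu mu _ mG G0))).
    apply: eq_integral => z _; rewrite /fubini_G /t6.
    have mGz : measurable_fun setT (fun y => G (y, z)).
      exact: (measurableT_comp mG (measurable_pair2 z)).
    have := @ge0_integral_affine R n 1 (c *: z) (fun y => G (y, z)) ltr01 mGz (fun y => G0 (y, z)).
    rewrite expr1n mul1e => E; apply: (etrans _ E).
    by apply: eq_integral => x _; rewrite /G /noisy scale1r (addrC x).
  apply: (etrans (@fubini_tonelli1 _ _ _ _ _ mu mu _ mG G0)).
  rewrite -(density_int1 dheat); apply: eq_integral => y _.
  rewrite /fubini_F /G /=; under eq_integral do rewrite EFinM.
  rewrite ge0_integralZl//.
  - have mgy : measurable_fun setT (fun z : 'rV[R]_n => (gauss (z - posterior y))%:E).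
      apply/measurable_EFinP; apply: (measurableT_comp (@measurable_gauss R n)).
      exact: (measurable_subv (@measurable_id _ _ _) (@measurable_cst _ _ _ _ setT (posterior y))).
    have gy0 (z : 'rV[R]_n) : (0 <= (gauss (z - posterior y))%:E)%E by rewrite lee_fin gauss_ge0.
    have := @ge0_integral_affine R n 1 (posterior y) _ ltr01 mgy gy0.
    rewrite expr1n mul1e => <-.
    under eq_integral do rewrite scale1r addrK.
    by rewrite integral_gauss mule1.
  - apply/measurable_EFinP; apply: (measurableT_comp (@measurable_gauss R n)).
    exact: (measurable_subv (@measurable_id _ _ _) (@measurable_cst _ _ _ _ setT (posterior y))).
  - by move=> z _; rewrite lee_fin gauss_ge0.
  - by rewrite lee_fin ltW.
have it6 : mm.-integrable setT (fun p => (t6 p)%:E).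
  apply/integrableP; split; first exact/measurable_EFinP.
  under eq_integral do rewrite gee0_abs ?lee_fin//.
  by rewrite It6 ltry.
have ij : mm.-integrable setT (fun p => (jnt p)%:E).
  rewrite (_ : (fun p => _) = (fun p => (1 * jnt p)%:E)); last by apply/funext => p; rewrite mul1r.
  apply: (@dominated_integrable _ _ _ _ jnt (@jquad R n)) => //.
  exact: dominatedC.
have iD : mm.-integrable setT (fun p => (D p * jnt p)%:E).
  exact: (@dominated_integrable _ _ _ _ jnt (@jquad R n)).
(* [ln v <= v - 1] with [v = t6 / joint], times the joint density. Both densities have mass one, so
   the left integral vanishes. *)
have key : (\int[mm]_p (jnt p - t6 p))%R <= (\int[mm]_p (t1 p - D p * jnt p))%R.
  apply: le_Rintegral => //.
  - rewrite (_ : EFin \o _ = (fun p => ((jnt p)%:E - (t6 p)%:E)%E)); last by apply/funext.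
    exact: integrableB.
  - rewrite (_ : EFin \o _ = (fun p => ((t1 p)%:E - (D p * jnt p)%:E)%E)); last by apply/funext.
    exact: integrableB.
  move=> p _.
  set a := posterior (noisyc p); set hy := heat (noisyc p).
  have hy0 : 0 < hy by exact: h0.
  rewrite /t6 gauss_shift -/a -/hy /t1 /D -/a -/hy /joint.
  set psi := dotv a p.2 - sqnorm a / 2; set g := gauss p.2.
  have g0 : 0 < g by exact: gauss_gt0.
  have [r0|rN] := eqVneq (rho p.1) 0.
    rewrite r0 !mul0r mulr0 subrr sub0r oppr_le0 !mulr_ge0// ?expR_ge0// ltW//.
  have r0 : 0 < rho p.1 by rewrite lt_neqAle eq_sym rN rho0.
  set r := rho p.1 in r0 *.
  have v0 : 0 < hy * expR psi / r by rewrite divr_gt0// mulr_gt0// expR_gt0.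
  have := ln_le_sub1 v0.
  rewrite ln_div ?posrE ?mulr_gt0 ?expR_gt0// lnM ?posrE ?expR_gt0// expRK => lv.
  have rg : 0 <= r * g by rewrite mulr_ge0// ltW.
  have := ler_wpM2l rg lv.
  have -> : r * g * (hy * expR psi / r - 1) = hy * (g * expR psi) - r * g.
    by field; rewrite gt_eqF.
  lra.
move: key; rewrite !RintegralB// Et1.
have -> : (\int[mm]_p jnt p)%R = 1 by rewrite /Rintegral integral_joint.
have -> : (\int[mm]_p t6 p)%R = 1 by rewrite /Rintegral It6.
rewrite -[(\int[mm]_p (D p * jnt p))%R]/(expect mm jnt D) ED.
lra.
Qed.

End entropy.

(** * Semigroup property of the heat flow *)

Section semigroup.
Context {R : realType} (n : nat).
Local Notation mu := (lebesgue_rV n).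

Lemma heat_kernel_semigroup (c1 c2 : R) (w : 'rV[R]_n) : 0 < c1 -> 0 < c2 ->
  (\int[mu]_z (heat_kernel c2 (w - c1 *: z) * gauss z)%:E =
   (heat_kernel (Num.sqrt (c1 ^+ 2 + c2 ^+ 2)) w)%:E)%E.
Proof.
move=> c10 c20; set c := Num.sqrt _.
have cc : c ^+ 2 = c1 ^+ 2 + c2 ^+ 2 by rewrite sqr_sqrtr// addr_ge0// sqr_ge0.
have c0 : 0 < c by rewrite sqrtr_gt0 addr_gt0// exprn_gt0.
pose m := (c1 / c ^+ 2) *: w; pose a := c / c2.
have a0 : 0 < a by rewrite divr_gt0.
have cN : c != 0 by rewrite gt_eqF. have c2N : c2 != 0 by rewrite gt_eqF.
(* completing the square *)
have E z : heat_kernel c2 (w - c1 *: z) * gauss z =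
    heat_kernel c w * (a ^+ n * gauss (a *: z + - (a *: m))).
  rewrite /heat_kernel /gauss -scalerBr !sqnormZ !sqnormB !sqnormZ !dotvZr.
  set P := (Num.sqrt (2 * pi))^-1 ^+ n; set W := sqnorm w; set Z := sqnorm z.
  rewrite (dotvC w z); set d := dotv z w.
  have -> : c2^-1 ^+ n * (P * expR (- (c2^-1 ^+ 2 * (W - 2 * (c1 * d) + c1 ^+ 2 * Z) / 2))) * (P * expR (- (Z / 2)))
     = (c2^-1 ^+ n * P * P) * expR (- (c2^-1 ^+ 2 * (W - 2 * (c1 * d) + c1 ^+ 2 * Z) / 2) + - (Z / 2)).
    by rewrite expRD; ring.
  have -> : c^-1 ^+ n * (P * expR (- (c^-1 ^+ 2 * W / 2))) *
     (a ^+ n * (P * expR (- (a ^+ 2 * (Z - 2 * (c1 / c ^+ 2 * d) + (c1 / c ^+ 2) ^+ 2 * W) / 2))))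
     = ((c^-1 ^+ n * a ^+ n) * P * P) * expR (- (c^-1 ^+ 2 * W / 2) + - (a ^+ 2 * (Z - 2 * (c1 / c ^+ 2 * d) + (c1 / c ^+ 2) ^+ 2 * W) / 2)).
    by rewrite expRD; ring.
  rewrite (_ : c^-1 ^+ n * a ^+ n = c2^-1 ^+ n); last by rewrite -exprMn /a mulrA mulVf ?mul1r.
  congr (_ * expR _).
  have c2E : c2 ^+ 2 = c ^+ 2 - c1 ^+ 2 by rewrite cc; ring.
  have c2N2 : c ^+ 2 - c1 ^+ 2 != 0 by rewrite -c2E expf_neq0.
  rewrite !expr_div_n !exprVn c2E; field.
  by rewrite c2N2 cN.
under eq_integral do rewrite E EFinM.
have mz b : measurable_fun setT (fun z : 'rV[R]_n => (gauss (a *: z + b))%:E).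
  by apply/measurable_EFinP; apply: (measurableT_comp (@measurable_gauss R n)); apply: measurable_affv.
rewrite ge0_integralZl//; last 3 first.
- by under eq_fun do rewrite EFinM; apply: measurable_funeM.
- by move=> z _; rewrite lee_fin mulr_ge0 ?gauss_ge0// exprn_ge0// ltW.
- by rewrite lee_fin heat_kernel_ge0.
under eq_integral do rewrite EFinM.
rewrite ge0_integralZl//; last 2 first.
- by move=> z _; rewrite lee_fin gauss_ge0.
- by rewrite lee_fin exprn_ge0// ltW.
rewrite (@ge0_integral_affine R n a (- (a *: m)) (fun z => (gauss z)%:E))//.
- by rewrite integral_gauss mule1.
- by apply/measurable_EFinP; exact: measurable_gauss.
- by move=> z; rewrite lee_fin gauss_ge0.
Qed.

(** Restarts the flow at a positive time, so that [entropy_dissipation] bounds the increment between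
    any two times. *)
Lemma heat_semigroup (rho : 'rV[R]_n -> R) (c1 c2 : R) : density rho -> 0 < c1 -> 0 < c2 ->
  heat (heat rho c1) c2 = heat rho (Num.sqrt (c1 ^+ 2 + c2 ^+ 2)).
Proof.
move=> drho c10 c20; set c := Num.sqrt _.
have c0 : 0 < c by rewrite sqrtr_gt0 addr_gt0// exprn_gt0.
have dh := heat_density drho c10.
have mrho : measurable_fun setT rho by apply: continuous_measurable_rV; exact: density_cts drho.
have rho0 := density_ge0 drho.
apply/funext => y; apply: EFin_inj.
rewrite -(heat_ext dh c20) -(heat_ext drho c0).
have mk : measurable_fun setT (fun u : 'rV[R]_n => heat_kernel c2 (y - u)).
  apply: continuous_measurable_rV; apply: continuous_comp_rsub.
  exact: continuous_heat_kernel.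
rewrite -(ge0_transfer drho c10 mk); last by move=> u; exact: heat_kernel_ge0.
rewrite fubini_tonelli1; last 2 first.
- apply/measurable_EFinP; apply: measurable_funM; last exact: measurable_joint.
  exact: (measurableT_comp mk (@measurable_noisy R n c1)).
- move=> p; rewrite lee_fin mulr_ge0 ?heat_kernel_ge0//; exact: joint_ge0.
apply: eq_integral => x _; rewrite /fubini_F /noisy /joint /=.
transitivity (\int[mu]_z ((rho x)%:E * (heat_kernel c2 ((y - x) - c1 *: z) * gauss z)%:E))%E.
  apply: eq_integral => z _; rewrite -EFinM opprD addrA addrAC; congr EFin; ring.
rewrite ge0_integralZl//.
- by rewrite heat_kernel_semigroup// -EFinM mulrC.
- apply/measurable_EFinP; apply: measurable_funM; last exact: measurable_gauss.
  apply: (measurableT_comp (f := heat_kernel c2)).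
    by apply: continuous_measurable_rV; exact: continuous_heat_kernel.
  apply: measurable_subv => //.
  rewrite (_ : *:%R c1 = (fun p => c1 *: p + 0)); last by apply/funext => p; rewrite addr0.
  exact: measurable_affv.
- by move=> z _; rewrite lee_fin mulr_ge0 ?gauss_ge0// heat_kernel_ge0.
- by rewrite lee_fin.
Qed.

End semigroup.

(** * Lipschitz functions and differentiable curves *)

Section lipschitz.
Context {R : realType} (n : nat).

Lemma enorm_lipschitz_cts (F : 'rV[R]_n -> R) (C : R) :
  (forall x y, `|F x - F y| <= C * enorm (x - y)) -> continuous F.
Proof.
move=> h x; apply: continuous_at_dist => e e0.
pose D := `|C| * n%:R + 1; have D0 : 0 < D by rewrite ltr_wpDl// mulr_ge0.
apply: filterS (near_norm_le x (divr_gt0 e0 D0)) => z.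
rewrite ler_pdivlMr// => hz; apply: (le_trans (h x z)).
apply: (@le_trans _ _ (`|C| * (n%:R * `|x - z|))).
  apply: (@le_trans _ _ (`|C| * enorm (x - z))).
    by rewrite ler_wpM2r ?enorm_ge0// ler_norm.
  by rewrite ler_wpM2l// enorm_le_normr.
by apply: le_trans hz; rewrite mulrA mulrC ler_wpM2l// lerDl.
Qed.

(* Derivative at time 0 of a curve, in the Euclidean norm. *)
Definition path_derive (X : R -> 'rV[R]_n) (v : 'rV[R]_n) :=
  forall e : R, 0 < e -> exists d : R, 0 < d /\
    forall h, `|h| <= d -> enorm (X h - X 0 - h *: v) <= e * `|h|.

Lemma path_derive_lip X v : path_derive X v -> exists C d : R,
  [/\ 0 <= C, 0 < d & forall h, `|h| <= d -> enorm (X h - X 0) <= C * `|h|].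
Proof.
move=> /(_ 1 ltr01) [d [d0 h]]; exists (1 + enorm v), d; split => //.
  by rewrite addr_ge0// enorm_ge0.
move=> k /h hk; rewrite -[X k - X 0](subrK (k *: v)) (le_trans (enormD _ _))//.
by rewrite mulrDl lerD// enormZ mulrC.
Qed.

Lemma path_derive_comp (F : 'rV[R]_n -> R) (X : R -> 'rV[R]_n) v :
  differentiable F (X 0) -> path_derive X v ->
  is_derive (0 : R) (1 : R) (fun h => F (X h)) ('D_v F (X 0)).
Proof.
move=> dF dX; apply: is_derive_eps => e e0.
have [C [d1 [C0 d10 h1]]] := path_derive_lip dX.
have [d2 [d20 h2]] := differentiable_eps dF (divr_gt0 e0 (ltr_wpDl (mulr_ge0 (ler0n _ 2) C0) ltr01)).
set g := grad F (X 0).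
have [d3 [d30 h3]] := dX (e / (2 * (enorm g + 1))) ltac:(by rewrite divr_gt0// mulr_gt0// ltr_wpDl// enorm_ge0).
exists (Num.min (Num.min d1 d3) (d2 / (C + 1))); split.
  by rewrite !lt_min d10 d30 divr_gt0// ltr_wpDl.
move=> h; rewrite !le_min => /andP[/andP[hd1 hd3]]; rewrite ler_pdivlMr ?ltr_wpDl// => hd2.
rewrite add0r.
have b1 := h1 h hd1; have b3 := h3 h hd3.
set w := X h - X 0 in b1 b3.
have nw : `|w| <= C * `|h| by exact: le_trans (normr_le_enorm _) b1.
have nw2 : `|w| <= d2.
  by apply: (le_trans nw); apply: le_trans hd2; rewrite mulrC ler_wpM2l// lerDl.
have := h2 w nw2; rewrite (_ : X 0 + w = X h) => [b2|]; last by rewrite /w addrC subrK.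
have -> : F (X h) - F (X 0) - h * 'D_v F (X 0) =
   (F (X h) - F (X 0) - 'D_w F (X 0)) + dotv (w - h *: v) g.
  by rewrite !derive_grad// -/g dotvDl dotvNl dotvZl; ring.
apply: (le_trans (ler_normD _ _)).
have -> : e * `|h| = e / 2 * `|h| + e / 2 * `|h| by lra.
apply: lerD.
  apply: (le_trans b2).
  apply: (@le_trans _ _ (e / (2 * C + 1) * (C * `|h|))).
    by rewrite ler_wpM2l// divr_ge0 ?ltW// ltr_wpDl// mulr_ge0.
  rewrite mulrA ler_wpM2r// mulrAC ler_pdivrMr; last by rewrite ltr_wpDl// mulr_ge0.
  rewrite (_ : e / 2 * (2 * C + 1) = e * C + e / 2); last by lra.
  by rewrite lerDl divr_ge0// ltW.
apply: (le_trans (normr_dotv _ _)).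
apply: (@le_trans _ _ (e / (2 * (enorm g + 1)) * `|h| * enorm g)).
  by rewrite ler_wpM2r// enorm_ge0.
rewrite mulrAC ler_wpM2r//.
have g0 := enorm_ge0 g.
rewrite mulrAC ler_pdivrMr; last by rewrite mulr_gt0// ltr_wpDl.
nra.
Qed.

Lemma derive_le_lipschitz (F : 'rV[R]_n -> R) x (C : R) : differentiable F x ->
  (forall v, `|F (x + v) - F x| <= C * enorm v) -> forall v, `|'D_v F x| <= C * enorm v.
Proof.
move=> dF h v.
have hv : path_derive (fun t => x + t *: v) v.
  move=> e e0; exists 1; split => // t _; rewrite scale0r addr0.
  rewrite (_ : _ - _ - _ = 0); first by rewrite enorm0 mulr_ge0// ltW.
  by apply/rowP => i; rewrite !mxE; ring.
have dF' : differentiable F ((fun t : R => x + t *: v) 0) by rewrite scale0r addr0.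
have D := path_derive_comp dF' hv; rewrite /= scale0r addr0 in D.
have ch : (k.+1%:R^-1 : R) @[k --> \oo] --> 0 by exact: cvg_harmonic.
have u0 k : (k.+1%:R^-1 : R) != 0 by rewrite invr_neq0// pnatr_eq0.
have L := cvg_diff_quotient D u0 ch.
have c1 : `|(F (x + (0 + k.+1%:R^-1) *: v) - F (x + 0 *: v)) / k.+1%:R^-1| @[k --> \oo] --> `|'D_v F x|.
  by apply: cvg_norm; exact: L.
rewrite -(cvg_lim (@Rhausdorff R) c1); apply: limr_le; first by apply/cvg_ex; eexists; exact: c1.
apply: nearW => k; rewrite scale0r addr0 add0r normrM normfV.
have k0 : 0 < `|k.+1%:R^-1 : R| by rewrite normr_gt0 invr_neq0// pnatr_eq0.
rewrite ler_pdivrMr// (le_trans (h _))// enormZ mulrCA mulrC //.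
Qed.

End lipschitz.

(** * The potential, its gradient and its proximal points *)

Section potential.
Context {R : realType} (n : nat) (f : 'rV[R]_n -> R) (L M : R).
Hypotheses (L0 : 0 <= L) (M0 : 0 <= M) (hf : LM_smooth f L M).
Implicit Types (x y v w : 'rV[R]_n).

Let hf1 x : [/\ differentiable f x, differentiable (grad f) x & differentiable (hess f) x].
Proof. by case: hf. Qed.

Lemma f_diff x : differentiable f x. Proof. by case: (hf1 x). Qed.

Lemma partial_diff i x : differentiable (partial i f) x.
Proof.
have [_ dg _] := hf1 x.
have -> : partial i f = (fun N : 'rV[R]_n => N ord0 i) \o grad f.
  by apply/funext => y; rewrite /= mxE.
exact: differentiable_comp dg (differentiable_coord _ _ _).
Qed.

(** In [hess] the component of the gradient is the row index; after transposition [v *m hesT x] is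
    the derivative of the gradient along [v] ([grad_jac]). *)
Definition hesT x : 'M[R]_n := (hess f x)^T.

Lemma hess_diff i j x : differentiable (fun x => hess f x i j) x.
Proof.
have [_ _ dh] := hf1 x.
exact: (differentiable_comp dh (differentiable_coord _ _ _)).
Qed.

Lemma hesT_bound x : opbound (hesT x) L.
Proof.
apply: opbound_trmx => // v; rewrite enorm_leP ?mulr_ge0 ?enorm_ge0//.
by rewrite exprMn sqr_enorm; case: hf.
Qed.

Lemma hesT_lip x y : opbound (hesT x - hesT y) (M * enorm (x - y)).
Proof.
have -> : hesT x - hesT y = (hess f x - hess f y)^T by rewrite raddfB.
apply: opbound_trmx; first by rewrite mulr_ge0 ?enorm_ge0.
move=> v; rewrite enorm_leP ?mulr_ge0 ?enorm_ge0//.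
by rewrite !exprMn !sqr_enorm; case: hf.
Qed.

Lemma hesT_cts i j : continuous (fun x => hesT x i j).
Proof.
apply: (@enorm_lipschitz_cts _ _ _ M) => x y.
by have := opbound_entry i j (hesT_lip x y); rewrite [X in `|X|]mxE [X in `|_ + X|]mxE.
Qed.

Lemma grad_jac x : has_jac (grad f) x (hesT x).
Proof.
move=> e e0; have [_ dg _] := hf1 x.
have [d [d0 hd]] := differentiable_eps dg e0; exists d; split => // v vd.
suff <- : 'D_v (grad f) x = v *m hesT x by exact: hd.
apply/rowP => i.
have -> : ('D_v (grad f) x) ord0 i = 'D_v (partial i f) x.
  have pE : partial i f = (fun N : 'rV[R]_n => N ord0 i) \o grad f.
    by apply/funext => y; rewrite /= mxE.
  rewrite (deriveE _ (partial_diff i x)) pE diff_comp//; last exact: differentiable_coord.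
  rewrite (deriveE _ dg) /=; set w := 'd _ _ _.
  have := (differentiable_proj i (grad f x)).2 w.
  by rewrite deriveE; [move=> ->|exact: differentiable_coord].
rewrite derive_grad; last exact: partial_diff.
by rewrite mxE /dotv; apply: eq_bigr => j _; rewrite !mxE.
Qed.

Lemma dot_grad_diff u x : differentiable (fun y => dotv u (grad f y)) x /\
  forall v, 'D_v (fun y => dotv u (grad f y)) x = dotv (v *m hesT x) u.
Proof.
have [H1 H2] : differentiable (fun y => dotv u (grad f y)) x /\
    forall v, 'D_v (fun y => dotv u (grad f y)) x = dotv v (u *m (hesT x)^T).
  apply: eps_differentiable => e e0.
  pose D := enorm u * n%:R + 1.
  have D0 : 0 < D by rewrite ltr_wpDl// mulr_ge0// enorm_ge0.
  have [d [d0 hd]] := grad_jac x (divr_gt0 e0 D0).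
  exists d; split => // v /hd hv.
  rewrite (_ : _ - _ - _ = dotv u (grad f (x + v) - grad f x - v *m hesT x)); last first.
    by rewrite !dotvDr !dotvNr -dotv_trmx (dotvC (v *m _)).
  apply: (le_trans (normr_dotv _ _)); apply: (@le_trans _ _ (enorm u * (n%:R * (e / D * `|v|)))).
    rewrite ler_wpM2l ?enorm_ge0//; apply: (le_trans (enorm_le_normr _)).
    by rewrite ler_wpM2l.
  rewrite (_ : _ * _ = (enorm u * n%:R) / D * (e * `|v|)); last by ring.
  by rewrite ler_piMl ?mulr_ge0 ?(ltW e0)// ler_pdivrMr// mul1r lerDl.
by split => // v; rewrite H2 -dotv_trmx.
Qed.

(** The scalar mean value theorem for the pairing of [grad f] with [u], where [u] is the gradient
    increment itself; one factor [|u|] then cancels. *)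
Lemma grad_lip x y : enorm (grad f x - grad f y) <= L * enorm (x - y).
Proof.
set u := grad f x - grad f y.
have [u0|uN] := eqVneq (enorm u) 0; first by rewrite u0 mulr_ge0 ?enorm_ge0.
have ugt : 0 < enorm u by rewrite lt_neqAle eq_sym uN enorm_ge0.
have [t [_ _]] := MVT_rV y (x - y) (fun z => (dot_grad_diff u z).1).
rewrite (_ : y + (x - y) = x); last by rewrite addrC subrK.
move=> E.
have : enorm u ^+ 2 <= L * enorm (x - y) * enorm u.
  rewrite sqr_enorm -dotvv {2}/u dotvDr dotvNr E.
  rewrite -derive_grad; last by case: (dot_grad_diff u (y + t *: (x - y))).
  rewrite (dot_grad_diff _ _).2 (le_trans (dotv_le _ _))// ler_wpM2r ?enorm_ge0//.
  exact: hesT_bound.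
by rewrite expr2 ler_pM2r.
Qed.

Lemma f_taylor x v : `|f (x + v) - f x - dotv v (grad f x)| <= L * sqnorm v.
Proof.
have [t [t0 t1 ->]] := MVT_rV x v f_diff.
rewrite -dotvNr -dotvDr (le_trans (normr_dotv _ _))//.
rewrite -sqr_enorm expr2 mulrCA ler_wpM2l ?enorm_ge0//.
apply: (le_trans (grad_lip _ _)); rewrite addrC addKr enormZ ger0_norm//.
by rewrite mulrCA ler_piMl// mulr_ge0 ?enorm_ge0.
Qed.

Lemma grad_growth x : enorm (grad f x) <= enorm (grad f 0) + L * enorm x.
Proof.
rewrite -[grad f x](subrK (grad f 0)) addrC (le_trans (enormD _ _))// lerD2l.
by apply: (le_trans (grad_lip _ _)); rewrite subr0.
Qed.

Lemma grad_coord_cts i : continuous (fun x => grad f x ord0 i).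
Proof.
apply: (@enorm_lipschitz_cts _ _ _ L) => x y; apply: le_trans (grad_lip x y).
by apply: le_trans (coord_le_enorm _ i); rewrite rV_coordB.
Qed.

Lemma f_cts : continuous f. Proof. exact: differentiable_cts f_diff. Qed.

Lemma f_growth : exists C, 0 <= C /\ forall x, `|f x| <= C * quad x.
Proof.
exists (`|f 0| + enorm (grad f 0) + L); split; first by rewrite !addr_ge0 ?enorm_ge0.
move=> x; have := f_taylor 0 x; rewrite add0r => h.
have := normr_dotv x (grad f 0).
have e0 := enorm_ge0 x; have g0 := enorm_ge0 (grad f 0).
have hx : enorm x <= quad x.
  by rewrite /quad -sqr_enorm; have := sqr_ge0 (enorm x - 1); nra.
have h1 : enorm x * enorm (grad f 0) <= enorm (grad f 0) * quad x.
  by rewrite mulrC ler_wpM2l.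
have h2 : L * sqnorm x <= L * quad x by rewrite ler_wpM2l// lerDr.
have h3 : `|f 0| <= `|f 0| * quad x by rewrite ler_peMr// quad_ge1.
move=> h4; rewrite -[f x](subrK (f 0)) -[f x - f 0](subrK (dotv x (grad f 0))).
apply: (le_trans (ler_normD _ _)); apply: (le_trans (lerD (ler_normD _ _) (lexx _))).
rewrite !mulrDl; lra.
Qed.

(** With [g] the defect in the equation, compare the minimiser with [p - s g]: the objective changes
    by [- s |g|^2 / eps] up to [O(s^2) |g|^2], and [s = 1 / D] forces [g = 0]. *)
Lemma prox_stationary (eps : R) (y p : 'rV[R]_n) : 0 < eps ->
  (forall x, f p + sqnorm (p - y) / (2 * eps) <= f x + sqnorm (x - y) / (2 * eps)) ->
  p + eps *: grad f p = y.
Proof.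
move=> e0 hp; pose g := eps *: grad f p + (p - y).
suff : g = 0 by rewrite /g => /eqP; rewrite addrA subr_eq0 addrC => /eqP.
pose D := 2 * (L * eps) + 1; have D0 : 0 < D by rewrite ltr_wpDl// mulr_ge0// mulr_ge0// ltW.
have H s : 0 <= s -> s * (2 * sqnorm g) <= s ^+ 2 * (D * sqnorm g).
  move=> s0; have := hp (p + (- s) *: g); have := f_taylor p (- s *: g).
  rewrite ler_norml => /andP[_ h1] h2.
  have h3 : sqnorm (p + - s *: g - y) = sqnorm (p - y) - 2 * s * dotv (p - y) g + s ^+ 2 * sqnorm g.
    rewrite (_ : p + - s *: g - y = (p - y) + - s *: g); last by rewrite addrAC.
    by rewrite sqnormD sqnormZ dotvZr sqrrN; ring.
  move: h1 h2; rewrite h3 sqnormZ sqrrN dotvZl => h1 h2.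
  have h4 : 0 <= - s * dotv g (grad f p) + L * (s ^+ 2 * sqnorm g) +
      (- 2 * s * dotv (p - y) g + s ^+ 2 * sqnorm g) / (2 * eps) by lra.
  have h5 : 0 <= 2 * eps * (- s * dotv g (grad f p) + L * (s ^+ 2 * sqnorm g) +
      (- 2 * s * dotv (p - y) g + s ^+ 2 * sqnorm g) / (2 * eps)).
    by rewrite mulr_ge0// mulr_ge0// ltW.
  have : sqnorm g = eps * dotv g (grad f p) + dotv (p - y) g.
    by rewrite -dotvv {2}/g dotvDr dotvZr (dotvC g (p - y)).
  move=> gE; move: h5.
  have -> : forall a b, 2 * eps * (a + b / (2 * eps)) = 2 * eps * a + b.
    by move=> a b; field; rewrite gt_eqF.
  rewrite /D; set G := sqnorm g in gE *; set a := dotv g _ in gE *; set b := dotv _ g in gE *.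
  move=> h5; have -> : s * (2 * G) = 2 * s * (eps * a + b) by rewrite -gE; ring.
  lra.
have := H (D^-1) (ltW _); rewrite invr_gt0 => /(_ D0).
rewrite (_ : D^-1 ^+ 2 * (D * sqnorm g) = D^-1 * sqnorm g); last by field; rewrite gt_eqF.
rewrite ler_pM2l ?invr_gt0// => h; apply: sqnorm_eq0; have := sqnorm_ge0 g; lra.
Qed.

Lemma prox_exists (t : R) y : 0 <= t -> t * L <= 4^-1 -> exists x, x + t *: grad f x = y.
Proof.
rewrite le_eqVlt => /predU1P[<- _|t0 tL]; first by exists y; rewrite scale0r addr0.
pose g x := f x + sqnorm (x - y) / (2 * t).
pose G := enorm (grad f y); have G0 : 0 <= G by exact: enorm_ge0.
(* Beyond this radius half of the quadratic penalty beats the gradient at [y], and the other half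
   beats the curvature because [t L <= 1/4]. The minimum over the ball is therefore global. *)
pose r := 4 * t * G.
have r0 : 0 <= r by rewrite mulr_ge0// mulr_ge0// ltW.
pose A := [set x : 'rV[R]_n | enorm (x - y) <= r].
have cg : continuous g.
  apply: ctsD; first exact: f_cts.
  apply: ctsM; last exact: ctsC.
  have -> : (fun x : 'rV[R]_n => sqnorm (x - y)) = (fun x => sqnorm (y - x)).
    by apply/funext => x; rewrite -sqnormN opprB.
  by apply: continuous_comp_rsub; exact: continuous_sqnorm.
have big x : r < enorm (x - y) -> g y <= g x.
  move=> hr; have := f_taylor y (x - y); rewrite (_ : y + (x - y) = x) ?ler_norml; last by rewrite addrC subrK.
  move=> /andP[h1 _].
  have := normr_dotv (x - y) (grad f y); rewrite ler_norml => /andP[h2 _].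
  rewrite /g subrr sqnorm0 mul0r addr0.
  rewrite -sqr_enorm in h1 *; set e := enorm (x - y) in hr h1 h2 *.
  have e0 : 0 <= e by exact: enorm_ge0.
  have it : t^-1 * t = 1 by rewrite mulVf// gt_eqF.
  have it0 : 0 < t^-1 by rewrite invr_gt0.
  have k1 : e * G <= e ^+ 2 / (4 * t).
    rewrite ler_pdivlMr ?mulr_gt0// expr2 -mulrA ler_wpM2l//.
    by move: hr; rewrite /r; lra.
  have k2 : L * e ^+ 2 <= e ^+ 2 / (4 * t).
    rewrite ler_pdivlMr ?mulr_gt0// mulrAC ler_piMl ?sqr_ge0//; lra.
  have k3 : e ^+ 2 / (2 * t) = e ^+ 2 / (4 * t) + e ^+ 2 / (4 * t) by field; rewrite gt_eqF.
  move: h1 h2; rewrite -/G => h1 h2; rewrite k3; lra.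
have cA : compact A.
  apply: bounded_closed_compact.
    exists (enorm y + r); split; first exact: num_real.
    move=> m hm x /= hx; apply: (le_trans (normr_le_enorm _)); apply: (le_trans _ (ltW hm)).
    by rewrite -[x](subrK y) addrC (le_trans (enormD _ _))// lerD2l.
  have -> : A = (fun x => sqnorm (y - x)) @^-1` [set s | s <= r ^+ 2].
    by apply/seteqP; split => x /=; rewrite /A /= enorm_leP// -sqnormN opprB.
  apply: preimage_closed; last exact: closed_le.
  by move=> ? _; apply: continuous_comp_rsub; exact: continuous_sqnorm.
have [x Ax hx] : exists2 x, x \in A & forall z, z \in A -> g x <= g z.
  apply: EVT_min_rV => //.
    by exists y; rewrite /A /= subrr enorm0.
  exact: continuous_subspaceT.
exists x; apply: prox_stationary => // z; rewrite -/(g x) -/(g z).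
have [hz|hz] := leP (enorm (z - y)) r; first by apply: hx; rewrite inE.
apply: le_trans (big z hz); apply: hx; by rewrite inE /A /= subrr enorm0.
Qed.

End potential.

Lemma is_derive_affine_sub {R : realType} (F : R -> R) (t l a b : R) :
  is_derive t (1 : R) F l ->
  is_derive t (1 : R) (fun s => F s - s * a - s ^+ 2 * b) (l - a - 2 * t * b).
Proof.
move=> D.
have D2 : is_derive t (1 : R) (fun s : R => s * a + s ^+ 2 * b) (a + 2 * t * b).
  by apply: is_derive_eq; rewrite /GRing.scale /=; ring.
rewrite (_ : (fun s => _) = F - (fun s : R => s * a + s ^+ 2 * b)); last first.
  by apply/funext => s; rewrite !fctE; ring.
by rewrite -addrA -opprD; exact: is_deriveB.
Qed.

(** * Taylor bounds for the potential and its gradient *)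

Section sharp_taylor.
Context {R : realType} (n : nat) (f : 'rV[R]_n -> R) (L M : R).
Hypotheses (L0 : 0 <= L) (M0 : 0 <= M) (hf : LM_smooth f L M).
Implicit Types (x y v w : 'rV[R]_n).

(** The mean value theorem is applied after subtracting the parabola, which keeps the factor 1/2
    that the direct estimate in [f_taylor] loses. *)
Lemma f_upper x v : f (x + v) <= f x + dotv v (grad f x) + L / 2 * sqnorm v.
Proof.
pose a := dotv v (grad f x); pose b := L / 2 * sqnorm v.
pose g (t : R) := f (x + t *: v) - t * a - t ^+ 2 * b.
pose g' (t : R) := dotv v (grad f (x + t *: v)) - a - 2 * t * b.
have dg t : is_derive t (1 : R) g (g' t).
  by apply: is_derive_affine_sub; apply: is_derive_line; exact: f_diff hf _.
have [|t] := @MVT R g g' 0 1 ltr01.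
  apply: continuous_subspaceT => t; apply: differentiable_continuous.
  by apply/derivable1_diffP; case: (dg t).
rewrite in_itv /= => /andP[t0 t1].
rewrite /g scale1r scale0r addr0 subr0 mulr1 mul0r expr0n /= mul0r !subr0 expr1n !mul1r => E.
suff : g' t <= 0 by rewrite -E /a /b; lra.
rewrite /g' /a /b.
have -> : dotv v (grad f (x + t *: v)) = dotv v (grad f x) + dotv v (grad f (x + t *: v) - grad f x).
  by rewrite dotvDr dotvNr; ring.
have h : dotv v (grad f (x + t *: v) - grad f x) <= t * (L * sqnorm v).
  apply: (le_trans (dotv_le _ _)).
  rewrite -sqr_enorm expr2 (_ : t * _ = enorm v * (L * (t * enorm v))); last by ring.
  rewrite ler_wpM2l ?enorm_ge0//; apply: (le_trans (grad_lip L0 hf _ _)).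
  by rewrite addrC addKr enormZ ger0_norm// ltW.
lra.
Qed.

Lemma f_lower x v : f x + dotv v (grad f x) - L / 2 * sqnorm v <= f (x + v).
Proof.
have := f_upper (x + v) (- v); rewrite addrK sqnormN dotvNl.
pose a := dotv v (grad f x); pose b := L / 2 * sqnorm v.
pose g (t : R) := f (x + t *: v) - t * a - t ^+ 2 * (- b).
pose g' (t : R) := dotv v (grad f (x + t *: v)) - a - 2 * t * (- b).
have dg t : is_derive t (1 : R) g (g' t).
  by apply: is_derive_affine_sub; apply: is_derive_line; exact: f_diff hf _.
have [|t] := @MVT R g g' 0 1 ltr01.
  apply: continuous_subspaceT => t; apply: differentiable_continuous.
  by apply/derivable1_diffP; case: (dg t).
rewrite in_itv /= => /andP[t0 t1].
rewrite /g scale1r scale0r addr0 subr0 mulr1 mul0r expr0n /= mul0r !subr0 expr1n !mul1r => E _.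
suff : 0 <= g' t by rewrite -E /a /b; lra.
rewrite /g' /a /b.
have -> : dotv v (grad f (x + t *: v)) = dotv v (grad f x) - dotv (- v) (grad f (x + t *: v) - grad f x).
  by rewrite dotvNl dotvDr dotvNr; ring.
have h : dotv (- v) (grad f (x + t *: v) - grad f x) <= t * (L * sqnorm v).
  apply: (le_trans (dotv_le _ _)); rewrite enormN.
  rewrite -sqr_enorm expr2 (_ : t * _ = enorm v * (L * (t * enorm v))); last by ring.
  rewrite ler_wpM2l ?enorm_ge0//; apply: (le_trans (grad_lip L0 hf _ _)).
  by rewrite addrC addKr enormZ ger0_norm// ltW.
lra.
Qed.

Lemma grad_taylor x v : enorm (grad f (x + v) - grad f x - v *m hesT f x) <= M * sqnorm v.
Proof.
set u := _ - _ - _.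
have [u0|uN] := eqVneq (enorm u) 0; first by rewrite u0 mulr_ge0 ?sqnorm_ge0.
have ugt : 0 < enorm u by rewrite lt_neqAle eq_sym uN enorm_ge0.
have [t [t0 t1 E]] := MVT_rV x v (fun z => (dot_grad_diff hf u z).1).
have : enorm u ^+ 2 <= M * sqnorm v * enorm u.
  rewrite sqr_enorm -dotvv {2}/u !dotvDr !dotvNr E.
  rewrite -derive_grad; last by case: (dot_grad_diff hf u (x + t *: v)).
  rewrite (dot_grad_diff hf _ _).2 (dotvC u (v *m _)) -dotvNl -dotvDl -mulmxN -mulmxDr.
  apply: (le_trans (dotv_le _ _)); rewrite ler_wpM2r ?enorm_ge0//.
  apply: (le_trans (hesT_lip M0 hf _ _ _)); rewrite addrC addKr enormZ ger0_norm//.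
  rewrite -mulrA ler_wpM2l// -mulrA -expr2 sqr_enorm ler_piMl// sqnorm_ge0//.
by rewrite expr2 ler_pM2r.
Qed.

End sharp_taylor.

(** * The proximal map and its derivative *)

Section prox_map.
Context {R : realType} (n : nat) (f : 'rV[R]_n -> R) (L M : R).
Hypotheses (L0 : 0 <= L) (M0 : 0 <= M) (hf : LM_smooth f L M).
Implicit Types (x y v w : 'rV[R]_n) (t s : R).

(** [4 / 3] is [1 / (1 - t L)] at [t L = 1/4]. Step size and datum vary together because the
    interpolation moves both. *)
Lemma prox_lip t s x x' y y' : 0 <= t -> t * L <= 4^-1 ->
  x + t *: grad f x = y -> x' + s *: grad f x' = y' ->
  enorm (x - x') <= 4 / 3 * (enorm (y - y') + `|t - s| * enorm (grad f x')).
Proof.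
move=> t0 tL <- <-.
have E : x - x' = (x + t *: grad f x - (x' + s *: grad f x')) -
    t *: (grad f x - grad f x') - (t - s) *: grad f x'.
  by apply/rowP => i; rewrite !mxE; ring.
set d := x + _ - _ in E *.
have : enorm (x - x') <= enorm d + t * (L * enorm (x - x')) + `|t - s| * enorm (grad f x').
  rewrite {1}E; apply: (le_trans (enormB _ _)); rewrite enormZ lerD2r.
  apply: (le_trans (enormB _ _)); rewrite enormZ ger0_norm// lerD2l ler_wpM2l//.
  exact: grad_lip L0 hf _ _.
have e0 := enorm_ge0 (x - x').
have : t * (L * enorm (x - x')) <= 4^-1 * enorm (x - x') by rewrite mulrA ler_wpM2r.
lra.
Qed.

Lemma prox_unique t x x' : 0 <= t -> t * L <= 4^-1 ->
  x + t *: grad f x = x' + t *: grad f x' -> x = x'.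
Proof.
move=> t0 tL E; have := @prox_lip t t x x' _ _ t0 tL E erefl.
rewrite !subrr enorm0 normr0 mul0r addr0 mulr0 => h.
have := enorm_ge0 (x - x') => h'.
by apply/eqP; rewrite -subr_eq0; apply/eqP; apply: enorm_eq0; apply/eqP; rewrite eq_le h h'.
Qed.

(** Selected by its stationarity equation. For [0 <= t] and [t L <= 1/4] a solution exists
    ([prox_exists]), so the default value 0 plays no part there. *)
Definition prox_map t y : 'rV[R]_n := xget 0 [set x | x + t *: grad f x = y].

Lemma prox_mapP t y : 0 <= t -> t * L <= 4^-1 ->
  prox_map t y + t *: grad f (prox_map t y) = y.
Proof.
by move=> t0 tL; have [x hx] := prox_exists L0 hf y t0 tL; 
have : [set x | x + t *: grad f x = y] (prox_map t y) by apply: xgetPex; exists x.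
Qed.

Lemma prox_mapE t x : 0 <= t -> t * L <= 4^-1 -> prox_map t (x + t *: grad f x) = x.
Proof. by move=> t0 tL; apply: (prox_unique t0 tL); exact: prox_mapP. Qed.

Lemma prox_map_lip t s y y' : 0 <= t -> t * L <= 4^-1 -> 0 <= s -> s * L <= 4^-1 ->
  enorm (prox_map t y - prox_map s y') <=
  4 / 3 * (enorm (y - y') + `|t - s| * enorm (grad f (prox_map s y'))).
Proof. by move=> *; apply: prox_lip => //; exact: prox_mapP. Qed.

Lemma prox_map_growth t y : 0 <= t -> t * L <= 4^-1 ->
  enorm (prox_map t y) <= 4 / 3 * (enorm y + t * enorm (grad f 0)).
Proof.
move=> t0 tL; have := @prox_lip t t (prox_map t y) 0 y (0 + t *: grad f 0) t0 tL (prox_mapP y t0 tL) erefl.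
rewrite subr0 subrr normr0 mul0r addr0 add0r => /le_trans; apply.
by rewrite ler_wpM2l// (le_trans (enormB _ _))// enormZ ger0_norm.
Qed.

Lemma continuous_prox_map t i : 0 <= t -> t * L <= 4^-1 ->
  continuous (fun y => prox_map t y ord0 i).
Proof.
move=> t0 tL; apply: (@enorm_lipschitz_cts _ _ _ (4 / 3)) => x y.
rewrite -rV_coordB (le_trans (coord_le_enorm _ _))// (le_trans (prox_map_lip _ _ _ _ _ _))//.
by rewrite subrr normr0 mul0r addr0.
Qed.

Lemma cts_prox_map t (F : 'rV[R]_n -> R) : 0 <= t -> t * L <= 4^-1 -> continuous F ->
  continuous (fun y => F (prox_map t y)).
Proof.
move=> t0 tL cF; apply: (@cts_comp _ _ _ (prox_map t) F) => //.
by apply: continuous_rVP => i; exact: continuous_prox_map.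
Qed.

Definition jacA t x : 'M[R]_n := 1%:M + t *: hesT f x.

Lemma opbound_thes t x : 0 <= t -> opbound (t *: hesT f x) (t * L).
Proof. by move=> t0; have := opboundZ t (hesT_bound L0 hf x); rewrite ger0_norm. Qed.

Lemma jacA_unit t x : 0 <= t -> t * L <= 4^-1 -> jacA t x \in unitmx.
Proof.
move=> t0 tL; apply: (@unitmx_1D _ _ _ (t * L)); [exact: mulr_ge0| lra|exact: opbound_thes].
Qed.

Lemma jacA_inv_bound t x : 0 <= t -> t * L <= 8^-1 -> opbound (invmx (jacA t x)) (8 / 7).
Proof.
move=> t0 tL; apply: (@opbound_le _ _ _ (1 - t * L)^-1).
  apply: opbound_inv_1D; [exact: mulr_ge0| lra|exact: opbound_thes].
have h : 0 < 1 - t * L by lra.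
by rewrite -[leLHS]mul1r ler_pdivrMr//; lra.
Qed.

(* Implicit differentiation of [x + t grad f x = y] along a moving [(t, y)]. *)
Lemma prox_map_path t (a : R) (Y : R -> 'rV[R]_n) v : 0 < t -> t * L <= 8^-1 ->
  path_derive Y v ->
  path_derive (fun h => prox_map (t + a * h) (Y h))
    ((v - a *: grad f (prox_map t (Y 0))) *m invmx (jacA t (prox_map t (Y 0)))).
Proof.
move=> t0 tL dY e e0.
have t0' := ltW t0; have tL4 : t * L <= 4^-1 by lra.
pose X h := prox_map (t + a * h) (Y h).
have X0 : X 0 = prox_map t (Y 0) by rewrite /X mulr0 addr0.
rewrite -X0; set x := X 0; set p := grad f x; set A := jacA t x.
have uA : A \in unitmx by exact: jacA_unit.
have [C [d1 [C0 d10 h1]]] := path_derive_lip dY.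
pose D := 4 / 3 * (C + `|a| * enorm p).
have D0 : 0 <= D by rewrite mulr_ge0// addr_ge0// mulr_ge0// enorm_ge0.
pose E := t * (M * D ^+ 2) + `|a| * (L * D).
have E0 : 0 <= E by rewrite addr_ge0// mulr_ge0// mulr_ge0// sqr_ge0.
have [d2 [d20 h2]] := dY (e / 4) ltac:(by rewrite divr_gt0).
pose d3 := Num.min t (8^-1 / (L + 1)) / (`|a| + 1).
have d30 : 0 < d3 by rewrite divr_gt0 ?ltr_wpDl// lt_min t0 divr_gt0// ltr_wpDl.
pose d4 := e / 4 / (E + 1).
have d40 : 0 < d4 by rewrite !divr_gt0// ltr_wpDl.
exists (Num.min (Num.min d1 d2) (Num.min d3 d4)); split; first by rewrite !lt_min d10 d20 d30 d40.
move=> h; rewrite !le_min => /andP[/andP[hd1 hd2] /andP[hd3 hd4]].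
have ah : `|a * h| <= Num.min t (8^-1 / (L + 1)).
  rewrite normrM; move: hd3; rewrite /d3 ler_pdivlMr ?ltr_wpDl// => hd3.
  by apply: le_trans hd3; rewrite mulrC ler_wpM2l// lerDl.
move: ah; rewrite le_min => /andP[ah1]; rewrite ler_pdivlMr ?ltr_wpDl// => ah2.
have s0 : 0 <= t + a * h by move: ah1; rewrite ler_norml; lra.
have sL : (t + a * h) * L <= 4^-1.
  have : a * h * L <= `|a * h| * (L + 1).
    apply: (@le_trans _ _ (`|a * h| * L)); first by rewrite ler_wpM2r// ler_norm.
    by rewrite ler_wpM2l// lerDl.
  rewrite mulrDl; lra.
have eX := prox_mapP (Y h) s0 sL; have eX0 := prox_mapP (Y 0) t0' tL4.
rewrite -/(X h) in eX; rewrite -X0 -/x in eX0.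
pose del := X h - x.
have bdel : enorm del <= D * `|h|.
  apply: (le_trans (prox_lip s0 sL eX eX0)).
  rewrite -[X in _ <= X]mulrA ler_wpM2l// mulrDl lerD ?h1//.
  by rewrite addrAC subrr add0r normrM mulrAC.
have Xh : X h = x + del by rewrite /del addrC subrK.
pose r := grad f (x + del) - p - del *m hesT f x.
have br : enorm r <= M * (D * `|h|) ^+ 2.
  apply: (le_trans (grad_taylor M0 hf _ _)); rewrite ler_wpM2l// -sqr_enorm.
  by rewrite ler_pXn2r ?nnegrE ?enorm_ge0// mulr_ge0.
pose q := grad f (x + del) - p.
have bq : enorm q <= L * (D * `|h|).
  apply: (le_trans (grad_lip L0 hf _ _)); rewrite addrC addKr ler_wpM2l//.
(* Difference of the two stationarity equations. [r] is the Taylor remainder of the gradient and [q]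
   its increment, which meets the change of step size; both contributions are quadratic in [h]. *)
have key : del *m A - h *: (v - a *: p) = (Y h - Y 0 - h *: v) - t *: r - (a * h) *: q.
  rewrite -eX -eX0 Xh /A /jacA mulmxDr mulmx1 -scalemxAr /r /q -/p.
  set w := del *m _; set g := grad f _.
  by apply/rowP => i; rewrite !mxE; ring.
have -> : X h - x - h *: ((v - a *: p) *m invmx A) =
    ((Y h - Y 0 - h *: v) - t *: r - (a * h) *: q) *m invmx A.
  by rewrite -key [RHS]mulmxBl mulmxK// -scalemxAl.
apply: (le_trans (jacA_inv_bound x t0' tL _)).
have b1 : enorm (Y h - Y 0 - h *: v - t *: r - (a * h) *: q) <= e / 4 * `|h| + E * `|h| ^+ 2.
  apply: (le_trans (enormB _ _)); apply: (le_trans (lerD (enormB _ _) (lexx _))).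
  rewrite !enormZ (ger0_norm t0') normrM -addrA lerD ?h2//.
  have k1 : t * enorm r <= t * (M * (D * `|h|) ^+ 2) by rewrite ler_wpM2l.
  have k2 : `|a| * `|h| * enorm q <= `|a| * `|h| * (L * (D * `|h|)) by rewrite ler_wpM2l// mulr_ge0.
  apply: (le_trans (lerD k1 k2)); rewrite /E le_eqVlt; apply/orP; left; apply/eqP; ring.
have b2 : E * `|h| ^+ 2 <= e / 4 * `|h|.
  rewrite expr2 mulrA ler_wpM2r// mulrC; move: hd4; rewrite /d4 ler_pdivlMr ?ltr_wpDl//.
  by apply: le_trans; rewrite ler_wpM2l// lerDl.
have eh : 0 <= e * `|h| by rewrite mulr_ge0// ltW.
apply: (@le_trans _ _ (8 / 7 * (e / 4 * `|h| + e / 4 * `|h|))); last lra.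
by rewrite ler_wpM2l// (le_trans b1)// lerD2l.
Qed.

End prox_map.

Section derivative_tools.
Context {R : realType}.

Lemma is_derive_shifted_cubic (F1 F2 F3 : R -> R) (t l1 l2 l3 c : R) :
  is_derive (0 : R) (1 : R) F1 l1 -> is_derive (0 : R) (1 : R) F2 l2 ->
  is_derive (0 : R) (1 : R) F3 l3 ->
  is_derive (0 : R) (1 : R)
    (fun h => F1 h + ((t + h) * F2 h - (t + h) ^+ 2 / 2 * F3 h + c * (t + h) ^+ 3))
    (l1 + (t * l2 + F2 0 - t ^+ 2 / 2 * l3 - t * F3 0 + 3 * c * t ^+ 2)).
Proof.
move=> D1 D2 D3.
have D0 : is_derive (0 : R) (1 : R) (fun h : R => t + h) 1.
  apply: is_derive_eps => e e0; exists 1; split => // h _.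
  rewrite (_ : t + (0 + h) - (t + 0) - h * 1 = 0); last by ring.
  by rewrite normr0 mulr_ge0// ltW.
have P1 := is_deriveM D0 D2.
have P0 := is_deriveM D0 D0.
have P2 := is_deriveM P0 D3.
have P3 := is_deriveM P0 D0.
have Q := is_deriveD (is_deriveD D1 (is_deriveB P1 (is_deriveZ 2^-1 P2))) (is_deriveZ c P3).
rewrite (_ : (fun h => _) = (F1 + ((fun h : R => t + h) * F2 - 2^-1 *: ((fun h : R => t + h) * (fun h : R => t + h) * F3)))
   + c *: ((fun h : R => t + h) * (fun h : R => t + h) * (fun h : R => t + h))); last first.
  apply/funext => h; rewrite !fctE /GRing.scale /=; ring.
apply: is_derive_eq Q _; rewrite !fctE /GRing.scale /= !addr0; lra.
Qed.

(** Serves the gradients of [trh] and [trh2], which need not be continuous: a partial derivative is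
    a limit of difference quotients along [1 / (k + 1)]. *)
Lemma measurable_partial n (F : 'rV[R]_n -> R) i : (forall x, differentiable F x) ->
  measurable_fun setT (partial i F).
Proof.
move=> dF.
have cF := differentiable_cts dF.
pose u k : R := k.+1%:R^-1.
have u0 k : u k != 0 by rewrite invr_neq0// pnatr_eq0.
have cu : u k @[k --> \oo] --> 0 by exact: cvg_harmonic.
have mq k : measurable_fun setT (fun x : 'rV[R]_n => (F (x + u k *: evec R i) - F x) / u k).
  apply: measurable_funM => //; apply: measurable_funB; last exact: continuous_measurable_rV.
  apply: (measurableT_comp (continuous_measurable_rV cF)).
  rewrite (_ : (fun x => _) = (fun x => 1 *: x + u k *: evec R i)); last first.
    by apply/funext => x; rewrite scale1r.
  exact: measurable_affv.
apply: (measurable_fun_cvg mq) => x _.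
have dF0 : differentiable F (x + (0 : R) *: evec R i) by exact: dF.
have D := is_derive_line dF0; rewrite scale0r addr0 in D.
have := cvg_diff_quotient D u0 cu.
rewrite dotvC dotv_evec [grad F x ord0 i]mxE.
by under eq_fun do rewrite add0r scale0r addr0.
Qed.

End derivative_tools.

(** * The energy density and its time derivative *)

Section trace_terms.
Context {R : realType} (n : nat) (f : 'rV[R]_n -> R) (L M : R).
Hypotheses (L0 : 0 <= L) (M0 : 0 <= M) (hf : LM_smooth f L M).
Implicit Types (x y v w : 'rV[R]_n) (t s : R).
Local Notation K := (hesT f).

Definition trh x : R := \tr (K x).
Definition trh2 x : R := \tr (K x *m K x).

Lemma trh_diff x : differentiable trh x.
Proof.
rewrite (_ : trh = \sum_(i < n) (fun x => hess f x i i)); last first.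
  by apply/funext => y; rewrite fct_sumE /trh /mxtrace; apply: eq_bigr => i _; rewrite mxE.
by apply: differentiable_sum => i; exact: hess_diff hf _ _ _.
Qed.

Lemma trh2_diff x : differentiable trh2 x.
Proof.
rewrite (_ : trh2 = \sum_(i < n) (\sum_(j < n) ((fun x => hess f x j i) * (fun x => hess f x i j)))); last first.
  apply/funext => y; rewrite fct_sumE /trh2 /mxtrace; apply: eq_bigr => i _.
  rewrite mxE fct_sumE; apply: eq_bigr => j _; by rewrite [hesT f y i j]mxE [hesT f y j i]mxE.
apply: differentiable_sum => i; apply: differentiable_sum => j.
by apply: differentiableM; exact: hess_diff hf _ _ _.
Qed.

Lemma trh_le x : `|trh x| <= n%:R * L.
Proof. by apply: opbound_trace; exact: (hesT_bound L0 hf). Qed.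

Lemma trh2_le x : `|trh2 x| <= n%:R * L ^+ 2.
Proof. by apply: opbound_trace; rewrite expr2; apply: opboundM => //; exact: (hesT_bound L0 hf). Qed.

Lemma trh_lip x y : `|trh x - trh y| <= n%:R * M * enorm (x - y).
Proof. by rewrite /trh -raddfB -mulrA; apply: opbound_trace; exact: (hesT_lip M0 hf). Qed.

Lemma trh2_lip x y : `|trh2 x - trh2 y| <= 2 * n%:R * L * M * enorm (x - y).
Proof.
have G (A B : 'M[R]_n) : \tr (A *m A) - \tr (B *m B) = \tr (A *m (A - B) + (A - B) *m B).
  by rewrite mxtraceD mulmxBr mulmxBl !raddfB /=; lra.
rewrite /trh2 G.
rewrite (_ : 2 * _ * _ * _ * _ = n%:R * (L * (M * enorm (x - y)) + (M * enorm (x - y)) * L)); last by ring.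
apply: opbound_trace; apply: opboundD.
  by apply: opboundM; [rewrite mulr_ge0// enorm_ge0|exact: (hesT_bound L0 hf)|exact: (hesT_lip M0 hf)].
by apply: opboundM => //; [exact: (hesT_lip M0 hf)|exact: (hesT_bound L0 hf)].
Qed.

Lemma trh_cts : continuous trh. Proof. exact: differentiable_cts trh_diff. Qed.
Lemma trh2_cts : continuous trh2. Proof. exact: differentiable_cts trh2_diff. Qed.

(* Second-order upper bound of [ln det (1 + t K)], see [ln_det_le]. *)
Definition ell t x : R := t * trh x - t ^+ 2 / 2 * trh2 x + n%:R * L ^+ 3 / 2 * t ^+ 3.

(** The spatial gradient of [ell t]. *)
Definition qvec t x : 'rV[R]_n := t *: grad trh x - (t ^+ 2 / 2) *: grad trh2 x.

Lemma dotv_qvec t x v : dotv v (qvec t x) = t * 'D_v trh x - t ^+ 2 / 2 * 'D_v trh2 x.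
Proof.
rewrite /qvec dotvDr dotvNr !dotvZr !derive_grad//; [exact: trh2_diff|exact: trh_diff].
Qed.

(** [t tr K] has Lipschitz constant [n M t], and [(t^2 / 2) tr K^2] has [(t L) n M t], at most an
    eighth of it. Differentiating along [qvec t x] itself turns these constants into a bound on its
    norm. The factor [n] of the trace is the source of [n^2 M^2] in the final error. *)
Lemma enorm_qvec t x : 0 <= t -> t * L <= 8^-1 -> enorm (qvec t x) <= 9 / 8 * n%:R * M * t.
Proof.
move=> t0 tL; set q := qvec t x.
have B0 : 0 <= n%:R * M by rewrite mulr_ge0.
have [->|qN] := eqVneq (enorm q) 0; first by rewrite !mulr_ge0.
have q0 : 0 < enorm q by rewrite lt_neqAle eq_sym qN enorm_ge0.
have h1 : `|'D_q trh x| <= n%:R * M * enorm q.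
  apply: derive_le_lipschitz; first exact: trh_diff.
  by move=> v; apply: (le_trans (trh_lip _ _)); rewrite addrC addKr.
have h2 : `|'D_q trh2 x| <= 2 * n%:R * L * M * enorm q.
  apply: derive_le_lipschitz; first exact: trh2_diff.
  by move=> v; apply: (le_trans (trh2_lip _ _)); rewrite addrC addKr.
rewrite -(ler_pM2r q0) -expr2 sqr_enorm -dotvv {2}/q dotv_qvec.
apply: (le_trans (ler_norm _)); apply: (le_trans (ler_normB _ _)).
rewrite (normrM t) (normrM (t ^+ 2 / 2)) (ger0_norm t0) (@ger0_norm _ (t ^+ 2 / 2)) ?divr_ge0 ?sqr_ge0//.
have k1 : t * `|'D_q trh x| <= t * (n%:R * M * enorm q) by rewrite ler_wpM2l.
have k2 : t ^+ 2 / 2 * `|'D_q trh2 x| <= t ^+ 2 / 2 * (2 * n%:R * L * M * enorm q).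
  by rewrite ler_wpM2l// divr_ge0// sqr_ge0.
have k3 : t * L * (t * (n%:R * M * enorm q)) <= 8^-1 * (t * (n%:R * M * enorm q)).
  by rewrite ler_wpM2r// !mulr_ge0// ltW.
have E : t ^+ 2 / 2 * (2 * n%:R * L * M * enorm q) = t * L * (t * (n%:R * M * enorm q)) by field.
lra.
Qed.

Lemma continuous_jacA t i j : continuous (fun x => jacA f t x i j).
Proof.
have -> : (fun x => jacA f t x i j) = (fun x => (i == j)%:R + t * K x i j).
  by apply/funext => x; rewrite /jacA [LHS]mxE [in X in X + _]mxE [in X in _ + X]mxE.
apply: ctsD; first exact: ctsC.
by apply: ctsM; [exact: ctsC|exact: hesT_cts M0 hf _ _].
Qed.

Lemma continuous_jacA_inv t i j : 0 <= t -> t * L <= 4^-1 ->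
  continuous (fun x => invmx (jacA f t x) i j).
Proof.
move=> t0 tL.
have -> : (fun x => invmx (jacA f t x) i j) =
   (fun x => (\det (jacA f t x))^-1 * ((-1) ^+ (j + i) * \det (row' j (col' i (jacA f t x))))).
  apply/funext => x; rewrite /invmx (jacA_unit L0 hf)// [LHS]mxE; congr (_ * _).
  by rewrite [LHS]mxE.
apply: ctsM.
  apply: ctsV; last by apply: continuous_det; exact: continuous_jacA.
  by move=> x; have := jacA_unit L0 hf x t0 tL; rewrite unitmxE unitfE.
apply: ctsM; first exact: ctsC.
apply: continuous_det => k l; under eq_fun do rewrite mxE mxE.
exact: continuous_jacA.
Qed.

Definition phi t y : R := f (prox_map f t y) + ell t (prox_map f t y).

Lemma ell_cts t : continuous (ell t).
Proof.
apply: ctsD; last exact: ctsC.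
by apply: ctsB; (apply: ctsM; [exact: ctsC|]); [exact: trh_cts|exact: trh2_cts].
Qed.

Lemma phi_cts t : 0 <= t -> t * L <= 4^-1 -> continuous (phi t).
Proof.
move=> t0 tL; apply: ctsD; apply: (cts_prox_map L0 hf) => //; [exact: f_cts hf|exact: ell_cts].
Qed.

Lemma phi_path t (Y : R -> 'rV[R]_n) v : 0 < t -> t * L <= 8^-1 -> path_derive Y v ->
  is_derive (0 : R) (1 : R) (fun h => phi (t + h) (Y h))
   (let x := prox_map f t (Y 0) in
    dotv ((v - grad f x) *m invmx (jacA f t x)) (grad f x + qvec t x) +
    (trh x - t * trh2 x) + 3 / 2 * n%:R * L ^+ 3 * t ^+ 2).
Proof.
move=> t0 tL dY; set x := prox_map f t (Y 0).
pose X h := prox_map f (t + 1 * h) (Y h).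
have X0 : X 0 = x by rewrite /X mulr0 addr0.
have dX := prox_map_path L0 M0 hf 1 t0 tL dY; rewrite -/x scale1r in dX.
set w := (v - grad f x) *m invmx (jacA f t x); rewrite -/w -/X in dX.
have D1 := @path_derive_comp _ _ f X w ltac:(exact: f_diff hf _) dX.
have D2 := @path_derive_comp _ _ trh X w ltac:(exact: trh_diff) dX.
have D3 := @path_derive_comp _ _ trh2 X w ltac:(exact: trh2_diff) dX.
have := is_derive_shifted_cubic t (n%:R * L ^+ 3 / 2) D1 D2 D3.
rewrite X0 => D.
rewrite (_ : (fun h => phi (t + h) (Y h)) = (fun h => f (X h) + ((t + h) * trh (X h) -
   (t + h) ^+ 2 / 2 * trh2 (X h) + n%:R * L ^+ 3 / 2 * (t + h) ^+ 3))); last first.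
  by apply/funext => h; rewrite /phi /ell /X mul1r.
apply: is_derive_eq D _.
rewrite /= dotvDr dotv_qvec derive_grad; last exact: f_diff hf _.
lra.
Qed.

(** The weight [N] reflects the linear growth of the gradient. The bound dominates the difference
    quotients of the energy, and with the second point at the origin and time 0 it gives the
    quadratic growth of [phi]. *)
Lemma phi_lip eps : 0 <= eps -> eps * L <= 4^-1 -> exists C, 0 <= C /\
  forall (r r' : R) y y', 0 <= r -> r <= eps -> 0 <= r' -> r' <= eps ->
  let N := 1 + enorm y + enorm y' in
  `|phi r y - phi r' y'| <= C * N * (enorm (y - y') + `|r - r'| * N).
Proof.
move=> e0 eL.
pose g0 := enorm (grad f 0); have g00 : 0 <= g0 by exact: enorm_ge0.
pose C1 := 4 / 3 * (1 + eps * g0).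
have C10 : 0 <= C1 by rewrite mulr_ge0// addr_ge0// mulr_ge0.
pose C2 := g0 + L * C1.
have C20 : 0 <= C2 by rewrite addr_ge0// mulr_ge0.
pose C3 := 4 / 3 * (1 + C2).
have C30 : 0 <= C3 by rewrite mulr_ge0// addr_ge0.
pose C4 := g0 + L * (3 * C1).
have C40 : 0 <= C4 by rewrite addr_ge0// mulr_ge0// mulr_ge0.
pose c3 := n%:R * L ^+ 3 / 2; have c30 : 0 <= c3 by rewrite divr_ge0// mulr_ge0// exprn_ge0.
pose Ca := n%:R * L + eps * (n%:R * L ^+ 2) + 3 * eps ^+ 2 * c3.
have Ca0 : 0 <= Ca by rewrite !addr_ge0// !mulr_ge0// exprn_ge0.
pose Cb := eps * (n%:R * M) + eps ^+ 2 / 2 * (2 * n%:R * L * M).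
have Cb0 : 0 <= Cb by rewrite addr_ge0// !mulr_ge0// exprn_ge0.
exists (C4 * C3 + (Ca + Cb * C3)); split.
  by apply: addr_ge0; [exact: mulr_ge0|apply: addr_ge0 => //; exact: mulr_ge0].
move=> r r' y y' r0 re r'0 r'e /=; set N := 1 + enorm y + enorm y'.
have rL s : s <= eps -> s * L <= 4^-1 by move=> se; apply: le_trans eL; rewrite ler_wpM2r.
have y0 := enorm_ge0 y; have y'0 := enorm_ge0 y'.
have N1 : 1 <= N by rewrite /N; lra.
have N0 : 0 <= N by lra.
set x := prox_map f r y; set x' := prox_map f r' y'.
have growth s z : 0 <= s -> s <= eps -> enorm z <= N - 1 -> enorm (prox_map f s z) <= C1 * N.
  move=> s0 se hz; apply: (le_trans (prox_map_growth L0 hf _ s0 (rL _ se))).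
  rewrite /C1 -(mulrA (4 / 3)) ler_wpM2l// mulrDl mul1r lerD//; first lra.
  by rewrite -/g0 -[leLHS]mulr1; apply: ler_pM; rewrite ?mulr_ge0 ?ler_wpM2r.
have hx : enorm x <= C1 * N by apply: growth => //; rewrite /N; lra.
have hx' : enorm x' <= C1 * N by apply: growth => //; rewrite /N; lra.
have C1N : 0 <= C1 * N by exact: mulr_ge0.
have hp : enorm (grad f x') <= C2 * N.
  apply: (le_trans (grad_growth L0 hf _)); rewrite -/g0 /C2 mulrDl lerD//; first by rewrite ler_peMr.
  by rewrite -mulrA ler_wpM2l.
set W := enorm (y - y') + `|r - r'| * N.
have W0 : 0 <= W by rewrite addr_ge0 ?enorm_ge0// mulr_ge0.
have d0 := enorm_ge0 (x - x').
have hd : enorm (x - x') <= C3 * W.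
  apply: (le_trans (prox_map_lip L0 hf _ _ r0 (rL _ re) r'0 (rL _ r'e))).
  rewrite -/x' /C3 -(mulrA (4 / 3)) ler_wpM2l// /W.
  apply: (@le_trans _ _ (enorm (y - y') + `|r - r'| * (C2 * N))); first by rewrite lerD2l ler_wpM2l.
  have u1 := mulr_ge0 C20 (enorm_ge0 (y - y')); have u2 : 0 <= `|r - r'| * N by rewrite mulr_ge0.
  lra.
have hf1 : `|f x - f x'| <= C4 * C3 * (N * W).
  have [tau [tau0 tau1]] := MVT_rV x' (x - x') (f_diff hf).
  rewrite (_ : x' + (x - x') = x); last by rewrite addrC subrK.
  move=> ->; apply: (le_trans (normr_dotv _ _)).
  rewrite (_ : C4 * C3 * (N * W) = (C3 * W) * (C4 * N)); last by ring.
  apply: ler_pM => //; first exact: enorm_ge0.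
  apply: (le_trans (grad_growth L0 hf _)); rewrite -/g0 /C4 mulrDl lerD//; first by rewrite ler_peMr.
  rewrite -mulrA ler_wpM2l// (le_trans (enormD _ _))// enormZ ger0_norm//.
  have : tau * enorm (x - x') <= enorm (x - x') by rewrite ler_piMl.
  have := enormB x x'; lra.
have rW : `|r - r'| <= W.
  have : `|r - r'| <= `|r - r'| * N by rewrite ler_peMr.
  by rewrite /W; have := enorm_ge0 (y - y'); lra.
have he : `|ell r x - ell r' x'| <= Ca * `|r - r'| + Cb * enorm (x - x').
  (* Each difference is split into a change of time, with [a - b] factored out, and a change of
     point. *)
  have G (a b c u u' v v' : R) : a * u - a ^+ 2 / 2 * v + c * a ^+ 3 - (b * u' - b ^+ 2 / 2 * v' + c * b ^+ 3) =
     ((a - b) * u + b * (u - u')) - ((a - b) * ((a + b) / 2 * v) + b ^+ 2 / 2 * (v - v')) +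
     (a - b) * (c * (a ^+ 2 + a * b + b ^+ 2)) by field.
  rewrite /ell -/c3 G.
  have dr := normr_ge0 (r - r').
  have m1 : `|(r - r') * trh x| <= `|r - r'| * (n%:R * L) by rewrite normrM ler_wpM2l// trh_le.
  have m2 : `|r' * (trh x - trh x')| <= eps * (n%:R * M * enorm (x - x')).
    by rewrite normrM (ger0_norm r'0) ler_pM// trh_lip.
  have m3 : `|(r - r') * ((r + r') / 2 * trh2 x)| <= `|r - r'| * (eps * (n%:R * L ^+ 2)).
    rewrite normrM ler_wpM2l// normrM ler_pM//; last exact: trh2_le.
    by rewrite ger0_norm; lra.
  have m4 : `|r' ^+ 2 / 2 * (trh2 x - trh2 x')| <= eps ^+ 2 / 2 * (2 * n%:R * L * M * enorm (x - x')).
    rewrite normrM ler_pM//; last exact: trh2_lip.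
    by rewrite ger0_norm ?divr_ge0 ?sqr_ge0// ler_wpM2r// ler_pXn2r ?nnegrE.
  have m5 : `|(r - r') * (c3 * (r ^+ 2 + r * r' + r' ^+ 2))| <= `|r - r'| * (c3 * (3 * eps ^+ 2)).
    rewrite normrM ler_wpM2l// normrM (ger0_norm c30) ler_wpM2l//.
    have v1 : r ^+ 2 <= eps ^+ 2 by rewrite ler_pXn2r ?nnegrE.
    have v2 : r' ^+ 2 <= eps ^+ 2 by rewrite ler_pXn2r ?nnegrE.
    have v3 : r * r' <= eps ^+ 2 by rewrite expr2 ler_pM.
    have v4 : 0 <= r * r' by rewrite mulr_ge0.
    have w1 := sqr_ge0 r; have w2 := sqr_ge0 r'; rewrite ger0_norm; lra.
  apply: (le_trans (ler_normD _ _)); apply: (le_trans (lerD (ler_normB _ _) (lexx _))).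
  apply: (le_trans (lerD (lerD (ler_normD _ _) (ler_normD _ _)) (lexx _))).
  rewrite /Ca /Cb; lra.
have -> : phi r y - phi r' y' = (f x - f x') + (ell r x - ell r' x').
  by rewrite /phi -/x -/x'; ring.
apply: (le_trans (ler_normD _ _)); rewrite -mulrA mulrDl lerD//.
apply: (le_trans he).
have NW : W <= N * W by rewrite ler_peMl.
have z1 : Ca * `|r - r'| <= Ca * (N * W) by rewrite ler_wpM2l// (le_trans rW).
have z2 : Cb * enorm (x - x') <= Cb * C3 * (N * W).
  rewrite -mulrA ler_wpM2l// (le_trans hd)// ler_wpM2l//.
by apply: (le_trans (lerD z1 z2)); rewrite -mulrDl.
Qed.

Lemma phi_growth eps : 0 <= eps -> eps * L <= 4^-1 -> exists C, 0 <= C /\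
  forall r y, 0 <= r -> r <= eps -> `|phi r y| <= C * quad y.
Proof.
move=> e0 eL; have [C [C0 hC]] := phi_lip e0 eL.
pose B := `|phi 0 0|; have B0 : 0 <= B by exact: normr_ge0.
exists (B + C * 2 * (1 + 2 * eps)); split; first by rewrite addr_ge0// !mulr_ge0// addr_ge0// mulr_ge0.
move=> r y r0 re; have := hC r 0 y 0 r0 re (lexx _) e0.
rewrite /= enorm0 !addr0 !subr0 (ger0_norm r0) => h.
have y0 := enorm_ge0 y; have q1 := quad_ge1 y.
have hB : B <= B * quad y by rewrite ler_peMr.
have hq : (1 + enorm y) ^+ 2 <= 2 * quad y.
  rewrite /quad -sqr_enorm; have := sqr_ge0 (enorm y - 1); nra.
have h2 : C * (1 + enorm y) * (enorm y + r * (1 + enorm y)) <= C * 2 * (1 + 2 * eps) * quad y.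
  apply: (@le_trans _ _ (C * (1 + enorm y) ^+ 2 * (1 + eps))).
    rewrite expr2 (_ : C * ((1 + enorm y) * (1 + enorm y)) * (1 + eps) = C * (1 + enorm y) * ((1 + enorm y) * (1 + eps))); last by ring.
    rewrite ler_wpM2l ?mulr_ge0 ?addr_ge0//.
    have : r * (1 + enorm y) <= eps * (1 + enorm y) by rewrite ler_wpM2r// addr_ge0.
    lra.
  rewrite (_ : C * 2 * (1 + 2 * eps) * quad y = C * (2 * quad y) * (1 + 2 * eps)); last by ring.
  rewrite ler_pM ?mulr_ge0 ?sqr_ge0 ?addr_ge0//; first by rewrite ler_wpM2l.
  lra.
rewrite -[phi r y](subrK (phi 0 0)) (le_trans (ler_normD _ _))// mulrDl -/B; lra.
Qed.

End trace_terms.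

(** * Square roots and the noise level as a function of time *)

Section elementary.
Context {R : realType}.

Lemma sqr_abs (x : R) : `|x| ^+ 2 = x ^+ 2.
Proof. by rewrite real_normK ?num_real. Qed.

Lemma sqrt_dist (a b : R) : 0 <= b -> b <= a -> Num.sqrt a <= Num.sqrt b + Num.sqrt (a - b).
Proof.
move=> b0 ba; have ab : 0 <= a - b by rewrite subr_ge0.
have s1 := sqrtr_ge0 b; have s2 := sqrtr_ge0 (a - b).
rewrite -[leRHS]ger0_norm ?addr_ge0// -sqrtr_sqr ler_wsqrtr// sqrrD !sqr_sqrtr//.
have := mulr_ge0 s1 s2; rewrite -mulr_natr; lra.
Qed.

Lemma cvg_harmonic_bound (v : nat -> R) (l A : R) :
  (forall k, `|l - v k| <= A * k.+1%:R^-1) -> v k @[k --> \oo] --> l.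
Proof.
move=> hv.
have c : A * k.+1%:R^-1 @[k --> \oo] --> 0.
  by rewrite -(mulr0 A); apply: cvgM; [exact: cvg_cst|exact: cvg_harmonic].
move/cvgrPdist_le: c => c; apply/cvgrPdist_le => e e0.
apply: filterS (c e e0) => k; rewrite sub0r normrN => h.
exact: le_trans (le_trans (hv k) (ler_norm _)) h.
Qed.

(* [rad r] is the standard deviation of the heat flow at time [r]. *)
Definition rad (r : R) : R := Num.sqrt (2 * r).

Lemma rad_ge0 r : 0 <= rad r. Proof. exact: sqrtr_ge0. Qed.

Lemma rad_gt0 r : 0 < r -> 0 < rad r. Proof. by move=> r0; rewrite sqrtr_gt0 mulr_gt0. Qed.

Lemma sqr_rad r : 0 <= r -> rad r ^+ 2 = 2 * r.
Proof. by move=> r0; rewrite sqr_sqrtr// mulr_ge0. Qed.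

Lemma rad_le r s : r <= s -> rad r <= rad s.
Proof. by move=> rs; rewrite ler_wsqrtr// ler_wpM2l. Qed.

Lemma rad_dist (r t : R) : 0 < t -> 0 <= r -> `|rad t - rad r| <= 2 / rad t * `|t - r|.
Proof.
move=> t0 r0; have b0 := rad_gt0 t0; have a0 := rad_ge0 r.
have E : (rad t - rad r) * (rad t + rad r) = 2 * (t - r).
  by rewrite -subr_sqr !sqr_rad ?(ltW t0)//; ring.
have s0 : 0 < rad t + rad r by rewrite ltr_pwDl.
have : `|rad t - rad r| * (rad t + rad r) = 2 * `|t - r|.
  by rewrite -[X in _ * X]ger0_norm ?(ltW s0)// -normrM E normrM ger0_norm.
move=> E2; rewrite mulrAC -E2 ler_pdivlMr// ler_wpM2l// lerDl//.
Qed.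

Lemma rad_taylor (t h : R) : 0 < t -> `|h| <= t ->
  `|rad (t + h) - rad t - h / rad t| <= 2 / rad t ^+ 3 * h ^+ 2.
Proof.
move=> t0 ht; have b0 := rad_gt0 t0.
have th : 0 <= t + h by move: ht; rewrite ler_norml; lra.
have := rad_dist t0 th; rewrite opprD addrA subrr sub0r normrN => d1.
have bN : rad t != 0 by rewrite gt_eqF.
have E1 := sqr_rad th; have E2 := sqr_rad (ltW t0).
set a := rad (t + h) in d1 E1 *; set b := rad t in b0 d1 bN E2 *.
have hE : h = (a ^+ 2 - b ^+ 2) / 2 by rewrite E1 E2; field.
have -> : a - b - h / b = - ((b - a) ^+ 2 / (2 * b)) by rewrite hE; field.
rewrite normrN ger0_norm; last by rewrite divr_ge0 ?sqr_ge0// mulr_ge0// ltW.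
have d2 : (b - a) ^+ 2 <= (2 / b * `|h|) ^+ 2.
  by rewrite -sqr_abs ler_pXn2r ?nnegrE// mulr_ge0// divr_ge0// ltW.
rewrite ler_pdivrMr ?mulr_gt0//; apply: (le_trans d2).
rewrite exprMn sqr_abs le_eqVlt; apply/orP; left; apply/eqP; field; exact: bN.
Qed.

End elementary.

(** * The energy along the flow *)

Section energy.
Context {R : realType} (n : nat) (f : 'rV[R]_n -> R) (L M eps : R).
Hypotheses (L0 : 0 <= L) (M0 : 0 <= M) (hf : LM_smooth f L M).
Hypotheses (eps0 : 0 < eps) (epsL : eps * L <= 8^-1).
Variable rho : 'rV[R]_n -> R.
Hypothesis drho : density rho.
Local Notation mu := (lebesgue_rV n).
Local Notation mm := (mu \x mu)%E.
Local Notation phi := (phi f L).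

Let mj := measurable_joint drho.
Let j0 := joint_ge0 drho.
Let ijq := integrable_jquad drho.

Let eL4 : eps * L <= 4^-1.
Proof. by apply: (le_trans epsL); lra. Qed.

Let rL r : 0 <= r -> r <= eps -> r * L <= 8^-1.
Proof. by move=> r0 re; apply: le_trans epsL; rewrite ler_wpM2r. Qed.

Let rL4 r : 0 <= r -> r <= eps -> r * L <= 4^-1.
Proof. by move=> r0 re; have := rL r0 re; lra. Qed.

Definition flow r (p : 'rV[R]_n * 'rV[R]_n) : R := phi r (noisy (rad r) p).

Definition energy r : R := expect mm (joint rho) (flow r).

Lemma measurable_flow r : 0 <= r -> r <= eps -> measurable_fun setT (flow r).
Proof.
move=> r0 re; apply: (measurableT_comp _ (@measurable_noisy R n (rad r))).
by apply: continuous_measurable_rV; apply: (phi_cts L0 hf) => //; exact: rL4.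
Qed.

Lemma flow_le : exists C, 0 <= C /\
  forall r p, 0 <= r -> r <= eps -> `|flow r p| <= C * jquad p.
Proof.
have [C [C0 hC]] := phi_growth L0 M0 hf (ltW eps0) eL4.
exists (C * (2 + 16 * eps)); split; first by rewrite mulr_ge0// addr_ge0// mulr_ge0// ltW.
move=> r p r0 re; apply: (le_trans (hC _ _ r0 re)); rewrite -mulrA ler_wpM2l//.
apply: (le_trans (quad_noisy_le _ _)); rewrite sqr_rad// ler_wpM2r//; first exact: le_trans ler01 (jquad_ge1 p).
lra.
Qed.

Lemma flow_dominated r : 0 <= r -> r <= eps -> dominated (@jquad R n) (flow r).
Proof.
move=> r0 re; split; first exact: measurable_flow.
by have [C [_ hC]] := flow_le; exists C => p; exact: hC.
Qed.

(** Bounds the weight [N] of [phi_lip] at two noisy points, uniformly over times up to [eps]. *)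
Let Np (p : 'rV[R]_n * 'rV[R]_n) := 2 * (1 + rad eps) * (1 + enorm p.1 + enorm p.2).

Let Np_ge0 p : 0 <= Np p.
Proof.
by rewrite mulr_ge0// ?mulr_ge0// ?addr_ge0// ?enorm_ge0// rad_ge0.
Qed.

Let flow_dist : exists C, 0 <= C /\ forall (r t : R) p, 0 <= r -> r <= eps -> 0 <= t -> t <= eps ->
  `|flow r p - flow t p| <= C * Np p * (`|rad r - rad t| * enorm p.2 + `|r - t| * Np p).
Proof.
have [C [C0 hC]] := phi_lip L0 M0 hf (ltW eps0) eL4.
exists C; split => // r t p r0 re t0 te.
have := hC r t (noisy (rad r) p) (noisy (rad t) p) r0 re t0 te; cbv zeta.
set N := 1 + _ + _.
have x0 := enorm_ge0 p.1; have z0 := enorm_ge0 p.2; have e0 := rad_ge0 eps.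
have hN s : s <= eps -> enorm (noisy (rad s) p) <= rad eps * enorm p.2 + enorm p.1.
  move=> se; apply: (le_trans (enormD _ _)); rewrite enormZ lerD2r ler_wpM2r//.
  by rewrite ger0_norm ?rad_ge0// rad_le.
have NN : N <= Np p.
  have := hN r re; have := hN t te; rewrite /N /Np.
  have := mulr_ge0 e0 z0; have := mulr_ge0 e0 x0; lra.
have N0 : 0 <= N by rewrite !addr_ge0 ?enorm_ge0.
have -> : enorm (noisy (rad r) p - noisy (rad t) p) = `|rad r - rad t| * enorm p.2.
  by rewrite -enormZ /noisy scalerBl; congr enorm; apply/rowP => i; rewrite !mxE; ring.
move=> h; apply: (le_trans h); apply: ler_pM.
- exact: mulr_ge0.
- by apply: addr_ge0; apply: mulr_ge0.
- by rewrite ler_wpM2l.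
- by rewrite lerD2l ler_wpM2l.
Qed.

Let Np_sq p : Np p ^+ 2 <= 4 * (1 + rad eps) ^+ 2 * 15 * jquad p.
Proof.
rewrite (_ : Np p ^+ 2 = 4 * (1 + rad eps) ^+ 2 * (1 + enorm p.1 + enorm p.2) ^+ 2); last by rewrite /Np; ring.
rewrite -(mulrA _ 15); apply: ler_wpM2l; first by apply: mulr_ge0 => //; exact: sqr_ge0.
have x0 := enorm_ge0 p.1; have z0 := enorm_ge0 p.2.
have h : (1 + enorm p.1 + enorm p.2) ^+ 2 <= 3 * (1 + sqnorm p.1 + sqnorm p.2).
  rewrite -!sqr_enorm; have := sqr_ge0 (enorm p.1 - 1); have := sqr_ge0 (enorm p.2 - 1).
  have := sqr_ge0 (enorm p.1 - enorm p.2); lra.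
apply: (le_trans h); rewrite /jquad /quad.
have h2 := sqnorm_le_expq p.2; have h3 := expq_ge1 p.2; have h4 := sqnorm_ge0 p.1.
have h5 : sqnorm p.1 <= sqnorm p.1 * expq p.2 by rewrite ler_peMr.
lra.
Qed.

(** Argued by contradiction in order to extract a sequence, on which dominated convergence
    applies. *)
Lemma energy_usc s : 0 <= s -> s < eps -> forall e : R, 0 < e ->
  exists d : R, 0 < d /\ forall r, s <= r -> r <= s + d -> r <= eps -> energy r <= energy s + e.
Proof.
move=> s0 se e e0; apply: contrapT => H.
pose u k : R := k.+1%:R^-1.
have u0 k : 0 < u k by rewrite invr_gt0 ltr0n.
have u1 k : u k <= 1 by rewrite invf_le1 ?ltr0n// ler1n.
(* Points are taken within [u k ^+ 2] of [s] because at [s = 0] the noise level [rad] is only Holder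
   of exponent 1/2; its increment is then [O(u k)]. *)
have H' k : exists r, [/\ s <= r, r <= s + u k ^+ 2, r <= eps & energy s + e < energy r].
  apply: contrapT => H2; apply: H; exists (u k ^+ 2); split; first exact: exprn_gt0.
  move=> r h1 h2 h3; rewrite leNgt; apply/negP => h4; apply: H2; by exists r.
pose r_ k := projT1 (cid (H' k)).
have rP k : [/\ s <= r_ k, r_ k <= s + u k ^+ 2, r_ k <= eps & energy s + e < energy (r_ k)].
  exact: projT2 (cid (H' k)).
have [C [C0 hC]] := flow_le; have [D [D0 hD]] := flow_dist.
have r0 k : 0 <= r_ k by case: (rP k) => h _ _ _; exact: le_trans h.
have re k : r_ k <= eps by case: (rP k).
have cv p : flow (r_ k) p @[k --> \oo] --> flow s p.
  apply: (@cvg_harmonic_bound _ _ _ (D * Np p * (Num.sqrt 2 * enorm p.2 + Np p))) => k.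
  rewrite distrC; apply: (le_trans (hD _ _ p (r0 k) (re k) s0 (ltW se))).
  rewrite -[leRHS]mulrA; apply: (ler_wpM2l (mulr_ge0 D0 (Np_ge0 p))).
  have [h1 h2 _ _] := rP k.
  have d1 : `|r_ k - s| <= u k ^+ 2 by rewrite ger0_norm; lra.
  have d1' : `|r_ k - s| <= u k.
    by apply: (le_trans d1); rewrite expr2 ler_piMr// ltW.
  have d2 : `|rad (r_ k) - rad s| <= Num.sqrt 2 * u k.
    rewrite ger0_norm ?subr_ge0 ?rad_le// lerBlDl.
    have := @sqrt_dist R (2 * r_ k) (2 * s); rewrite mulr_ge0// ler_wpM2l// => /(_ isT isT) h.
    apply: (le_trans h); rewrite lerD2l -mulrBr sqrtrM// ler_wpM2l ?sqrtr_ge0//.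
    by rewrite -[leRHS]ger0_norm ?(ltW (u0 k))// -sqrtr_sqr ler_wsqrtr// (le_trans (ler_norm _)).
  rewrite mulrDl lerD//; first by rewrite mulrAC ler_wpM2r ?enorm_ge0.
  by rewrite mulrC ler_wpM2l.
have mF k : measurable_fun setT (flow (r_ k)) by exact: measurable_flow.
have [_ cE] := expect_dct mj j0 ijq mF (fun k p => hC _ p (r0 k) (re k)) cv.
have : energy s + e <= energy s.
  rewrite -{2}[energy s](cvg_lim (@Rhausdorff R) cE); apply: limr_ge.
    by apply/cvg_ex; exists (energy s).
  by apply: nearW => k; case: (rP k) => _ _ _ /ltW.
lra.
Qed.

(* Time derivative of [flow] at [t]. *)
Definition flow' t (p : 'rV[R]_n * 'rV[R]_n) : R :=
  let x := prox_map f t (noisy (rad t) p) in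
  dotv (((rad t)^-1 *: p.2 - grad f x) *m invmx (jacA f t x)) (grad f x + qvec f t x) +
  (trh f x - t * trh2 f x) + 3 / 2 * n%:R * L ^+ 3 * t ^+ 2.

Lemma noisy_path (t : R) (p : 'rV[R]_n * 'rV[R]_n) : 0 < t ->
  path_derive (fun h => noisy (rad (t + h)) p) ((rad t)^-1 *: p.2).
Proof.
move=> t0 e e0; have b0 := rad_gt0 t0.
pose B := 2 / rad t ^+ 3 * enorm p.2.
have B0 : 0 <= B by rewrite mulr_ge0 ?enorm_ge0// divr_ge0// exprn_ge0// ltW.
exists (Num.min t (e / (B + 1))); split; first by rewrite lt_min t0 divr_gt0// ltr_wpDl.
move=> h; rewrite le_min => /andP[h1]; rewrite ler_pdivlMr ?ltr_wpDl// => h2.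
rewrite addr0 (_ : _ - _ = (rad (t + h) - rad t - h / rad t) *: p.2); last first.
  by rewrite /noisy; apply/rowP => i; rewrite !mxE; ring.
rewrite enormZ; apply: (@le_trans _ _ (2 / rad t ^+ 3 * h ^+ 2 * enorm p.2)).
  by rewrite ler_wpM2r ?enorm_ge0// rad_taylor.
rewrite (_ : _ * _ * enorm p.2 = B * `|h| * `|h|); last first.
  by rewrite -(sqr_abs h) /B; ring.
rewrite ler_wpM2r//; apply: le_trans h2; rewrite mulrC ler_wpM2l// lerDl//.
Qed.

(** Left difference quotients converge to the mean of [flow'] along one sequence; [dini_decay] asks
    for no more than one small [h]. *)
Lemma energy_slope t : 0 < t -> t <= eps ->
  dominated (@jquad R n) (flow' t) /\
  forall k d : R, 0 < k -> 0 < d -> exists h, [/\ 0 < h, h <= d, h <= t &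
    energy t - energy (t - h) <= h * (expect mm (joint rho) (flow' t) + k)].
Proof.
move=> t0 te; have t0' := ltW t0; have b0 := rad_gt0 t0.
pose u k : R := - (t / 2 * k.+1%:R^-1).
have iv0 k : 0 < (k.+1%:R^-1 : R) by rewrite invr_gt0 ltr0n.
have iv1 k : (k.+1%:R^-1 : R) <= 1 by rewrite invf_le1 ?ltr0n// ler1n.
have u0 k : u k < 0 by rewrite oppr_lt0 mulr_gt0// divr_gt0.
have uN k : u k != 0 by rewrite lt_eqF.
have ut k : - (t / 2) <= u k by rewrite lerN2 ler_piMr// divr_ge0.
have cu : u k @[k --> \oo] --> 0.
  rewrite -oppr0 -(mulr0 (t / 2)); apply: cvgN; apply: cvgM; [exact: cvg_cst|exact: cvg_harmonic].
have tu0 k : 0 <= t + u k by have := ut k; lra.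
have tue k : t + u k <= eps by have := u0 k; lra.
pose Q k p := (flow (t + u k) p - flow t p) / u k.
have mQ k : measurable_fun setT (Q k).
  apply: measurable_funM => //; apply: measurable_funB; exact: measurable_flow.
have [D [D0 hD]] := flow_dist.
pose C := D * ((1 / rad t) * (4 * (1 + rad eps) ^+ 2 * 15 + 4) + 4 * (1 + rad eps) ^+ 2 * 15).
have bQ k p : `|Q k p| <= C * jquad p.
  rewrite /Q normrM normfV ler_pdivrMr ?normr_gt0//.
  apply: (le_trans (hD _ _ p (tu0 k) (tue k) t0' te)).
  have e1 : `|t + u k - t| = `|u k| by rewrite addrC addKr.
  rewrite e1.
  have e2 : `|rad (t + u k) - rad t| <= 2 / rad t * `|u k|.
    by rewrite distrC (le_trans (rad_dist t0 (tu0 k)))// opprD addrA subrr sub0r normrN.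
  have jq := le_trans ler01 (jquad_ge1 p).
  have z2 : sqnorm p.2 <= 4 * jquad p.
    apply: (le_trans (sqnorm_le_expq _)); rewrite ler_wpM2l// /jquad ler_peMl ?quad_ge1//.
    exact: le_trans ler01 (expq_ge1 _).
  have z0 := enorm_ge0 p.2.
  have nz : Np p * enorm p.2 <= (Np p ^+ 2 + sqnorm p.2) / 2.
    by rewrite -sqr_enorm; have := sqr_ge0 (Np p - enorm p.2); lra.
  apply: (@le_trans _ _ (D * Np p * ((2 / rad t * `|u k|) * enorm p.2 + `|u k| * Np p))).
    by apply: (ler_wpM2l (mulr_ge0 D0 (Np_ge0 p))); rewrite lerD2r ler_wpM2r.
  rewrite (_ : _ * _ * (_ + _) = D * (2 / rad t * (Np p * enorm p.2) + Np p ^+ 2) * `|u k|); last by ring.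
  rewrite ler_wpM2r// /C -(mulrA D); apply: ler_wpM2l => //.
  rewrite [leRHS]mulrDl; apply: lerD; last exact: Np_sq.
  rewrite (_ : 1 / rad t * _ * _ = 2 / rad t * ((4 * (1 + rad eps) ^+ 2 * 15 + 4) * jquad p / 2)); last first.
    by field; rewrite gt_eqF.
  rewrite ler_wpM2l ?divr_ge0 ?(ltW b0)//; apply: (le_trans nz).
  by rewrite ler_wpM2r// (mulrDl (4 * (1 + rad eps) ^+ 2 * 15)); apply: lerD => //; exact: Np_sq.
have cQ p : Q k p @[k --> \oo] --> flow' t p.
  have := phi_path L0 M0 hf t0 (rL t0' te) (noisy_path p t0).
  rewrite addr0 => Dp.
  have := cvg_diff_quotient Dp uN cu.
  by under eq_fun do rewrite add0r !addr0.
have [dF cE] := expect_dct mj j0 ijq mQ bQ cQ.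
split => // k d k0 d0.
have EQ i : expect mm (joint rho) (Q i) = (energy (t + u i) - energy t) / u i.
  rewrite /energy -(@expectB _ _ _ _ _ (@jquad R n))//; [|exact: flow_dominated..].
  rewrite mulrC -(@expectZ _ _ _ _ _ (@jquad R n))//; last first.
    by apply: dominatedB; exact: flow_dominated.
  by congr expect; apply/funext => p; rewrite /Q mulrC.
have /cvgrPdist_le/(_ k k0) n1 := cE.
have /cvgrPdist_le/(_ d d0) n2 := cu.
have [i [h1 h2]] : exists i, `|expect mm (joint rho) (flow' t) - expect mm (joint rho) (Q i)| <= k /\ `|0 - u i| <= d.
  by have [i ?] := filter_ex (filterI n1 n2); exists i.
exists (- u i); rewrite sub0r normrN (ltr0_norm (u0 i)) in h2.
split => //.
- by rewrite oppr_gt0.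
- by have := ut i; lra.
have ui := u0 i.
move: h1; rewrite EQ ler_norml opprK => /andP[h1 _].
set F := expect mm (joint rho) (flow' t) in h1 *.
have : (energy (t + u i) - energy t) / u i <= F + k by lra.
rewrite ler_ndivrMr// => h3; lra.
Qed.

End energy.

(** * The dissipation inequality at a point *)

Section scalar.
Context {R : realType}.

(* Here G = |g| and P = |p| with g = s + p; the constants come from AM-GM on the
   cross terms and from [P^2 <= G^2 - 2 (tr + s.p) + (16/7) N L], where
   [tr + s.p] has mean zero by Stein's identity. *)
Lemma dissipation_scalar (N L M t al G P ss sp tr k1 k2 r3 gBp gBq jj ff : R) :
  1 <= N -> 0 <= L -> 0 <= M -> 0 <= t -> 0 <= al -> t * L <= 8^-1 -> al <= 5 / 4 * L ->
  0 <= G -> 0 <= P ->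
  ss + 2 * sp + P ^+ 2 = G ^+ 2 ->
  `|sp + P ^+ 2| <= G * P ->
  sp + P ^+ 2 - 8 / 7 * (t * L) * G * P <= gBp ->
  - (9 / 7 * N * M * t * G) <= gBq ->
  k1 - t * k2 = tr - t ^+ 2 * r3 -> `|r3| <= 8 / 7 * (N * L ^+ 3) ->
  tr <= 8 / 7 * (N * L) -> k2 <= N * L ^+ 2 ->
  jj <= (G + t * L * P) ^+ 2 ->
  ff <= - (t * P ^+ 2) + L / 2 * t ^+ 2 * P ^+ 2 ->
  - ss + (- gBp - gBq + (k1 - t * k2) + 3 / 2 * N * L ^+ 3 * t ^+ 2) + jj / 2 +
    al * (ff + (t * k1 - t ^+ 2 / 2 * k2 + N * L ^+ 3 / 2 * t ^+ 3)) <=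
  (1 + al * t - 26 * (t * L) ^+ 2) * (tr + sp) +
    34 * t ^+ 2 * (N * (L ^+ 3 + 9 * N ^+ 2 * M ^+ 2)).
Proof.
move=> N1 L0 M0 t0 al0 tL alL G0 P0 hG hgp hgBp hgBq hk hr3 htr hk2 hjj hff.
have N0 : 0 <= N by lra.
pose b := t * L; have b0 : 0 <= b by rewrite mulr_ge0.
pose v := b * P; have v0 : 0 <= v by rewrite mulr_ge0.
have hGP : 0 <= G * P by rewrite mulr_ge0.
move: hgp; rewrite ler_norml => /andP[hgp1 hgp2].
move: hr3; rewrite ler_norml => /andP[hr1 hr2].
have t20 : 0 <= t ^+ 2 by exact: sqr_ge0.
pose W := N * L ^+ 3 * t ^+ 2; have W0 : 0 <= W by rewrite !mulr_ge0// exprn_ge0.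
have alt0 : 0 <= al * t by rewrite mulr_ge0.
have alt : al * t <= 5 / 4 * b by rewrite /b (mulrC t) mulrA ler_wpM2r.
have e2 : - (t ^+ 2 * r3) <= 8 / 7 * W.
  have := ler_wpM2l t20 hr1; rewrite /W; lra.
have e3a : al * t * (t / 2 * k2) <= 5 / 8 * W.
  have h1 : al * t * (t / 2 * k2) <= al * t * (t / 2 * (N * L ^+ 2)).
    by rewrite ler_wpM2l// ler_wpM2l// divr_ge0.
  have h2 : al * t * (t / 2 * (N * L ^+ 2)) <= 5 / 4 * b * (t / 2 * (N * L ^+ 2)).
    by rewrite ler_wpM2r// !mulr_ge0// sqr_ge0.
  have -> : 5 / 8 * W = 5 / 4 * b * (t / 2 * (N * L ^+ 2)) by rewrite /W /b; field.
  exact: le_trans h2.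
have e3b : al * t * (- (t ^+ 2 * r3) + N * L ^+ 3 / 2 * t ^+ 2) <= 5 / 4 * 8^-1 * (8 / 7 + 2^-1) * W.
  have h1 : al * t * (- (t ^+ 2 * r3) + N * L ^+ 3 / 2 * t ^+ 2) <= al * t * ((8 / 7 + 2^-1) * W).
    by rewrite ler_wpM2l//; move: e2; rewrite /W; lra.
  have h2 : al * t * ((8 / 7 + 2^-1) * W) <= (5 / 4 * 8^-1) * ((8 / 7 + 2^-1) * W).
    apply: ler_wpM2r; first by apply: mulr_ge0 => //; lra.
    by move: tL alt; rewrite /b; lra.
  by apply: (le_trans h1); rewrite -[leRHS]mulrA.
have e3c : al * t * (G * P) <= 5 / 4 * (v * G).
  have := ler_wpM2r hGP alt; rewrite /v; lra.
have e3d : al * (L / 2 * t ^+ 2 * P ^+ 2) <= 5 / 8 * v ^+ 2.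
  have h : 0 <= L / 2 * t * P ^+ 2 by rewrite !mulr_ge0// sqr_ge0.
  have := ler_wpM2r h alt.
  have -> : al * t * (L / 2 * t * P ^+ 2) = al * (L / 2 * t ^+ 2 * P ^+ 2) by ring.
  by have -> : 5 / 4 * b * (L / 2 * t * P ^+ 2) = 5 / 8 * v ^+ 2 by rewrite /v /b; field.
have e3e : al * ff <= al * (- (t * P ^+ 2) + L / 2 * t ^+ 2 * P ^+ 2) by rewrite ler_wpM2l.
have e3f : - (al * t * (sp + P ^+ 2)) <= al * t * (G * P).
  by rewrite -mulrN ler_wpM2l// lerNl.
have e4 : jj / 2 <= G ^+ 2 / 2 + v * G + v ^+ 2 / 2.
  by move: hjj; rewrite -/b -/v; clear; lra.
(* [95 / 28 = 8 / 7 + 5 / 4 + 1] collects the cross terms [v * G] of [gB], [e3c] and [e4];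
   [9025 / 784] is its square. *)
have e5 : 95 / 28 * (v * G) <= G ^+ 2 / 4 + 9025 / 784 * v ^+ 2.
  have := sqr_ge0 (G / 2 - 95 / 28 * v); clear; lra.
have e6 : P ^+ 2 <= G ^+ 2 - 2 * (tr + sp) + 16 / 7 * (N * L).
  have := sqr_ge0 (G - P); clear -hgp1 hgp2 htr hG; lra.
(* The total coefficient of [v ^+ 2] is [9025 / 784 + 1 / 2 + 5 / 8 < 13]. Thirteen copies of this
   bound are used: they produce the 26 in front of [tr + sp], whose sign is unknown and which must
   therefore match exactly, and [13 * 16 / 7 < 30] of the final 34. *)
have e7 : v ^+ 2 <= b ^+ 2 * (G ^+ 2 - 2 * (tr + sp) + 16 / 7 * (N * L)).
  by rewrite /v exprMn ler_wpM2l// sqr_ge0.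
(* Thirteen copies cost [13 / 64]; with [1 / 4] from [e5] and [1 / 25] from [e9] they fit in the
   half of [G ^+ 2] that [e4] leaves. *)
have e8 : b ^+ 2 * G ^+ 2 <= 64^-1 * G ^+ 2.
  rewrite ler_wpM2r ?sqr_ge0//; have : b ^+ 2 <= (8^-1) ^+ 2 by rewrite ler_pXn2r ?nnegrE.
  lra.
have e9 : 9 / 7 * N * M * t * G <= G ^+ 2 / 25 + 2025 / 196 * (N * M * t) ^+ 2.
  have := sqr_ge0 (G / 5 - 45 / 14 * (N * M * t)); clear; lra.
have e10 : (N * M * t) ^+ 2 <= N ^+ 3 * M ^+ 2 * t ^+ 2.
  rewrite !exprMn ler_wpM2r ?sqr_ge0// ler_wpM2r ?sqr_ge0//.
  by rewrite exprS ler_peMl ?sqr_ge0.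
have e11 : 0 <= N ^+ 3 * M ^+ 2 * t ^+ 2 by rewrite !mulr_ge0// exprn_ge0.
have e12 : 0 <= v ^+ 2 by exact: sqr_ge0.
have e13 : b ^+ 2 * (N * L) = W by rewrite /b /W; ring.
have e14 : 0 <= G ^+ 2 by exact: sqr_ge0.
have gB : - gBp <= - (sp + P ^+ 2) + 8 / 7 * (v * G) by move: hgBp; rewrite /v /b; clear; lra.
have k1E : k1 = tr + t * k2 - t ^+ 2 * r3 by clear -hk; lra.
have lE : al * (ff + (t * k1 - t ^+ 2 / 2 * k2 + N * L ^+ 3 / 2 * t ^+ 3)) =
   al * ff + al * t * (tr + sp) - al * t * (sp + P ^+ 2) + al * (t * P ^+ 2) + al * t * (t / 2 * k2) +
   al * t * (- (t ^+ 2 * r3) + N * L ^+ 3 / 2 * t ^+ 2).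
  by rewrite k1E; field.
have RE : 34 * t ^+ 2 * (N * (L ^+ 3 + 9 * N ^+ 2 * M ^+ 2)) = 34 * W + 306 * (N ^+ 3 * M ^+ 2 * t ^+ 2).
  by rewrite /W; ring.
rewrite RE lE -/b.
have lam : (1 + al * t - 26 * b ^+ 2) * (tr + sp) = (tr + sp) + al * t * (tr + sp) - 26 * (b ^+ 2 * (tr + sp)) by ring.
rewrite lam.
have e7' : v ^+ 2 <= b ^+ 2 * G ^+ 2 - 2 * (b ^+ 2 * (tr + sp)) + 16 / 7 * W.
  by rewrite -e13; apply: (le_trans e7); rewrite le_eqVlt; apply/orP; left; apply/eqP; ring.
have e3e' : al * ff + al * (t * P ^+ 2) <= 5 / 8 * v ^+ 2.
  by clear -e3e e3d; lra.
have sE : ss = G ^+ 2 - 2 * sp - P ^+ 2 by clear -hG; lra.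
rewrite sE hk -/W.
have W3 : 3 / 2 * N * L ^+ 3 * t ^+ 2 = 3 / 2 * W by rewrite /W; ring.
rewrite W3.
move: e2 e3a e3b e3c e3e' e3f e4 e5 e7' e8 e9 e10 e11 e12 e14 gB hgBq W0.
(* The nonlinear monomials become variables; what remains is linear in them. *)
move: (al * t * (t / 2 * k2)) (al * t * (- (t ^+ 2 * r3) + N * L ^+ 3 / 2 * t ^+ 2)).
move: (al * t * (sp + P ^+ 2)) (al * t * (tr + sp)) (al * t * (G * P)) (al * ff) (al * (t * P ^+ 2)).
move: (b ^+ 2 * (tr + sp)) (b ^+ 2 * G ^+ 2) (t ^+ 2 * r3) (N ^+ 3 * M ^+ 2 * t ^+ 2) ((N * M * t) ^+ 2).
move: (9 / 7 * N * M * t * G) (v * G) (v ^+ 2) (G ^+ 2) (P ^+ 2).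
clear; move=> *; lra.
Qed.

End scalar.

Section pointwise.
Context {R : realType} (n : nat) (f : 'rV[R]_n -> R) (L M : R).
Hypotheses (n0 : (0 < n)%N) (L0 : 0 <= L) (M0 : 0 <= M) (hf : LM_smooth f L M).

(** The left side is the integrand of [H' + al H] once the log-Sobolev inequality has replaced [al]
    times the divergence by half the Fisher term; the last summand moves the energy from [y] to [x].
    The multiple of [\tr (B K) + s.p] on the right costs nothing after averaging. *)
Lemma dissipation_pointwise (t al : R) (x y s : 'rV[R]_n) :
  0 <= t -> t * L <= 8^-1 -> 0 <= al -> al <= 5 / 4 * L ->
  x + t *: grad f x = y ->
  let B := invmx (jacA f t x) in let p := grad f x in
  - sqnorm s + (dotv ((- s - p) *m B) (p + qvec f t x) + (trh f x - t * trh2 f x) +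
     3 / 2 * n%:R * L ^+ 3 * t ^+ 2) + sqnorm (s + grad f y) / 2 +
     al * (f x - f y + ell f L t x) <=
  (1 + al * t - 26 * (t * L) ^+ 2) * (\tr (B *m hesT f x) + dotv s p) +
    34 * t ^+ 2 * (n%:R * (L ^+ 3 + 9 * n%:R ^+ 2 * M ^+ 2)).
Proof.
move=> t0 tL al0 alL xy; cbv zeta.
set B := invmx _; set p := grad f x; set q := qvec f t x; set K := hesT f x.
have tL4 : t * L <= 4^-1 by lra.
have uA : jacA f t x \in unitmx by exact: (jacA_unit L0 hf).
have bB : opbound B (8 / 7) by exact: (jacA_inv_bound L0 hf).
have bK : opbound K L by exact: (hesT_bound L0 hf).
have c87 : 0 <= 8 / 7 :> R by lra.
set g := s + p.
have gE : - s - p = - g by rewrite /g opprD.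
rewrite gE mulNmx dotvNl dotvDr opprD.
have BE : g *m B = g - t *: (g *m B *m K).
  have : g *m B *m jacA f t x = g by rewrite mulmxKV.
  by rewrite /jacA mulmxDr mulmx1 -scalemxAr -/K => {2}<-; rewrite addrK.
have hdg : dotv g p = dotv s p + sqnorm p by rewrite /g dotvDl dotvv.
have gB1 : enorm (g *m B) <= 8 / 7 * enorm g by exact: bB.
have e0 := enorm_ge0 g; have p0 := enorm_ge0 p.
have hgBp : dotv s p + enorm p ^+ 2 - 8 / 7 * (t * L) * enorm g * enorm p <= dotv (g *m B) p.
  have -> : dotv (g *m B) p = dotv g p - t * dotv (g *m B *m K) p.
    by rewrite {1}BE dotvDl dotvNl dotvZl.
  rewrite sqr_enorm -hdg lerD2l lerN2.
  have h : dotv (g *m B *m K) p <= 8 / 7 * L * enorm g * enorm p.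
    apply: (le_trans (dotv_le _ _)); rewrite ler_wpM2r//; apply: (le_trans (bK _)).
    by rewrite (mulrC (8 / 7)) -!mulrA ler_wpM2l// mulrA.
  by have := ler_wpM2l t0 h; lra.
have hgBq : - (9 / 7 * n%:R * M * t * enorm g) <= dotv (g *m B) q.
  rewrite lerNl -dotvNl; apply: (le_trans (dotv_le _ _)); rewrite enormN.
  have hq := enorm_qvec L0 M0 hf x t0 tL.
  apply: (@le_trans _ _ ((8 / 7 * enorm g) * (9 / 8 * n%:R * M * t))).
    by apply: ler_pM => //; exact: enorm_ge0.
  by rewrite le_eqVlt; apply/orP; left; apply/eqP; field.
have iE := inv_1D_expand uA; rewrite -/B -/K in iE.
pose r3 := \tr (B *m (K *m (K *m K))).
have hk : trh f x - t * trh2 f x = \tr (B *m K) - t ^+ 2 * r3.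
  by rewrite iE !raddfD /= raddfN /= !linearZ /= /trh /trh2 -/K -/r3 /GRing.scale /=; ring.
have hr3 : `|r3| <= 8 / 7 * (n%:R * L ^+ 3).
  rewrite mulrCA; apply: opbound_trace.
  rewrite (_ : 8 / 7 * L ^+ 3 = 8 / 7 * (L * (L * L))); last by ring.
  have KK : opbound (K *m K) (L * L) by exact: opboundM.
  apply: opboundM => //; first by rewrite !mulr_ge0.
  by apply: opboundM => //; rewrite mulr_ge0.
have htr : \tr (B *m K) <= 8 / 7 * (n%:R * L).
  apply: (le_trans (ler_norm _)); rewrite mulrCA; apply: opbound_trace.
  exact: opboundM.
have hk2 : trh2 f x <= n%:R * L ^+ 2 by apply: (le_trans (ler_norm _)); exact: (trh2_le L0 hf).
have xyd : y = x + t *: p by [].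
have hjj : sqnorm (s + grad f y) <= (enorm g + t * L * enorm p) ^+ 2.
  rewrite -sqr_enorm ler_pXn2r ?nnegrE ?enorm_ge0// ?addr_ge0// ?mulr_ge0//.
  rewrite (_ : s + grad f y = g + (grad f y - p)); last by rewrite /g addrA addrAC addrK.
  apply: (le_trans (enormD _ _)); rewrite lerD2l; apply: (le_trans (grad_lip L0 hf _ _)).
  by rewrite xyd addrC addKr enormZ ger0_norm// mulrCA mulrA.
have hff : f x - f y <= - (t * enorm p ^+ 2) + L / 2 * t ^+ 2 * enorm p ^+ 2.
  have := f_lower L0 hf x (t *: p); rewrite -xyd dotvZl dotvv sqnormZ sqr_enorm; lra.
have n1 : 1 <= n%:R :> R by rewrite ler1n.
have := @dissipation_scalar R n%:R L M t al (enorm g) (enorm p) (sqnorm s) (dotv s p)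
  (\tr (B *m K)) (trh f x) (trh2 f x) r3 (dotv (g *m B) p) (dotv (g *m B) q)
  (sqnorm (s + grad f y)) (f x - f y) n1 L0 M0 t0 al0 tL alL e0 p0.
apply => //.
- by rewrite !sqr_enorm /g sqnormD.
- by rewrite sqr_enorm -hdg; exact: normr_dotv.
Qed.

End pointwise.

(** * Averages under the noisy law *)

Section averages.
Context {R : realType} (n : nat) (f : 'rV[R]_n -> R) (L M : R).
Hypotheses (n0 : (0 < n)%N) (L0 : 0 <= L) (M0 : 0 <= M) (hf : LM_smooth f L M).
Variable rho : 'rV[R]_n -> R.
Hypothesis drho : density rho.
Variable t : R.
Hypotheses (t0 : 0 < t) (tL : t * L <= 8^-1).
Local Notation mu := (lebesgue_rV n).
Local Notation mm := (mu \x mu)%E.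
Local Notation c := (rad t).
Local Notation sig := (heat rho c).
Local Notation post := (posterior rho c).
Local Notation X := (prox_map f t).
Local Notation B y := (invmx (jacA f t (X y))).
Local Notation gp y := (grad f (X y)).

Let c0 : 0 < c.
Proof. exact: rad_gt0. Qed.
Let t0' : 0 <= t.
Proof. exact: ltW. Qed.
Let tL4 : t * L <= 4^-1.
Proof. by apply: (le_trans tL); lra. Qed.

Let mj := measurable_joint drho.
Let j0 := joint_ge0 drho.
Let ijq := integrable_jquad drho.
Let jq1 := @jquad_ge1 R n.
Let dsig := heat_density drho c0.
Let isq := density_quad dsig.
Let sig0 := density_ge0 dsig.
Let msig : measurable_fun setT sig.
Proof. by apply: continuous_measurable_rV; exact: density_cts dsig. Qed.

Let mX : measurable_fun setT X.
Proof.
apply: measurable_fun_rV => i; apply: continuous_measurable_rV.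
exact: (continuous_prox_map L0 hf).
Qed.

Let ctsX (F : 'rV[R]_n -> R) : continuous F -> continuous (fun y => F (X y)).
Proof. exact: (cts_prox_map L0 hf). Qed.

Lemma enorm_grad_prox : exists C, 0 <= C /\ forall y, enorm (gp y) <= C * (1 + enorm y).
Proof.
pose g0 := enorm (grad f 0); have g00 : 0 <= g0 by exact: enorm_ge0.
pose D := 4 / 3 * (1 + t * g0).
have D0 : 0 <= D by rewrite mulr_ge0// addr_ge0// mulr_ge0.
exists (g0 + L * D); split; first by rewrite addr_ge0// mulr_ge0.
move=> y; have y0 := enorm_ge0 y.
apply: (le_trans (grad_growth L0 hf _)); rewrite -/g0 mulrDl; apply: lerD.
  by rewrite ler_peMr// lerDl.
rewrite -mulrA ler_wpM2l//; apply: (le_trans (prox_map_growth L0 hf _ t0' tL4)); rewrite -/g0.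
rewrite /D -(mulrA (4 / 3)); apply: ler_wpM2l; first lra.
have := mulr_ge0 (mulr_ge0 t0' g00) y0; lra.
Qed.

Lemma grad_prox_growth i : linear_growth (fun y => gp y ord0 i).
Proof.
split; first by apply: continuous_measurable_rV; apply: (ctsX (F := fun x => grad f x ord0 i)); exact: (grad_coord_cts L0 hf).
have [C [C0 hC]] := enorm_grad_prox; exists C => y.
exact: le_trans (coord_le_enorm _ _) (hC y).
Qed.

(** The vector that [flow'] pairs with the velocity [Z / c - grad f x], the inverse Jacobian being
    moved onto it by transposition. *)
Definition drift y : 'rV[R]_n := (gp y + qvec f t (X y)) *m (B y)^T.

Lemma drift_growth i : linear_growth (fun y => drift y ord0 i).
Proof.
split.
  have mq j : measurable_fun setT (fun y => qvec f t (X y) ord0 j).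
    have -> : (fun y => qvec f t (X y) ord0 j) = (fun x => t * partial j (trh f) x - t ^+ 2 / 2 * partial j (trh2 f) x) \o X.
      by apply/funext => y /=; rewrite /qvec rV_coordB [in X in X - _]mxE [in X in _ - X]mxE ![grad _ _ _ _]mxE.
    apply: measurableT_comp => //.
    apply: measurable_funB; apply: measurable_funM => //; apply: measurable_partial => x.
      exact: (trh_diff hf).
    exact: (trh2_diff hf).
  have mB j : measurable_fun setT (fun y => B y i j).
    apply: continuous_measurable_rV; apply: (ctsX (F := fun x => invmx (jacA f t x) i j)).
    exact: (continuous_jacA_inv L0 M0 hf).
  have -> : (fun y => drift y ord0 i) = (fun y => \sum_j (gp y ord0 j + qvec f t (X y) ord0 j) * B y i j).
    apply/funext => y; rewrite /drift [LHS]mxE; apply: eq_bigr => j _.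
    by rewrite [in X in X * _]mxE [in X in _ * X]mxE.
  apply: measurable_sum => j; apply: measurable_funM => //.
  by apply: measurable_funD => //; case: (grad_prox_growth j).
have [C [C0 hC]] := enorm_grad_prox.
exists (8 / 7 * (C + 9 / 8 * n%:R * M * t)) => y; have y0 := enorm_ge0 y.
apply: (le_trans (coord_le_enorm _ _)).
have c87 : 0 <= 8 / 7 :> R by lra.
apply: (le_trans (opbound_trmx c87 (jacA_inv_bound L0 hf (X y) t0' tL) _)).
rewrite -(mulrA (8 / 7)) ler_wpM2l//; apply: (le_trans (enormD _ _)); rewrite mulrDl.
apply: lerD => //; apply: (le_trans (enorm_qvec L0 M0 hf _ t0' tL)).
by rewrite ler_peMr ?lerDl// !mulr_ge0//; lra.
Qed.

Definition rest y : R := - dotv (gp y) (drift y) + (trh f (X y) - t * trh2 f (X y)) +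
  3 / 2 * n%:R * L ^+ 3 * t ^+ 2.

Let quad1 := @quad_ge1 R n.

Lemma trace_dominated : dominated (@quad R n) (fun y => trh f (X y) - t * trh2 f (X y)).
Proof.
apply: dominatedB.
  apply: (bounded_dominated (C := n%:R * L)).
    by apply: ctsX; exact: (trh_cts hf).
  by move=> y; exact: (trh_le L0 hf).
apply: dominatedZ; apply: (bounded_dominated (C := n%:R * L ^+ 2)).
  by apply: ctsX; exact: (trh2_cts hf).
by move=> y; exact: (trh2_le L0 hf).
Qed.

Lemma rest_dominated : dominated (@quad R n) rest.
Proof.
apply: dominatedD; last exact: dominatedC.
apply: dominatedD; last exact: trace_dominated.
apply: dominatedN; apply: dominated_sum => // i.
by apply: linear_growth_mul; [exact: grad_prox_growth|exact: drift_growth].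
Qed.

(* The score of [sig]. *)
Definition score y : 'rV[R]_n := - (c^-1 *: post y).

(** Conditional expectation of [flow'] given the output: the noise enters linearly, so [Z / c]
    becomes [posterior / c], that is [- score]. *)
Definition slope y : R := dotv ((- score y - gp y) *m B y) (gp y + qvec f t (X y)) +
  (trh f (X y) - t * trh2 f (X y)) + 3 / 2 * n%:R * L ^+ 3 * t ^+ 2.

Lemma slopeE y : slope y = \sum_i c^-1 * (drift y ord0 i * post y ord0 i) + rest y.
Proof.
rewrite /slope /rest dotv_trmx -/(drift y) /score opprK dotvDl dotvNl dotvZl.
rewrite -mulr_sumr (_ : dotv (post y) (drift y) = \sum_i drift y ord0 i * post y ord0 i); last first.
  by apply: eq_bigr => i _; rewrite mulrC.
by ring.
Qed.

Lemma flow'E p : flow' f L t p = \sum_i c^-1 * (drift (noisy c p) ord0 i * p.2 ord0 i) + rest (noisy c p).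
Proof.
rewrite /flow' /rest; cbv zeta; set y := noisy c p.
rewrite dotv_trmx -/(drift y) dotvDl dotvNl dotvZl.
rewrite -mulr_sumr (_ : dotv p.2 (drift y) = \sum_i drift y ord0 i * p.2 ord0 i); last first.
  by apply: eq_bigr => i _; rewrite mulrC.
by ring.
Qed.

Lemma drift_post_dominated i : dominated (@quad R n) (fun y => c^-1 * (drift y ord0 i * post y ord0 i)).
Proof.
apply: dominatedZ; apply: linear_growth_mul; first exact: drift_growth.
exact: posterior_linear_growth.
Qed.

Lemma slope_dominated : dominated (@quad R n) slope.
Proof.
rewrite (_ : slope = (fun y => \sum_i c^-1 * (drift y ord0 i * post y ord0 i) + rest y)); last first.
  by apply/funext => y; exact: slopeE.
apply: dominatedD; last exact: rest_dominated.
by apply: dominated_sum => // i; exact: drift_post_dominated.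
Qed.

Lemma expect_flow' : expect mm (joint rho) (flow' f L t) = expect mu sig slope.
Proof.
rewrite (_ : slope = (fun y => \sum_i c^-1 * (drift y ord0 i * post y ord0 i) + rest y)); last first.
  by apply/funext => y; exact: slopeE.
rewrite (_ : flow' f L t = (fun p => \sum_i c^-1 * (drift (noisy c p) ord0 i * p.2 ord0 i) + rest (noisy c p))); last first.
  by apply/funext => p; exact: flow'E.
have d1 i := linear_growth_coord_dominated c i (drift_growth i).
have d2 i := dominatedZ c^-1 (d1 i).
have d3 := dominated_noisy c rest_dominated.
have ds : dominated (@jquad R n) (fun p => \sum_i c^-1 * (drift (noisy c p) ord0 i * p.2 ord0 i)).
  exact: dominated_sum.
have d4 i := drift_post_dominated i; have d5 := rest_dominated.
have d6 : dominated (@quad R n) (fun y => \sum_i c^-1 * (drift y ord0 i * post y ord0 i)).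
  by apply: dominated_sum => // i; exact: drift_post_dominated.
transitivity (\sum_i expect mm (joint rho) (fun p => c^-1 * (drift (noisy c p) ord0 i * p.2 ord0 i)) +
    expect mm (joint rho) (fun p => rest (noisy c p))).
  rewrite -(@expect_sum _ _ _ _ _ (@jquad R n))//; exact: (expectD mj ijq ds d3).
transitivity (\sum_i expect mu sig (fun y => c^-1 * (drift y ord0 i * post y ord0 i)) +
    expect mu sig rest); last first.
  apply: esym; apply: (etrans (expectD msig isq d6 d5)); congr (_ + _).
  have := expect_sum msig quad1 isq (index_enum 'I_n) xpredT d4.
  by apply.
have eR := expect_noisy drho c0 rest_dominated.
apply: (congr2 +%R); last exact: eR.
apply: eq_bigr => i _.
have dg : dominated (@quad R n) (fun y => drift y ord0 i * post y ord0 i).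
  by apply: linear_growth_mul; [exact: drift_growth|exact: posterior_linear_growth].
transitivity (c^-1 * expect mm (joint rho) (fun p => drift (noisy c p) ord0 i * p.2 ord0 i)).
  exact: (expectZ mj ijq _ (d1 i)).
rewrite (expect_noisy_coord drho c0 _ (drift_growth i)).
apply: esym; exact: (expectZ msig isq _ dg).
Qed.

Lemma prox_grad_derive y i : is_derive (0 : R) (1 : R)
  (fun h => gp (y + h *: evec R i) ord0 i) ((B y *m hesT f (X y)) i i).
Proof.
have dY : path_derive (fun h => y + h *: evec R i) (evec R i).
  move=> e e0; exists 1; split => // h _; rewrite scale0r addr0.
  rewrite (_ : _ - _ - _ = 0); first by rewrite enorm0 mulr_ge0// ltW.
  by apply/rowP => j; rewrite !mxE; ring.
have dX := prox_map_path L0 M0 hf 0 t0 tL dY.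
rewrite !scale0r subr0 addr0 in dX.
have D := @path_derive_comp _ _ (partial i f) _ _ ltac:(exact: (partial_diff hf)) dX.
rewrite /= mul0r !addr0 scale0r addr0 in D.
rewrite (_ : (fun h => _) = (fun h => partial i f (prox_map f (t + 0 * h) (y + h *: evec R i)))); last first.
  by apply/funext => h; rewrite mul0r addr0 [LHS]mxE.
apply: is_derive_eq D _; rewrite derive_grad; last exact: (partial_diff hf).
have -> : (B y *m hesT f (X y)) i i = (evec R i *m B y *m hesT f (X y)) ord0 i.
  by rewrite -mulmxA evec_mulmx [RHS]mxE.
by rewrite [RHS]mxE /dotv; apply: eq_bigr => j _; congr (_ * _); rewrite !mxE.
Qed.

(** The divergence of the field [y |-> grad f (X y)], by [prox_grad_derive]. *)
Definition itrace y : R := \tr (B y *m hesT f (X y)).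

Lemma BK_dominated i : dominated (@quad R n) (fun y => (B y *m hesT f (X y)) i i).
Proof.
apply: (bounded_dominated (C := 8 / 7 * L)).
  have -> : (fun y => (B y *m hesT f (X y)) i i) = (fun y => \sum_j B y i j * hesT f (X y) j i).
    by apply/funext => y; rewrite mxE.
  apply: continuous_sum => j; apply: ctsM.
    by apply: (ctsX (F := fun x => invmx (jacA f t x) i j)); exact: (continuous_jacA_inv L0 M0 hf).
  by apply: (ctsX (F := fun x => hesT f x j i)); exact: (hesT_cts M0 hf).
move=> y; apply: opbound_entry; apply: opboundM => //.
  exact: (jacA_inv_bound L0 hf).
exact: (hesT_bound L0 hf).
Qed.

Lemma score_grad_dominated : dominated (@quad R n) (fun y => dotv (score y) (gp y)).
Proof.
have -> : (fun y => dotv (score y) (gp y)) = (fun y => \sum_i - c^-1 * (gp y ord0 i * post y ord0 i)).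
  apply/funext => y; rewrite /score dotvNl dotvZl -mulr_sumr mulNr; congr (- (_ * _)).
  by apply: eq_bigr => i _; rewrite mulrC.
apply: dominated_sum => // i; apply: dominatedZ; apply: linear_growth_mul.
  exact: grad_prox_growth.
exact: posterior_linear_growth.
Qed.

Lemma itrace_dominated : dominated (@quad R n) itrace.
Proof. by apply: dominated_sum => // i; exact: BK_dominated. Qed.

(** Integrates that divergence by parts against [sig]: [stein] is applied to each coordinate, with
    the noise replaced by its posterior mean. *)
Lemma expect_stein : expect mu sig (fun y => itrace y + dotv (score y) (gp y)) = 0.
Proof.
have S i : expect mu sig (fun y => gp y ord0 i * post y ord0 i) =
    c * expect mu sig (fun y => (B y *m hesT f (X y)) i i).
  rewrite -(expect_noisy_coord drho c0 _ (grad_prox_growth i)) -(expect_noisy drho c0 (BK_dominated i)).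
  apply: (@stein _ _ _ drho _ c0 (fun y => gp y ord0 i) (fun y => (B y *m hesT f (X y)) i i) i (4 / 3 * L)).
  - by apply: (ctsX (F := fun x => grad f x ord0 i)); exact: (grad_coord_cts L0 hf).
  - by case: (grad_prox_growth i).
  - move=> y h; rewrite -rV_coordB (le_trans (coord_le_enorm _ _))//.
    apply: (le_trans (grad_lip L0 hf _ _)); rewrite (mulrC (4 / 3)) -mulrA ler_wpM2l//.
    apply: (le_trans (prox_map_lip L0 hf _ _ t0' tL4 t0' tL4)).
    by rewrite subrr normr0 mul0r addr0 addrC addKr enormZ enorm_evec mulr1.
  - by move=> y; exact: prox_grad_derive.
rewrite (@expectD _ _ _ _ _ (@quad R n))//; [|exact: itrace_dominated|exact: score_grad_dominated].
have -> : (fun y => dotv (score y) (gp y)) = (fun y => \sum_i - c^-1 * (gp y ord0 i * post y ord0 i)).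
  apply/funext => y; rewrite /score dotvNl dotvZl -mulr_sumr mulNr; congr (- (_ * _)).
  by apply: eq_bigr => i _; rewrite mulrC.
have dgp i : dominated (@quad R n) (fun y => gp y ord0 i * post y ord0 i).
  by apply: linear_growth_mul; [exact: grad_prox_growth|exact: posterior_linear_growth].
have dz i := dominatedZ (- c^-1) (dgp i).
have dB i := BK_dominated i.
rewrite /itrace /mxtrace !(@expect_sum _ _ _ _ _ (@quad R n))//.
rewrite -big_split /= big1// => i _.
by rewrite (@expectZ _ _ _ _ _ (@quad R n))// S mulNr mulKf ?subrr// gt_eqF.
Qed.

Lemma sqnorm_score y : sqnorm (score y) = (2 * t)^-1 * sqnorm (post y).
Proof. by rewrite sqnormN sqnormZ exprVn sqr_rad. Qed.

Lemma sqnorm_score_dominated : dominated (@quad R n) (fun y => sqnorm (score y)).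
Proof.
under eq_fun do rewrite sqnorm_score.
apply: dominatedZ; exact: sqnorm_posterior_dominated.
Qed.

Lemma grad_growth_coord i : linear_growth (fun y => grad f y ord0 i).
Proof.
split; first by apply: continuous_measurable_rV; exact: (grad_coord_cts L0 hf).
exists (enorm (grad f 0) + L) => y.
apply: (le_trans (coord_le_enorm _ _)); apply: (le_trans (grad_growth L0 hf _)).
set g := enorm (grad f 0); have g0 : 0 <= g by exact: enorm_ge0.
by rewrite mulrDl; apply: lerD; [rewrite ler_peMr// lerDl enorm_ge0|rewrite ler_wpM2l// lerDr].
Qed.

Lemma sqnorm_fisher_dominated : dominated (@quad R n) (fun y => sqnorm (score y + grad f y)).
Proof.
have lg i : linear_growth (fun y => (score y + grad f y) ord0 i).
  have [m1 [C1 h1]] := posterior_linear_growth drho c0 i; have [m2 [C2 h2]] := grad_growth_coord i.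
  have E y : (score y + grad f y) ord0 i = - (c^-1 * post y ord0 i) + grad f y ord0 i.
    by rewrite [LHS]mxE; congr (_ + _); rewrite /score [LHS]mxE [in LHS]mxE.
  split.
    under eq_fun do rewrite E.
    by apply: measurable_funD => //; apply: measurable_funN; apply: measurable_funM.
  exists (c^-1 * C1 + C2) => y; rewrite E (le_trans (ler_normD _ _))// mulrDl; apply: lerD => //.
  by rewrite normrN normrM ger0_norm ?invr_ge0 ?(ltW c0)// -mulrA ler_wpM2l// invr_ge0 ltW.
apply: dominated_sum => // i; have := linear_growth_mul (lg i) (lg i).
by congr dominated; apply/funext => y; rewrite expr2.
Qed.

Lemma phi_dominated : dominated (@quad R n) (phi f L t).
Proof.
have [C [C0 hC]] := phi_growth L0 M0 hf t0' tL4.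
apply: (cts_dominated (C := C)); first exact: (phi_cts L0 hf).
by move=> y; exact: hC.
Qed.

Lemma f_dominated : dominated (@quad R n) f.
Proof.
have [C [C0 hC]] := f_growth L0 hf.
by apply: (cts_dominated (C := C)) => //; exact: (f_cts hf).
Qed.

(** Integrates [dissipation_pointwise] against [sig]. The Stein term drops out, and the log-Sobolev
    hypothesis supplies the half Fisher term that the pointwise bound absorbs. *)
Lemma dissipation (al : R) : 0 < al -> al <= 5 / 4 * L ->
  expect mu sig (fun y => ln (sig y) + f y) <=
    (2 * al)^-1 * expect mu sig (fun y => sqnorm (score y + grad f y)) ->
  - expect mu sig (fun y => sqnorm (score y)) + expect mm (joint rho) (flow' f L t) +
    al * (expect mu sig (fun y => ln (sig y)) + energy f L rho t) <=
  34 * t ^+ 2 * (n%:R * (L ^+ 3 + 9 * n%:R ^+ 2 * M ^+ 2)).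
Proof.
move=> al0 alL lsi.
have dln := ln_heat_dominated drho c0.
have d1 := sqnorm_score_dominated; have d2 := slope_dominated.
have d3 := sqnorm_fisher_dominated; have d4 := phi_dominated; have d5 := f_dominated.
have d6 := itrace_dominated; have d7 := score_grad_dominated.
rewrite expect_flow'.
have -> : energy f L rho t = expect mu sig (phi f L t) by exact: (expect_noisy drho c0 d4).
move: lsi; rewrite (@expectD _ _ _ _ _ (@quad R n))// => lsi.
have lsi' : al * (expect mu sig (fun y => ln (sig y)) + expect mu sig f) <=
    2^-1 * expect mu sig (fun y => sqnorm (score y + grad f y)).
  have := ler_wpM2l (ltW al0) lsi; rewrite invfM mulrA (mulrCA al) mulfV ?mulr1//.
  by rewrite gt_eqF.
set lam := 1 + al * t - 26 * (t * L) ^+ 2.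
set K := 34 * _ * _.
have dd1 : dominated (@quad R n) (fun y => - sqnorm (score y) + slope y + 2^-1 * sqnorm (score y + grad f y) +
   al * (phi f L t y - f y)).
  apply: dominatedD; last by apply: dominatedZ; exact: dominatedB.
  apply: dominatedD; last exact: dominatedZ.
  by apply: dominatedD => //; exact: dominatedN.
have dd2 : dominated (@quad R n) (fun y => lam * (itrace y + dotv (score y) (gp y)) + K).
  by apply: dominatedD; [apply: dominatedZ; exact: dominatedD|exact: dominatedC].
have := expect_le msig sig0 isq dd1 dd2.
rewrite (@expectD _ _ _ _ _ (@quad R n))//; last 2 first.
- by apply: dominatedD; [apply: dominatedD => //; exact: dominatedN|exact: dominatedZ].
- by apply: dominatedZ; exact: dominatedB.
rewrite (@expectD _ _ _ _ _ (@quad R n))//; last 2 first.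
- by apply: dominatedD => //; exact: dominatedN.
- exact: dominatedZ.
rewrite (@expectD _ _ _ _ _ (@quad R n))//; last exact: dominatedN.
rewrite (@expectN _ _ _ _ _ (@quad R n))//.
rewrite (@expectZ _ _ _ _ _ (@quad R n) msig isq 2^-1)//.
rewrite (@expectZ _ _ _ _ _ (@quad R n) msig isq al)//; last exact: dominatedB.
rewrite (@expectB _ _ _ _ _ (@quad R n))//.
rewrite (@expectD _ _ _ _ _ (@quad R n) msig isq (fun y => lam * _))//; last 2 first.
- by apply: dominatedZ; exact: dominatedD.
- exact: dominatedC.
rewrite (@expectZ _ _ _ _ _ (@quad R n) msig isq lam)//; last exact: dominatedD.
rewrite expect_stein mulr0 add0r (expect_cst dsig).
move=> H.
have {}H := H _.
suff PW : forall y, - sqnorm (score y) + slope y + 2^-1 * sqnorm (score y + grad f y) +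
   al * (phi f L t y - f y) <= lam * (itrace y + dotv (score y) (gp y)) + K.
  have := H PW; lra.
move=> y; have := dissipation_pointwise n0 L0 M0 hf (score y) t0' tL (ltW al0) alL (prox_mapP L0 hf y t0' tL4).
cbv zeta; rewrite -/(slope y) -/(itrace y) -/lam -/K.
rewrite (_ : phi f L t y - f y = f (X y) - f y + ell f L t (X y)); last by rewrite /phi; ring.
by rewrite (mulrC 2^-1).
Qed.

End averages.

(** * The log-Sobolev inequality in real-valued form *)

Section real_valued.
Context {R : realType}.

Lemma expect_EFin d (T : measurableType d) (m : {measure set T -> \bar R}) (w q F : T -> R) :
  measurable_fun setT w -> (forall x, 0 <= w x) ->
  m.-integrable setT (fun x => (q x * w x)%:E) -> dominated q F ->
  (\int[m]_x (F x * w x)%:E)%E = (expect m w F)%:E.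
Proof.
move=> mw w0 iqw dF; rewrite /expect /Rintegral fineK//; apply: integrable_fin_num => //.
exact: (@dominated_integrable _ _ _ _ w q).
Qed.

Lemma integral_RnE n (g : 'rV[R]_n -> R) : measurable_fun setT g ->
  integral_Rn g = (\int[lebesgue_rV n]_x (g x)%:E)%E.
Proof.
move=> mg; rewrite /integral_Rn !iintE; last 4 first.
- apply/measurable_EFinP; apply: measurable_maxr => //; exact: measurable_funN.
- by move=> x; rewrite lee_fin le_max lexx orbT.
- by apply/measurable_EFinP; apply: measurable_maxr.
- by move=> x; rewrite lee_fin le_max lexx orbT.
rewrite [RHS]integralE; congr (_ - _)%E; apply: eq_integral => x _.
  by rewrite funeposE EFin_max.
by rewrite funenegE EFin_max EFinN.
Qed.

End real_valued.

Section log_sobolev.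
Context {R : realType} (n : nat) (f : 'rV[R]_n -> R) (L M : R).
Hypotheses (L0 : 0 <= L) (hf : LM_smooth f L M).
Local Notation mu := (lebesgue_rV n).
Local Notation nu := (fun x => expR (- f x)).

Lemma ln_ratio (sigma : 'rV[R]_n -> R) y : 0 < sigma y -> ln (sigma y / nu y) = ln (sigma y) + f y.
Proof. by move=> s0; rewrite ln_div ?posrE ?expR_gt0// expRK opprK. Qed.

Lemma partial_ln_ratio (sigma : 'rV[R]_n -> R) i x : (forall y, 0 < sigma y) ->
  differentiable sigma x ->
  partial i (fun y => ln (sigma y / nu y)) x = partial i sigma x / sigma x + partial i f x.
Proof.
move=> s0 ds.
have -> : (fun y => ln (sigma y / nu y)) = (fun y => ln (sigma y) + f y).
  by apply/funext => y; exact: ln_ratio.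
have [d1 e1] := chain_real ds (is_derive1_ln (s0 x)).
have [_ e2] := differentiable_add d1 (f_diff hf x).
by rewrite /partial e2 e1 mulrC.
Qed.

Let f_dom : dominated (@quad R n) f.
Proof.
have [C [C0 hC]] := f_growth L0 hf.
by apply: (cts_dominated (C := C)) => //; exact: (f_cts hf).
Qed.

(** Trades extended iterated integrals for real expectations. The score [s] is given by its defining
    equation, so that both the heat flow and translated Gaussians fit. *)
Lemma LSI_density (al : R) (sigma : 'rV[R]_n -> R) (s : 'rV[R]_n -> 'rV[R]_n) :
  LSI nu al -> density sigma -> smooth sigma -> (forall y, 0 < sigma y) ->
  (forall y i, partial i sigma y = s y ord0 i * sigma y) ->
  dominated (@quad R n) (fun y => ln (sigma y)) ->
  dominated (@quad R n) (fun y => sqnorm (s y + grad f y)) ->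
  expect mu sigma (fun y => ln (sigma y) + f y) <=
    (2 * al)^-1 * expect mu sigma (fun y => sqnorm (s y + grad f y)).
Proof.
move=> lsi dsig ssig sig0 score dln dfi.
have msig : measurable_fun setT sigma by apply: continuous_measurable_rV; exact: density_cts dsig.
have sge0 := density_ge0 dsig; have iq := density_quad dsig.
have dsq := @sqnorm_dominated R n.
have dl := dominatedD dln f_dom.
have pd : prob_density sigma.
  split => //; rewrite iintE; [exact: density_int1 dsig|exact/measurable_EFinP|].
  by move=> x; rewrite lee_fin.
have fs : finite_second_moment sigma.
  rewrite /finite_second_moment iintE.
  - by rewrite (expect_EFin msig sge0 iq dsq) ltry.
  - by apply/measurable_EFinP; apply: measurable_funM => //; exact: dsq.1.
  - by move=> x; rewrite lee_fin mulr_ge0// sqnorm_ge0.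
have := lsi sigma ssig pd fs.
have gE y : grad (fun y => ln (sigma y / nu y)) y = s y + grad f y.
  apply/rowP => i; rewrite [LHS]mxE [RHS]mxE [grad f y ord0 i]mxE.
  by rewrite partial_ln_ratio// ?score ?mulfK ?gt_eqF//; exact: (ssig [::] y).
have -> : KL nu sigma = (expect mu sigma (fun y => ln (sigma y) + f y))%:E.
  rewrite -(expect_EFin msig sge0 iq dl) /KL integral_RnE; last first.
    under eq_fun do rewrite ln_ratio//.
    by apply: measurable_funM => //; exact: dl.1.
  by apply: eq_integral => y _; rewrite ln_ratio// mulrC.
have -> : Fisher nu sigma = (expect mu sigma (fun y => sqnorm (s y + grad f y)))%:E.
  rewrite -(expect_EFin msig sge0 iq dfi) /Fisher.
  rewrite (_ : (fun x => _) = (fun x => (sqnorm (s x + grad f x) * sigma x)%:E)); last first.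
    by apply/funext => y; rewrite gE mulrC.
  rewrite iintE//.
  - by apply/measurable_EFinP; apply: measurable_funM => //; exact: dfi.1.
  - by move=> x; rewrite lee_fin mulr_ge0// sqnorm_ge0.
by rewrite -EFinM lee_fin.
Qed.

End log_sobolev.

(** * Translated Gaussians as test densities *)

Section shifted_gaussian.
Context {R : realType} (n : nat).
Local Notation mu := (lebesgue_rV n).
Local Notation g := (@gauss R n).
Implicit Types (a x z : 'rV[R]_n).

Lemma gaussN (z : 'rV[R]_n) : gauss (- z) = gauss z.
Proof. by rewrite /gauss sqnormN. Qed.

Lemma gauss_heat_kernel : heat_kernel 1 = g.
Proof. by apply/funext => w; rewrite /heat_kernel invr1 expr1n mul1r scale1r. Qed.

Let mg := @measurable_gauss R n.
Let g0 := @gauss_ge0 R n.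

Lemma integrable_expq_gauss : mu.-integrable setT (fun z => (expq z * g z)%:E).
Proof.
apply/integrableP; split.
  by apply/measurable_EFinP; apply: measurable_funM => //; exact: measurable_expq.
under eq_integral do rewrite gee0_abs ?lee_fin ?mulr_ge0 ?gauss_ge0 ?expR_ge0//.
by rewrite integral_expq_gauss ltry.
Qed.

Let ieg := integrable_expq_gauss.
Let eq1 := @expq_ge1 R n.

Lemma quad_shift_le (z a : 'rV[R]_n) : quad (z + a) <= 2 * quad a * quad z.
Proof.
rewrite /quad; have := sqnormDle z a; have := mulr_ge0 (sqnorm_ge0 z) (sqnorm_ge0 a).
have := sqnorm_ge0 z; have := sqnorm_ge0 a; lra.
Qed.

Lemma continuous_comp_shift (F : 'rV[R]_n -> R) a :
  continuous F -> continuous (fun z : 'rV[R]_n => F (z + a)).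
Proof.
move=> cF.
have -> : (fun z : 'rV[R]_n => F (z + a)) = (fun z => (fun w => F (- w)) (- a - z)).
  by apply/funext => z; rewrite opprD !opprK addrC.
apply: (@continuous_comp_rsub _ _ (fun w => F (- w))).
have -> : (fun w : 'rV[R]_n => F (- w)) = (fun w => F (0 - w)) by apply/funext => w; rewrite sub0r.
exact: continuous_comp_rsub.
Qed.

Lemma dominated_quad_expq (F : 'rV[R]_n -> R) C : continuous F -> (forall z, `|F z| <= C * quad z) ->
  dominated (@expq R n) F.
Proof.
move=> cF hC; split; first exact: continuous_measurable_rV.
have C0 : 0 <= C.
  by have := le_trans (normr_ge0 _) (hC 0); rewrite /quad sqnorm0 addr0 mulr1.
by exists (C * 5) => z; apply: (le_trans (hC z)); rewrite -mulrA ler_wpM2l// quad_le_expq.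
Qed.

Lemma dominated_shift (F : 'rV[R]_n -> R) C a : continuous F -> (forall z, `|F z| <= C * quad z) ->
  dominated (@expq R n) (fun z => F (z + a)).
Proof.
move=> cF hC.
have C0 : 0 <= C.
  by have := le_trans (normr_ge0 _) (hC 0); rewrite /quad sqnorm0 addr0 mulr1.
apply: (@dominated_quad_expq _ (C * (2 * quad a))); first exact: continuous_comp_shift.
by move=> z; apply: (le_trans (hC _)); rewrite -mulrA ler_wpM2l// quad_shift_le.
Qed.

Lemma shift_transfer a (h : 'rV[R]_n -> R) : measurable_fun setT h ->
  mu.-integrable setT (fun z => (h (z + a))%:E) ->
  mu.-integrable setT (fun z => (h z)%:E) /\ (\int[mu]_z h (z + a))%R = (\int[mu]_z h z)%R.
Proof.
move=> mh ih.
have mS : measurable_fun setT (fun z : 'rV[R]_n => 1 *: z + a) by exact: measurable_affv.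
have E z : (1 : R) *: z + a = z + a by rewrite scale1r.
have tr (H : 'rV[R]_n -> \bar R) : measurable_fun setT H -> (forall p, (0 <= H p)%E) ->
     ((1 : R)%:E * \int[mu]_p H (1 *: p + a)%R = \int[mu]_p H p)%E.
  by move=> mH H0; have := ge0_integral_affine a (@ltr01 R) mH H0; rewrite expr1n.
have [|I1 I2] := signed_transfer (@ltr01 R) mS tr mh.
  by under eq_fun do rewrite E.
split => //; move: I2; rewrite mul1r => <-.
by apply: eq_Rintegral => z _; rewrite E.
Qed.

Lemma expect_shift a (F : 'rV[R]_n -> R) C : continuous F -> (forall z, `|F z| <= C * quad z) ->
  mu.-integrable setT (fun x => (F x * g (a - x))%:E) /\
  expect mu (fun x => g (a - x)) F = expect mu g (fun z => F (z + a)).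
Proof.
move=> cF hC.
pose h x := F x * g (a - x).
have hE z : h (z + a) = F (z + a) * gauss z by rewrite /h opprD addrCA subrr addr0 gaussN.
have mh : measurable_fun setT h.
  apply: measurable_funM; apply: continuous_measurable_rV => //.
  by apply: continuous_comp_rsub; exact: continuous_gauss.
have [|I1 I2] := @shift_transfer a h mh.
  under eq_fun do rewrite hE.
  apply: (@dominated_integrable _ _ _ _ g (@expq R n)) => //.
  exact: (dominated_shift (C := C)).
split; first exact: I1.
rewrite /expect; transitivity (\int[mu]_z h z)%R; first by apply: eq_Rintegral => z _.
by rewrite -I2; apply: eq_Rintegral => z _; exact: hE.
Qed.

Lemma gauss_density a : density (fun x => g (a - x)).
Proof.
have cq : continuous (@quad R n) by exact: continuous_quad.
split.
- by apply: continuous_comp_rsub; exact: continuous_gauss.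
- by move=> x; exact: gauss_ge0.
- have mga : measurable_fun setT (fun x : 'rV[R]_n => (g (a - x))%:E).
    apply/measurable_EFinP; apply: continuous_measurable_rV.
    by apply: continuous_comp_rsub; exact: continuous_gauss.
  have ga0 (x : 'rV[R]_n) : (0 <= (g (a - x))%:E)%E by rewrite lee_fin gauss_ge0.
  have := ge0_integral_affine a (@ltr01 R) mga ga0; rewrite expr1n mul1e => <-.
  rewrite -(@integral_gauss R n); apply: eq_integral => z _.
  by rewrite scale1r opprD addrCA subrr addr0 gaussN.
- apply: (@expect_shift a (@quad R n) 1 _ _).1 => //.
  by move=> z; rewrite mul1r ger0_norm// (le_trans ler01)// quad_ge1.
Qed.

Lemma pder_shift (F : 'rV[R]_n -> R) a s : pder s (fun x => F (x - a)) = (fun x => pder s F (x - a)).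
Proof.
elim: s => [//|i s IH] /=; rewrite IH; apply/funext => x.
set G := pder s F; rewrite /partial /derive.
have -> // : (fun h : R => h^-1 *: (((fun x0 => G (x0 - a)) \o shift x) (h *: evec R i) - G (x - a))) =
  (fun h => h^-1 *: ((G \o shift (x - a)) (h *: evec R i) - G (x - a))).
by apply/funext => h; rewrite /= /shift /= addrA.
Qed.

Lemma gauss_shift_smooth a : smooth (fun x => g (a - x)).
Proof.
have -> : (fun x => g (a - x)) = (fun x => g (x - a)).
  by apply/funext => x; rewrite -gaussN opprB.
move=> s x; rewrite pder_shift.
have := (@heat_kernel_smooth R n 1 ltr01 s).1 (x - a); rewrite gauss_heat_kernel => d.
have ds : differentiable (fun x : 'rV[R]_n => x - a) x.
  by apply: differentiableB => //; exact: differentiable_cst.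
exact: (differentiable_comp ds d).
Qed.

Lemma partial_gauss_shift a i x : partial i (fun x => g (a - x)) x = (a - x) ord0 i * g (a - x).
Proof.
have E : (fun x => g (a - x)) = (fun x => g (x - a)).
  by apply/funext => y; rewrite -gaussN opprB.
have := pder_shift g a [:: i] => /= /(congr1 (@^~ x)) /= H.
rewrite E H.
have := @partial_heat_kernel R n 1 i (x - a) ltr01; rewrite gauss_heat_kernel invr1 scale1r mulN1r => ->.
by rewrite -mulNr -(gaussN (x - a)) opprB; congr (_ * _); rewrite !rV_coordB opprB.
Qed.

Lemma gauss_le_peak (z : 'rV[R]_n) : g z <= (Num.sqrt (2 * pi))^-1 ^+ n.
Proof.
rewrite /gauss ler_piMr ?exprn_ge0 ?invr_ge0 ?sqrtr_ge0//.
by rewrite expR_le1 oppr_le0 divr_ge0 ?sqnorm_ge0.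
Qed.

End shifted_gaussian.

(** * Upper bound on the log-Sobolev constant *)

Section curvature_bound.
Context {R : realType} (n : nat) (f : 'rV[R]_n -> R) (L M : R).
Hypotheses (n0 : (0 < n)%N) (L0 : 0 <= L) (hf : LM_smooth f L M).
Local Notation mu := (lebesgue_rV n).
Local Notation nu := (fun x => expR (- f x)).
Local Notation g := (@gauss R n).
Hypothesis pnu : prob_density nu.
Implicit Types (x z m : 'rV[R]_n).

Let mg := @measurable_gauss R n.
Let g0 := @gauss_ge0 R n.
Let ieg := @integrable_expq_gauss R n.
Let eq1 := @expq_ge1 R n.
Let peak : R := (Num.sqrt (2 * pi))^-1 ^+ n.
Let peak0 : 0 < peak.
Proof. by rewrite exprn_gt0// invr_gt0 sqrtr_gt0 mulr_gt0// pi_gt0. Qed.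

Let mnu : measurable_fun setT nu.
Proof.
apply: measurableT_comp => //; apply: measurable_funN.
by apply: continuous_measurable_rV; exact: (f_cts hf).
Qed.

Let inu1 : (\int[mu]_x (nu x)%:E = 1)%E.
Proof.
case: pnu => _; rewrite iintE//; first exact/measurable_EFinP.
Qed.

(** The Gaussian mean, left unevaluated: centring at it makes linear terms average to zero by
    definition. *)
Let b : 'rV[R]_n := \row_i expect mu g (fun z => z ord0 i).
Let V : R := expect mu g (fun z => sqnorm (z - b)).
Let S : R := expect mu g (@sqnorm R n).

Let dcoord i : dominated (@expq R n) (fun z => z ord0 i).
Proof.
apply: (@dominated_quad_expq _ _ _ 1); first exact: continuous_coord.
by move=> z; rewrite mul1r; exact: quad_coord_le.
Qed.

Let dsq : dominated (@expq R n) (@sqnorm R n).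
Proof.
apply: (@dominated_quad_expq _ _ _ 1); first exact: continuous_sqnorm.
by move=> z; rewrite mul1r ger0_norm ?sqnorm_ge0// /quad lerDr.
Qed.

Let dV : dominated (@expq R n) (fun z => sqnorm (z - b)).
Proof.
apply: (@dominated_shift _ _ _ 1); first exact: continuous_sqnorm.
by move=> z; rewrite mul1r ger0_norm ?sqnorm_ge0// /quad lerDr.
Qed.

Let df m : dominated (@expq R n) (fun z => f (z + (m - b))).
Proof.
have [C [C0 hC]] := f_growth L0 hf.
by apply: (@dominated_shift _ _ _ C) => //; exact: (f_cts hf).
Qed.

Let ecst (a : R) : expect mu g (fun=> a) = a.
Proof.
have d1 : dominated (@expq R n) (fun _ : 'rV[R]_n => (1 : R)) by exact: dominatedC.
have -> : expect mu g (fun=> a) = a * expect mu g (fun=> 1).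
  by rewrite -(@expectZ _ _ _ _ _ (@expq R n))//; congr expect; apply/funext => z; rewrite mulr1.
rewrite (_ : expect mu g (fun=> 1) = 1) ?mulr1//.
rewrite /expect /Rintegral; under eq_integral do rewrite mul1r.
by rewrite integral_gauss.
Qed.

Let lin m z := dotv (z - b) (grad f m).

Let dlin m : dominated (@expq R n) (lin m).
Proof.
rewrite (_ : lin m = (fun z => \sum_i (grad f m ord0 i * z ord0 i - grad f m ord0 i * b ord0 i))); last first.
  by apply/funext => z; apply: eq_bigr => i _; rewrite rV_coordB; ring.
by apply: dominated_sum => // i; apply: dominatedB; [exact: dominatedZ|exact: dominatedC].
Qed.

Let elin m : expect mu g (lin m) = 0.
Proof.
rewrite (_ : lin m = (fun z => \sum_i (grad f m ord0 i * z ord0 i - grad f m ord0 i * b ord0 i))); last first.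
  by apply/funext => z; apply: eq_bigr => i _; rewrite rV_coordB; ring.
have d1 i : dominated (@expq R n) (fun z => grad f m ord0 i * z ord0 i) by exact: dominatedZ.
have d2 i : dominated (@expq R n) (fun _ : 'rV[R]_n => grad f m ord0 i * b ord0 i) by exact: dominatedC.
have d3 i := dominatedB (d1 i) (d2 i).
rewrite (@expect_sum _ _ _ _ _ (@expq R n))// big1// => i _.
rewrite (@expectB _ _ _ _ _ (@expq R n))// (@expectZ _ _ _ _ _ (@expq R n))// ecst.
by rewrite [b ord0 i]mxE subrr.
Qed.

Let Ef m : R := expect mu g (fun z => f (z + (m - b))).

Let shiftE m z : z + (m - b) = m + (z - b).
Proof. by apply/rowP => i; rewrite !mxE; ring. Qed.

(** Second-order Taylor bounds at [m], whose linear term has mean zero by [elin]. *)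
Let Ef_bounds m : f m - L / 2 * V <= Ef m /\ Ef m <= f m + L / 2 * V.
Proof.
have dc : dominated (@expq R n) (fun _ : 'rV[R]_n => f m) by exact: dominatedC.
have dLV := dominatedZ (L / 2) dV.
have d1 := dominatedD dc (dlin m).
split.
  have := expect_le mg g0 ieg (dominatedB d1 dLV) (df m).
  rewrite (@expectB _ _ _ _ _ (@expq R n))// (@expectD _ _ _ _ _ (@expq R n))// ecst elin addr0.
  rewrite (@expectZ _ _ _ _ _ (@expq R n))//; apply => z.
  by rewrite shiftE; exact: (f_lower L0 hf).
have := expect_le mg g0 ieg (df m) (dominatedD d1 dLV).
rewrite (@expectD _ _ _ _ _ (@expq R n))// (@expectD _ _ _ _ _ (@expq R n))// ecst elin addr0.
rewrite (@expectZ _ _ _ _ _ (@expq R n))//; apply => z.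
by rewrite shiftE; exact: (f_upper L0 hf).
Qed.

Let inu : mu.-integrable setT (fun x => (nu x)%:E).
Proof.
apply/integrableP; split; first exact/measurable_EFinP.
by under eq_integral do rewrite gee0_abs ?lee_fin ?expR_ge0//; rewrite inu1 ltry.
Qed.

(* Jensen's inequality against the Gaussian, which is at most [peak]. *)
Lemma potential_bounded_below : exists D, forall m, - D <= f m.
Proof.
exists (L / 2 * V + ln peak) => m.
pose k := - f m - L / 2 * V.
suff : expR k <= peak.
  by move=> h; rewrite -(ler_ln _ _) ?posrE ?expR_gt0// expRK in h; move: h; rewrite /k; lra.
(* The tangent of the exponential at [k], divided by [peak] to compensate for the Gaussian weight.
   Its mean is at least [expR k / peak], and at most the mass of [nu], which is one. *)
pose h2 z := peak^-1 * expR k * (1 - k - f (z + (m - b))).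
have dh2 : dominated (@expq R n) h2.
  by apply: dominatedZ; apply: dominatedB => //; exact: dominatedC.
have ih1 : mu.-integrable setT (fun z => (nu (z + (m - b)))%:E).
  apply/integrableP; split.
    apply/measurable_EFinP; apply: measurableT_comp => //; apply: measurable_funN.
    exact: (df m).1.
  under eq_integral do rewrite gee0_abs ?lee_fin ?expR_ge0//.
  have mE : measurable_fun setT (fun x => (nu x)%:E) by exact/measurable_EFinP.
  have E0 x : (0 <= (nu x)%:E)%E by rewrite lee_fin expR_ge0.
  have := ge0_integral_affine (m - b) (@ltr01 R) mE E0; rewrite expr1n mul1e inu1.
  move=> E1; rewrite (_ : (\int[mu]_x _)%E = 1%E) ?ltry//; apply: (etrans _ E1).
  by apply: eq_integral => z _; rewrite scale1r.
have [_ I2] := shift_transfer mnu ih1.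
have I1 : (\int[mu]_z nu z)%R = 1 by rewrite /Rintegral inu1.
have : expect mu g h2 <= (\int[mu]_z nu (z + (m - b)))%R.
  apply: le_Rintegral => //.
    exact: (@dominated_integrable _ _ _ _ g (@expq R n)).
  move=> z _; rewrite /h2; set u := f _.
  have hu : expR k * (1 - k - u) <= expR (- u).
    have := expR_ge1Dx (- u - k).
    rewrite -(ler_pM2l (expR_gt0 k)) -expRD (_ : k + (- u - k) = - u); last by ring.
    by apply: le_trans; rewrite ler_wpM2l ?expR_ge0//; lra.
  have gz := gauss_le_peak z; rewrite -/peak in gz.
  apply: (@le_trans _ _ (peak^-1 * g z * expR (- u))).
    rewrite (_ : _ * _ * g z = peak^-1 * g z * (expR k * (1 - k - u))); last by ring.
    by rewrite ler_wpM2l// mulr_ge0// invr_ge0 ltW.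
  rewrite ler_piMl ?expR_ge0// mulrC ler_pdivrMr// mul1r//.
rewrite I2 I1 /h2 (@expectZ _ _ _ _ _ (@expq R n))//; last by apply: dominatedB => //; exact: dominatedC.
rewrite (@expectB _ _ _ _ _ (@expq R n))//; last exact: dominatedC.
rewrite ecst -/(Ef m) => H.
have [_ hE] := Ef_bounds m.
have h1 : 1 <= 1 - k - Ef m by rewrite /k; lra.
have ek : 0 < peak^-1 * expR k by rewrite mulr_gt0 ?invr_gt0 ?expR_gt0.
have : peak^-1 * expR k <= 1 by apply: le_trans H; rewrite ler_peMr// ltW.
by rewrite mulrC ler_pdivrMr// mul1r.
Qed.

(** Otherwise [nu] would be at least [e^(-C)] and Lebesgue measure finite with positive mass;
    scaling by 2 multiplies that mass by [2 ^+ n], which is impossible for positive [n]. *)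
Lemma potential_unbounded (C : R) : ~ forall m, f m <= C.
Proof.
move=> hC.
have m1 : measurable_fun setT (fun _ : 'rV[R]_n => 1%E : \bar R) by exact: measurable_cst.
have p1 (x : 'rV[R]_n) : (0 <= (1 : \bar R))%E by [].
pose I := (\int[mu]_(x in setT) (1 : \bar R))%E.
have I0 : (0 <= I)%E by apply: integral_ge0.
have Ile : (I <= (expR C)%:E)%E.
  have mE : measurable_fun setT (fun x => (nu x)%:E) by exact/measurable_EFinP.
  have E0 x : setT x -> (0 <= (nu x)%:E)%E by rewrite lee_fin expR_ge0.
  have eC : (0 <= (expR C)%:E)%E by rewrite lee_fin expR_ge0.
  rewrite -[leRHS]mule1 -inu1 -(ge0_integralZl _ _ mE E0 eC)//.
  apply: ge0_le_integral => //.
  - by apply/measurable_EFinP; apply: measurable_funM.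
  - move=> x _; rewrite -EFinM lee_fin -expRD -[leLHS]expR0 ler_expR subr_ge0; exact: hC.
have If : I \is a fin_num by rewrite ge0_fin_numE// (le_lt_trans Ile)// ltry.
have Igt : (0 < I)%E.
  rewrite lt_neqAle I0 andbT; apply/eqP => I00.
  have : (\int[mu]_z (g z)%:E <= peak%:E * I)%E.
    rewrite -ge0_integralZl//; last by rewrite lee_fin ltW.
    apply: ge0_le_integral => //.
    - by move=> x _; rewrite lee_fin.
    - exact/measurable_EFinP.
    - by move=> x _; rewrite mule1 lee_fin; exact: gauss_le_peak.
  by rewrite -I00 mule0 integral_gauss lee_fin ler10.
have f0 : 0 < fine I by rewrite fine_gt0// Igt ltey_eq If.
have EI : ((2 ^+ n)%:E * I)%E = I by have := ge0_integral_affine (0 : 'rV[R]_n) (@ltr0Sn R 1) m1 p1.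
have E2 : 2 ^+ n * fine I = fine I by apply: EFin_inj; rewrite EFinM fineK.
have E : (2 : R) ^+ n = 1 by rewrite -[LHS](mulfK (lt0r_neq0 f0)) E2 divff// gt_eqF.
have : (1 : R) < 2 ^+ n by rewrite exprn_egt1// ?ltr1n// -lt0n.
by rewrite E ltxx.
Qed.

(* Testing the log-Sobolev inequality on Gaussians centred where [f] is large. *)
Lemma LSI_constant_le (al : R) : 0 < al -> LSI nu al -> al <= 5 / 4 * L.
Proof.
move=> al0 lsi; rewrite leNgt; apply/negP => hal.
have [D hD] := potential_bounded_below.
(* Under the negated claim [L < L'], and [L'] is positive even when [L = 0], so it can serve as an
   inverse step length. *)
pose L' := 4 / 5 * al.
have LL' : L <= L' by rewrite /L'; lra.
have L'0 : 0 < L' by rewrite /L'; lra.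
(* A gradient step of length [1 / L'] cannot bring [f] below [- D]. *)
have grad_le x : sqnorm (grad f x) <= 2 * L' * (f x + D).
  have := f_upper L0 hf x (- (L'^-1 *: grad f x)).
  rewrite dotvNl sqnormN dotvZl dotvv sqnormZ => h.
  have := hD (x - L'^-1 *: grad f x) => h'.
  set G := sqnorm (grad f x) in h *; have G0 : 0 <= G by exact: sqnorm_ge0.
  have k1 : L / 2 * (L'^-1 ^+ 2 * G) <= L'^-1 * G / 2.
    rewrite (_ : L / 2 * _ = (L / L') * (L'^-1 * G / 2)); last by field; rewrite gt_eqF.
    by rewrite ler_piMl ?divr_ge0 ?mulr_ge0 ?invr_ge0 ?(ltW L'0)// ler_pdivrMr// mul1r.
  have k2 : L'^-1 * G / 2 <= f x + D by lra.
  have := ler_wpM2l (mulr_ge0 (ler0n R 2) (ltW L'0)) k2.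
  by rewrite (_ : 2 * L' * (L'^-1 * G / 2) = G)//; field; rewrite gt_eqF.
(* The log-Sobolev inequality will bound [Ef m] by [9 / 10] of itself plus a constant, where
   [9 / 10] is [9 / 8] times [4 / 5]; [C1] is ten times that constant. *)
pose C1 := 10 * (9 / 10 * D + 9 / (2 * al) * S - ln peak + S / 2).
apply: (@potential_unbounded (C1 + L / 2 * V)) => m.
have [hEf _] := Ef_bounds m.
suff : Ef m <= C1 by lra.
pose a := m - b; pose tau := fun x => g (a - x).
have lntau x : ln (tau x) = ln peak - sqnorm (a - x) / 2.
  by rewrite /tau /gauss -/peak lnM ?posrE ?expR_gt0// expRK.
have sqb x : sqnorm (a - x) <= 2 * quad a * quad x.
  have := sqnormDle a (- x); rewrite sqnormN /quad.
  have := mulr_ge0 (sqnorm_ge0 a) (sqnorm_ge0 x); have := sqnorm_ge0 x; have := sqnorm_ge0 a; lra.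
have csq : continuous (fun x => sqnorm (a - x)) by apply: continuous_comp_rsub; exact: continuous_sqnorm.
have cln : continuous (fun x => ln (tau x)).
  under eq_fun do rewrite lntau.
  by apply: ctsB; [exact: ctsC|apply: ctsM => //; exact: ctsC].
have bln x : `|ln (tau x)| <= (`|ln peak| + quad a) * quad x.
  rewrite lntau (le_trans (ler_normB _ _))// mulrDl lerD//.
    by rewrite ler_peMr// quad_ge1.
  rewrite ger0_norm ?divr_ge0 ?sqnorm_ge0//; have := sqb x; lra.
pose s x : 'rV[R]_n := a - x.
have cfi : continuous (fun x => sqnorm (s x + grad f x)).
  apply: continuous_sum => i.
  have -> : (fun x => (s x + grad f x) ord0 i ^+ 2) =
     (fun x => (a ord0 i - x ord0 i + grad f x ord0 i) * (a ord0 i - x ord0 i + grad f x ord0 i)).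
    by apply/funext => x; rewrite expr2 [(s x + _) _ _]mxE rV_coordB.
  have c1 : continuous (fun x => a ord0 i - x ord0 i + grad f x ord0 i).
    apply: ctsD; last exact: (grad_coord_cts L0 hf).
    by apply: ctsB; [exact: ctsC|exact: continuous_coord].
  exact: ctsM.
have [Cf [Cf0 hCf]] := f_growth L0 hf.
(* Young's inequality with weight 8, [2 s.p <= |p|^2 / 8 + 8 |s|^2]; the weight must be large enough
   to keep the resulting factor below 1. *)
have fi_le x : sqnorm (s x + grad f x) <= 9 / 8 * (2 * L' * (f x + D)) + 9 * sqnorm (a - x).
  have h1 : sqnorm (s x + grad f x) <= 9 / 8 * sqnorm (grad f x) + 9 * sqnorm (a - x).
    have h := sqnorm_ge0 (grad f x - 8 *: s x).
    rewrite sqnormB sqnormZ dotvZr (dotvC (grad f x)) in h.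
    rewrite sqnormD -/(s x); lra.
  by apply: (le_trans h1); rewrite lerD2r ler_wpM2l.
have bfi x : `|sqnorm (s x + grad f x)| <= (9 / 8 * (2 * L' * (Cf + `|D|)) + 18 * quad a) * quad x.
  rewrite ger0_norm ?sqnorm_ge0//; apply: (le_trans (fi_le x)).
  have q1 := quad_ge1 x.
  have u1 : f x + D <= (Cf + `|D|) * quad x.
    rewrite mulrDl lerD//; first by apply: le_trans (hCf x); exact: ler_norm.
    by apply: (le_trans (ler_norm _)); rewrite ler_peMr.
  have u2 := ler_wpM2l (mulr_ge0 (ler0n R 2) (ltW L'0)) u1.
  rewrite [leRHS]mulrDl; apply: lerD.
    by rewrite -(mulrA (9 / 8)) ler_wpM2l// -(mulrA (2 * L')).
  by have := sqb x; lra.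
have dtau := gauss_density a.
have sc x i : partial i tau x = s x ord0 i * tau x by exact: partial_gauss_shift.
have t0 x : 0 < tau x by exact: gauss_gt0.
have := @LSI_density _ _ _ _ _ L0 hf al tau s lsi dtau (@gauss_shift_smooth _ _ a) t0 sc
  (cts_dominated cln bln) (cts_dominated cfi bfi).
have cl : continuous (fun y => ln (tau y) + f y) by apply: ctsD => //; exact: (f_cts hf).
have bl y : `|ln (tau y) + f y| <= (`|ln peak| + quad a + Cf) * quad y.
  by rewrite (le_trans (ler_normD _ _))// mulrDl lerD.
rewrite (expect_shift a cl bl).2 (expect_shift a cfi bfi).2.
have sz z : a - (z + a) = - z by rewrite opprD addrCA subrr addr0.
have -> : expect mu g (fun z => ln (tau (z + a)) + f (z + a)) = ln peak - S / 2 + Ef m.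
  rewrite (_ : (fun z => _) = (fun z => (ln peak - 2^-1 * sqnorm z) + f (z + a))); last first.
    by apply/funext => z; rewrite lntau sz sqnormN (mulrC 2^-1).
  have d1 : dominated (@expq R n) (fun _ : 'rV[R]_n => ln peak) by exact: dominatedC.
  have d2 := dominatedZ 2^-1 dsq; have d3 := dominatedB d1 d2; have d4 := df m.
  rewrite (@expectD _ _ _ _ _ (@expq R n))// (@expectB _ _ _ _ _ (@expq R n))// ecst.
  by rewrite (@expectZ _ _ _ _ _ (@expq R n))// (mulrC 2^-1).
have : expect mu g (fun z => sqnorm (s (z + a) + grad f (z + a))) <=
    9 / 8 * (2 * L') * (Ef m + D) + 9 * S.
  have d1 : dominated (@expq R n) (fun _ : 'rV[R]_n => D) by exact: dominatedC.
  have d4 := df m; have d5 := dominatedD d4 d1; have d6 := dominatedZ (9 / 8 * (2 * L')) d5.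
  have d7 := dominatedZ 9 dsq; have d8 := dominatedD d6 d7.
  have := expect_le mg g0 ieg (dominated_shift a cfi bfi) d8.
  rewrite (@expectD _ _ _ _ _ (@expq R n))// (@expectZ _ _ _ _ _ (@expq R n))//.
  rewrite (@expectD _ _ _ _ _ (@expq R n))// ecst (@expectZ _ _ _ _ _ (@expq R n))//; apply => z.
  have := fi_le (z + a); rewrite sz sqnormN; lra.
move=> H1 H2.
have i0 : 0 < (2 * al)^-1 by rewrite invr_gt0 mulr_gt0.
have H3 := le_trans H2 (ler_wpM2l (ltW i0) H1).
have E1 : (2 * al)^-1 * (9 / 8 * (2 * L') * (Ef m + D) + 9 * S) = 9 / 10 * (Ef m + D) + 9 / (2 * al) * S.
  by rewrite /L'; field; rewrite gt_eqF.
rewrite E1 in H3; rewrite /C1; lra.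
Qed.

End curvature_bound.

(** * Decay along the interpolation *)

Section decay.
Context {R : realType} (n : nat) (f : 'rV[R]_n -> R) (L M eps al : R).
Hypotheses (n0 : (0 < n)%N) (L0 : 0 <= L) (M0 : 0 <= M) (hf : LM_smooth f L M).
Hypotheses (eps0 : 0 < eps) (epsL : eps * L <= 8^-1) (al0 : 0 < al).
Local Notation mu := (lebesgue_rV n).
Local Notation mm := (mu \x mu)%E.
Local Notation nu := (fun x => expR (- f x)).
Hypotheses (pnu : prob_density nu) (lsi : LSI nu al).
Variable rho : 'rV[R]_n -> R.
Hypothesis drho : density rho.
Hypothesis ient : mu.-integrable setT (fun x => (rho x * ln (rho x))%:E).

Let mh c (c0 : 0 < c) : measurable_fun setT (heat rho c).
Proof. by apply: continuous_measurable_rV; exact: density_cts (heat_density drho c0). Qed.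

(* Negative entropy along the heat flow. *)
Definition entropy (t : R) : R := if t == 0 then (\int[mu]_x (rho x * ln (rho x)))%R
  else expect mu (heat rho (rad t)) (fun y => ln (heat rho (rad t) y)).

Let fisher (t : R) : R := expect mu (heat rho (rad t)) (fun y => sqnorm (score rho t y)).

Let fisher_ge0 t : 0 < t -> 0 <= fisher t.
Proof.
move=> t0; have c0 := rad_gt0 t0; have dh := heat_density drho c0.
have d1 := sqnorm_score_dominated drho t0.
have d0 : dominated (@quad R n) (fun _ : 'rV[R]_n => (0 : R)).
  by apply: dominatedC; exact: quad_ge1.
have := expect_le (mh c0) (density_ge0 dh) (density_quad dh) d0 d1.
by rewrite (expect_cst dh); apply => y; exact: sqnorm_ge0.
Qed.

Lemma score_partial (t : R) y i : 0 < t ->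
  partial i (heat rho (rad t)) y = score rho t y ord0 i * heat rho (rad t) y.
Proof.
move=> t0; have c0 := rad_gt0 t0.
have G (v : 'rV[R]_n) (u : R) : (- (u *: v)) ord0 i = - (u * v ord0 i) by rewrite !mxE.
by rewrite (partial_heat drho c0) /score G !mulNr mulrA.
Qed.

Let LSI_heat (t : R) : 0 < t ->
  expect mu (heat rho (rad t)) (fun y => ln (heat rho (rad t) y) + f y) <=
  (2 * al)^-1 * expect mu (heat rho (rad t)) (fun y => sqnorm (score rho t y + grad f y)).
Proof.
move=> t0; have c0 := rad_gt0 t0.
apply: (LSI_density L0 hf lsi (heat_density drho c0)).
- exact: (heat_smooth drho c0).
- by move=> y; exact: (heat_gt0 drho c0).
- by move=> y i; exact: score_partial.
- exact: (ln_heat_dominated drho c0).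
- exact: (sqnorm_fisher_dominated L0 hf drho t0).
Qed.

(** At [s = 0] this is [entropy_dissipation]; for [s > 0] it is applied to [heat rho (rad s)], whose
    posterior mean is a multiple of the score at time [t] by Tweedie's formula. In both cases the
    Fisher information sits at the later time, as the left increments in [dini_decay] require. *)
Let entropy_drop (s t : R) : 0 <= s -> s < t -> (t - s) * fisher t <= entropy s - entropy t.
Proof.
move=> s0 st; have t0 : 0 < t by exact: le_lt_trans st.
have c0 := rad_gt0 t0; have dh := heat_density drho c0.
rewrite /entropy (gt_eqF t0).
have [->|sN] := eqVneq s 0.
  rewrite subr0; apply: le_trans (entropy_dissipation drho c0 ient).
  rewrite /fisher (_ : (fun y => sqnorm (score rho t y)) = (fun y => (2 * t)^-1 * sqnorm (posterior rho (rad t) y))); last first.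
    by apply/funext => y; exact: sqnorm_score.
  rewrite (expectZ (mh c0) (density_quad dh) _ (sqnorm_posterior_dominated drho c0)).
  by rewrite mulrA invfM mulrCA mulfV ?gt_eqF// mulr1.
have sgt : 0 < s by rewrite lt_neqAle eq_sym sN.
have cs := rad_gt0 sgt; have ds := heat_density drho cs.
have ts : 0 < t - s by rewrite subr_gt0.
have cd := rad_gt0 ts.
have sem : heat (heat rho (rad s)) (rad (t - s)) = heat rho (rad t).
  have e : rad s ^+ 2 + rad (t - s) ^+ 2 = 2 * t by rewrite !sqr_rad ?(ltW ts)//; ring.
  by rewrite (heat_semigroup drho cs cd) e.
have lnd := ln_heat_dominated drho cs.
have ients : mu.-integrable setT (fun x => (heat rho (rad s) x * ln (heat rho (rad s) x))%:E).
  have := dominated_integrable (mh cs) (density_quad ds) lnd.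
  by under eq_fun do rewrite mulrC.
have := entropy_dissipation ds cd ients; rewrite sem.
have -> : (\int[mu]_x (heat rho (rad s) x * ln (heat rho (rad s) x)))%R =
    expect mu (heat rho (rad s)) (fun y => ln (heat rho (rad s) y)).
  by rewrite /expect; apply: eq_Rintegral => x _; rewrite mulrC.
apply: le_trans.
have pE y : sqnorm (posterior (heat rho (rad s)) (rad (t - s)) y) = 2 * (t - s) * sqnorm (score rho t y).
  have -> : posterior (heat rho (rad s)) (rad (t - s)) y = - (rad (t - s) *: score rho t y).
    apply/rowP => i; have := partial_heat ds cd i y; rewrite sem score_partial//.
    have hy := heat_gt0 drho c0 y.
    have G2 (p q h u : R) : h != 0 -> u != 0 -> q * h = - u^-1 * (p * h) -> p = - (u * q).
      move=> hN uN E; have -> : q = - (u^-1 * p) by apply: (mulIf hN); rewrite E; ring.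
      by field.
    have G (v : 'rV[R]_n) (u : R) : (- (u *: v)) ord0 i = - (u * v ord0 i) by rewrite !mxE.
    by move=> E0; rewrite G; exact: (G2 _ _ _ _ (lt0r_neq0 hy) (lt0r_neq0 cd) E0).
  by rewrite sqnormN sqnormZ sqr_rad// ltW.
rewrite (_ : (fun y => sqnorm (posterior _ _ y)) = (fun y => 2 * (t - s) * sqnorm (score rho t y))); last first.
  by apply/funext => y; exact: pE.
rewrite (expectZ (mh c0) (density_quad dh) _ (sqnorm_score_dominated drho t0)).
by rewrite !mulrA mulVf// mul1r.
Qed.

Lemma heat_flow_decay (C : R) :
  C = 34 * eps ^+ 2 * (n%:R * (L ^+ 3 + 9 * n%:R ^+ 2 * M ^+ 2)) ->
  entropy eps + energy f L rho eps - C / al <=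
  expR (- (al * eps)) * (entropy 0 + energy f L rho 0 - C / al).
Proof.
move=> CE; have alL := LSI_constant_le n0 L0 hf pnu al0 lsi.
apply: (@dini_decay R entropy (energy f L rho) al C eps al0 eps0).
- move=> s t s0; rewrite le_eqVlt => /predU1P[->//|st] te.
  have t0 : 0 < t by exact: le_lt_trans st.
  have := entropy_drop s0 st.
  have : 0 <= (t - s) * fisher t by rewrite mulr_ge0 ?fisher_ge0// subr_ge0 ltW.
  by move=> h1 h2; rewrite -subr_ge0; exact: le_trans h1 h2.
- by move=> s s0 se e e0; exact: (energy_usc L0 M0 hf eps0 epsL drho).
- move=> t t0 te k d k0 d0.
  have [_ /(_ k d k0 d0) [h [h0 hd ht hU]]] := energy_slope L0 M0 hf eps0 epsL drho t0 te.
  exists h; split => //.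
  have tL : t * L <= 8^-1 by apply: le_trans epsL; rewrite ler_wpM2r.
  have hD := dissipation n0 L0 M0 hf drho t0 tL al0 alL (LSI_heat t0).
  rewrite -/(fisher t) in hD.
  have th : t - h < t by rewrite ltrBlDr ltrDl.
  have := @entropy_drop (t - h) t _ th; rewrite subr_ge0 => /(_ ht).
  rewrite opprB addrC subrK => hE.
  have et : entropy t = expect mu (heat rho (rad t)) (fun y => ln (heat rho (rad t) y)).
    by rewrite /entropy gt_eqF.
  rewrite -et in hD.
  set D := expect mm _ _ in hU hD.
  have CC : 34 * t ^+ 2 * (n%:R * (L ^+ 3 + 9 * n%:R ^+ 2 * M ^+ 2)) <= C.
    rewrite CE; apply: ler_wpM2r.
      by rewrite mulr_ge0// addr_ge0 ?exprn_ge0// mulr_ge0 ?sqr_ge0// mulr_ge0// sqr_ge0.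
    by rewrite ler_wpM2l// ler_pXn2r ?nnegrE// ltW.
  have hDC := le_trans hD CC.
  have hh : h * (- fisher t + D + k) <= h * (- (al * (entropy t + energy f L rho t)) + C + k).
    by rewrite ler_wpM2l ?(ltW h0)// lerD2r [leRHS]addrC lerBrDr.
  apply: le_trans hh; rewrite (_ : h * _ = - (h * fisher t) + h * (D + k)); last by ring.
  have G (u v w z : R) : u + v - (w + z) = (u - w) + (v - z) by ring.
  by rewrite G lerD// lerNr opprB.
Qed.

Lemma expect_fst (F : 'rV[R]_n -> R) : dominated (@quad R n) F ->
  expect mm (joint rho) (fun p => F p.1) = expect mu rho F.
Proof.
move=> [mF [C hC]].
have mrho : measurable_fun setT rho by apply: continuous_measurable_rV; exact: density_cts drho.
have C0 : 0 <= C.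
  by have := le_trans (normr_ge0 _) (hC 0); rewrite /quad sqnorm0 addr0 mulr1.
have dF : dominated (@jquad R n) (fun p => F p.1).
  split; first exact: (measurableT_comp mF measurable_fst).
  exists C => p; apply: (le_trans (hC _)); rewrite ler_wpM2l// /jquad ler_peMr ?expq_ge1//.
  exact: le_trans ler01 (quad_ge1 _).
have iF := dominated_integrable (measurable_joint drho) (integrable_jquad drho) dF.
rewrite /expect /Rintegral; congr fine; apply: (etrans (esym (integral12_prod_meas1 iF))).
apply: eq_integral => x _; rewrite /fubini_F /joint.
rewrite (_ : (fun y => _) = (fun y => ((F x * rho x)%:E * (gauss y)%:E)%E)); last first.
  by apply/funext => y; rewrite -EFinM mulrA.
rewrite integralZl//; first by rewrite integral_gauss mule1.
apply/integrableP; split; first by apply/measurable_EFinP; exact: measurable_gauss.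
by under eq_integral do rewrite gee0_abs ?lee_fin ?gauss_ge0//; rewrite integral_gauss ltry.
Qed.

Lemma energy0 : energy f L rho 0 = expect mu rho f.
Proof.
have [C [C0 hC]] := f_growth L0 hf.
have df : dominated (@quad R n) f by apply: (cts_dominated (C := C)) => //; exact: (f_cts hf).
rewrite -(expect_fst df) /energy; congr expect; apply/funext => p.
rewrite /flow /rad mulr0 sqrtr0 /noisy scale0r add0r /phi /ell.
have := prox_mapP L0 hf p.1 (lexx 0) ltac:(by rewrite mul0r invr_ge0).
rewrite scale0r addr0 => ->; rewrite mul0r !expr0n /= !mul0r mulr0 subrr !addr0 //.
Qed.

End decay.

(** * Densities compared through test functions *)

Section test_functions.
Context {R : realType} (n : nat).
Local Notation mu := (lebesgue_rV n).

(** The positive part of [u - v], truncated at 1, is an admissible test [G]. The nonnegative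
    function [G (u - v)] then has integral zero, the subtraction being licit because [v] is
    integrable. *)
Lemma ae_le_of_tests (u v : 'rV[R]_n -> R) : continuous u -> continuous v ->
  (forall x, 0 <= u x) -> (forall x, 0 <= v x) -> (\int[mu]_x (v x)%:E < +oo)%E ->
  (forall G : 'rV[R]_n -> R, continuous G -> (forall x, 0 <= G x) -> (forall x, G x <= 1) ->
    (\int[mu]_x (G x * u x)%:E = \int[mu]_x (G x * v x)%:E)%E) ->
  {ae mu, forall x, u x <= v x}.
Proof.
move=> cu cv u0 v0 iv H.
pose G x := Num.min (Num.max (u x - v x) 0) 1.
have cG : continuous G.
  move=> x; apply: (@continuous_min _ _ (fun x => Num.max (u x - v x) 0) (fun=> 1) x); last exact: (@ctsC _ _ (1 : R) x).
  apply: (@continuous_max _ _ (fun x => u x - v x) (fun=> 0) x); last exact: (@ctsC _ _ (0 : R) x).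
  exact: ctsB.
have G0 x : 0 <= G x by rewrite le_min ler01 le_max lexx orbT.
have G1 x : G x <= 1 by rewrite ge_min lexx orbT.
pose h x := G x * (u x - v x).
have h0 x : 0 <= h x.
  rewrite /h; have [uv|uv] := leP (u x) (v x); last by rewrite mulr_ge0// subr_ge0 ltW.
  rewrite (_ : G x = 0) ?mul0r// /G (_ : Num.max _ 0 = 0); last by apply/max_idPr; rewrite subr_le0.
  by apply/min_idPl.
have mu_ : measurable_fun setT u by exact: continuous_measurable_rV.
have mv : measurable_fun setT v by exact: continuous_measurable_rV.
have mG : measurable_fun setT G by exact: continuous_measurable_rV.
have mh : measurable_fun setT h by apply: measurable_funM => //; exact: measurable_funB.
have mGv : measurable_fun setT (fun x => (G x * v x)%:E) by apply/measurable_EFinP; exact: measurable_funM.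
have E : (\int[mu]_x (G x * u x)%:E = \int[mu]_x (G x * v x)%:E + \int[mu]_x (h x)%:E)%E.
  rewrite -ge0_integralD//.
  - by apply: eq_integral => x _; rewrite -EFinD /h; congr EFin; ring.
  - by move=> x _; rewrite lee_fin mulr_ge0.
  - by move=> x _; rewrite lee_fin.
  - exact/measurable_EFinP.
have fv : (\int[mu]_x (G x * v x)%:E)%E \is a fin_num.
  rewrite ge0_fin_numE; last by apply: integral_ge0 => x _; rewrite lee_fin mulr_ge0.
  apply: le_lt_trans iv; apply: ge0_le_integral => //.
  - by move=> x _; rewrite lee_fin mulr_ge0.
  - exact/measurable_EFinP.
  - by move=> x _; rewrite lee_fin ler_piMl.
have Ih : (\int[mu]_x (h x)%:E = 0)%E.
  have := H G cG G0 G1; rewrite E => /(congr1 (fun w => (w - \int[mu]_x (G x * v x)%:E)%E)).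
  by rewrite addeAC subee// add0e.
have : ae_eq mu setT (fun x => (h x)%:E) (cst 0%E).
  apply/ae_eq_integral_abs => //; first exact/measurable_EFinP.
  by rewrite -Ih; apply: eq_integral => x _; rewrite gee0_abs// lee_fin.
apply: filterS => x /(_ Logic.I) [] hx; rewrite leNgt; apply/negP => uv.
have d0 : 0 < u x - v x by rewrite subr_gt0.
have : 0 < h x by rewrite mulr_gt0// lt_min ltr01 lt_max d0.
by rewrite hx ltxx.
Qed.

End test_functions.

(** * The integrand of the divergence *)

Section relative_entropy.
Context {R : realType} (n : nat) (f : 'rV[R]_n -> R) (L M : R).
Hypotheses (L0 : 0 <= L) (hf : LM_smooth f L M).
Local Notation mu := (lebesgue_rV n).
Local Notation nu := (fun x => expR (- f x)).
Hypothesis pnu : prob_density nu.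
Implicit Types (r : 'rV[R]_n -> R) (x : 'rV[R]_n).

Definition klp r x := r x * ln (r x / nu x).

Lemma klpE r x : 0 <= r x -> klp r x = r x * ln (r x) + f x * r x.
Proof.
rewrite le_eqVlt => /predU1P[r0|r0]; first by rewrite /klp -r0 !mul0r mulr0 addr0.
by rewrite /klp ln_ratio// mulrDr (mulrC (f x)).
Qed.

(** From [ln u <= u - 1] at [u = nu / r]. The negative part is thus below the integrable [nu], so
    the divergence is either finite or [+oo]. *)
Lemma klp_ge r x : 0 <= r x -> - nu x <= klp r x.
Proof.
move=> r0; have [rz|rp] := leP (r x) 0.
  have rx : r x = 0 by apply/eqP; rewrite eq_le rz r0.
  by rewrite /klp rx mul0r oppr_le0 expR_ge0.
have h := ln_le_sub1 (divr_gt0 (expR_gt0 (- f x)) rp).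
rewrite /klp -[r x / _]invf_div lnV ?posrE ?divr_gt0 ?expR_gt0//.
have := ler_wpM2l r0 h; rewrite mulrBr mulr1 mulrCA mulfV ?gt_eqF// mulr1.
by rewrite mulrN; lra.
Qed.

Lemma integral_gibbs : (\int[mu]_x (nu x)%:E = 1)%E.
Proof.
case: pnu => _; rewrite iintE//; apply/measurable_EFinP.
apply: measurableT_comp => //; apply: measurable_funN.
by apply: continuous_measurable_rV; exact: (f_cts hf).
Qed.

Lemma integrable_gibbs : mu.-integrable setT (fun x => (nu x)%:E).
Proof.
have mnu : measurable_fun setT nu.
  apply: measurableT_comp => //; apply: measurable_funN.
  by apply: continuous_measurable_rV; exact: (f_cts hf).
apply/integrableP; split; first exact/measurable_EFinP.
under eq_integral do rewrite gee0_abs ?lee_fin ?expR_ge0//.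
by rewrite integral_gibbs ltry.
Qed.

Lemma potential_dominated : dominated (@quad R n) f.
Proof.
have [C [C0 hC]] := f_growth L0 hf.
by apply: (cts_dominated (C := C)) => //; exact: (f_cts hf).
Qed.

Lemma measurable_klp r : measurable_fun setT r -> (forall x, 0 <= r x) -> measurable_fun setT (klp r).
Proof.
move=> mr r0; rewrite (_ : klp r = (fun x => r x * ln (r x) + f x * r x)); last first.
  by apply/funext => x; exact: klpE.
apply: measurable_funD; apply: measurable_funM => //; last exact: potential_dominated.1.
exact: (measurableT_comp (@measurable_ln R) mr).
Qed.

End relative_entropy.

(** * One iteration of the algorithm *)

Section step.
Context {R : realType} (n : nat) (f : 'rV[R]_n -> R) (L M eps al : R).
Hypotheses (n0 : (0 < n)%N) (L0 : 0 <= L) (M0 : 0 <= M) (hf : LM_smooth f L M).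
Hypotheses (eps0 : 0 < eps) (epsL : eps * L <= 8^-1) (al0 : 0 < al).
Local Notation mu := (lebesgue_rV n).
Local Notation mm := (mu \x mu)%E.
Local Notation nu := (fun x => expR (- f x)).
Hypotheses (pnu : prob_density nu) (lsi : LSI nu al).
Variables (rho rho' : 'rV[R]_n -> R) (P : 'rV[R]_n -> 'rV[R]_n).
Hypothesis drho : density rho.
Hypotheses (crho' : continuous rho') (prho' : prob_density rho') (hP : is_prox eps f P).
Hypothesis law : forall phi : 'rV[R]_n -> R, continuous phi -> (forall x, 0 <= phi x) ->
  (exists C, forall x, phi x <= C) ->
  iint (fun y => (phi y * rho' y)%:E) =
  iint (fun x => iint (fun z =>
      (phi (P (x + Num.sqrt (2 * eps) *: z)) * rho x * gauss z)%:E)).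
Local Notation sig := (heat rho (rad eps)).
Local Notation T := (prox_map f eps).
Local Notation S := (fun x : 'rV[R]_n => x + eps *: grad f x).

Let c0 : 0 < rad eps.
Proof. exact: rad_gt0. Qed.
Let eps0' : 0 <= eps.
Proof. exact: ltW. Qed.
Let eL4 : eps * L <= 4^-1.
Proof. by apply: (le_trans epsL); lra. Qed.
Let dsig := heat_density drho c0.
Let csig := density_cts dsig.
Let sig0 := density_ge0 dsig.
Let msig : measurable_fun setT sig.
Proof. exact: continuous_measurable_rV. Qed.
Let isq := density_quad dsig.

(** A minimiser solves the stationarity equation, whose solution is unique; the given [P] becomes
    the differentiable map [T]. *)
Let PT y : P y = T y.
Proof.
have h := prox_stationary L0 hf eps0 (hP y).
by rewrite -{2}h (prox_mapE L0 hf).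
Qed.

Let TS x : T (S x) = x.
Proof. exact: (prox_mapE L0 hf). Qed.

Let jac x : has_jac S x (jacA f eps x).
Proof.
move=> e e0; have [d [d0 h]] := grad_jac hf x (divr_gt0 e0 eps0).
exists d; split => // v vd.
rewrite (_ : _ - _ - _ = eps *: (grad f (x + v) - grad f x - v *m hesT f x)); last first.
  rewrite /jacA mulmxDr mulmx1 -scalemxAr; set w := v *m _.
  by apply/rowP => i; rewrite !mxE; ring.
rewrite normrZ gtr0_norm//; apply: (le_trans (ler_wpM2l eps0' (h v vd))).
by rewrite mulrA mulrCA mulfV ?mulr1// gt_eqF.
Qed.

Let cov (g : 'rV[R]_n -> R) : continuous g -> (forall x, 0 <= g x) ->
  (\int[mu]_x (g (S x) * \det (jacA f eps x))%:E = \int[mu]_x (g x)%:E)%E.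
Proof.
apply: (@ge0_change_of_variables _ _ S (jacA f eps) (1 - eps * L)).
- by rewrite subr_gt0; apply: (le_lt_trans epsL); lra.
- exact: jac.
- exact: (continuous_jacA M0 hf).
- by move=> x; apply: coercive_1D; exact: (opbound_thes L0 hf).
Qed.

Let detA0 x : 0 < \det (jacA f eps x).
Proof.
apply: (@coercive_det_gt0 _ _ _ (1 - eps * L)).
  by rewrite subr_gt0; apply: (le_lt_trans epsL); lra.
by apply: coercive_1D; exact: (opbound_thes L0 hf).
Qed.

Let cS (F : 'rV[R]_n -> R) : continuous F -> continuous (fun x => F (S x)).
Proof.
move=> cF; apply: (@cts_comp 'rV[R]_n 'rV[R]_n R S F) => //; apply: continuous_rVP => i.
have -> : (fun x : 'rV[R]_n => (x + eps *: grad f x) ord0 i) = (fun x => x ord0 i + eps * grad f x ord0 i).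
  by apply/funext => x; rewrite [LHS]mxE [in X in _ + X]mxE.
apply: ctsD; first exact: continuous_coord.
by apply: ctsM; [exact: ctsC|exact: (grad_coord_cts L0 hf)].
Qed.

Let cT (F : 'rV[R]_n -> R) : continuous F -> continuous (fun y => F (T y)).
Proof. exact: (cts_prox_map L0 hf). Qed.

(** The density of the image of [sig] under [T], written through the inverse map [S]. *)
Let a x : R := sig (S x) * \det (jacA f eps x).

Let ca : continuous a.
Proof.
apply: ctsM; first exact: cS.
by apply: continuous_det => i j; exact: (continuous_jacA M0 hf).
Qed.

Let a0 x : 0 <= a x.
Proof. by rewrite mulr_ge0// ltW. Qed.

Let ma : measurable_fun setT a.
Proof. exact: continuous_measurable_rV. Qed.

Let mrho' : measurable_fun setT rho'.
Proof. exact: continuous_measurable_rV. Qed.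

Let rho'0 x : 0 <= rho' x.
Proof. by case: prho'. Qed.

Let int_rho' : (\int[mu]_x (rho' x)%:E = 1)%E.
Proof.
case: prho' => _; rewrite iintE//; first exact/measurable_EFinP.
Qed.

Let cov_a (G : 'rV[R]_n -> R) : continuous G -> (forall x, 0 <= G x) ->
  (\int[mu]_x (G x * a x)%:E = \int[mu]_y (G (T y) * sig y)%:E)%E.
Proof.
move=> cG G0; rewrite -(@cov (fun y => G (T y) * sig y)).
- by apply: eq_integral => x _; rewrite TS /a mulrA.
- by apply: ctsM => //; exact: cT.
- by move=> x; rewrite mulr_ge0.
Qed.

Let int_a : (\int[mu]_x (a x)%:E = 1)%E.
Proof.
rewrite -(density_int1 dsig) -(@cov sig)//.
Qed.

Let test_eq (G : 'rV[R]_n -> R) : continuous G -> (forall x, 0 <= G x) -> (forall x, G x <= 1) ->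
  (\int[mu]_x (G x * rho' x)%:E = \int[mu]_x (G x * a x)%:E)%E.
Proof.
move=> cG G0 G1; rewrite cov_a//.
have mG : measurable_fun setT G by exact: continuous_measurable_rV.
have mGT : measurable_fun setT (fun y => G (T y)) by apply: continuous_measurable_rV; exact: cT.
rewrite -(ge0_transfer drho c0 mGT)//.
have := law cG G0 (ex_intro _ 1 G1).
rewrite iintE; last 2 first.
- by apply/measurable_EFinP; exact: measurable_funM.
- by move=> x; rewrite lee_fin mulr_ge0.
move=> ->.
pose H (p : 'rV[R]_n * 'rV[R]_n) := (G (T (noisy (rad eps) p)) * joint rho p)%:E.
have mH : measurable_fun setT H.
  apply/measurable_EFinP; apply: measurable_funM; last exact: (measurable_joint drho).
  exact: (measurableT_comp mGT (@measurable_noisy R n (rad eps))).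
have H0 p : (0 <= H p)%E by rewrite lee_fin mulr_ge0// (joint_ge0 drho).
have E x : iint (fun z => (G (P (x + Num.sqrt (2 * eps) *: z)) * rho x * gauss z)%:E) = fubini_F mu H x.
  rewrite (_ : (fun z => _) = (fun z => H (x, z))); last first.
    apply/funext => z; rewrite PT /H /joint /noisy /= /rad addrC mulrA //.
  rewrite iintE//; exact: (measurableT_comp mH (measurable_pair1 x)).
rewrite (_ : (fun x => iint _) = fubini_F mu H); last by apply/funext => x; exact: E.
rewrite iintE.
- exact: esym (@fubini_tonelli1 _ _ _ _ _ mu mu H mH H0).
- exact: measurable_fun_fubini_tonelli_F.
- by move=> x; apply: integral_ge0 => z _; exact: H0.
Qed.

(** The laws are specified by bounded continuous tests, so [rho'] and [a] are compared by
    [ae_le_of_tests] in both directions. *)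
Let ae_rho' : {ae mu, forall x, rho' x = a x}.
Proof.
have h1 : {ae mu, forall x, rho' x <= a x}.
  by apply: ae_le_of_tests => //; rewrite int_a ltry.
have h2 : {ae mu, forall x, a x <= rho' x}.
  apply: ae_le_of_tests => //; first by rewrite int_rho' ltry.
  by move=> G cG G0 G1; rewrite test_eq.
apply: filterS2 h1 h2 => x l1 l2; by apply/eqP; rewrite eq_le l1 l2.
Qed.

Let quadT : dominated (@quad R n) (fun y => quad (T y)).
Proof.
have g0 := enorm_ge0 (grad f 0).
pose C := 2 * (4 / 3 * (1 + eps * enorm (grad f 0))) ^+ 2 + 1.
apply: (cts_dominated (C := C)); first by apply: cT; exact: continuous_quad.
move=> y; rewrite ger0_norm; last exact: le_trans ler01 (quad_ge1 _).
have y0 := enorm_ge0 y.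
set D := 4 / 3 * (1 + eps * enorm (grad f 0)) in C *.
have eg : 0 <= eps * enorm (grad f 0) by rewrite mulr_ge0.
have h : enorm (T y) <= D * (1 + enorm y).
  apply: (le_trans (prox_map_growth L0 hf _ eps0' eL4)).
  rewrite /D -(mulrA (4 / 3)); apply: ler_wpM2l; first lra.
  by have := mulr_ge0 eg y0; lra.
have D0 : 0 <= D by rewrite /D mulr_ge0// addr_ge0.
have h2 : sqnorm (T y) <= (D * (1 + enorm y)) ^+ 2.
  by rewrite -sqr_enorm ler_pXn2r ?nnegrE ?enorm_ge0// mulr_ge0// addr_ge0.
have h3 : (1 + enorm y) ^+ 2 <= 2 * quad y.
  rewrite /quad -sqr_enorm; have := sqr_ge0 (enorm y - 1); lra.
rewrite /quad -/(quad y); apply: (@le_trans _ _ (1 + D ^+ 2 * (2 * quad y))).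
  by rewrite lerD2l (le_trans h2)// exprMn; apply: ler_wpM2l => //; exact: sqr_ge0.
by have := quad_ge1 y; rewrite /C; lra.
Qed.

Lemma step_density : density rho'.
Proof.
split => //.
have cq := @continuous_quad R n.
have mq : measurable_fun setT (fun x => (quad x * rho' x)%:E).
  by apply/measurable_EFinP; apply: measurable_funM => //; exact: measurable_quad.
have q0 (x : 'rV[R]_n) : 0 <= quad x by exact: le_trans ler01 (quad_ge1 _).
apply/integrableP; split => //.
under eq_integral do rewrite gee0_abs ?lee_fin ?mulr_ge0//.
rewrite (@ge0_ae_eq_integral _ _ _ mu setT _ (fun x => (quad x * a x)%:E))//.
- rewrite (cov_a cq q0) (expect_EFin msig sig0 isq quadT) ltry//.
- by apply/measurable_EFinP; apply: measurable_funM => //; exact: measurable_quad.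
- by move=> x _; rewrite lee_fin mulr_ge0.
- by move=> x _; rewrite lee_fin mulr_ge0.
- by apply: filterS ae_rho' => x -> _.
Qed.

(** Its mean under [sig] is the interpolating functional at time [eps]. *)
Let W y : R := ln (sig y) + phi f L eps y.

Let cW : continuous W.
Proof.
apply: ctsD; last exact: (phi_cts L0 hf).
move=> y; apply: (@continuous_comp _ _ _ sig (@ln R)); first exact: csig.
by apply: continuous_ln; exact: (heat_gt0 drho c0).
Qed.

Let dW : dominated (@quad R n) W.
Proof.
apply: dominatedD; first exact: (ln_heat_dominated drho c0).
by apply: (phi_dominated L0 M0 hf).
Qed.

(** [cov] for an integrand of either sign: the absolute value gives integrability, and the positive
    and negative parts give the identity. *)
Let signed_cov : mu.-integrable setT (fun x => (W (S x) * a x)%:E) /\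
  (\int[mu]_x (W (S x) * a x))%R = expect mu sig W.
Proof.
have E (F : 'rV[R]_n -> R) : continuous F -> (forall y, 0 <= F y) ->
    (\int[mu]_x (F (S x) * a x)%:E = \int[mu]_y (F y * sig y)%:E)%E.
  move=> cF F0; rewrite -(@cov (fun y => F y * sig y)).
  - by apply: eq_integral => x _; rewrite /a mulrA.
  - exact: ctsM.
  - by move=> x; rewrite mulr_ge0.
have mWa : measurable_fun setT (fun x => W (S x) * a x).
  by apply: measurable_funM => //; apply: continuous_measurable_rV; exact: cS.
split.
  apply/integrableP; split; first exact/measurable_EFinP.
  have /integrableP[_] := dominated_integrable msig isq dW.
  have cN : continuous (fun y => `|W y|).
    by move=> y; apply: (@continuous_comp _ _ _ W (fun u : R => `|u|)); [exact: cW|exact: norm_continuous].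
  have := E (fun y => `|W y|) cN (fun y => normr_ge0 _).
  rewrite (_ : (\int[mu]_x (`|W (S x)| * a x)%:E)%E = (\int[mu]_x `|(W (S x) * a x)%:E|)%E); last first.
    by apply: eq_integral => x _; rewrite abse_EFin normrM (ger0_norm (a0 x)).
  rewrite (_ : (\int[mu]_x (`|W x| * sig x)%:E)%E = (\int[mu]_x `|(W x * sig x)%:E|)%E); last first.
    by apply: eq_integral => x _; rewrite abse_EFin normrM (ger0_norm (sig0 x)).
  by move=> ->.
rewrite /expect /Rintegral; congr fine; rewrite integralE [RHS]integralE.
have maxM (u v : R) : 0 <= v -> maxe (u * v)%:E 0 = (Num.max u 0 * v)%:E.
  by move=> v0; rewrite -EFin_max; congr EFin; rewrite maxr_pMl// mul0r.
have cp : continuous (fun y => Num.max (W y) 0).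
  by move=> y; apply: (@continuous_max _ _ W (fun=> 0) y); [exact: cW|exact: (@ctsC _ _ (0 : R) y)].
have cm : continuous (fun y => Num.max (- W y) 0).
  by move=> y; apply: (@continuous_max _ _ (fun y => - W y) (fun=> 0) y); [exact: (ctsN cW)|exact: (@ctsC _ _ (0 : R) y)].
have e1 := E (fun y => Num.max (W y) 0) cp (fun y => ltac:(by rewrite le_max lexx orbT)).
have e2 := E (fun y => Num.max (- W y) 0) cm (fun y => ltac:(by rewrite le_max lexx orbT)).
congr (_ - _)%E.
  apply: (etrans _ (etrans e1 _)); apply: eq_integral => x _; rewrite funeposE maxM//.
apply: (etrans _ (etrans e2 _)); apply: eq_integral => x _.
  by rewrite funenegE -EFinN -mulNr maxM.
by rewrite funenegE -EFinN -mulNr maxM.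
Qed.

Local Notation klp := (klp f).
Let inu := integrable_gibbs hf pnu.
Let df := potential_dominated L0 hf.
Let mklp := measurable_klp L0 hf.

(** [ln a] is [ln (sig (S x))] plus the log-determinant, which [ln_det_le] bounds by [ell]. Adding
    [f x] gives [W (S x)], because [T (S x) = x]. *)
Let kl_a_le x : klp a x <= W (S x) * a x.
Proof.
have sS : 0 < sig (S x) by exact: (heat_gt0 drho c0).
rewrite klpE// (mulrC (W _)) (mulrC (f x)) -mulrDr ler_wpM2l// /W /phi TS.
rewrite /a lnM ?posrE// -addrA lerD2l addrC lerD2l.
have := ln_det_le L0 (hesT_bound L0 hf x) eps0' eL4; by rewrite /ell /trh /trh2 /jacA.
Qed.

Let kl_a_integrable : mu.-integrable setT (fun x => (klp a x)%:E).
Proof.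
apply: (@le_integrable _ _ _ mu setT measurableT _ (fun x => ((`|W (S x) * a x| + nu x)%:E))).
- by apply/measurable_EFinP; exact: mklp.
- move=> x _; rewrite !abse_EFin lee_fin [leRHS]ger0_norm; last by rewrite addr_ge0// expR_ge0.
  have h1 := kl_a_le x; have h2 := klp_ge f (a0 x).
  have h3 := ler_norm (W (S x) * a x); have h4 := normr_ge0 (W (S x) * a x).
  have h5 := expR_ge0 (- f x).
  rewrite ler_norml; apply/andP; split.
    by apply: le_trans h2; rewrite lerN2 lerDr.
  by apply: (le_trans h1); apply: (le_trans h3); rewrite lerDl.
- under eq_fun do rewrite EFinD.
  by apply: integrableD => //; have := integrable_abse signed_cov.1.
Qed.

Let ae_klp : ae_eq mu setT (fun x => (klp rho' x)%:E) (fun x => (klp a x)%:E).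
Proof. by apply: filterS ae_rho' => x h _; rewrite (congr1 (fun u => (u * ln (u / nu x))%:E) h). Qed.

Lemma step_KL_integrable : mu.-integrable setT (fun x => (rho' x * ln (rho' x / nu x))%:E).
Proof.
have mk : measurable_fun setT (fun x => (klp rho' x)%:E) by apply/measurable_EFinP; exact: mklp.
have mka : measurable_fun setT (fun x => (klp a x)%:E) by apply/measurable_EFinP; exact: mklp.
apply/integrableP; split; first exact: mk.
have /integrableP[_] := kl_a_integrable; apply: le_lt_trans; rewrite le_eqVlt; apply/orP; left; apply/eqP.
apply: ge0_ae_eq_integral => //; [exact: measurableT_comp|exact: measurableT_comp|].
by apply: filterS ae_klp => x h _; rewrite -[in RHS]h.
Qed.

Let KL_int (r : 'rV[R]_n -> R) : R := (\int[mu]_x klp r x)%R.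

Let KL_step_le : KL_int rho' <= expect mu sig W.
Proof.
have mk : measurable_fun setT (fun x => (klp rho' x)%:E) by apply/measurable_EFinP; exact: mklp.
have mka : measurable_fun setT (fun x => (klp a x)%:E) by apply/measurable_EFinP; exact: mklp.
have -> : KL_int rho' = (\int[mu]_x klp a x)%R.
  by rewrite /KL_int /Rintegral; congr fine; apply: ae_eq_integral => //; exact: ae_klp.
by rewrite -signed_cov.2; apply: le_Rintegral => //; exact: signed_cov.1.
Qed.

Hypothesis ikl : mu.-integrable setT (fun x => (rho x * ln (rho x / nu x))%:E).

Lemma step_decay (C : R) :
  C = 34 * eps ^+ 2 * (n%:R * (L ^+ 3 + 9 * n%:R ^+ 2 * M ^+ 2)) ->
  (\int[mu]_x (rho' x * ln (rho' x / nu x)))%R - C / al <=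
  expR (- (al * eps)) * ((\int[mu]_x (rho x * ln (rho x / nu x)))%R - C / al).
Proof.
move=> CE.
have mrho : measurable_fun setT rho by apply: continuous_measurable_rV; exact: density_cts drho.
have rho0 := density_ge0 drho; have iq := density_quad drho.
have ifr : mu.-integrable setT (fun x => (f x * rho x)%:E) by exact: (dominated_integrable mrho iq df).
have ient : mu.-integrable setT (fun x => (rho x * ln (rho x))%:E).
  rewrite (_ : (fun x => _) = (fun x => ((klp rho x)%:E - (f x * rho x)%:E)%E)).
    exact: integrableB.
  by apply/funext => x; rewrite -EFinB klpE// addrK.
have K0 : (\int[mu]_x (rho x * ln (rho x / nu x)))%R = entropy rho 0 + energy f L rho 0.
  rewrite (energy0 L0 hf drho) /entropy eqxx /expect -RintegralD//.
  by apply: eq_Rintegral => x _; exact: klpE.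
rewrite K0; apply: le_trans (heat_flow_decay n0 L0 M0 hf eps0 epsL al0 pnu lsi drho ient CE).
rewrite lerD2r; apply: (le_trans KL_step_le).
rewrite /W (expectD msig isq (ln_heat_dominated drho c0) (phi_dominated L0 M0 hf eps0 epsL)).
rewrite /entropy gt_eqF// lerD2l /energy.
by rewrite -(expect_noisy drho c0 (phi_dominated L0 M0 hf eps0 epsL)).
Qed.

End step.

(** Dimension zero is treated apart because the unboundedness of the potential, and with it the
    bound on the log-Sobolev constant, is available only for positive [n]. *)
Lemma KL_dim0 (R : realType) (nu rho : 'rV[R]_0 -> R) : prob_density nu -> prob_density rho ->
  KL nu rho = 0%E.
Proof.
move=> [_ nu1] [_ rho1].
have n1 : nu 0 = 1 by exact: EFin_inj nu1.
have r1 : rho 0 = 1 by exact: EFin_inj rho1.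
by rewrite /KL /integral_Rn /= n1 r1 divr1 ln1 mulr0 oppr0 maxxx subee.
Qed.

(** * Iteration and conclusion *)

Section iteration.
Context {R : realType} (n : nat) (f : 'rV[R]_n -> R) (L M eps al : R).
Hypotheses (n0 : (0 < n)%N) (L0 : 0 <= L) (M0 : 0 <= M) (hf : LM_smooth f L M).
Hypotheses (eps0 : 0 < eps) (epsL : eps * L <= 8^-1) (al0 : 0 < al).
Local Notation mu := (lebesgue_rV n).
Local Notation nu := (fun x => expR (- f x)).
Hypotheses (pnu : prob_density nu) (lsi : LSI nu al).
Variables (P : 'rV[R]_n -> 'rV[R]_n) (rho : nat -> 'rV[R]_n -> R).
Hypothesis hP : is_prox eps f P.
Hypothesis fsm : finite_second_moment (rho 0%N).
Hypothesis hrho : forall k, continuous (rho k) /\ prob_density (rho k).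
Hypothesis laws : PLA_laws eps P rho.

Let mrho k : measurable_fun setT (rho k).
Proof. by apply: continuous_measurable_rV; case: (hrho k). Qed.

Let rho_ge0 k x : 0 <= rho k x.
Proof. by case: (hrho k) => _ []. Qed.

Let mk k : measurable_fun setT (klp f (rho k)).
Proof. exact: (measurable_klp L0 hf). Qed.

Lemma KL_integral k : KL nu (rho k) = (\int[mu]_x (klp f (rho k) x)%:E)%E.
Proof. exact: (integral_RnE (mk k)). Qed.

Lemma density0 : density (rho 0%N).
Proof.
have mr : measurable_fun setT (fun x => (rho 0%N x)%:E) by exact/measurable_EFinP.
have r0 x : (0 <= (rho 0%N x)%:E)%E by rewrite lee_fin.
have ms : measurable_fun setT (fun x => (sqnorm x * rho 0%N x)%:E).
  by apply/measurable_EFinP; apply: measurable_funM => //; exact: measurable_sqnorm.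
have s0 x : (0 <= (sqnorm x * rho 0%N x)%:E)%E by rewrite lee_fin mulr_ge0// sqnorm_ge0.
have I1 : (\int[mu]_x (rho 0%N x)%:E = 1)%E.
  by case: (hrho 0%N) => _ [_]; rewrite iintE.
split => //; first by case: (hrho 0%N).
apply/integrableP; split.
  by apply/measurable_EFinP; apply: measurable_funM => //; exact: measurable_quad.
have -> : (\int[mu]_x `|(quad x * rho 0%N x)%:E| =
    \int[mu]_x (rho 0%N x)%:E + \int[mu]_x (sqnorm x * rho 0%N x)%:E)%E.
  rewrite -ge0_integralD//; apply: eq_integral => x _.
  rewrite gee0_abs ?lee_fin; last by rewrite mulr_ge0// (le_trans ler01)// quad_ge1.
  by rewrite -EFinD /quad mulrDl mul1r.
rewrite I1 lte_add_pinfty ?ltry//; move: fsm; rewrite /finite_second_moment iintE//.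
Qed.

(** [C / al] is the fixed point of the one-step recursion: only the excess over it is contracted, so
    the error term does not accumulate. Density and integrability are carried along since
    [step_decay] needs them of the current iterate. *)
Lemma iterate_decay (C : R) :
  C = 34 * eps ^+ 2 * (n%:R * (L ^+ 3 + 9 * n%:R ^+ 2 * M ^+ 2)) ->
  mu.-integrable setT (fun x => (klp f (rho 0%N) x)%:E) ->
  forall k, [/\ density (rho k), mu.-integrable setT (fun x => (klp f (rho k) x)%:E) &
    (\int[mu]_x klp f (rho k) x)%R <=
      expR (- (al * eps * k%:R)) * (\int[mu]_x klp f (rho 0%N) x)%R + C / al].
Proof.
move=> CE i0; have C0 : 0 <= C / al.
  have X : 0 <= L ^+ 3 + 9 * n%:R ^+ 2 * M ^+ 2.
    by rewrite addr_ge0 ?exprn_ge0// mulr_ge0 ?sqr_ge0// mulr_ge0// sqr_ge0.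
  rewrite CE; apply: divr_ge0; last exact: ltW.
  by apply: mulr_ge0; [apply: mulr_ge0 => //; exact: sqr_ge0|exact: mulr_ge0].
elim=> [|k [dk ik hk]].
  by split => //; [exact: density0|rewrite mulr0 oppr0 expR0 mul1r lerDl].
have [ck pk] := hrho k.+1.
have hd := step_density L0 M0 hf eps0 epsL dk ck pk hP (laws k).
have hi := step_KL_integrable L0 M0 hf eps0 epsL pnu dk ck pk hP (laws k).
have hs := step_decay n0 L0 M0 hf eps0 epsL al0 pnu lsi dk ck pk hP (laws k) ik CE.
split => //.
set K' := (\int[mu]_x klp f (rho k.+1) x)%R.
set K := (\int[mu]_x klp f (rho k) x)%R in hk.
set K0 := (\int[mu]_x klp f (rho 0%N) x)%R in hk *.
have {}hs : K' - C / al <= expR (- (al * eps)) * (K - C / al) by exact: hs.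
have e0 := expR_ge0 (- (al * eps)).
have h1 : expR (- (al * eps)) * (K - C / al) <= expR (- (al * eps)) * (expR (- (al * eps * k%:R)) * K0).
  by rewrite ler_wpM2l// lerBlDr.
have -> : expR (- (al * eps * k.+1%:R)) = expR (- (al * eps)) * expR (- (al * eps * k%:R)).
  by rewrite -expRD -natr1; congr expR; ring.
by rewrite -mulrA -lerBlDr; exact: le_trans hs h1.
Qed.

(** The negative part is bounded by [nu], hence has integral at most 1; failure of integrability can
    only come from the positive part. *)
Lemma KL_infinite : ~ mu.-integrable setT (fun x => (klp f (rho 0%N) x)%:E) ->
  KL nu (rho 0%N) = +oo%E.
Proof.
move=> ni; pose g := klp f (rho 0%N).
have mp : measurable_fun setT (fun x => (Num.max (g x) 0)%:E).
  by apply/measurable_EFinP; apply: measurable_maxr => //; exact: mk.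
have mn : measurable_fun setT (fun x => (Num.max (- g x) 0)%:E).
  by apply/measurable_EFinP; apply: measurable_maxr => //; apply: measurable_funN; exact: mk.
have p0 x : (0 <= (Num.max (g x) 0)%:E)%E by rewrite lee_fin le_max lexx orbT.
have q0 x : (0 <= (Num.max (- g x) 0)%:E)%E by rewrite lee_fin le_max lexx orbT.
have gn x : Num.max (- g x) 0 <= nu x.
  by rewrite ge_max expR_ge0 andbT lerNl; exact: klp_ge.
have mnu : measurable_fun setT (fun x => (nu x)%:E) by case/integrableP: (integrable_gibbs hf pnu).
have B : (\int[mu]_x (Num.max (- g x) 0)%:E <= 1)%E.
  rewrite -(integral_gibbs hf pnu); apply: ge0_le_integral => //.
  by move=> x _; rewrite lee_fin.
have A : (\int[mu]_x (Num.max (g x) 0)%:E = +oo)%E.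
  apply/eqP; rewrite -leye_eq leNgt; apply/negP => fin; apply: ni.
  have ip : mu.-integrable setT (fun x => (Num.max (g x) 0)%:E).
    by apply/integrableP; split => //; under eq_integral do rewrite gee0_abs//.
  apply: (@le_integrable _ _ _ mu setT measurableT _ (fun x => ((Num.max (g x) 0)%:E + (nu x)%:E)%E)).
  - by apply/measurable_EFinP; exact: mk.
  - move=> x _; rewrite -EFinD !abse_EFin lee_fin [leRHS]ger0_norm; last first.
      by rewrite addr_ge0 ?expR_ge0// le_max lexx orbT.
    have h1 : g x <= Num.max (g x) 0 by rewrite le_max lexx.
    have h2 : 0 <= Num.max (g x) 0 by rewrite le_max lexx orbT.
    have h3 := expR_ge0 (- f x); have h4 : - nu x <= g x by exact: klp_ge.
    rewrite ler_norml -/g; apply/andP; split.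
      by apply: le_trans h4; rewrite lerN2 lerDr.
    by apply: (le_trans h1); rewrite lerDl.
  - by apply: integrableD => //; exact: (integrable_gibbs hf pnu).
rewrite /KL /integral_Rn -/g !iintE// A addye// gt_eqF// ltNye_eq.
apply/orP; left; rewrite fin_numN ge0_fin_numE ?(le_lt_trans B) ?ltry//.
by apply: integral_ge0 => x _; exact: q0.
Qed.

End iteration.

Theorem theorem1 (R : realType) (n : nat) (f : 'rV[R]_n -> R)
  (alpha L M eps : R) (P : 'rV[R]_n -> 'rV[R]_n) (rho : nat -> 'rV[R]_n -> R) :
  let nu := fun x => expR (- f x) in
  prob_density nu ->
  0 < alpha -> LSI nu alpha ->
  0 <= L -> 0 <= M -> LM_smooth f L M ->
  0 < eps -> 8 * L * eps <= 1 -> M * eps <= 1 -> 32 * L ^+ 2 * eps <= 3 * alpha ->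
  is_prox eps f P ->
  smooth (rho 0%N) -> prob_density (rho 0%N) -> finite_second_moment (rho 0%N) ->
  (forall k, continuous (rho k) /\ prob_density (rho k)) ->
  PLA_laws eps P rho ->
  forall k : nat,
    (KL nu (rho k) <=
       (expR (- (alpha * eps * k%:R)))%:E * KL nu (rho 0%N)
       + (34 * eps ^+ 2 * n%:R * (L ^+ 3 + 9 * n%:R ^+ 2 * M ^+ 2) / alpha)%:E)%E.
Proof.
move: f P rho; case: n => [|n] f P rho nu pnu al0 lsi L0 M0 hf eps0 e1 _ _ hP _ prho0 fsm hrho laws k.
  rewrite (KL_dim0 pnu (hrho k).2) (KL_dim0 pnu prho0) mule0 add0e lee_fin.
  by rewrite (_ : 34 * eps ^+ 2 * 0%:R = 0) ?mul0r// mulr0.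
have epsL : eps * L <= 8^-1 by lra.
set C := 34 * eps ^+ 2 * (n.+1%:R * (L ^+ 3 + 9 * n.+1%:R ^+ 2 * M ^+ 2)).
have -> : 34 * eps ^+ 2 * n.+1%:R * (L ^+ 3 + 9 * n.+1%:R ^+ 2 * M ^+ 2) / alpha = C / alpha.
  by rewrite /C !mulrA.
(* If the initial divergence is infinite, the right side is [+oo], the decay factor being
   positive. *)
have [ikl|nikl] := pselect ((lebesgue_rV n.+1).-integrable setT (fun x => (klp f (rho 0%N) x)%:E)); last first.
  rewrite (KL_infinite L0 hf pnu hrho nikl) gt0_muley ?lte_fin ?expR_gt0// addye//.
  exact: leey.
have [_ ik h] := iterate_decay (ltn0Sn n) L0 M0 hf eps0 epsL al0 pnu lsi hP fsm hrho laws (erefl C) ikl k.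
rewrite !(KL_integral L0 hf hrho).
rewrite -(fineK (integrable_fin_num measurableT ik)) -(fineK (integrable_fin_num measurableT ikl)).
by rewrite -EFinM -EFinD lee_fin.
Qed.
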